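(* There exists an absolute constant $\lambda\in(0,1)$ such that the following holds. Let $\epsilon>0$ and let $\Omega\subset\mathbb{R}^2$ be a convex set of diameter $2$ with $C^2$ boundary whose curvature is bounded above by $\epsilon^{-1/2}$. There exists a constant $C=C(\Omega)>1$, depending only on $\Omega$, such that if $u$ is a minimiser of $I_\epsilon$ over $\Lambda(\Omega)$, then $$\|u-\zeta\|_{W^{1,2}(\Omega)}\le C\left(\epsilon+\inf_{y\in\Omega}|\Omega\,\triangle\,B_1(y)|\right)^{\lambda},$$ where $\zeta(z)=\mathrm{dist}(z,\partial\Omega)$.
   Context: $I_\epsilon(u)=\frac12\int_\Omega \epsilon^{-1}\left|1-|\nabla u|^2\right|^2+\epsilon|\nabla^2u|^2\,dz$. $\Lambda(\Omega)=\{u\in W^{2,2}(\Omega): u=0\text{ on }\partial\Omega\text{ and }\nabla u(z)\cdot\eta_z=1\text{ for }z\in\partial\Omega\}$, with boundary values in the sense of trace and $\eta_z$ the inward pointing unit normal to $\partial\Omega$ at $z$. $B_r(y)$ is the ball of radius $r$ centred at $y$; $|\cdot|$ of a set is Lebesgue measure; $\triangle$ is symmetric difference. *)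

(* Defs.v *)
(* The plane is [R * R], whose product topology is the usual one; the library
   norm on it is the sup norm, so the Euclidean norm is defined here.  Lebesgue measure on the plane is the product measure on Borel sets. *)
From HB Require Import structures.
From mathcomp Require Import all_boot all_order all_algebra.
From mathcomp Require Import all_classical all_reals all_analysis.

Set Implicit Arguments.
Unset Strict Implicit.
Unset Printing Implicit Defensive.

Import Order.TTheory GRing.Theory Num.Theory numFieldNormedType.Exports.

Local Open Scope classical_set_scope.
Local Open Scope ring_scope.

Section Plane.
Context {R : realType}.
Implicit Types (z w y : R * R) (Omega : set (R * R)).

(* [measurableTypeR R] is [R] with the Borel sets, on which the library defines
   [lebesgue_measure]. *)
Definition leb2 :
    {measure set (measurableTypeR R * measurableTypeR R) -> \bar R} :=
  (@lebesgue_measure R \x @lebesgue_measure R)%E.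

Definition dotp z w : R := z.1 * w.1 + z.2 * w.2.
Definition enorm z : R := Num.sqrt (dotp z z).
Definition rot90 z : R * R := (- z.2, z.1).

Definition eball y (r : R) : set (R * R) := [set z | enorm (z - y) < r].

Definition bdry Omega : set (R * R) := closure Omega `\` interior Omega.

Definition ediam Omega : \bar R :=
  ereal_sup [set (enorm (p.1 - p.2))%:E | p in Omega `*` Omega].

Definition dist_bdry Omega z : R :=
  inf [set enorm (z - w) | w in bdry Omega].

Definition disc_defect Omega : \bar R :=
  ereal_inf [set leb2 (Omega `+` eball y 1) | y in Omega].

End Plane.

Section SmoothFunctions.
Context {R : realType}.
Implicit Types (phi : R * R -> R).

Definition basis2 (i : 'I_2) : R * R := if i == ord0 then (1, 0) else (0, 1).

Definition pderiv (i : 'I_2) phi : R * R -> R := fun z => 'D_(basis2 i) phi z.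

Fixpoint Ck (k : nat) phi : Prop :=
  if k is k'.+1 then
    (forall z, differentiable phi z) /\ (forall i, Ck k' (pderiv i phi))
  else continuous phi.

Definition smooth phi : Prop := forall k, Ck k phi.

Definition test_fun (Omega : set (R * R)) phi : Prop :=
  let supp := closure [set z | phi z != 0] in
  [/\ smooth phi, compact supp & supp `<=` Omega].

End SmoothFunctions.

Section Sobolev.
Context {R : realType}.
Implicit Types (Omega : set (R * R)) (u v g : R * R -> R).

Definition L2 Omega v : Prop :=
  measurable_fun (Omega : set (measurableTypeR R * measurableTypeR R)) v /\
  (\int[leb2]_(z in Omega) ((v z) ^+ 2)%:E < +oo)%E.

Definition is_weak_pderiv Omega (i : 'I_2) v g : Prop :=
  L2 Omega g /\
  forall phi, test_fun Omega phi ->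
    (\int[leb2]_(z in Omega) (v z * pderiv i phi z)%:E =
     - \int[leb2]_(z in Omega) (g z * phi z)%:E)%E.

(* A representative of the weak derivative; it is unique up to null sets, and
   is only meaningful when a square integrable weak derivative exists. *)
Definition wpderiv Omega (i : 'I_2) v : R * R -> R :=
  xget (fun=> 0) [set g | is_weak_pderiv Omega i v g].

Definition W12 Omega v : Prop :=
  L2 Omega v /\ forall i, exists g, is_weak_pderiv Omega i v g.

Definition W22 Omega v : Prop :=
  W12 Omega v /\ forall i, W12 Omega (wpderiv Omega i v).

Definition wgrad_sq Omega v z : R := \sum_(i < 2) (wpderiv Omega i v z) ^+ 2.

Definition whess_sq Omega v z : R :=
  \sum_(i < 2) \sum_(j < 2) (wpderiv Omega j (wpderiv Omega i v) z) ^+ 2.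

Definition W12norm Omega v : \bar R :=
  if `[< W12 Omega v >] then
    ((\int[leb2]_(z in Omega) ((v z) ^+ 2 + wgrad_sq Omega v z)%:E) `^ 2^-1)%E
  else +oo%E.

End Sobolev.

Section Boundary.
Context {R : realType}.
Implicit Types (Omega : set (R * R)) (gamma : R -> R * R).

(* [gamma], of period [l], is a C^2 arclength parametrisation of the boundary,
   which is a simple closed curve of length [l], with Omega on its left. *)
Definition arclength_param Omega gamma (l : R) : Prop :=
  [/\ 0 < l,
      (forall s : R, derivable gamma s 1 /\ derivable (derive1 gamma) s 1),
      continuous (derive1 (derive1 gamma)),
      (forall s, enorm (derive1 gamma s) = 1) &
   [/\ (forall s, gamma (s + l) = gamma s),
      {in `[0, l[ &, injective gamma},
      range gamma = bdry Omega &
      forall s, \forall t \near (0 : R)^'+,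
        Omega (gamma s + t *: rot90 (derive1 gamma s))]].

Definition C2_boundary Omega : Prop :=
  exists gamma l, arclength_param Omega gamma l.

(* Two such parametrisations differ by a shift of the parameter, so nothing
   below depends on the chosen one. *)
Definition bd_param Omega : (R -> R * R) * R :=
  xget (fun=> 0, 0) [set p | arclength_param Omega p.1 p.2].

Definition bd_curve Omega : R -> R * R := (bd_param Omega).1.
Definition bd_length Omega : R := (bd_param Omega).2.

Definition inward_normal Omega (s : R) : R * R :=
  rot90 (derive1 (bd_curve Omega) s).

(* Signed so as to be nonnegative for a convex Omega. *)
Definition curvature Omega (s : R) : R :=
  dotp (derive1 (derive1 (bd_curve Omega)) s) (inward_normal Omega s).

(* [g] is the trace of [v] on the boundary, as a function of arclength: the
   value at [v] of the continuous extension to W^{1,2} of the restriction of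
   smooth functions to the boundary, with values in L^2 of the boundary. *)
Definition has_trace Omega (v : R * R -> R) (g : R -> R) : Prop :=
  measurable_fun (`[0, bd_length Omega] : set (measurableTypeR R)) g /\
  exists phi : nat -> (R * R -> R),
  [/\ forall n, smooth (phi n),
      W12norm Omega (phi n \- v) @[n --> \oo] --> 0%E &
      (\int[lebesgue_measure]_(s in `[0%R, bd_length Omega])
          ((phi n (bd_curve Omega s) - g s) ^+ 2)%:E)%E @[n --> \oo] --> 0%E].

End Boundary.

Section AvilesGiga.
Context {R : realType}.
Implicit Types (Omega : set (R * R)) (u v : R * R -> R).

Definition AG_energy (eps : R) Omega u : \bar R :=
  ((2^-1)%:E * \int[leb2]_(z in Omega)
     (eps^-1 * `|1 - wgrad_sq Omega u z| ^+ 2 + eps * whess_sq Omega u z)%:E)%E.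

Definition Lambda Omega u : Prop :=
  [/\ W22 Omega u,
      has_trace Omega u (fun=> 0) &
      exists g : 'I_2 -> R -> R,
        (forall i, has_trace Omega (wpderiv Omega i u) (g i)) /\
        {ae lebesgue_measure, forall s, s \in `[0, bd_length Omega] ->
           dotp (g ord0 s, g ord_max s) (inward_normal Omega s) = 1}].

Definition AG_minimiser (eps : R) Omega u : Prop :=
  Lambda Omega u /\
  forall v, Lambda Omega v -> (AG_energy eps Omega u <= AG_energy eps Omega v)%E.

End AvilesGiga.

(* Main.v *)
(* The estimate is uniform in eps away from discs, and quantitative only on discs.

   Fix Omega.  Some boundary point has curvature bounded below, so the curvature hypothesis bounds eps; comparing the
   minimiser with a fixed admissible function and using a Poincare inequality with trace then bounds u in W^{1,2}
   by a constant depending on Omega.  If the defect inf_y |Omega /_\ B_1(y)| is positive, the right-hand side is bounded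
   below and nothing more is needed.  If it vanishes, Omega is a unit disc B_1(c), and a power of eps has to be gained.

   On the disc, write x = z - c and eps = d^9, with 0 < d <= 1 (for eps > 1 the uniform bound suffices).  Comparison with
   the cone 1 - |x| smoothed at scale d^6 gives
     int (1 - |grad u|^2)^2 <= C d^12   and   int |hess u|^2 <= C d^-6.
   There is a polynomial vector field S(x, w) such that, for a gradient field w, div S(x, w) is x.w up to an error bounded
   by C |1 - |w|^2| (1 + |grad w|).  Since grad u = - x on the boundary, the flux of S is the same for u and for the
   smoothed cone; hence the integrals of x.grad u and of -|x| differ by at most C d^3, the product of the square roots of
   the two energies.  As |grad u| is close to 1, |x| |grad u + x/|x||^2 is small in L^1; removing the ball |x| < d, where
   the weight |x| degenerates, leaves int |grad u + x/|x||^2 <= C d^2.  This is the assertion with lambda = 1/9. *)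
Require Import Defs.
From HB Require Import structures.
From mathcomp Require Import all_boot all_order all_algebra.
From mathcomp Require Import all_classical all_reals all_analysis.
From mathcomp Require Import measurable_realfun ring lra.
Set Implicit Arguments.
Unset Strict Implicit.
Unset Printing Implicit Defensive.
Import Order.TTheory GRing.Theory Num.Theory numFieldNormedType.Exports.
Local Open Scope classical_set_scope.
Local Open Scope ring_scope.
Local Notation plane R := (measurableTypeR R * measurableTypeR R)%type.

(** The exponents come from two balances. Smoothing the cone at scale e costs, up to constants, e^2
    / eps in the well term and eps / e... weighted as eps * (1 / e) in the Hessian term; they agree
    when e^3 = eps^2, hence eps = d^9, e = d^6, and both are d^3. Excising a ball of radius rho then
    leaves d^3 / rho + rho^2, balanced at rho = d. The obstacle is that the calibration is nonlinear
    in a gradient known only to be in W^{1,2}, with an L^2 trace. Identities are proved for smooth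
    fields and passed to L^2 limits. The components of grad u are approximated separately, so the
    approximating fields are not gradients, and a curl term is carried until the symmetry of the
    weak Hessian removes it. Truncating the field makes all error factors bounded and Lipschitz, so
    no pointwise convergence is required. [Lambda] prescribes u and the normal component of its
    gradient on the boundary; the vanishing of the tangential component is recovered by integrations
    by parts. Convexity enters twice: it makes the distance concave, which yields its weak gradient,
    and it turns equality with a disc up to null sets into equality. *)

(** * Borel sets and Lebesgue measure on the plane *)

Lemma open_measurable2 (R : realType) (U : set (R * R)) :
  open U -> measurable (U : set (plane R)).
Proof.
move=> oU.
pose rect (q : (rat * rat) * (rat * rat)) : set (plane R) :=
  `]ratr q.1.1, ratr q.1.2[ `*` `]ratr q.2.1, ratr q.2.2[.
(* The sigma-algebra is generated by measurable rectangles, so U is written as a countable union of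
   open rectangles with rational corners; a rectangle not inside U contributes [set0]. *)
have -> : (U : set (plane R)) =
    \bigcup_q (if `[< rect q `<=` U >] then rect q else set0).
  apply/seteqP; split=> [z Uz|z [q _]]; last by case: asboolP => // h /h.
  have /nbhs_ballP[e /= e0 eU] : nbhs (z : R * R) U by exact: open_nbhs_nbhs.
  have h (x : R) : {q : rat * rat | x \in `]ratr q.1, ratr q.2[ &
      forall y, y \in `](ratr q.1 : R), ratr q.2[ -> ball x e y}.
    have [p hp] : {p : rat | (ratr p : R) \in `]x - e, x[}.
      by apply/cid; apply: rat_in_itvoo; rewrite ltrBlDr ltrDl.
    have [q hq] : {q : rat | (ratr q : R) \in `]x, x + e[}.
      by apply/cid; apply: rat_in_itvoo; rewrite ltrDl.
    exists (p, q) => /=.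
      by move: hp hq; rewrite !in_itv/= => /andP[_ ->] /andP[->].
    move=> y; rewrite in_itv/= -ball_normE/= => /andP[py yq].
    move: hp hq; rewrite !in_itv/= => /andP[a _] /andP[_ b].
    by rewrite ltr_norml; apply/andP; split; lra.
  have [p hp1 hp2] := h z.1; have [q hq1 hq2] := h z.2.
  exists (p, q) => //; case: asboolP => [_|[]]; first by split.
  by move=> w [/= w1 w2]; apply: eU; split; [exact: hp2|exact: hq2].
apply: countable_bigcupT_measurable => //.
move=> q; case: asboolP => // _.
by apply: measurableX; exact: measurable_itv.
Qed.

Lemma continuous_measurable2 (R : realType) (f : R * R -> R) :
  continuous f -> measurable_fun setT (f : plane R -> measurableTypeR R).
Proof.
move=> /continuousP cf; apply: (measurability _ (RGenOpens.measurableE R)).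
move=> _ [_ [a [b ->] <-]]; rewrite setTI; apply: open_measurable2.
exact/cf/interval_open.
Qed.

Lemma leb2X (R : realType) (A B : set (measurableTypeR R)) :
  measurable A -> measurable B ->
  leb2 (A `*` B) = (lebesgue_measure A * lebesgue_measure B)%E.
Proof. exact: product_measure1E. Qed.

Section translation.
Context (R : realType).

Lemma measurable_shiftr (a : R) :
  measurable_fun setT (fun x : measurableTypeR R => (x + a : measurableTypeR R)).
Proof. exact: measurable_funD. Qed.

(** Lebesgue measure is determined by its values on the intervals ]b, c], whose length is invariant.
    The translation is bundled as a measurable function so that its pushforward is a measure, to
    which uniqueness applies. *)
Lemma lebesgue_measure_shift (a : R) (A : set (measurableTypeR R)) :
  measurable A ->
  pushforward lebesgue_measure (fun x : measurableTypeR R => (x + a : measurableTypeR R)) A =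
  lebesgue_measure A.
Proof.
move=> mA; apply/esym.
pose mf := isMeasurableFun.Build _ _ _ _ _ (measurable_shiftr a).
pose F : {mfun measurableTypeR R >-> measurableTypeR R} :=
  HB.pack (fun x : measurableTypeR R => (x + a : measurableTypeR R)) mf.
apply: (@lebesgue_measure_unique R (pushforward lebesgue_measure F)) => // _ [[b c]] _ <-.
have e : F @^-1` `]b, c] = `](b - a)%R, (c - a)%R]%classic.
  by apply/seteqP; split=> x /=; rewrite !in_itv/= ltrBlDr lerBrDr.
rewrite -[RHS]/(lebesgue_measure (F @^-1` `]b, c])) e /=.
by rewrite !lebesgue_measure_itv/= !lte_fin ltrD2r -!EFinB; case: ifP => // _; congr EFin; ring.
Qed.

Definition shift2 (a : R * R) (z : plane R) : plane R := (z.1 + a.1, z.2 + a.2).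

Lemma measurable_shift2 a : measurable_fun setT (shift2 a).
Proof.
apply/measurable_fun_pairP; split.
  by apply: (measurableT_comp (measurable_shiftr a.1)); exact: measurable_fst.
by apply: (measurableT_comp (measurable_shiftr a.2)); exact: measurable_snd.
Qed.

Lemma leb2_shift a (A : set (plane R)) : measurable A ->
  pushforward leb2 (shift2 a) A = leb2 A.
Proof.
move=> mA; apply/esym.
pose mf := isMeasurableFun.Build _ _ _ _ _ (measurable_shift2 a).
pose F : {mfun plane R >-> plane R} := HB.pack (shift2 a) mf.
apply: (@product_measure_unique _ _ _ _ _ _ _ (pushforward leb2 F)) => // B C mB mC.
have e : F @^-1` (B `*` C) =
  ((fun x : measurableTypeR R => (x + a.1 : measurableTypeR R)) @^-1` B) `*`
  ((fun x : measurableTypeR R => (x + a.2 : measurableTypeR R)) @^-1` C) by [].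
rewrite -[LHS]/(leb2 (F @^-1` (B `*` C))) e leb2X.
- by congr (_ * _)%E; exact: lebesgue_measure_shift.
- by rewrite -[X in measurable X]setTI; apply: measurable_shiftr.
- by rewrite -[X in measurable X]setTI; apply: measurable_shiftr.
Qed.

(** This invariance is what moves a difference quotient from one factor of an integrand to the
    other. *)
Lemma integral_shift2 a (f : plane R -> \bar R) : measurable_fun setT f ->
  leb2.-integrable setT (f \o shift2 a) ->
  (\int[leb2]_z f (shift2 a z) = \int[leb2]_z f z)%E.
Proof.
move=> mf fi.
have := integral_pushforward (measurable_shift2 a) mf (mu := leb2) (D := setT).
rewrite preimage_setT => /(_ fi measurableT) <-.
apply: eq_measure_integral => [|mS A mA _]; first exact: measurable_shift2.
exact: leb2_shift.
Qed.

End translation.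

(** * Square integrable functions *)

Section square_integrable.
Context d (T : measurableType d) (R : realType) (mu : {measure set T -> \bar R}).
Variable D : set T.
Hypothesis mD : measurable D.
Implicit Types f g : T -> R.

(** Integrals are taken below as real numbers ([Rintegral]), with integrability carried explicitly.
    The measure is arbitrary because the same calculus serves the domain, with [leb2], and its
    boundary, with arclength. *)
Definition intg (f : T -> R) := mu.-integrable D (EFin \o f).
Definition sqint (f : T -> R) :=
  measurable_fun D f /\ intg (fun z => f z ^+ 2).

Lemma intg_meas f : intg f -> measurable_fun D f.
Proof. by move=> /measurable_int /measurable_EFinP. Qed.

Lemma le_intg f g : measurable_fun D f -> intg g ->
  (forall z, D z -> `|f z| <= g z) -> intg f.
Proof.
move=> mf ig fg; apply: (le_integrable mD _ _ ig); first exact/measurable_EFinP.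
by move=> z Dz /=; rewrite lee_fin (le_trans (fg _ Dz))// ler_norm.
Qed.

Lemma eq_intg f g : (forall z, D z -> f z = g z) -> intg f -> intg g.
Proof.
by move=> fg; apply: (eq_integrable mD) => z /set_mem Dz /=; rewrite fg.
Qed.

Lemma intgD f g : intg f -> intg g -> intg (fun z => f z + g z).
Proof. by move=> fi gi; have := integrableD mD fi gi. Qed.

Lemma intgZ k f : intg f -> intg (fun z => k * f z).
Proof. by move=> fi; have := integrableZl mD k fi. Qed.

Lemma intgN f : intg f -> intg (fun z => - f z).
Proof. by move=> fi; have := integrableN fi. Qed.

Lemma intgB f g : intg f -> intg g -> intg (fun z => f z - g z).
Proof. by move=> fi gi; apply: intgD => //; exact: intgN. Qed.

Lemma intg_norm f : intg f -> intg (fun z => `|f z|).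
Proof. by move=> fi; have := integrable_abse fi. Qed.

Lemma intg_bounded f (M : R) : (mu D < +oo)%E -> measurable_fun D f ->
  (forall z, D z -> `|f z| <= M) -> intg f.
Proof.
move=> Doo mf fM.
have : intg (fun=> M).
  apply/integrableP; split; first exact/measurable_EFinP/measurable_cst.
  rewrite (_ : (fun _ => _) = cst `|M|%:E)// integral_cst//.
  by rewrite lte_mul_pinfty// lee_fin.
by move/le_intg; apply.
Qed.

Lemma intgE f : intg f -> (\int[mu]_(z in D) (f z)%:E)%E = (Rintegral mu D f)%:E.
Proof. by move=> fi; rewrite /Rintegral fineK//; exact: integrable_fin_num. Qed.

Lemma sqintP f : sqint f <->
  measurable_fun D f /\ (\int[mu]_(z in D) ((f z) ^+ 2)%:E < +oo)%E.
Proof.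
split=> -[mf fi]; split => //; first exact: integrable_lty.
apply/integrableP; split; first exact/measurable_EFinP/measurable_funX.
by under eq_integral do rewrite /= ger0_norm ?sqr_ge0//.
Qed.

Lemma sqint_mul f g : sqint f -> sqint g -> intg (fun z => f z * g z).
Proof.
move=> [mf fi] [mg gi]; apply: (@le_intg _ (fun z => f z ^+ 2 + g z ^+ 2)).
- exact: measurable_funM.
- exact: intgD.
- move=> z _; rewrite normrM -(real_normK (num_real (f z))) -(real_normK (num_real (g z))).
  by have := sqr_ge0 (`|f z| - `|g z|); have := normr_ge0 (f z); have := normr_ge0 (g z); nra.
Qed.

Lemma sqintD f g : sqint f -> sqint g -> sqint (fun z => f z + g z).
Proof.
move=> f2 g2; have fg := sqint_mul f2 g2; move: f2 g2 => [mf fi] [mg gi]; split.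
  exact: measurable_funD.
apply: (@eq_intg (fun z => f z ^+ 2 + 2 * (f z * g z) + g z ^+ 2)).
  by move=> z _; ring.
by apply: intgD => //; apply: intgD => //; exact: intgZ.
Qed.

Lemma sqint_bmul f g (M : R) : sqint f -> measurable_fun D g ->
  (forall z, D z -> `|g z| <= M) -> sqint (fun z => g z * f z).
Proof.
move=> [mf fi] mg gM; split; first exact: measurable_funM.
apply: (@le_intg _ (fun z => M ^+ 2 * f z ^+ 2)).
- exact/measurable_funX/measurable_funM.
- exact: intgZ.
- move=> z Dz; rewrite ger0_norm ?sqr_ge0// exprMn ler_wpM2r ?sqr_ge0//.
  by rewrite -(real_normK (num_real (g z))) lerXn2r ?nnegrE// ?gM// (le_trans _ (gM _ Dz)).
Qed.

Lemma sqintZ k f : sqint f -> sqint (fun z => k * f z).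
Proof. by move=> f2; apply: (sqint_bmul f2 _ (M := `|k|)). Qed.

Lemma sqintN f : sqint f -> sqint (fun z => - f z).
Proof.
move=> /(sqintZ (-1)); rewrite (_ : (fun z => -1 * f z) = fun z => - f z)//.
by apply/funext => z; rewrite mulN1r.
Qed.

Lemma sqintB f g : sqint f -> sqint g -> sqint (fun z => f z - g z).
Proof. by move=> f2 g2; apply: sqintD => //; exact: sqintN. Qed.

Lemma eq_sqint f g : (forall z, D z -> f z = g z) -> sqint f -> sqint g.
Proof.
move=> fg [mf fi]; split.
  by apply: (eq_measurable_fun f) => // z /set_mem; exact: fg.
by apply: eq_intg fi => z Dz; rewrite fg.
Qed.

Lemma sqint_bounded f (M : R) : (mu D < +oo)%E -> measurable_fun D f ->
  (forall z, D z -> `|f z| <= M) -> sqint f.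
Proof.
move=> Doo mf fM; split => //; apply: (intg_bounded (M := M ^+ 2)) => //.
  exact: measurable_funX.
move=> z Dz; rewrite normrX lerXn2r ?nnegrE ?fM//.
by rewrite (le_trans _ (fM _ Dz)).
Qed.

Lemma sqint_intg f : (mu D < +oo)%E -> sqint f -> intg f.
Proof.
move=> Doo f2; apply: (@eq_intg (fun z => 1 * f z)); first by move=> z _; rewrite mul1r.
by apply: sqint_mul => //; apply: (sqint_bounded (M := 1)) => // z _; rewrite normr1.
Qed.

Local Notation I := (Rintegral mu D).

Lemma RintD f g : intg f -> intg g -> I (fun z => f z + g z) = I f + I g.
Proof. exact: RintegralD. Qed.

Lemma RintB f g : intg f -> intg g -> I (fun z => f z - g z) = I f - I g.
Proof. exact: RintegralB. Qed.

Lemma RintZ k f : intg f -> I (fun z => k * f z) = k * I f.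
Proof. by move=> fi; rewrite -RintegralZl. Qed.

Lemma RintN f : intg f -> I (fun z => - f z) = - I f.
Proof.
move=> fi; rewrite -mulN1r -RintZ//; apply: eq_Rintegral => z _.
by rewrite mulN1r.
Qed.

Lemma eq_Rint f g : (forall z, D z -> f z = g z) -> I f = I g.
Proof. by move=> fg; apply: eq_Rintegral => z /set_mem; exact: fg. Qed.

Lemma le_Rint f g : intg f -> intg g -> (forall z, D z -> f z <= g z) -> I f <= I g.
Proof. exact: le_Rintegral. Qed.

Lemma Rint_ge0 f : (forall z, D z -> 0 <= f z) -> 0 <= I f.
Proof. exact: Rintegral_ge0. Qed.

Lemma norm_Rint f : intg f -> `|I f| <= I (fun z => `|f z|).
Proof. exact: le_normr_Rintegral. Qed.

Lemma ae_eq_Rint f g : measurable_fun D f -> measurable_fun D g -> ae_eq mu D f g ->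
  I f = I g.
Proof.
move=> mf mg fg; congr fine; apply: ae_eq_integral => //; [exact/measurable_EFinP|exact/measurable_EFinP|].
by apply: filterS fg => z /= h Dz; rewrite h.
Qed.

Lemma RintBl f g h : intg (fun z => f z * h z) -> intg (fun z => g z * h z) ->
  I (fun z => (f z - g z) * h z) = I (fun z => f z * h z) - I (fun z => g z * h z).
Proof. by move=> fi gi; rewrite -RintB//; apply: eq_Rint => z _; rewrite mulrBl. Qed.

Lemma cauchy_schwarz f g : sqint f -> sqint g ->
  `|I (fun z => f z * g z)| <=
  Num.sqrt (I (fun z => f z ^+ 2)) * Num.sqrt (I (fun z => g z ^+ 2)).
Proof.
move=> f2 g2; have fg := sqint_mul f2 g2; have [_ fi] := f2; have [_ gi] := g2.
set A := I (fun z => f z ^+ 2); set C := I (fun z => g z ^+ 2); set B := I _.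
have A0 : 0 <= A by apply: Rint_ge0 => z _; exact: sqr_ge0.
have C0 : 0 <= C by apply: Rint_ge0 => z _; exact: sqr_ge0.
(* The integral of (f - t g)^2, a nonnegative polynomial in t. *)
have key t : 0 <= A - 2 * t * B + t ^+ 2 * C.
  rewrite -!RintZ// -RintB//; last exact: intgZ.
  rewrite -RintD//; [|by apply: intgB => //; exact: intgZ|exact: intgZ].
  apply: Rint_ge0 => z _; rewrite (_ : _ + _ = (f z - t * g z) ^+ 2) ?sqr_ge0//; ring.
rewrite -sqrtrM// -sqrtr_sqr ler_wsqrtr//.
(* For C = 0 the polynomial is affine in t and bounded below, so B = 0: the value of t chosen next
   would make it -1. Otherwise it is evaluated at its minimum B / C. *)
have [C00|C00] := eqVneq C 0.
  have : B = 0.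
    apply/eqP/negPn/negP => B0.
    have := key ((A + 1) / (2 * B)); rewrite C00 mulr0 addr0.
    by rewrite (_ : 2 * _ * B = A + 1); [lra|field].
  by move=> ->; rewrite C00 expr0n mulr0.
have := key (B / C).
rewrite (_ : A - _ + _ = (A * C - B ^+ 2) / C); last by field.
by rewrite pmulr_lge0 ?invr_gt0 ?lt_neqAle 1?eq_sym ?C00// subr_ge0.
Qed.

Lemma sq_le2 f g : sqint f -> sqint g ->
  I (fun z => (f z + g z) ^+ 2) <=
  2 * I (fun z => f z ^+ 2) + 2 * I (fun z => g z ^+ 2).
Proof.
move=> f2 g2; have [_ fi] := f2; have [_ gi] := g2; rewrite -!RintZ// -RintD; try exact: intgZ.
apply: le_Rint; [by have [] := sqintD f2 g2|by apply: intgD; exact: intgZ|].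
by move=> z _; have := sqr_ge0 (f z - g z); nra.
Qed.

Definition cvg2 (F : nat -> T -> R) (f : T -> R) :=
  I (fun z => (F n z - f z) ^+ 2) @[n --> \oo] --> (0 : R).

Lemma cvg2_mul F f g : (forall n, sqint (F n)) -> sqint f -> sqint g ->
  cvg2 F f -> I (fun z => F n z * g z) @[n --> \oo] --> I (fun z => f z * g z).
Proof.
move=> F2 f2 g2 Ff; apply/subr_cvg0.
pose h n := Num.sqrt (I (fun z => (F n z - f z) ^+ 2)) * Num.sqrt (I (fun z => g z ^+ 2)).
have h0 : h n @[n --> \oo] --> (0 : R).
  rewrite -[X in _ --> X](mul0r (Num.sqrt (I (fun z => g z ^+ 2)))).
  apply: cvgM; last exact: cvg_cst.
  by rewrite -[X in _ --> X](sqrtr0 R); apply: continuous_cvg => //; exact: sqrt_continuous.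
apply/norm_cvg0P; apply: (squeeze_cvgr _ (cvg_cst 0) h0).
near=> n; rewrite normr_ge0/= -RintB ?sqint_mul//.
rewrite (_ : (fun z => _ - _) = fun z => (F n z - f z) * g z); last first.
  by apply/funext => z; rewrite mulrBl.
by apply: cauchy_schwarz => //; exact: sqintB.
Unshelve. all: by end_near.
Qed.

Lemma Rint_dct (F : nat -> T -> R) f G : (forall n, measurable_fun D (F n)) ->
  (forall z, D z -> F n z @[n --> \oo] --> f z) -> intg G ->
  (forall n z, D z -> `|F n z| <= G z) ->
  intg f /\ I (F n) @[n --> \oo] --> I f.
Proof.
move=> mF Ff Gi FG.
have mf : measurable_fun D f by apply: (measurable_fun_cvg mF).
have fi : intg f.
  apply: (le_intg mf Gi) => z Dz.
  have h : `|F n z| @[n --> \oo] --> `|f z| by apply: cvg_norm; exact: Ff.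
  rewrite -(cvg_lim (@Rhausdorff R) h); apply: limr_le; first by apply/cvg_ex; exists `|f z|.
  by near=> n; exact: FG.
split => //; apply: (@fine_cvg _ _ _ _ (fun n => \int[mu]_(z in D) (F n z)%:E)%E).
rewrite -(intgE fi); apply: (@dominated_cvg _ _ _ _ _ mD (fun n z => (F n z)%:E) _ (EFin \o G)) => //.
- by move=> n; exact/measurable_EFinP.
- by move=> z Dz; apply: cvg_EFin; [by near=> n|exact: Ff].
Unshelve. all: by end_near. Qed.

End square_integrable.

Lemma L2_sqint (R : realType) (D : set (R * R)) (f : R * R -> R) :
  measurable (D : set (plane R)) -> L2 D f <-> sqint leb2 (D : set (plane R)) f.
Proof. by move=> mD; rewrite sqintP. Qed.

(** * Smooth functions *)

Section smooth_functions.
Context {R : realType}.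
Implicit Types (f g : R * R -> R) (h : R -> R).

Lemma pderiv_cst i (a : R) : pderiv i (fun=> a) = fun=> 0.
Proof. by apply/funext => z; exact: (derive_cst (V := (R * R)%type) a z). Qed.

Lemma pderivD i f g : (forall z, differentiable f z) ->
  (forall z, differentiable g z) ->
  pderiv i (fun z => f z + g z) = fun z => pderiv i f z + pderiv i g z.
Proof.
move=> df dg; apply/funext => z; rewrite /pderiv -deriveD//.
- exact: diff_derivable.
- exact: diff_derivable.
Qed.

Lemma pderivM i f g : (forall z, differentiable f z) ->
  (forall z, differentiable g z) ->
  pderiv i (fun z => f z * g z) =
  fun z => pderiv i f z * g z + f z * pderiv i g z.
Proof.
move=> df dg; apply/funext => z; rewrite /pderiv.
rewrite (_ : (fun z => f z * g z) = (f * g)%R)// deriveM; try exact: diff_derivable.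
by rewrite addrC /GRing.scale/=; congr (_ + _); rewrite mulrC.
Qed.

Lemma pderiv_comp i h f : (forall x, derivable h x 1) ->
  (forall z, differentiable f z) ->
  pderiv i (fun z => h (f z)) = fun z => derive1 h (f z) * pderiv i f z.
Proof.
move=> dh df; apply/funext => z; rewrite /pderiv.
have dhf : differentiable (h \o f) z.
  by apply: differentiable_comp => //; exact/derivable1_diffP.
rewrite (_ : (fun z => h (f z)) = h \o f)// !deriveE// diff_comp//; last exact/derivable1_diffP.
by rewrite /= deriv1E// mulrC.
Qed.

Lemma continuous_fst2 : continuous (fst : R * R -> R).
Proof. by move=> z; exact: cvg_fst. Qed.

Lemma continuous_snd2 : continuous (snd : R * R -> R).
Proof. by move=> z; exact: cvg_snd. Qed.

Lemma pderiv_fst i : pderiv i (fun z : R * R => z.1) = fun=> (basis2 i).1 :> R.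
Proof.
apply/funext => z; rewrite /pderiv.
rewrite deriveE; last exact: linear_differentiable continuous_fst2.
by rewrite diff_lin//; exact: continuous_fst2.
Qed.

Lemma pderiv_snd i : pderiv i (fun z : R * R => z.2) = fun=> (basis2 i).2 :> R.
Proof.
apply/funext => z; rewrite /pderiv.
rewrite deriveE; last exact: linear_differentiable continuous_snd2.
by rewrite diff_lin//; exact: continuous_snd2.
Qed.

Lemma differentiable_fst z : differentiable (fst : R * R -> R) z.
Proof. exact: linear_differentiable continuous_fst2. Qed.

Lemma differentiable_snd z : differentiable (snd : R * R -> R) z.
Proof. exact: linear_differentiable continuous_snd2. Qed.

Lemma CkS k f : Ck k.+1 f <->
  (forall z, differentiable f z) /\ forall i, Ck k (pderiv i f).
Proof. by []. Qed.

Lemma Ck_diff k f : Ck k.+1 f -> forall z, differentiable f z.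
Proof. by case. Qed.

Lemma CkW k f : Ck k.+1 f -> Ck k f.
Proof.
elim: k f => [f [df _] z|k IH f [df dk]]; last by split => // i; exact: IH.
exact: differentiable_continuous.
Qed.

Lemma Ck_cst k (a : R) : Ck k (fun=> a).
Proof.
elim: k a => [a|k IH a /=]; first exact: cst_continuous.
by split=> [z|i]; [exact: differentiable_cst|rewrite pderiv_cst].
Qed.

Lemma Ck_fst k : Ck k (fun z : R * R => z.1).
Proof.
case: k => [z|k /=]; first exact: continuous_fst2.
by split=> [z|i]; [exact: differentiable_fst|rewrite pderiv_fst; exact: Ck_cst].
Qed.

Lemma Ck_snd k : Ck k (fun z : R * R => z.2).
Proof.
case: k => [z|k /=]; first exact: continuous_snd2.
by split=> [z|i]; [exact: differentiable_snd|rewrite pderiv_snd; exact: Ck_cst].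
Qed.

Lemma CkD k f g : Ck k f -> Ck k g -> Ck k (fun z => f z + g z).
Proof.
elim: k f g => [f g cf cg z|k IH f g /CkS[df fk] /CkS[dg gk]].
  by apply: cvgD; [exact: cf|exact: cg].
apply/CkS; split=> [z|i]; first exact: differentiableD.
by rewrite pderivD//; exact: IH.
Qed.

Lemma CkM k f g : Ck k f -> Ck k g -> Ck k (fun z => f z * g z).
Proof.
elim: k f g => [f g cf cg z|k IH f g fk gk].
  by apply: cvgM; [exact: cf|exact: cg].
have /CkS[df fk'] := fk; have /CkS[dg gk'] := gk.
apply/CkS; split=> [z|i]; first exact: differentiableM.
by rewrite pderivM//; apply: CkD; apply: IH => //; exact: CkW.
Qed.

Lemma CkZ k (a : R) f : Ck k f -> Ck k (fun z => a * f z).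
Proof. by apply: CkM; exact: Ck_cst. Qed.

Lemma CkN k f : Ck k f -> Ck k (fun z => - f z).
Proof.
move=> /(CkZ (-1)); congr Ck; apply/funext => z; exact: mulN1r.
Qed.

Lemma CkB k f g : Ck k f -> Ck k g -> Ck k (fun z => f z - g z).
Proof. by move=> fk gk; apply: CkD => //; exact: CkN. Qed.

Fixpoint Ck1 (k : nat) h : Prop :=
  if k is k'.+1 then (forall x, derivable h x 1) /\ Ck1 k' (derive1 h)
  else continuous h.

Lemma Ck1S k h : Ck1 k.+1 h <->
  (forall x, derivable h x 1) /\ Ck1 k (derive1 h).
Proof. by []. Qed.

Lemma Ck_comp k h f : Ck1 k h -> Ck k f -> Ck k (fun z => h (f z)).
Proof.
elim: k h f => [h f ch cf z|k IH h f hk fk].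
  by apply: (continuous_comp (cf z)); exact: ch.
have /Ck1S[dh hk'] := hk; have /CkS[df fk'] := fk.
apply/CkS; split=> [z|i].
  by apply: differentiable_comp => //; exact/derivable1_diffP.
rewrite pderiv_comp//; apply: CkM => //; apply: IH => //; exact: CkW.
Qed.

Lemma Ck1D k h1 h2 : Ck1 k h1 -> Ck1 k h2 -> Ck1 k (fun x => h1 x + h2 x).
Proof.
elim: k h1 h2 => [h1 h2 c1 c2 x|k IH h1 h2 /Ck1S[d1 k1] /Ck1S[d2 k2]].
  by apply: cvgD; [exact: c1|exact: c2].
apply/Ck1S; split=> [x|]; first exact: derivableD.
rewrite (_ : derive1 (fun x => h1 x + h2 x) = fun x => derive1 h1 x + derive1 h2 x); first exact: IH.
by apply/funext => x; rewrite !derive1E deriveD.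
Qed.

Lemma Ck1Z k (a : R) h : Ck1 k h -> Ck1 k (fun x => a * h x).
Proof.
elim: k h => [h ch x|k IH h /Ck1S[dh hk]].
  by apply: cvgM; [exact: cvg_cst|exact: ch].
apply/Ck1S; split=> [x|]; first exact: derivableZ.
rewrite (_ : derive1 (fun x => a * h x) = fun x => a * derive1 h x); first exact: IH.
by apply/funext => x; rewrite !derive1E deriveZ.
Qed.

(** The index m makes the family t^-m exp(-1/t), extended by 0, stable under differentiation up to
    linear combinations, so smoothness is an induction over all m at once. *)
Definition flat_exp (m : nat) (t : R) : R :=
  if 0 < t then t^-1 ^+ m * expR (- t^-1) else 0.

(** With y = 1/t this is exp y >= 1 + y^m / m!, read off the exponential series. *)
Lemma flat_exp_bounded m t : 0 <= flat_exp m t <= m`!%:R.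
Proof.
rewrite /flat_exp; case: ifPn => [t0|_]; last by rewrite lexx ler0n.
have y0 : 0 < t^-1 by rewrite invr_gt0.
rewrite mulr_ge0 ?expR_ge0 ?exprn_ge0 ?(ltW y0)//= expRN ler_pdivrMr ?expR_gt0//.
case: m => [|m]; first by rewrite expr0 fact0 mul1r -[X in X <= _]expR0 ler_expR ltW.
have := expR_ge1Dxn m (ltW y0); set F := _`!%:R => h.
have F0 : 0 < F by rewrite ltr0n fact_gt0.
rewrite mulrC -ler_pdivrMr//; apply: le_trans h; by rewrite lerDr.
Qed.

Lemma flat_expS m t : t ^+ 2 * flat_exp m.+2 t = flat_exp m t.
Proof.
rewrite /flat_exp; case: ifPn => [t0|_]; last by rewrite mulr0.
have -> : t^-1 ^+ m.+2 = t ^- 2 * t^-1 ^+ m by rewrite -exprVn -exprD.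
rewrite !mulrA mulfV ?mul1r//.
by rewrite expf_neq0 ?gt_eqF.
Qed.

Lemma is_derive_flat_exp m (t : R) :
  is_derive t 1 (flat_exp m) (- m%:R * flat_exp m.+1 t + flat_exp m.+2 t).
Proof.
have [t0|t0|->] := ltgtP t 0.
- rewrite /flat_exp !ltNge (ltW t0)/= mulr0 addr0.
  have h : is_derive t (1 : R) (cst (0 : R)) 0 := is_derive_cst _ _ _.
  apply: near_eq_is_derive h.
  near=> s; rewrite ltNge (_ : s <= 0)//; apply/ltW; near: s.
  exact: lt_nbhsl.
- rewrite /flat_exp t0.
  have tn0 : t != 0 by rewrite gt_eqF.
  have h1 : is_derive t (1 : R) (fun s : R => s^-1) (- t ^- 2).
    have := @is_deriveV R id t 1 1 tn0 (is_derive_id _ _).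
    by rewrite /GRing.scale/= mulr1.
  have h2 : is_derive t (1 : R) (fun s : R => expR (- s^-1)) (expR (- t^-1) * t ^- 2).
    have h3 : is_derive t (1 : R) (fun s : R => - s^-1) (t ^- 2).
      by apply: is_derive_eq; rewrite opprK.
    exact: (is_derive1_comp (f := expR) (g := fun s : R => - s^-1)).
  have h4 : is_derive t (1 : R) (fun s : R => s^-1 ^+ m * expR (- s^-1))
    (- m%:R * (t^-1 ^+ m.+1 * expR (- t^-1)) + t^-1 ^+ m.+2 * expR (- t^-1)).
    rewrite (_ : (fun s : R => s^-1 ^+ m * expR (- s^-1)) =
      ((fun s : R => s^-1) ^+ m) * (fun s : R => expR (- s^-1))); last first.
      by apply/funext => s /=; rewrite /GRing.mul/= exprfctE.
    apply: is_derive_eq; rewrite /GRing.scale/= exprfctE -exprVn.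
    case: m => [|m] /=; rewrite ?mulr0n ?mul0r ?oppr0 ?mul0r ?add0r ?expr0 ?mul1r.
      by ring.
    rewrite !exprS -mulr_natl; ring.
  apply: near_eq_is_derive h4.
  by near=> s; rewrite (_ : 0 < s)//; near: s; exact: lt_nbhsr.
- rewrite {2 3}/flat_exp ltxx mulr0 addr0.
  (* At 0 the difference quotient is z * [flat_exp m.+2 z] by [flat_expS], and it tends to 0 because
     [flat_exp m.+2] is bounded. *)
  apply/is_derive1_caratheodory; exists (fun z => z * flat_exp m.+2 z); split.
  + move=> z; rewrite {2}/flat_exp ltxx !subr0 -[LHS]flat_expS; ring.
  + suff: (z * flat_exp m.+2 z) @[z --> (0 : R)] --> (0 : R).
      by rewrite /prop_for /continuous_at mul0r.
    apply/norm_cvg0P.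
    apply: (@squeeze_cvgr _ _ _ _ (cst 0) (fun z => `|z| * m.+2`!%:R)).
    * near=> z; rewrite normr_ge0 normrM ler_wpM2l ?normr_ge0//=.
      by have /andP[e0 e1] := flat_exp_bounded m.+2 z; rewrite ger0_norm.
    * exact: cvg_cst.
    * rewrite -[X in _ --> X](mul0r m.+2`!%:R); apply: cvgM; last exact: cvg_cst.
      by have := @norm_continuous _ R (0 : R); rewrite /continuous_at normr0.
  + by rewrite mul0r.
Unshelve. all: by end_near. Qed.

Lemma Ck1_flat_exp k m : Ck1 k (flat_exp m).
Proof.
elim: k m => [m x|k IH m].
  apply: differentiable_continuous; apply/derivable1_diffP.
  by case: (is_derive_flat_exp m x).
apply/Ck1S; split=> [x|]; first by case: (is_derive_flat_exp m x).
rewrite (_ : derive1 _ = fun x => - m%:R * flat_exp m.+1 x + 1 * flat_exp m.+2 x).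
  by apply: Ck1D; apply: Ck1Z.
apply/funext => x; rewrite derive1E mul1r.
by case: (is_derive_flat_exp m x).
Qed.

Lemma pderiv_continuous i f k : Ck k.+1 f -> continuous (pderiv i f).
Proof. by move=> /CkS[_ /(_ i)]; elim: k => // k IH /CkW. Qed.

Lemma smooth_continuous f : smooth f -> continuous f.
Proof. by move=> /(_ 0%N). Qed.

Lemma smooth_diff f : smooth f -> forall z, differentiable f z.
Proof. by move=> /(_ 1%N)/CkS[]. Qed.

Lemma smooth_pderiv i f : smooth f -> smooth (pderiv i f).
Proof. by move=> sf k; have /CkS[_] := sf k.+1. Qed.

End smooth_functions.

(** * The fundamental lemma of the calculus of variations *)

Section box_test_functions.
Context {R : realType}.
Implicit Types (a b c d : R).

(** The parameter n is a steepness: exp(-1/(n t)) tends to 1 for t > 0 and the extension by 0 stays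
    0 for t <= 0. The bumps thus stay in [0, 1] and tend pointwise to the indicator of the open
    interval. *)
Definition bump (n a b x : R) : R :=
  flat_exp 0 (n * (x - a)) * flat_exp 0 (n * (b - x)).

Definition box_bump (n a b c d : R) (z : R * R) : R :=
  bump n a b z.1 * bump n c d z.2.

Lemma flat_exp0_gt0 (t : R) : (0 < flat_exp 0 t) = (0 < t).
Proof.
by rewrite /flat_exp; case: ifPn => // _; rewrite expr0 mul1r expR_gt0.
Qed.

Lemma flat_exp01 (t : R) : 0 <= flat_exp 0 t <= 1.
Proof. exact: (flat_exp_bounded 0). Qed.

Lemma bump01 n a b x : 0 <= bump n a b x <= 1.
Proof.
have /andP[u0 u1] := flat_exp01 (n * (x - a)).
have /andP[v0 v1] := flat_exp01 (n * (b - x)).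
by rewrite mulr_ge0//= mulr_ile1.
Qed.

Lemma box_bump01 n a b c d z : 0 <= box_bump n a b c d z <= 1.
Proof.
have /andP[u0 u1] := bump01 n a b z.1; have /andP[v0 v1] := bump01 n c d z.2.
by rewrite mulr_ge0//= mulr_ile1.
Qed.

Lemma bump_neq0 n a b x : 0 < n -> (bump n a b x != 0) = (x \in `]a, b[).
Proof.
move=> n0; rewrite in_itv/= mulf_eq0 negb_or.
rewrite !neq_lt ![_ < 0]ltNge.
have /andP[-> _] := flat_exp01 (n * (x - a)).
have /andP[-> _] := flat_exp01 (n * (b - x)).
by rewrite /= !flat_exp0_gt0 !pmulr_rgt0// !subr_gt0.
Qed.

Lemma box_bump_neq0 n a b c d z : 0 < n ->
  (box_bump n a b c d z != 0) = (z.1 \in `]a, b[) && (z.2 \in `]c, d[).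
Proof. by move=> n0; rewrite mulf_eq0 negb_or !bump_neq0. Qed.

Lemma Ck_bump1 k n a b : Ck k (fun z : R * R => bump n a b z.1).
Proof.
apply: CkM; apply: (Ck_comp (Ck1_flat_exp k 0)); apply: CkZ; apply: CkB;
  by [exact: Ck_fst|exact: Ck_cst].
Qed.

Lemma Ck_bump2 k n a b : Ck k (fun z : R * R => bump n a b z.2).
Proof.
apply: CkM; apply: (Ck_comp (Ck1_flat_exp k 0)); apply: CkZ; apply: CkB;
  by [exact: Ck_snd|exact: Ck_cst].
Qed.

Lemma smooth_box_bump n a b c d : smooth (box_bump n a b c d).
Proof. by move=> k; apply: CkM; [exact: Ck_bump1|exact: Ck_bump2]. Qed.

Lemma pderiv_indep1 (f : R * R -> R) : (forall z w, z.1 = w.1 -> f z = f w) ->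
  pderiv ord_max f = fun=> 0.
Proof.
move=> h; apply/funext => z; rewrite /pderiv /derive.
rewrite (_ : (fun t => _) = cst 0) ?lim_cst//.
apply/funext => t /=; rewrite (h _ z) ?subrr ?scaler0//=.
by rewrite /GRing.scale/= mulr0 add0r.
Qed.

Lemma pderiv_indep2 (f : R * R -> R) : (forall z w, z.2 = w.2 -> f z = f w) ->
  pderiv ord0 f = fun=> 0.
Proof.
move=> h; apply/funext => z; rewrite /pderiv /derive.
rewrite (_ : (fun t => _) = cst 0) ?lim_cst//.
apply/funext => t /=; rewrite (h _ z) ?subrr ?scaler0//=.
by rewrite /GRing.scale/= mulr0 add0r.
Qed.

Lemma pderiv_indep1_indep (f : R * R -> R) : (forall z w, z.1 = w.1 -> f z = f w) ->
  forall z w, z.1 = w.1 -> pderiv ord0 f z = pderiv ord0 f w.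
Proof.
move=> h z w zw.
have e : (fun t : R => t^-1 *: (f (t *: basis2 ord0 + z) - f z)) =
         (fun t : R => t^-1 *: (f (t *: basis2 ord0 + w) - f w)).
  apply/funext => t; rewrite (h z w)//; congr (_ *: (_ - _)).
  by apply: h; rewrite /= zw.
by rewrite /pderiv /derive e.
Qed.

Lemma pderiv_indep2_indep (f : R * R -> R) : (forall z w, z.2 = w.2 -> f z = f w) ->
  forall z w, z.2 = w.2 -> pderiv ord_max f z = pderiv ord_max f w.
Proof.
move=> h z w zw.
have e : (fun t : R => t^-1 *: (f (t *: basis2 ord_max + z) - f z)) =
         (fun t : R => t^-1 *: (f (t *: basis2 ord_max + w) - f w)).
  apply/funext => t; rewrite (h z w)//; congr (_ *: (_ - _)).
  by apply: h; rewrite /= zw.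
by rewrite /pderiv /derive e.
Qed.

(** The bump is a product of functions of one coordinate each, so both mixed derivatives are the
    product of the two one-variable derivatives. The symmetry of weak Hessians is tested on these
    functions. *)
Lemma pderivC_box_bump n a b c d :
  pderiv ord_max (pderiv ord0 (box_bump n a b c d)) =
  pderiv ord0 (pderiv ord_max (box_bump n a b c d)).
Proof.
set A := fun z : R * R => bump n a b z.1; set B := fun z : R * R => bump n c d z.2.
have sA : smooth A by move=> k; exact: Ck_bump1.
have sB : smooth B by move=> k; exact: Ck_bump2.
have iA z w : z.1 = w.1 -> A z = A w by rewrite /A => ->.
have iB z w : z.2 = w.2 -> B z = B w by rewrite /B => ->.
have dA := smooth_diff sA; have dB := smooth_diff sB.
have d0A := smooth_diff (smooth_pderiv ord0 sA).
have d1B := smooth_diff (smooth_pderiv ord_max sB).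
have -> : box_bump n a b c d = (fun z => A z * B z) by [].
have e0 : pderiv ord0 (fun z => A z * B z) = (fun z => pderiv ord0 A z * B z).
  rewrite (pderivM _ dA dB) (pderiv_indep2 iB).
  by apply/funext => z; rewrite mulr0 addr0.
have e1 : pderiv ord_max (fun z => A z * B z) = (fun z => A z * pderiv ord_max B z).
  rewrite (pderivM _ dA dB) (pderiv_indep1 iA).
  by apply/funext => z; rewrite mul0r add0r.
rewrite e0 e1 (pderivM _ d0A dB) (pderivM _ dA d1B).
rewrite (pderiv_indep1 (pderiv_indep1_indep iA)) (pderiv_indep2 (pderiv_indep2_indep iB)).
by apply/funext => z; rewrite mulr0 mul0r addr0 add0r.
Qed.

Lemma closed_box a b c d : closed ((`[a, b]%classic `*` `[c, d]%classic) : set (R * R)).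
Proof.
rewrite (_ : _ `*` _ = fst @^-1` `[a, b]%classic `&` snd @^-1` `[c, d]%classic)//.
apply: closedI.
  by apply: (continuous_closedP _).1; [exact: continuous_fst2|exact: interval_closed].
by apply: (continuous_closedP _).1; [exact: continuous_snd2|exact: interval_closed].
Qed.

Lemma test_fun_box_bump (Omega : set (R * R)) n a b c d : 0 < n ->
  (`[a, b]%classic `*` `[c, d]%classic) `<=` Omega ->
  test_fun Omega (box_bump n a b c d).
Proof.
move=> n0 sub.
have h : closure [set z | box_bump n a b c d z != 0] `<=` `[a, b]%classic `*` `[c, d]%classic.
  rewrite closureE => z /(_ (`[a, b]%classic `*` `[c, d]%classic)); apply; split.
    exact: closed_box.
  move=> w /=; rewrite box_bump_neq0// => /andP[].
  by rewrite !in_itv/= => /andP[/ltW-> /ltW->] /andP[/ltW-> /ltW->].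
split; first exact: smooth_box_bump.
  apply: (subclosed_compact _ _ h); first exact: closed_closure.
  by apply: compact_setX; exact: segment_compact.
exact: subset_trans h sub.
Qed.

Lemma cvg_flat_exp0 (t : R) :
  flat_exp 0 (n.+1%:R * t) @[n --> \oo] --> (if 0 < t then 1 else 0 : R).
Proof.
case: ifPn => [t0|t0]; last first.
  rewrite (_ : (fun n => _) = cst 0); first exact: cvg_cst.
  apply/funext => n; rewrite /flat_exp ifF//; apply/negbTE.
  by rewrite pmulr_rgt0.
rewrite (_ : (fun n => _) = (fun n => expR (- (t^-1 * n.+1%:R^-1)))); last first.
  apply/funext => n; rewrite /flat_exp pmulr_rgt0// t0 expr0 mul1r.
  by rewrite invfM mulrC.
rewrite -[X in _ --> X]expR0 -oppr0 -[X in - X](mulr0 t^-1).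
apply: continuous_cvg; first exact: continuous_expR.
apply: cvgN; apply: cvgM; first exact: cvg_cst.
exact: cvg_harmonic.
Qed.

Lemma cvg_box_bump a b c d z :
  box_bump n.+1%:R a b c d z @[n --> \oo] -->
  (\1_(`]a, b[%classic `*` `]c, d[%classic) z : R).
Proof.
have h x u v : bump n.+1%:R u v x @[n --> \oo] --> (\1_(`]u, v[%classic) x : R).
  rewrite indicE mem_setE in_itv/=.
  have -> : ((u < x < v)%R%:R : R) = (if 0 < x - u then 1 else 0) * (if 0 < v - x then 1 else 0).
    by rewrite !subr_gt0; case: (u < x); case: (x < v); rewrite /= ?mulr0 ?mul0r ?mulr1.
  by apply: cvgM; exact: cvg_flat_exp0.
have -> : (\1_(`]a, b[%classic `*` `]c, d[%classic) z : R) =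
  \1_(`]a, b[%classic) z.1 * \1_(`]c, d[%classic) z.2.
  by rewrite !indicE -natrM mulnb in_setX.
by apply: cvgM; exact: h.
Qed.

End box_test_functions.

Section fundamental_lemma.
Context {R : realType}.

Lemma measurable_box (a b c d : R) :
  measurable ((`]a, b[%classic `*` `]c, d[%classic) : set (plane R)).
Proof. by apply: measurableX; exact: measurable_itv. Qed.

(** The sets A with vanishing integral over the preimage form a Dynkin system, by additivity for
    complements and countable additivity for disjoint unions; it contains a generator stable under
    intersection. *)
Lemma integral_preimage_eq0 d (T : measurableType d) (mu : {measure set T -> \bar R})
    d' (S : measurableType d') (G : set (set S)) (p : T -> S) (Q : set T) (g : T -> \bar R) :
  measurable = <<s G >> -> setI_closed G -> measurable_fun setT p -> measurable Q ->
  mu.-integrable Q g -> (\int[mu]_(z in Q) g z = 0)%E ->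
  (forall A, G A -> \int[mu]_(z in Q `&` p @^-1` A) g z = 0)%E ->
  forall A, measurable A -> (\int[mu]_(z in Q `&` p @^-1` A) g z = 0)%E.
Proof.
move=> mG GI mp mQ gi Q0 G0 A mA.
have mpre B : measurable B -> measurable (Q `&` p @^-1` B).
  by move=> mB; apply: measurableI => //; rewrite -[X in measurable X]setTI; exact: mp.
have igr B : measurable B -> mu.-integrable (Q `&` p @^-1` B) g.
  by move=> mB; apply: (integrableS mQ (mpre _ mB)).
pose P (B : set S) := (\int[mu]_(z in Q `&` p @^-1` B) g z = 0)%E.
suff : P A by [].
rewrite mG in mA; move: A mA; apply: (dynkin_induction mG GI); rewrite /P//.
- by rewrite preimage_setT setIT.
- move=> B mB PB; have mB' := measurableC mB.
  move: (Q0); rewrite -{1}(setUIDK Q (p @^-1` B)) integral_setU//.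
  + by rewrite PB add0e => <-; congr (\int[mu]_(z in _) _)%E.
  + exact: mpre.
  + exact: (mpre _ mB').
  + by rewrite setUIDK; exact: (measurable_int _ gi).
  + by apply/disj_set2P; rewrite -setIA setDIK setI0.
- move=> F mF tF F0; rewrite preimage_bigcup setI_bigcupr integral_bigcup//.
  + by apply: eseries0 => n _ _; exact: F0.
  + apply/trivIsetP => i j _ _ ij; have /trivIsetP/(_ i j I I ij) h := tF.
    apply/seteqP; split=> z //= [[_ Fi] [_ Fj]].
    by have : (F i `&` F j) (p z) by []; rewrite h.
  + by move=> k; exact: mpre.
  + apply: (integrableS mQ _ _ gi); last by move=> z [k _ []].
    by apply: bigcup_measurable => k _; exact: mpre.
Qed.

Lemma itvoo_setI (a b c d : R) : `]a, b[%classic `&` `]c, d[%classic =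
  `]Num.max a c, Num.min b d[%classic.
Proof.
apply/seteqP; split=> x; rewrite /= !in_itv/= gt_max lt_min.
  by move=> [/andP[-> ->] /andP[-> ->]].
by move=> /andP[/andP[-> ->] /andP[-> ->]].
Qed.

Lemma setI_closed_itvoo : setI_closed (RGenOpens.G (R := R)).
Proof.
move=> _ _ [a [b ->]] [c [d ->]]; rewrite itvoo_setI.
by exists (Num.max a c), (Num.min b d).
Qed.

(** Three uses of the Dynkin argument: intervals become Borel sets in the second coordinate, then in
    the first, and finally products of Borel sets become arbitrary measurable sets. An integrable
    function whose integral vanishes over every measurable subset is almost everywhere zero. *)
Lemma ae_eq0_box (a b c d : R) (g : R * R -> R) (Q : set (plane R)) :
  Q = `]a, b[%classic `*` `]c, d[%classic ->
  leb2.-integrable Q (EFin \o g) ->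
  (forall a' b' c' d', a <= a' -> a' < b' -> b' <= b -> c <= c' -> c' < d' -> d' <= d ->
    (\int[leb2]_(z in (`]a', b'[%classic `*` `]c', d'[%classic : set (plane R))) (g z)%:E = 0)%E) ->
  ae_eq leb2 Q (EFin \o g) (cst 0%E).
Proof.
move=> QE gi h.
have mQ : measurable Q by rewrite QE; exact: measurable_box.
(* The intersection of a rectangle with Q is a rectangle inside Q or empty, so the hypothesis
   extends to all rectangles. *)
have {}h a' b' c' d' : (\int[leb2]_(z in Q `&` (`]a', b'[%classic `*` `]c', d'[%classic)) (g z)%:E = 0)%E.
  rewrite QE -setXI !itvoo_setI.
  have [ab|ab] := ltP (Num.max a a') (Num.min b b'); last first.
    by rewrite set_itv_ge ?set0X ?integral_set0// bnd_simp -leNgt.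
  have [cd|cd] := ltP (Num.max c c') (Num.min d d'); last first.
    by rewrite [X in _ `*` X]set_itv_ge ?setX0 ?integral_set0// bnd_simp -leNgt.
  by apply: h => //; rewrite ?le_max ?ge_min ?lexx.
have e (A B : set (measurableTypeR R)) : Q `&` (A `*` B) = Q `&` snd @^-1` B `&` fst @^-1` A.
  by apply/seteqP; split=> z [] => [Qz [? ?]|[Qz ? ?]].
have e' (A B : set (measurableTypeR R)) : Q `&` (A `*` B) = Q `&` fst @^-1` A `&` snd @^-1` B.
  by rewrite e setIAC.
have mpre1 (A : set (measurableTypeR R)) : measurable A -> measurable (Q `&` fst @^-1` A).
  by move=> mA; apply: measurableI => //; rewrite -[X in measurable X]setTI; exact: measurable_fst.
have mpre2 (A : set (measurableTypeR R)) : measurable A -> measurable (Q `&` snd @^-1` A).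
  by move=> mA; apply: measurableI => //; rewrite -[X in measurable X]setTI; exact: measurable_snd.
have Qab (A : set (measurableTypeR R)) : Q `&` fst @^-1` A = Q `&` (A `*` `]c, d[%classic).
  by rewrite QE; apply/seteqP; split=> z [] => [[? ?] ?|[? ?] [? ?]].
have Qcd (A : set (measurableTypeR R)) : Q `&` snd @^-1` A = Q `&` (`]a, b[%classic `*` A).
  by rewrite QE; apply/seteqP; split=> z [] => [[? ?] ?|[? ?] [? ?]].
have s1 (A B : set (measurableTypeR R)) : measurable A -> RGenOpens.G B ->
    (\int[leb2]_(z in Q `&` (A `*` B)) (g z)%:E = 0)%E.
  move=> mA [c' [d' ->]]; rewrite e.
  apply: (integral_preimage_eq0 (RGenOpens.measurableE R) setI_closed_itvoo _ _ _ _ _ mA).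
  - exact: measurable_fst.
  - by apply: mpre2; exact: measurable_itv.
  - by apply: integrableS gi => //; apply: mpre2; exact: measurable_itv.
  - by rewrite Qcd.
  - by move=> _ [a' [b' ->]]; rewrite -e.
have s2 (A B : set (measurableTypeR R)) : measurable A -> measurable B ->
    (\int[leb2]_(z in Q `&` (A `*` B)) (g z)%:E = 0)%E.
  move=> mA mB; rewrite e'.
  apply: (integral_preimage_eq0 (RGenOpens.measurableE R) setI_closed_itvoo _ _ _ _ _ mB).
  - exact: measurable_snd.
  - exact: mpre1.
  - by apply: integrableS gi => //; exact: mpre1.
  - by rewrite Qab; apply: s1 => //; exists c, d.
  - by move=> B' GB'; rewrite -e'; exact: s1.
apply: integral_ae_eq => // E EQ mE; rewrite integral0.
(* For the last pass the map is the identity and the generator is the family of measurable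
   rectangles. *)
have -> : E = Q `&` id @^-1` E by rewrite preimage_id setIC; apply/esym/setIidPl.
apply: (integral_preimage_eq0 (measurable_prod_measurableType _ _) _ _ mQ gi _ _ mE).
- move=> _ _ [A1 mA1 [B1 mB1 <-]] [A2 mA2 [B2 mB2 <-]].
  exists (A1 `&` A2); first exact: measurableI.
  by exists (B1 `&` B2); [exact: measurableI|rewrite setXI].
- exact: measurable_id.
- have <- : Q `&` (setT `*` setT) = Q by rewrite setXTT setIT.
  exact: s2.
- by move=> _ [A mA [B mB <-]]; rewrite preimage_id; exact: s2.
Qed.

(** Box bumps suffice as test functions: letting their steepness grow shows that g has zero integral
    over every open box whose closed box lies in Omega, and countably many rational boxes of this
    kind cover Omega. *)
Lemma fundamental_lemma (Omega : set (R * R)) (g : R * R -> R) : open Omega ->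
  leb2.-integrable (Omega : set (plane R)) (EFin \o g) ->
  (forall n a b c d, 0 < n -> test_fun Omega (box_bump n a b c d) ->
    (\int[leb2]_(z in Omega) (g z * box_bump n a b c d z)%:E = 0)%E) ->
  ae_eq leb2 (Omega : set (plane R)) g (cst 0).
Proof.
move=> oO gi h; have domain_measurable := open_measurable2 oO.
have box0 a b c d : (`[a, b]%classic `*` `[c, d]%classic) `<=` Omega ->
    (\int[leb2]_(z in (`]a, b[%classic `*` `]c, d[%classic : set (plane R))) (g z)%:E = 0)%E.
  move=> sub; set B : set (plane R) := _ `*` _.
  have mB : measurable B by exact: measurable_box.
  have BO : B `<=` Omega.
    apply: subset_trans sub => z; rewrite /B /= !in_itv/=.
    by move=> [/andP[/ltW-> /ltW->] /andP[/ltW-> /ltW->]].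
  have cv : (fun n : nat => \int[leb2]_(z in Omega) (g z * box_bump n.+1%:R a b c d z)%:E)%E @ \oo -->
     (\int[leb2]_(z in Omega) (g z * \1_B z)%:E)%E.
    apply: (@dominated_cvg _ _ _ _ _ domain_measurable _ _ (fun z => `|g z|%:E)) => //.
    - move=> n; apply/measurable_EFinP; apply: measurable_funM.
        by apply/measurable_EFinP; exact: measurable_int gi.
      apply: measurable_funTS; apply: continuous_measurable2.
      exact: smooth_continuous (smooth_box_bump _ _ _ _ _).
    - move=> z _; apply: cvg_EFin; first by near=> n.
      by apply: cvgM; [exact: cvg_cst|exact: cvg_box_bump].
    - exact: integrable_abse gi.
    - move=> n z _ /=; rewrite lee_fin normrM ler_piMr//.
      by have /andP[h0 h1] := box_bump01 n.+1%:R a b c d z; rewrite ger0_norm.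
  have c0 : (fun n : nat => \int[leb2]_(z in Omega) (g z * box_bump n.+1%:R a b c d z)%:E)%E @ \oo --> 0%E.
    rewrite (_ : (fun n : nat => _) = cst 0%E); first exact: cvg_cst.
    by apply/funext => n; apply: h => //; exact: test_fun_box_bump.
  transitivity (\int[leb2]_(z in Omega) (g z * \1_B z)%:E)%E; last first.
    exact: (cvg_unique (@ereal_hausdorff R) cv c0).
  rewrite integral_mkcond [RHS]integral_mkcond; apply: eq_integral => z _.
  rewrite /patch; case: ifPn => zB; case: ifPn => zO //.
  - by rewrite indicE zB mulr1.
  - by move: zO; rewrite (mem_set (BO _ (set_mem zB))).
  - by rewrite indicE (negbTE zB) mulr0.
pose rect (q : (rat * rat) * (rat * rat)) : set (plane R) :=
  `]ratr q.1.1, ratr q.1.2[ `*` `]ratr q.2.1, ratr q.2.2[.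
pose crect (q : (rat * rat) * (rat * rat)) : set (plane R) :=
  `[ratr q.1.1, ratr q.1.2] `*` `[ratr q.2.1, ratr q.2.2].
(* The exceptional set is contained in the union of the [N q], indexed by rational boxes; boxes not
   inside Omega contribute [set0]. *)
pose N q : set (plane R) := if `[< crect q `<=` Omega >] then rect q `&` [set z | g z != 0] else set0.
have N0 q : leb2.-negligible (N q).
  rewrite /N; case: asboolP => [sub|_]; last exact: negligible_set0.
  have : ae_eq leb2 (rect q) (EFin \o g) (cst 0%E).
    apply: ae_eq0_box => //.
      apply: (integrableS domain_measurable _ _ gi); first exact: measurable_box.
      apply: subset_trans sub => z; rewrite /rect /crect /= !in_itv/=.
      by move=> [/andP[/ltW-> /ltW->] /andP[/ltW-> /ltW->]].
    move=> a b c d a1 ab b1 c1 cd d1; apply: box0; apply: subset_trans sub => z /=.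
    rewrite /crect/= !in_itv/= => -[/andP[h1 h2] /andP[h3 h4]].
    rewrite (le_trans a1 h1) (le_trans h2 b1) (le_trans c1 h3) (le_trans h4 d1).
    by [].
  apply: negligibleS => z [qz gz] /= hz; have := hz qz => -[] /eqP.
  exact/negP.
have : leb2.-negligible (\bigcup_n (if (unpickle n : option ((rat * rat) * (rat * rat))) is Some q then N q else set0)).
  apply: negligible_bigcup => n; case: unpickle => [q|]; first exact: N0.
  exact: negligible_set0.
apply: negligibleS => z /= /not_implyP[Oz gz].
have /nbhs_ballP[e /= e0 eU] : nbhs (z : R * R) Omega by exact: open_nbhs_nbhs.
have hq (x : R) : {q : rat * rat | x \in `]ratr q.1, ratr q.2[ &
      forall y, y \in `[(ratr q.1 : R), ratr q.2] -> ball x e y}.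
  have [p hp] : {p : rat | (ratr p : R) \in `]x - e, x[}.
    by apply/cid; apply: rat_in_itvoo; rewrite ltrBlDr ltrDl.
  have [q hq] : {q : rat | (ratr q : R) \in `]x, x + e[}.
    by apply/cid; apply: rat_in_itvoo; rewrite ltrDl.
  exists (p, q) => /=.
    by move: hp hq; rewrite !in_itv/= => /andP[_ ->] /andP[->].
  move=> y; rewrite in_itv/= -ball_normE/= => /andP[py yq].
  move: hp hq; rewrite !in_itv/= => /andP[a _] /andP[_ b].
  by rewrite ltr_norml; apply/andP; split; lra.
have [p hp1 hp2] := hq z.1; have [q hq1 hq2] := hq z.2.
exists (pickle ((p, q) : (rat * rat) * (rat * rat))); first exact: I.
rewrite pickleK /N; case: asboolP => [_|[]].
  by split=> //=; apply/eqP.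
by move=> w [/= w1 w2]; apply: eU; split; [exact: hp2|exact: hq2].
Unshelve. all: by end_near. Qed.

End fundamental_lemma.

(** * Weak derivatives *)

Section lines.
Context {R : realType}.
Implicit Types (f : R * R -> R) (z v : R * R).

Lemma is_derive_line f z v (t : R) : differentiable f (t *: v + z) ->
  is_derive t (1 : R) (fun s : R => f (s *: v + z)) ('D_v f (t *: v + z)).
Proof.
move=> df.
have e : (fun h : R => h^-1 *: (((fun s : R => f (s *: v + z)) \o shift t) (h *: (1 : R)) - f (t *: v + z)))
   = (fun h : R => h^-1 *: ((f \o shift (t *: v + z)) (h *: v) - f (t *: v + z))).
  apply/funext => h; congr (_ *: (f _ - _)) => /=.
  by rewrite scalerDl /= [h *: 1]mulr1 addrA.
apply: DeriveDef; first by rewrite /derivable e; exact: diff_derivable.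
by rewrite /derive e.
Qed.

Lemma is_derive_horizontal f (x y : R) : differentiable f (x, y) ->
  is_derive x (1 : R) (fun s : R => f (s, y)) (pderiv ord0 f (x, y)).
Proof.
have e (s : R) : s *: (basis2 ord0 : R * R) + (0, y) = (s, y).
  by rewrite /basis2/=; congr pair; rewrite /= /GRing.scale/= ?mulr1 ?mulr0 ?addr0 ?add0r.
move=> df; have := @is_derive_line f (0, y) (basis2 ord0) x.
rewrite e => /(_ df); rewrite (_ : (fun s : R => _) = (fun s : R => f (s, y)))//.
by apply/funext => s; rewrite e.
Qed.

Lemma is_derive_vertical f (x y : R) : differentiable f (x, y) ->
  is_derive y (1 : R) (fun s : R => f (x, s)) (pderiv ord_max f (x, y)).
Proof.
have e (s : R) : s *: (basis2 ord_max : R * R) + (x, 0) = (x, s).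
  by rewrite /basis2/=; congr pair; rewrite /= /GRing.scale/= ?mulr1 ?mulr0 ?addr0 ?add0r.
move=> df; have := @is_derive_line f (x, 0) (basis2 ord_max) y.
rewrite e => /(_ df); rewrite (_ : (fun s : R => _) = (fun s : R => f (x, s)))//.
by apply/funext => s; rewrite e.
Qed.

Lemma cvg_difference_quotient f z v (h : nat -> R) : differentiable f z ->
  (forall n, h n != 0) -> h n @[n --> \oo] --> (0 : R) ->
  (h n)^-1 * (f (h n *: v + z) - f z) @[n --> \oo] --> 'D_v f z.
Proof.
move=> df h0 hc; have := diff_derivable (v := v) df.
rewrite /derivable => /cvg_lim h1.
have h2 : (fun t : R => t^-1 *: ((f \o shift z) (t *: v) - f z)) @ 0^' --> 'D_v f z.
  by have := diff_derivable (v := v) df.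
have h3 : h n @[n --> \oo] --> (0 : R)^'.
  move=> A [e /= e0 eA]; have /cvgrPdist_lt/(_ e e0) := hc.
  by apply: filterS => n hn; apply: eA => //.
exact: (cvg_comp _ _ h3 h2).
Qed.

Definition square_box (r : R) : set (R * R) := `[- r, r]%classic `*` `[- r, r]%classic.

Lemma continuous_bounded_box f r : continuous f ->
  exists2 M : R, 0 <= M & forall z, square_box r z -> `|f z| <= M.
Proof.
move=> cf.
have : compact (f @` square_box r).
  apply: continuous_compact; first exact: continuous_subspaceT.
  by apply: compact_setX; exact: segment_compact.
move=> /compact_bounded [M [_ hM]]; exists (`|M| + 1); first by rewrite addr_ge0.
move=> z rz; apply: (hM (`|M| + 1)); last by exists z.
by rewrite (le_lt_trans (ler_norm M))// ltrDl.
Qed.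

(** Only increments in the direction [basis2 i] of size at most 1 are bounded: this dominates the
    difference quotients with steps 1/(n+1). *)
Definition locally_lipschitz (i : 'I_2) f := forall r : R, exists2 M : R, 0 <= M &
  forall z, square_box r z -> forall t : R, 0 < t <= 1 ->
    `|f (t *: basis2 i + z) - f z| <= M * t.

Lemma square_boxD r z i (t : R) : square_box r z -> `|t| <= 1 ->
  square_box (r + 1) (t *: basis2 i + z).
Proof.
rewrite /square_box/= !in_itv/= => -[/andP[a1 a2] /andP[b1 b2]] t1.
have := ler_norm t; have := ler_norm (- t); rewrite normrN => t2 t3.
rewrite /basis2; case: ifP => _ /=; rewrite /GRing.scale/= ?mulr0 ?mulr1 ?add0r;
  split; apply/andP; split; lra.
Qed.

Lemma C1_locally_lipschitz i f : Ck 1 f -> locally_lipschitz i f.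
Proof.
move=> f1 r; have [M M0 hM] := continuous_bounded_box (r + 1) (@pderiv_continuous _ i f 0 f1).
exists M => // z rz t /andP[t0 t1]; have df := Ck_diff f1.
have ds (s : R) : is_derive s (1 : R) (fun s : R => f (s *: basis2 i + z)) (pderiv i f (s *: basis2 i + z)).
  exact: is_derive_line.
have [|c] := @MVT R _ _ 0 t t0 (fun s _ => ds s).
  apply: derivable_within_continuous => s _; by case: (ds s).
rewrite in_itv/= => /andP[c0 ct].
rewrite scale0r add0r subr0 => ->.
rewrite normrM (gtr0_norm t0); apply: ler_wpM2r; first exact: ltW.
apply: hM; apply: square_boxD => //.
by rewrite gtr0_norm// ltW// (lt_le_trans ct).
Qed.

Lemma compact_square_box (K : set (R * R)) : compact K ->
  exists2 r : R, 0 <= r & K `<=` square_box r.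
Proof.
move=> /compact_bounded[M [_ hM]]; exists (`|M| + 1); first by rewrite addr_ge0.
move=> z Kz; have := hM (`|M| + 1); rewrite (le_lt_trans (ler_norm M)) ?ltrDl// => /(_ isT z Kz).
rewrite /= prod_normE ge_max/= => /andP[].
by rewrite !ler_norml /square_box/= !in_itv/=.
Qed.

Lemma measurable_square_box r : measurable (square_box r : set (plane R)).
Proof. by apply: measurableX; exact: measurable_itv. Qed.

Lemma square_box_lty r : (leb2 (square_box r : set (plane R)) < +oo)%E.
Proof.
rewrite /square_box leb2X; [|exact: measurable_itv|exact: measurable_itv].
have h : (lebesgue_measure (`[(- r)%R, r]%classic : set (measurableTypeR R)) < +oo)%E.
  by rewrite lebesgue_measure_itv/=; case: ifP => // _; rewrite -EFinB ltry.
by rewrite lte_mul_pinfty// ge0_fin_numE.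
Qed.

Lemma bounded_support_intg (f : R * R -> R) r M :
  measurable_fun setT (f : plane R -> measurableTypeR R) ->
  (forall z, square_box r z -> `|f z| <= M) ->
  (forall z, ~ square_box r z -> f z = 0) ->
  intg leb2 (setT : set (plane R)) f.
Proof.
move=> mf fM f0.
have mB := measurable_square_box r.
have : intg leb2 (square_box r : set (plane R)) f.
  by apply: (intg_bounded mB (square_box_lty r) _ fM); exact: measurable_funTS.
rewrite /intg (integrable_mkcond _ mB); congr (_ : Prop); congr (is_true _).
congr (leb2.-integrable _ _); apply/funext => z; rewrite /patch.
by case: ifPn => // /negP; rewrite inE => /f0 /= ->.
Qed.
End lines.

Section weak_derivatives.
Context {R : realType}.
Variable Omega : set (R * R).
Hypothesis oO : open Omega.
Variable rO : R.
Hypothesis bO : Omega `<=` square_box rO.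
Implicit Types (f g v : R * R -> R) (i j : 'I_2).

Local Notation mu := (@leb2 R).
Local Notation I := (Rintegral mu (Omega : set (plane R))).

Lemma domain_measurable : measurable (Omega : set (plane R)).
Proof. exact: open_measurable2. Qed.

Lemma domain_finite : (mu (Omega : set (plane R)) < +oo)%E.
Proof.
apply: le_lt_trans (square_box_lty rO); apply: le_measure => //; rewrite inE.
  exact: domain_measurable.
exact: measurable_square_box.
Qed.

Lemma L2P f : L2 Omega f <-> sqint mu (Omega : set (plane R)) f.
Proof. exact: L2_sqint domain_measurable. Qed.

Lemma continuous_meas f : continuous f ->
  measurable_fun (Omega : set (plane R)) (f : plane R -> measurableTypeR R).
Proof. by move=> cf; apply: measurable_funTS; exact: continuous_measurable2. Qed.

Lemma continuous_sqint f : continuous f -> sqint mu (Omega : set (plane R)) f.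
Proof.
move=> cf; have [M M0 hM] := continuous_bounded_box rO cf.
apply: (sqint_bounded domain_measurable domain_finite (M := M)); first exact: continuous_meas.
by move=> z /bO; exact: hM.
Qed.

Lemma test_fun_smooth f : test_fun Omega f -> smooth f.
Proof. by case. Qed.

Lemma test_fun_out f z : test_fun Omega f -> ~ Omega z -> f z = 0.
Proof.
move=> [_ _ sO] nO; apply/eqP/negPn/negP => fz; apply: nO; apply: sO.
exact: subset_closure.
Qed.

Lemma test_fun_pderiv_out i f z : test_fun Omega f ->
  ~ closure [set z | f z != 0] z -> pderiv i f z = 0.
Proof.
move=> tf nz; rewrite /pderiv.
rewrite (@near_eq_derive _ _ _ f (cst 0)) ?derive_cst//.
have : nbhs z (~` closure [set z | f z != 0]).
  by apply: open_nbhs_nbhs; split => //; apply: closed_openC; exact: closed_closure.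
apply: filterS => w nw; apply/eqP/negPn/negP => fw; apply: nw.
exact: subset_closure.
Qed.

Lemma test_fun_pderiv i f : test_fun Omega f -> test_fun Omega (pderiv i f).
Proof.
move=> tf; have [sf cf sO] := tf.
have sub : closure [set z | pderiv i f z != 0] `<=` closure [set z | f z != 0].
  rewrite closureE => z /(_ (closure [set z | f z != 0])); apply; split.
    exact: closed_closure.
  by move=> w /= /eqP h; apply: contrapT => /(test_fun_pderiv_out i tf).
split; first exact: smooth_pderiv.
  by apply: (subclosed_compact _ cf sub); exact: closed_closure.
exact: subset_trans sub sO.
Qed.

Lemma is_weak_pderivP i v g : L2 Omega v -> is_weak_pderiv Omega i v g <->
  sqint mu (Omega : set (plane R)) g /\
  forall phi, test_fun Omega phi ->
    I (fun z => v z * pderiv i phi z) = - I (fun z => g z * phi z).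
Proof.
move=> /L2P v2.
have ct phi : test_fun Omega phi -> sqint mu (Omega : set (plane R)) phi.
  by move=> /test_fun_smooth/smooth_continuous/continuous_sqint.
have ctd phi : test_fun Omega phi -> sqint mu (Omega : set (plane R)) (pderiv i phi).
  by move=> /(test_fun_pderiv i)/ct.
split=> -[g2 h].
  move/L2P in g2; split => // phi tp; have := h _ tp.
  rewrite (intgE domain_measurable (sqint_mul domain_measurable v2 (ctd _ tp))) (intgE domain_measurable (sqint_mul domain_measurable g2 (ct _ tp))).
  by rewrite -EFinN => e; exact: (EFin_inj e).
split=> [|phi tp]; first exact/L2P.
rewrite (intgE domain_measurable (sqint_mul domain_measurable v2 (ctd _ tp))) (intgE domain_measurable (sqint_mul domain_measurable g2 (ct _ tp))).
by rewrite h// EFinN.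
Qed.

Lemma weak_pderiv_unique i v g g' : L2 Omega v -> is_weak_pderiv Omega i v g ->
  is_weak_pderiv Omega i v g' -> ae_eq mu (Omega : set (plane R)) g g'.
Proof.
move=> v2 /(is_weak_pderivP _ _ v2)[g2 h] /(is_weak_pderivP _ _ v2)[g2' h'].
have : ae_eq mu (Omega : set (plane R)) (fun z => g z - g' z) (cst 0).
  apply: fundamental_lemma => //.
    by apply: (sqint_intg domain_measurable domain_finite); exact: (sqintB domain_measurable).
  move=> n a b c d n0 tb; have b2 : sqint mu (Omega : set (plane R)) (box_bump n a b c d).
    by apply: continuous_sqint; apply: smooth_continuous; exact: test_fun_smooth tb.
  have i1 := sqint_mul domain_measurable g2 b2; have i2 := sqint_mul domain_measurable g2' b2.
  rewrite (intgE domain_measurable); last by apply: sqint_mul => //; [exact: domain_measurable|exact: (sqintB domain_measurable)].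
  rewrite (RintBl domain_measurable i1 i2) -[X in X - _]opprK -[X in _ - X]opprK -h// -h'//.
  by rewrite subrr.
by apply: filterS => z /= h0 Oz; apply/eqP; rewrite -subr_eq0; apply/eqP; exact: h0.
Qed.

Lemma weak_pderivB i v w g h : L2 Omega v -> L2 Omega w ->
  is_weak_pderiv Omega i v g -> is_weak_pderiv Omega i w h ->
  is_weak_pderiv Omega i (fun z => v z - w z) (fun z => g z - h z).
Proof.
move=> v2 w2 /(is_weak_pderivP _ _ v2)[g2 hg] /(is_weak_pderivP _ _ w2)[h2 hh].
move: (v2) (w2) => /L2P v2' /L2P w2'.
apply/is_weak_pderivP; first by apply/L2P; exact: (sqintB domain_measurable).
split=> [|phi tp]; first exact: (sqintB domain_measurable).
have p2 := continuous_sqint (smooth_continuous (test_fun_smooth tp)).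
have dp2 := continuous_sqint (smooth_continuous (test_fun_smooth (test_fun_pderiv i tp))).
rewrite !(RintBl domain_measurable); try by apply: (sqint_mul domain_measurable).
by rewrite hg// hh// opprB addrC opprK.
Qed.

Lemma is_weak_wpderiv i v : W12 Omega v -> is_weak_pderiv Omega i v (wpderiv Omega i v).
Proof. by move=> [_ /(_ i)[g hg]]; exact: (xgetPex _ (ex_intro _ g hg)). Qed.

(** Against a box bump, both mixed derivatives become the integral of v times a mixed derivative of
    the bump, and the two mixed derivatives of the bump coincide. *)
Lemma mixed_weak_pderiv v w0 w1 h01 h10 : L2 Omega v ->
  is_weak_pderiv Omega ord0 v w0 -> is_weak_pderiv Omega ord_max v w1 ->
  is_weak_pderiv Omega ord_max w0 h01 -> is_weak_pderiv Omega ord0 w1 h10 ->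
  ae_eq mu (Omega : set (plane R)) h01 h10.
Proof.
move=> v2 W0 W1; have w02 := W0.1; have w12 := W1.1.
move: W0 W1 => /(is_weak_pderivP _ _ v2)[_ e0] /(is_weak_pderivP _ _ v2)[_ e1].
move=> /(is_weak_pderivP _ _ w02)[h2 k0] /(is_weak_pderivP _ _ w12)[h2' k1].
have : ae_eq mu (Omega : set (plane R)) (fun z => h01 z - h10 z) (cst 0).
  apply: fundamental_lemma => //.
    by apply: (sqint_intg domain_measurable domain_finite); exact: (sqintB domain_measurable).
  move=> n a b c d n0 tb; have b2 : sqint mu (Omega : set (plane R)) (box_bump n a b c d).
    by apply: continuous_sqint; apply: smooth_continuous; exact: test_fun_smooth tb.
  have i1 := sqint_mul domain_measurable h2 b2; have i2 := sqint_mul domain_measurable h2' b2.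
  rewrite (intgE domain_measurable); last by apply: sqint_mul => //; [exact: domain_measurable|exact: (sqintB domain_measurable)].
  rewrite (RintBl domain_measurable i1 i2) -[X in X - _]opprK -[X in _ - X]opprK -k0// -k1//.
  have t0 := test_fun_pderiv ord0 tb; have t1 := test_fun_pderiv ord_max tb.
  have E1 := e0 _ t1; have E2 := e1 _ t0; rewrite pderivC_box_bump in E2.
  congr (_%:E); apply/eqP; rewrite subr_eq0; apply/eqP.
  exact: (etrans (esym E1) E2).
by apply: filterS => z /= h0 Oz; apply/eqP; rewrite -subr_eq0; apply/eqP; exact: h0.
Qed.

End weak_derivatives.

Section difference_quotients.
Context {R : realType}.
Variable Omega : set (R * R).
Hypothesis oO : open Omega.
Variable rO : R.
Hypothesis bO : Omega `<=` square_box rO.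
Implicit Types (f g v : R * R -> R) (i j : 'I_2).

Local Notation mu := (@leb2 R).
Local Notation I := (Rintegral mu (Omega : set (plane R))).
Local Notation J := (Rintegral mu (setT : set (plane R))).

Lemma J_supp f : (forall z, ~ Omega z -> f z = 0) -> I f = J f.
Proof.
move=> f0; rewrite Rintegral_mkcond; congr (Rintegral _ _ _).
apply/funext => z; rewrite /patch; case: ifPn => // /negP; rewrite inE => /f0 ->.
by [].
Qed.

Lemma shift_continuous (a : R * R) f : continuous f -> continuous (fun z => f (a + z)).
Proof.
move=> cf z; apply: (continuous_comp (g := f)); last exact: cf.
by apply: cvgD; [exact: cvg_cst|exact: cvg_id].
Qed.

Lemma harmonic_seq_props : (forall n, (n.+1%:R^-1 : R) != 0) /\
  (n.+1%:R^-1 @[n --> \oo] --> (0 : R)).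
Proof. by split=> [n|]; [rewrite invr_neq0// pnatr_eq0|exact: cvg_harmonic]. Qed.

(** Discrete integration by parts followed by dominated convergence. The hypothesis is a limit along
    the steps 1/(n+1) alone, so that the lemma covers both smooth functions and the distance to the
    boundary, which need not be differentiable at every point. *)
Lemma weak_pderiv_difference_quotient i f g :
  continuous f -> locally_lipschitz i f ->
  sqint mu (Omega : set (plane R)) g ->
  (forall z, Omega z -> n.+1%:R * (f (n.+1%:R^-1 *: basis2 i + z) - f z) @[n --> \oo] --> g z) ->
  is_weak_pderiv Omega i f g.
Proof.
move=> cf lf g2 fg; have f2 : L2 Omega f by apply/(L2P oO); exact: (continuous_sqint oO bO cf).
apply/(is_weak_pderivP oO bO _ _ f2); split => // phi tp.
have [sp cp pO] := tp; have cphi := smooth_continuous sp.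
have [r r0 Kr] := compact_square_box cp.
have phi0 z : ~ square_box r z -> phi z = 0.
  move=> nz; apply/eqP/negPn/negP => pz; apply: nz; apply: Kr; exact: subset_closure.
have lp := C1_locally_lipschitz i (sp 1%N).
have [h0 hc] := harmonic_seq_props.
have h1 n : (n.+1%:R^-1 : R) <= 1 by rewrite invf_le1// ler1n.
have sqW (s t : R) : s <= t -> square_box s `<=` square_box t.
  by move=> st z; rewrite /square_box/= !in_itv/= => -[/andP[? ?] /andP[? ?]]; split; apply/andP; split; lra.
(* The test function moved by the step, so that its backward quotient is n+1 times
   [phi z - psi n z]. Its support may leave the square of half-side r, by at most 1. *)
pose psi n z := phi (- n.+1%:R^-1 *: basis2 i + z).
have cpsi n : continuous (psi n) by exact: shift_continuous.
have psi0 n z : ~ square_box (r + 1) z -> psi n z = 0.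
  move=> nz; apply: phi0 => rz; apply: nz.
  have := square_boxD i (t := n.+1%:R^-1) rz.
  rewrite addrA -scalerDl addrN scale0r add0r; apply.
  by rewrite ger0_norm// invr_ge0.
have [Mf Mf0 hMf] := continuous_bounded_box (r + 2) cf.
have [Mp Mp0 hMp] := continuous_bounded_box (r + 2) cphi.
have [Lf Lf0 hLf] := lf (r + 2).
have [Lp Lp0 hLp] := lp (r + 2).
have mc := @continuous_measurable2 R.
have mmul (F G : R * R -> R) : continuous F -> continuous G ->
    measurable_fun setT ((fun z => F z * G z) : plane R -> measurableTypeR R).
  by move=> cF cG; apply: mc => z; apply: cvgM; [exact: cF|exact: cG].
(* Discrete integration by parts: translating the product f(step + z) phi(z) turns the forward
   quotient of f into the backward quotient of phi. *)
have key n : J (fun z => f z * (n.+1%:R * (phi z - psi n z))) =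
    - J (fun z => (n.+1%:R * (f (n.+1%:R^-1 *: basis2 i + z) - f z)) * phi z).
  have cfn : continuous (fun z => f (n.+1%:R^-1 *: basis2 i + z)) by exact: shift_continuous.
  have i1 : intg mu (setT : set (plane R)) (fun z => f z * phi z).
    apply: (bounded_support_intg (r := r) (M := Mf * Mp)); first exact: mmul.
      move=> z /(sqW _ (r + 2)) rz; rewrite normrM ler_pM// ?hMf ?hMp//; apply: rz; lra.
    by move=> z /phi0 ->; rewrite mulr0.
  have i2 : intg mu (setT : set (plane R)) (fun z => f z * psi n z).
    apply: (bounded_support_intg (r := r + 1) (M := Mf * Mp)); first exact: mmul.
      move=> z rz; rewrite normrM ler_pM//; first by apply: hMf; apply: sqW rz; lra.
      apply: hMp; apply: (sqW (r + 1 + 1)); first lra.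
      by apply: square_boxD => //; rewrite normrN ger0_norm// invr_ge0.
    by move=> z /psi0 ->; rewrite mulr0.
  have i3 : intg mu (setT : set (plane R)) (fun z => f (n.+1%:R^-1 *: basis2 i + z) * phi z).
    apply: (bounded_support_intg (r := r) (M := Mf * Mp)); first exact: mmul.
      move=> z rz; rewrite normrM ler_pM//; last by apply: hMp; apply: sqW rz; lra.
      apply: hMf; apply: (sqW (r + 1)); first lra.
      by apply: square_boxD => //; rewrite ger0_norm// invr_ge0.
    by move=> z /phi0 ->; rewrite mulr0.
  have tr : J (fun z => f (n.+1%:R^-1 *: basis2 i + z) * phi z) = J (fun z => f z * psi n z).
    congr fine; rewrite -(@integral_shift2 R (n.+1%:R^-1 *: basis2 i) (fun z => (f z * psi n z)%:E)).
    - apply: eq_integral => z _; congr (_%:E).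
      rewrite (_ : shift2 _ z = n.+1%:R^-1 *: basis2 i + z); last by rewrite addrC.
      by rewrite /psi addrA -scalerDl addNr scale0r add0r.
    - by apply/measurable_EFinP; exact: mmul.
    - move: i3; rewrite /intg; apply: eq_integrable => // z _ /=; congr (_%:E).
      rewrite (_ : shift2 _ z = n.+1%:R^-1 *: basis2 i + z); last by rewrite addrC.
      by rewrite /psi addrA -scalerDl addNr scale0r add0r.
  transitivity (J (fun z => n.+1%:R * (f z * phi z - f z * psi n z))).
    by apply: eq_Rint => z _; ring.
  transitivity (- J (fun z => n.+1%:R * (f (n.+1%:R^-1 *: basis2 i + z) * phi z - f z * phi z))); last first.
    by congr (- _); apply: eq_Rint => z _; ring.
  rewrite (RintZ measurableT _ (intgB measurableT i1 i2)) (RintZ measurableT _ (intgB measurableT i3 i1)).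
  by rewrite (RintB measurableT i1 i2) (RintB measurableT i3 i1) tr; ring.
have lim1 : J (fun z => f z * (n.+1%:R * (phi z - psi n z))) @[n --> \oo] --> J (fun z => f z * pderiv i phi z).
  (* The dominating function: f is bounded by [Mf] and the quotients of phi by [Lp], and all of them
     vanish outside the enlarged square. *)
  pose G : R * R -> R := \1_(square_box (r + 1)) \* cst (Mf * Lp).
  have Gi : intg mu (setT : set (plane R)) G.
    apply: (bounded_support_intg (r := r + 1) (M := Mf * Lp)).
    - by apply: measurable_funM => //; apply: measurable_indic; exact: measurable_square_box.
    - by move=> z rz; rewrite /G/= indicE mem_set// mul1r ger0_norm// mulr_ge0.
    - by move=> z rz; rewrite /G/= indicE memNset// mul0r.
  apply: (Rint_dct measurableT _ _ Gi _).2.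
  - move=> n; apply: mmul => // z; apply: cvgM; first exact: cvg_cst.
    by apply: cvgB; [exact: cphi|exact: cpsi].
  - move=> z _; apply: cvgM; first exact: cvg_cst.
    have H1 n : (- n.+1%:R^-1 : R) != 0 by rewrite oppr_eq0.
    have H2 : - n.+1%:R^-1 @[n --> \oo] --> (0 : R).
      by rewrite -[X in _ --> X]oppr0; exact: cvgN.
    have := cvg_difference_quotient (v := basis2 i) (smooth_diff sp z) H1 H2.
    rewrite (_ : (fun n : nat => (- n.+1%:R^-1)^-1 * _) = (fun n : nat => n.+1%:R * (phi z - psi n z)))//.
    by apply/funext => n; rewrite invrN invrK /psi; ring.
  - move=> n z _; rewrite /G/= indicE; case: (boolP (z \in _)) => [/set_mem rz|/negP]; last first.
      rewrite inE => nz; rewrite mul0r psi0// phi0 ?subrr ?mulr0 ?normr0//.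
      by move=> rz; apply: nz; apply: sqW rz; lra.
    rewrite mul1r normrM ler_pM//; first by apply: hMf; apply: sqW rz; lra.
    rewrite normrM ger0_norm// mulrC -ler_pdivlMr ?ltr0n//.
    have sK : n.+1%:R^-1 *: basis2 i + (- n.+1%:R^-1 *: basis2 i + z) = z.
      by rewrite addrA -scalerDl addrN scale0r add0r.
    have := hLp (- n.+1%:R^-1 *: basis2 i + z) _ n.+1%:R^-1 _.
    rewrite sK; apply.
      apply: (sqW (r + 1 + 1)); first lra.
      by apply: square_boxD => //; rewrite normrN ger0_norm// invr_ge0.
    by rewrite invr_gt0 ltr0n h1.
have lim2 : J (fun z => (n.+1%:R * (f (n.+1%:R^-1 *: basis2 i + z) - f z)) * phi z) @[n --> \oo] -->
   J (fun z => (g \_ Omega) z * phi z).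
  have Gi : intg mu (setT : set (plane R)) (fun z => Lf * `|phi z|).
    apply: intgZ => //; apply: intg_norm => //.
    apply: (bounded_support_intg (r := r) (M := Mp)) => //; first exact: mc.
    by move=> z rz; apply: hMp; apply: sqW rz; lra.
  apply: (Rint_dct measurableT _ _ Gi _).2.
  - move=> n; apply: mmul => // z; apply: cvgM; first exact: cvg_cst.
    by apply: cvgB; [exact: shift_continuous|exact: cf].
  - move=> z _; rewrite /patch; case: ifPn => [/set_mem Oz|/negP]; last first.
      rewrite inE => nO; rewrite (test_fun_out tp nO) mulr0.
      rewrite (_ : (fun n => _) = cst 0); first exact: cvg_cst.
      by apply/funext => n; rewrite mulr0.
    by apply: cvgM; [exact: fg|exact: cvg_cst].
  - move=> n z _; rewrite normrM.
    have [->|pz] := eqVneq (phi z) 0; first by rewrite normr0 !mulr0.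
    apply: ler_wpM2r => //; rewrite normrM ger0_norm// mulrC -ler_pdivlMr ?ltr0n//.
    apply: hLf; last by rewrite invr_gt0 ltr0n h1.
    apply: (sqW r); first lra.
    by apply: contrapT => /phi0 h; rewrite h eqxx in pz.
have out z : ~ Omega z -> f z * pderiv i phi z = 0.
  by move=> nO; rewrite (test_fun_out (test_fun_pderiv i tp) nO) mulr0.
have -> : I (fun z => g z * phi z) = J (fun z => (g \_ Omega) z * phi z).
  rewrite -J_supp; last by move=> z nO; rewrite (test_fun_out tp nO) mulr0.
  by apply: eq_Rint => z Oz; rewrite /patch mem_set.
rewrite (J_supp out).
apply: (cvg_unique (@Rhausdorff R) lim1).
rewrite (_ : (fun n => _) = (fun n => - J (fun z => (n.+1%:R * (f (n.+1%:R^-1 *: basis2 i + z) - f z)) * phi z))).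
  exact: cvgN.
by apply/funext => n; exact: key.
Qed.

Lemma smooth_weak_pderiv i phi : smooth phi -> is_weak_pderiv Omega i phi (pderiv i phi).
Proof.
move=> sp; apply: weak_pderiv_difference_quotient.
- exact: smooth_continuous.
- exact: C1_locally_lipschitz (sp 1%N).
- apply: (continuous_sqint oO bO); exact: smooth_continuous (smooth_pderiv i sp).
- move=> z _; have [h0 hc] := harmonic_seq_props.
  have := cvg_difference_quotient (v := basis2 i) (smooth_diff sp z) h0 hc.
  by rewrite (_ : (fun n : nat => n.+1%:R^-1^-1 * _) = (fun n : nat => n.+1%:R * (phi (n.+1%:R^-1 *: basis2 i + z) - phi z)))//;
    apply/funext => n; rewrite invrK.
Qed.

End difference_quotients.

(** * Sobolev norms and approximation of traces *)

Lemma itv_lty (R : realType) (a b : R) :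
  (lebesgue_measure (`[a, b]%classic : set (measurableTypeR R)) < +oo)%E.
Proof. by rewrite lebesgue_measure_itv/=; case: ifP => // _; rewrite -EFinB ltry. Qed.

Section sobolev_norm.
Context {R : realType}.
Variable Omega : set (R * R).
Hypothesis oO : open Omega.
Variable rO : R.
Hypothesis bO : Omega `<=` square_box rO.
Implicit Types (f g v : R * R -> R) (i j : 'I_2).

Local Notation mu := (@leb2 R).
Local Notation I := (Rintegral mu (Omega : set (plane R))).
Let mOm : measurable (Omega : set (plane R)) := domain_measurable oO.

Lemma ord2_ind (P : 'I_2 -> Prop) : P ord0 -> P ord_max -> forall i, P i.
Proof.
move=> P0 P1 [[|[|//]] h].
  by rewrite (_ : Ordinal h = ord0)//; exact/val_inj.
by rewrite (_ : Ordinal h = ord_max)//; exact/val_inj.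
Qed.

Lemma sum2 (F : 'I_2 -> R) : \sum_(i < 2) F i = F ord0 + F ord_max.
Proof. by rewrite big_ord_recr big_ord1; congr (F _ + _); exact/val_inj. Qed.

Lemma weak_W12 v (g : 'I_2 -> R * R -> R) : L2 Omega v ->
  (forall i, is_weak_pderiv Omega i v (g i)) -> W12 Omega v.
Proof. by move=> v2 vg; split => // i; exists (g i). Qed.

(** [wpderiv] is a chosen representative; uniqueness almost everywhere allows any weak derivatives g
    in its place and makes the norm a real number. *)
Lemma W12normE v (g : 'I_2 -> R * R -> R) : L2 Omega v ->
  (forall i, is_weak_pderiv Omega i v (g i)) ->
  W12norm Omega v = (Num.sqrt (I (fun z => v z ^+ 2) + I (fun z => g ord0 z ^+ 2)
    + I (fun z => g ord_max z ^+ 2)))%:E.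
Proof.
move=> v2 vg; have vW := weak_W12 v2 vg.
rewrite /W12norm asboolT//.
have ww i := is_weak_wpderiv i vW.
have g2 i := ((is_weak_pderivP oO bO i (g i) v2).1 (vg i)).1.
have w2 i := ((is_weak_pderivP oO bO i _ v2).1 (ww i)).1.
have vv : sqint mu (Omega : set (plane R)) v by exact/(L2P oO).
have e i : I (fun z => wpderiv Omega i v z ^+ 2) = I (fun z => g i z ^+ 2).
  apply: (ae_eq_Rint mOm).
  - by apply: measurable_funX; case: (w2 i).
  - by apply: measurable_funX; case: (g2 i).
  - by apply: filterS (weak_pderiv_unique oO bO v2 (ww i) (vg i)) => z /= h Oz; rewrite h.
have i1 := vv.2; have i2 := (w2 ord0).2; have i3 := (w2 ord_max).2.
rewrite (_ : (\int[mu]_(z in Omega) _)%E =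
  (I (fun z => v z ^+ 2) + I (fun z => g ord0 z ^+ 2) + I (fun z => g ord_max z ^+ 2))%:E).
  rewrite poweR_EFin powR12_sqrt//.
  by rewrite !addr_ge0//; apply: Rint_ge0 => z _; exact: sqr_ge0.
rewrite -!e -(RintD mOm i1 i2) -(RintD mOm (intgD mOm i1 i2) i3) -(intgE mOm); last first.
  exact: (intgD mOm (intgD mOm i1 i2) i3).
by apply: eq_integral => z _; rewrite /wgrad_sq sum2 addrA.
Qed.

Lemma smooth_L2 phi : smooth phi -> L2 Omega phi.
Proof. by move=> /smooth_continuous/(continuous_sqint oO bO)/(L2P oO). Qed.

Lemma W12norm_cvg2 v (w : 'I_2 -> R * R -> R) (phi : nat -> R * R -> R) :
  L2 Omega v -> (forall i, is_weak_pderiv Omega i v (w i)) ->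
  (forall n, smooth (phi n)) -> W12norm Omega (phi n \- v) @[n --> \oo] --> 0%E ->
  cvg2 mu (Omega : set (plane R)) phi v /\
  forall i, cvg2 mu (Omega : set (plane R)) (fun n => pderiv i (phi n)) (w i).
Proof.
move=> v2 vw sphi.
pose S n := I (fun z => (phi n z - v z) ^+ 2) + I (fun z => (pderiv ord0 (phi n) z - w ord0 z) ^+ 2) +
  I (fun z => (pderiv ord_max (phi n) z - w ord_max z) ^+ 2).
have p2 n := smooth_L2 (sphi n).
have -> : (fun n => W12norm Omega (phi n \- v)) = (fun n => (Num.sqrt (S n))%:E).
  apply/funext => n.
  rewrite (@W12normE (phi n \- v) (fun i z => pderiv i (phi n) z - w i z))//.
    by apply/(L2P oO); apply: (sqintB mOm); exact/(L2P oO).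
  by move=> i; apply: (weak_pderivB oO bO) => //; exact: (smooth_weak_pderiv oO bO).
move=> h0; have h : Num.sqrt (S n) @[n --> \oo] --> (0 : R).
  exact: (fine_cvg h0).
have i0 n : 0 <= I (fun z => (phi n z - v z) ^+ 2) by apply: Rint_ge0 => z _; exact: sqr_ge0.
have ii i n : 0 <= I (fun z => (pderiv i (phi n) z - w i z) ^+ 2).
  by apply: Rint_ge0 => z _; exact: sqr_ge0.
have S0 : S n @[n --> \oo] --> (0 : R).
  rewrite (_ : S = fun n => Num.sqrt (S n) * Num.sqrt (S n)); last first.
    by apply/funext => n; rewrite -expr2 sqr_sqrtr// !addr_ge0.
  by rewrite -[X in _ --> X](mulr0 0); apply: cvgM.
split=> [|]; last apply: ord2_ind; rewrite /cvg2; apply: (squeeze_cvgr _ (cvg_cst 0) S0).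
- by near=> n; rewrite i0/= /S -addrA lerDl addr_ge0.
- by near=> n; rewrite ii/= /S addrAC lerDr addr_ge0.
- by near=> n; rewrite ii/= /S lerDr addr_ge0.
Unshelve. all: by end_near. Qed.

Lemma curve_sqint (phi : R * R -> R) (c : R -> R * R) (l : R) :
  continuous phi -> continuous c ->
  sqint (@lebesgue_measure R) (`[0, l]%classic : set (measurableTypeR R)) (fun s => phi (c s)).
Proof.
move=> cp cc; have cpc : continuous (phi \o c).
  by move=> s; apply: (continuous_comp (cc s)); exact: cp.
have mcc : measurable (`[0%R, l]%classic : set (measurableTypeR R)) by exact: measurable_itv.
have [M [_ hM]] : bounded_set ((phi \o c) @` `[0, l]).
  apply: compact_bounded; apply: continuous_compact; first exact: continuous_subspaceT.
  exact: segment_compact.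
apply: (sqint_bounded mcc (M := `|M| + 1)).
- exact: itv_lty.
- by apply: measurable_funTS; exact: continuous_measurable_fun.
- move=> s sl; apply: (hM (`|M| + 1)); last by exists s.
  by rewrite (le_lt_trans (ler_norm M))// ltrDl.
Qed.

Definition bd_set : set (measurableTypeR R) := `[0, bd_length Omega]%classic.
Local Notation B := bd_set.

Lemma bd_set_measurable : measurable bd_set. Proof. exact: measurable_itv. Qed.

Lemma trace_approximation v (w : 'I_2 -> R * R -> R) (g : R -> R) :
  continuous (bd_curve Omega) ->
  L2 Omega v -> (forall i, is_weak_pderiv Omega i v (w i)) ->
  has_trace Omega v g ->
  sqint lebesgue_measure B g /\ exists phi : nat -> R * R -> R,
   [/\ forall n, smooth (phi n),
    cvg2 mu (Omega : set (plane R)) phi v,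
    forall i, cvg2 mu (Omega : set (plane R)) (fun n => pderiv i (phi n)) (w i) &
    cvg2 lebesgue_measure B (fun n s => phi n (bd_curve Omega s)) g].
Proof.
move=> cc v2 vw [mg [phi [sphi h1 h2]]].
have [c1 c2] := W12norm_cvg2 v2 vw sphi h1.
have p2 n : sqint lebesgue_measure B (fun s => phi n (bd_curve Omega s)).
  by apply: curve_sqint => //; exact: smooth_continuous.
have g2 : sqint lebesgue_measure B g.
  (* Convergence to 0 makes the extended integral finite for some n; g is then the difference of two
     square integrable functions. *)
  have [n hn] : exists n, ((\int[lebesgue_measure]_(s in B)
      ((phi n (bd_curve Omega s) - g s) ^+ 2)%:E)%E \is a fin_num).
    by have /fine_cvgP[/filter_ex] := h2.
  have d2 : sqint lebesgue_measure B (fun s => phi n (bd_curve Omega s) - g s).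
    apply/(sqintP _ bd_set_measurable); split; last by rewrite ltey_eq hn.
    by apply: measurable_funB => //; case: (p2 n).
  apply: (eq_sqint bd_set_measurable _ (sqintB bd_set_measurable (p2 n) d2)) => s _.
  by rewrite opprB addrC subrK.
split => //; exists phi; split => //; rewrite /cvg2.
apply: (@fine_cvg _ _ _ _ (fun n => \int[lebesgue_measure]_(s in B) ((phi n (bd_curve Omega s) - g s) ^+ 2)%:E)%E).
exact: h2.
Qed.

End sobolev_norm.

(** * Trace inequalities *)

Section slices.
Context {R : realType}.
Implicit Types (Omega : set (R * R)) (psi D : R * R -> R) (gamma : R -> R * R).

Lemma derive_lipschitz (F d : R -> R) (M a b : R) :
  (forall x, is_derive x (1 : R) F (d x)) ->
  (forall x, (a <= x <= b) || (b <= x <= a) -> `|d x| <= M) ->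
  `|F b - F a| <= M * `|b - a|.
Proof.
move=> dF dM.
have main (u v : R) : u < v -> (forall x, u <= x <= v -> `|d x| <= M) -> `|F v - F u| <= M * (v - u).
  move=> uv h; have [|c] := @MVT R F d u v uv (fun s _ => dF s).
    by apply: derivable_within_continuous => s _; by case: (dF s).
  rewrite in_itv/= => /andP[uc cv] ->; rewrite normrM (gtr0_norm (x := v - u)) ?subr_gt0//.
  by apply: ler_wpM2r; [rewrite subr_ge0 ltW|apply: h; rewrite !ltW].
have [ab|ba|->] := ltgtP a b; last by rewrite !subrr normr0 mulr0.
  rewrite (gtr0_norm (x := b - a)) ?subr_gt0//; apply: main => // x xab.
  by apply: dM; rewrite xab.
rewrite distrC (distrC b) (gtr0_norm (x := a - b)) ?subr_gt0//; apply: main => // x xab.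
by apply: dM; rewrite xab orbT.
Qed.

Lemma C1_lipschitz_box psi r : Ck 1 psi -> exists2 M, 0 <= M &
  forall z w, square_box r z -> square_box r w ->
    `|psi z - psi w| <= M * (`|z.1 - w.1| + `|z.2 - w.2|).
Proof.
move=> p1; have dp := Ck_diff p1.
have [M0 M00 h0] := continuous_bounded_box r (@pderiv_continuous _ ord0 psi 0 p1).
have [M1 M10 h1] := continuous_bounded_box r (@pderiv_continuous _ ord_max psi 0 p1).
exists (M0 + M1); first by rewrite addr_ge0.
move=> [z1 z2] [w1 w2]; rewrite /square_box/= !in_itv/=.
move=> [/andP[a1 a2] /andP[b1 b2]] [/andP[c1 c2] /andP[d1 d2]].
have k1 : `|psi (z1, z2) - psi (w1, z2)| <= M0 * `|z1 - w1|.
  apply: (@derive_lipschitz (fun x => psi (x, z2)) (fun x => pderiv ord0 psi (x, z2))).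
    by move=> x; exact: is_derive_horizontal.
  move=> x hx; apply: h0; rewrite /square_box/= !in_itv/=; move: hx.
  by move=> /orP[] /andP[? ?]; split; apply/andP; split; lra.
have k2 : `|psi (w1, z2) - psi (w1, w2)| <= M1 * `|z2 - w2|.
  apply: (@derive_lipschitz (fun x => psi (w1, x)) (fun x => pderiv ord_max psi (w1, x))).
    by move=> x; exact: is_derive_vertical.
  move=> x hx; apply: h1; rewrite /square_box/= !in_itv/=; move: hx.
  by move=> /orP[] /andP[? ?]; split; apply/andP; split; lra.
have -> : psi (z1, z2) - psi (w1, w2) = (psi (z1, z2) - psi (w1, z2)) + (psi (w1, z2) - psi (w1, w2)).
  by rewrite addrA subrK.
apply: (le_trans (ler_normD _ _)).
have := normr_ge0 (z1 - w1); have := normr_ge0 (z2 - w2); nra.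
Qed.

Lemma left_boundary_point Omega r : open Omega -> Omega `<=` square_box r ->
  forall z, Omega z -> exists2 a, a < z.1 & bdry Omega (a, z.2) /\
    forall x, a < x <= z.1 -> Omega (x, z.2).
Proof.
move=> oO bO z Oz.
(* The supremum of S is the last abscissa left of z at which the horizontal line is outside
   Omega. *)
pose S := [set t : R | t <= z.1 /\ ~ Omega (t, z.2)].
have S0 : has_sup S.
  split.
    exists (- r - 1); split.
      by have := bO z Oz; rewrite /square_box/= !in_itv/= => -[/andP[? ?] _]; lra.
    by move=> /bO; rewrite /square_box/= !in_itv/= => -[/andP[? ?] _]; lra.
  by exists z.1 => t [].
have fc : continuous (fun t : R => (t, z.2)).
  move=> t A /nbhs_ballP[e /= e0 eA]; apply: filterS (nbhsx_ballx t e e0) => u tu.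
  by apply: eA; split => //=; exact: ballxx.
pose a := sup S.
have aub t : S t -> t <= a by move=> St; apply: ub_le_sup => //; case: S0.
have az : a <= z.1 by apply: ge_sup; [case: S0|move=> t []].
have nOa : ~ Omega (a, z.2).
  move=> Oa; have : nbhs a [set t | Omega (t, z.2)].
    by apply: fc; exact: open_nbhs_nbhs.
  move=> [e /= e0 he]; have [t St at_] := sup_adherent e0 S0.
  have ta := aub _ St; case: St => _; apply; apply: he => /=.
  by rewrite ger0_norm ?subr_ge0//; move: at_; rewrite -/a; lra.
have alt : a < z.1.
  rewrite lt_neqAle az andbT; apply/eqP => e; apply: nOa; rewrite e.
  by case: z {S fc S0 a aub az e} Oz.
have inO x : a < x <= z.1 -> Omega (x, z.2).
  by move=> /andP[ax xz]; apply: contrapT => nO; have := aub x (conj xz nO); lra.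
exists a => //; split => //; split; last first.
  by rewrite /interior => /nbhs_singleton.
move=> U; have := fc a => /(_ U) h nU.
have [e /= e0 he] := h nU.
pose x := Num.min z.1 (a + e / 2).
exists (x, z.2); split.
  apply: inO; rewrite lt_min alt ltrDl divr_gt0//= ge_min lexx//.
have ax : a < x by rewrite lt_min alt ltrDl divr_gt0.
have xa : x <= a + e / 2 by rewrite ge_min lexx orbT.
by apply: he => /=; rewrite ltr0_norm ?subr_lt0//; lra.
Qed.

(** Along a horizontal slice, psi at z is at most its value at the boundary point to the left plus
    the integral of the derivative. The boundary value is replaced by a function G of the height y
    alone: the integral of psi, divided by h, over the parameters s at which gamma is within h of
    the height y. As gamma is 1-Lipschitz these include an interval of length h next to the
    parameter of the boundary point, on which psi varies by at most eta. Measurability of G is thus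
    automatic, and no graph representation of the boundary intervenes. *)
Lemma slice_bound Omega r psi D gamma l : open Omega -> Omega `<=` square_box r ->
  0 < l -> continuous psi -> continuous D ->
  (forall x y, is_derive x (1 : R) (fun s => psi (s, y)) (D (x, y))) ->
  (forall z, 0 <= psi z) ->
  continuous gamma -> (forall s t, `|(gamma s).2 - (gamma t).2| <= `|s - t|) ->
  (forall z, bdry Omega z -> exists2 s, 0 <= s <= l & gamma s = z) ->
  (exists2 L, 0 <= L & forall s t, 0 <= s <= l -> 0 <= t <= l ->
     `|psi (gamma s) - psi (gamma t)| <= L * `|s - t|) ->
  forall eta, 0 < eta -> exists G : R -> \bar R,
  [/\ measurable_fun setT (G : measurableTypeR R -> \bar R), (forall y, 0 <= G y)%E,
   (\int[lebesgue_measure]_y G y = 2%:E * \int[lebesgue_measure]_(s in `[0%R, l]) (psi (gamma s))%:E)%E &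
   forall z, Omega z -> ((psi z)%:E <= G z.2 + eta%:E +
     \int[lebesgue_measure]_x (`|D (x, z.2)| * \1_Omega (x, z.2))%:E)%E].
Proof.
move=> oO bO l0 cpsi cD dD psi0 cg lg bg [L L0 hL] eta eta0.
(* The bound l / 2 leaves room in [0, l] for an interval of length h on one side of any parameter;
   the other bound gives L h <= eta. *)
pose h := Num.min (l / 2) (eta / (L + 1)).
have h0 : 0 < h by rewrite lt_min !divr_gt0// ltr_wpDl.
have hl : h <= l / 2 by rewrite ge_min lexx.
have hLe : L * h <= eta.
  apply: (@le_trans _ _ ((L + 1) * h)); first by rewrite ler_wpM2r ?(ltW h0)// lerDl.
  by rewrite mulrC -ler_pdivlMr ?ltr_wpDl// ge_min lexx orbT.
pose C : set (R * R) := [set p | `|(gamma p.1).2 - p.2| <= h].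
have cg2 : continuous (fun s => (gamma s).2).
  by move=> s; apply: (continuous_comp (cg s)); exact: continuous_snd2.
have mC : measurable (C : set (plane R)).
  rewrite -(setCK C); apply: measurableC; apply: open_measurable2; apply: closed_openC.
  rewrite (_ : C = (fun p : R * R => `|(gamma p.1).2 - p.2|) @^-1` [set x | x <= h])//.
  apply: (continuous_closedP _).1; last exact: closed_le.
  move=> p; apply: cvg_norm; apply: cvgB; last exact: continuous_snd2.
  by apply: (continuous_comp (g := fun s => (gamma s).2)); [exact: continuous_fst2|exact: cg2].
pose I01 : set (measurableTypeR R) := `[0, l]%classic.
have mI : measurable I01 by exact: measurable_itv.
pose K (p : measurableTypeR R * measurableTypeR R) : \bar R :=
  (h^-1 * (\1_I01 p.1 * psi (gamma p.1)) * \1_C p)%:E.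
have cpg : continuous (fun s => psi (gamma s)).
  by move=> s; apply: (continuous_comp (cg s)); exact: cpsi.
have mK : measurable_fun setT K.
  apply/measurable_EFinP; apply: measurable_funM; last exact: measurable_indic.
  apply: measurable_funM => //.
  have m1 : measurable_fun setT (fun s : measurableTypeR R => \1_I01 s * psi (gamma s) : measurableTypeR R).
    apply: measurable_funM; first exact: measurable_indic.
    exact: continuous_measurable_fun.
  exact: (measurableT_comp m1 measurable_fst).
have K0 p : (0 <= K p)%E by rewrite lee_fin !mulr_ge0// ?invr_ge0 ?(ltW h0).
pose G : R -> \bar R := fun y => (\int[lebesgue_measure]_s K (s, y))%E.
have G0 y : (0 <= G y)%E by apply: integral_ge0.
have mG : measurable_fun setT (G : measurableTypeR R -> \bar R).
  exact: (measurable_fun_fubini_tonelli_G K mK K0).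
exists G; split => //.
- rewrite /G -(fubini_tonelli K)//.
  transitivity (\int[lebesgue_measure]_s (2%:E * (\1_I01 s * psi (gamma s))%:E))%E.
    apply: eq_integral => s _.
    (* For fixed s the admissible heights form an interval of length 2h; divided by h this gives the
       factor 2 in the conclusion. *)
    pose J : set (measurableTypeR R) := `[(gamma s).2 - h, (gamma s).2 + h]%classic.
    transitivity (\int[lebesgue_measure]_y ((h^-1 * (\1_I01 s * psi (gamma s)))%:E * (\1_J y)%:E))%E.
      apply: eq_integral => y _; rewrite /K -EFinM; congr (_ * _)%:E.
      rewrite !indicE; congr (_%:R); congr nat_of_bool.
      apply/idP/idP; rewrite !inE /C /J /= in_itv/= ler_norml => /andP[? ?]; apply/andP; split; lra.
    rewrite ge0_integralZl//.
    + rewrite integral_indic//; last exact: measurable_itv.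
      have lJ : lebesgue_measure J = (2 * h)%:E.
        rewrite /J lebesgue_measure_itv/= lte_fin (_ : (gamma s).2 - h < (gamma s).2 + h)%R; last by lra.
        by rewrite -EFinB; congr EFin; ring.
      rewrite setIT [X in (_ * X)%E](_ : _ = (2 * h)%:E)//.
      by rewrite -!EFinM; congr EFin; field; exact: lt0r_neq0.
    + by apply/measurable_EFinP; apply: measurable_indic; exact: measurable_itv.
    + by rewrite lee_fin !mulr_ge0// ?invr_ge0 ?(ltW h0).
  rewrite ge0_integralZl//.
  + congr (_ * _)%E; rewrite [RHS]integral_mkcond; apply: eq_integral => s _.
    by rewrite /patch indicE; case: ifPn => _; rewrite ?mul1r ?mul0r.
  + apply/measurable_EFinP; apply: measurable_funM; first exact: measurable_indic.
    exact: continuous_measurable_fun.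
  + by move=> s _; rewrite lee_fin mulr_ge0.
- move=> z Oz; have [a az [ba inO]] := left_boundary_point oO bO Oz.
  have [s0 /andP[s00 s0l] gs0] := bg _ ba.
  have Gz : ((psi (gamma s0) - eta)%:E <= G z.2)%E.
    have [neg|pos] := leP (psi (gamma s0) - eta) 0.
      by apply: le_trans (G0 _); rewrite lee_fin.
    (* J lies to the right of [s0] if there is room in [0, l], and to the left otherwise. *)
    have [J [mJ lJ JI Js]] : exists J : set (measurableTypeR R), [/\ measurable J,
        lebesgue_measure J = h%:E, J `<=` I01 & forall s, J s -> `|s - s0| <= h].
      have [h1|h1] := leP (s0 + h) l.
        exists `[s0, s0 + h]%classic; split; first exact: measurable_itv.
        - rewrite lebesgue_measure_itv/= lte_fin ltrDl h0 -EFinB; congr EFin; ring.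
        - by move=> s; rewrite /I01/= !in_itv/= => /andP[? ?]; apply/andP; split; lra.
        - by move=> s; rewrite /= in_itv/= => /andP[? ?]; rewrite ger0_norm ?subr_ge0//; lra.
      exists `[s0 - h, s0]%classic; split; first exact: measurable_itv.
      - rewrite lebesgue_measure_itv/= lte_fin ltrBlDr ltrDl h0 -EFinB; congr EFin; ring.
      - by move=> s; rewrite /I01/= !in_itv/= => /andP[? ?]; apply/andP; split; lra.
      - by move=> s; rewrite /= in_itv/= => /andP[? ?]; rewrite ler0_norm ?subr_le0//; lra.
    apply: (@le_trans _ _ (\int[lebesgue_measure]_(s in J) (K (s, z.2)))%E); last first.
      apply: ge0_subset_integral => //.
      by apply: (measurableT_comp mK); exact: measurable_pair2.
    rewrite (_ : (psi (gamma s0) - eta)%:E = \int[lebesgue_measure]_(s in J) (h^-1 * (psi (gamma s0) - eta))%:E)%E; last first.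
      transitivity ((h^-1 * (psi (gamma s0) - eta))%:E * lebesgue_measure J)%E.
        by rewrite lJ -EFinM; congr EFin; field; exact: lt0r_neq0.
      by apply/esym; exact: integral_cst.
    apply: ge0_le_integral => //.
    + by move=> s _; rewrite lee_fin mulr_ge0 ?invr_ge0 ?ltW.
    + by apply: measurable_funTS; apply: (measurableT_comp mK); exact: measurable_pair2.
    + move=> s Jss; rewrite lee_fin !indicE mem_set/=; last exact: JI.
      have hs := Js _ Jss; have := JI _ Jss; rewrite /I01/= in_itv/= => Is.
      rewrite mem_set/=; last first.
        rewrite /C/=; have -> : z.2 = (gamma s0).2 by rewrite gs0.
        exact: le_trans (lg _ _) hs.
      rewrite mul1r mulr1 ler_wpM2l ?invr_ge0 ?(ltW h0)//.
      have := hL s s0 Is; rewrite s00 s0l => /(_ isT); rewrite ler_norml => /andP[h1 _].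
      have : L * `|s - s0| <= L * h by rewrite ler_wpM2l.
      lra.
  pose f x := D (x, z.2).
  have cf : continuous f.
    move=> x; apply: (continuous_comp (f := fun x : R => (x, z.2)) (g := D)); last exact: cD.
    move=> A /nbhs_ballP[e /= e0 eA]; apply: filterS (nbhsx_ballx x e e0) => u tu.
    by apply: eA; split => //=; exact: ballxx.
  have FTC : (\int[lebesgue_measure]_(x in `[a, z.1]) (f x)%:E = (psi z)%:E - (psi (gamma s0))%:E)%E.
    rewrite gs0 (_ : psi z = psi (z.1, z.2)); last by case: (z).
    apply: (@continuous_FTC2 R f (fun x => psi (x, z.2))) => //.
    + exact: continuous_subspaceT.
    + have cp2 x : {for x, continuous (fun x => psi (x, z.2))}.
        by apply: differentiable_continuous; apply/derivable1_diffP; case: (dD x z.2).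
      split.
      * by move=> x _; case: (dD x z.2).
      * by apply: cvg_at_right_filter; exact: cp2.
      * by apply: cvg_at_left_filter; exact: cp2.
    + by move=> x _; rewrite derive1E; case: (dD x z.2).
  have le1 : (\int[lebesgue_measure]_(x in `[a, z.1]) (f x)%:E <=
     \int[lebesgue_measure]_x (`|D (x, z.2)| * \1_Omega (x, z.2))%:E)%E.
    have mf : measurable_fun setT (f : measurableTypeR R -> measurableTypeR R) by exact: continuous_measurable_fun.
    apply: (le_trans (lee_abs _)); apply: (le_trans (le_abse_integral _ _ _)) => //.
      by apply/measurable_EFinP; apply: measurable_funTS.
    rewrite -integral_itv_obnd_cbnd; last first.
      by apply: measurable_funTS; apply/measurable_EFinP; apply: measurableT_comp.
    apply: (@le_trans _ _ (\int[lebesgue_measure]_(x in `]a, z.1]) (`|D (x, z.2)| * \1_Omega (x, z.2))%:E)%E).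
      rewrite le_eqVlt; apply/orP; left; apply/eqP; apply: eq_integral => x; rewrite inE/= in_itv/= => xa.
      by rewrite indicE mem_set ?mulr1//; exact: inO.
    apply: ge0_subset_integral => //.
      apply/measurable_EFinP; apply: measurable_funM; first exact: measurableT_comp.
      have mO1 : measurable_fun setT (\1_(Omega : set (plane R)) : plane R -> measurableTypeR R).
        by apply: measurable_indic; exact: open_measurable2.
      by apply: (measurableT_comp mO1); exact: measurable_pair2.
  rewrite FTC -EFinB in le1.
  have : ((psi z)%:E <= (psi (gamma s0) - eta)%:E + eta%:E + (psi z - psi (gamma s0))%:E)%E.
    by rewrite -!EFinD lee_fin; lra.
  move=> /le_trans; apply; apply: leeD => //; exact: leeD2r.
Qed.

End slices.

Section trace_inequalities.
Context {R : realType}.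
Implicit Types (Omega : set (R * R)).

Definition swap2 (z : R * R) : R * R := (z.2, z.1).

Lemma swap2_continuous : continuous swap2.
Proof.
move=> z A /nbhs_ballP[e /= e0 eA].
apply/nbhs_ballP; exists e => //= w [w1 w2]; apply: eA; split => //.
Qed.

Lemma bdry_open Omega z : open Omega -> bdry Omega z <-> closure Omega z /\ ~ Omega z.
Proof. by move=> /interior_id; rewrite /bdry => ->. Qed.

Lemma closure_square_box Omega r : Omega `<=` square_box r -> closure Omega `<=` square_box r.
Proof.
move=> h; rewrite closureE => z /(_ (square_box r)); apply; split => //.
exact: closed_box.
Qed.

Lemma integral_tensor (a b : R -> \bar R) :
  measurable_fun setT (a : measurableTypeR R -> \bar R) ->
  measurable_fun setT (b : measurableTypeR R -> \bar R) ->
  (forall x, 0 <= a x)%E -> (forall x, 0 <= b x)%E ->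
  (\int[leb2]_z (a z.1 * b z.2) =
   (\int[lebesgue_measure]_x a x) * (\int[lebesgue_measure]_y b y))%E.
Proof.
move=> ma mb a0 b0; rewrite /leb2 fubini_tonelli2 /=.
- transitivity (\int[lebesgue_measure]_y ((\int[lebesgue_measure]_x a x) * b y))%E.
    apply: eq_integral => y _; rewrite /fubini_G/=.
    under eq_integral do rewrite muleC.
    by rewrite ge0_integralZl// muleC.
  by rewrite ge0_integralZl//; exact: integral_ge0.
- apply: emeasurable_funM.
    exact: (measurableT_comp ma measurable_fst).
  exact: (measurableT_comp mb measurable_snd).
- by move=> x; rewrite mule_ge0.
Qed.

Section data.
Variables (Omega : set (R * R)) (r : R) (gamma : R -> R * R) (l : R).
Hypotheses (oO : open Omega) (r0 : 0 < r) (bO : Omega `<=` square_box r) (l0 : 0 < l).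
Hypothesis cg : continuous gamma.
Hypothesis lg1 : forall s t, `|(gamma s).1 - (gamma t).1| <= `|s - t|.
Hypothesis lg2 : forall s t, `|(gamma s).2 - (gamma t).2| <= `|s - t|.
Hypothesis gb : forall s, bdry Omega (gamma s).
Hypothesis bg : forall z, bdry Omega z -> exists2 s, 0 <= s <= l & gamma s = z.

Local Notation mu := (@leb2 R).
Local Notation I := (Rintegral mu (Omega : set (plane R))).
Local Notation Bd := (Rintegral (@lebesgue_measure R) (`[0, l]%classic : set (measurableTypeR R))).
Let mOm : measurable (Omega : set (plane R)) := domain_measurable oO.
Let mI : measurable (`[0, l]%classic : set (measurableTypeR R)).
Proof. exact: measurable_itv. Qed.

(** [slice_bound] for phi^2, whose derivative is 2 phi times that of phi: on Omega, phi^2 is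
    dominated by a function of the height alone with controlled integral. Integrating such envelopes
    gives both the Poincare and the L^4 inequality. *)
Lemma slice_envelope (phi : R * R -> R) (eta : R) : smooth phi -> 0 < eta ->
  exists A : R -> \bar R, [/\
    measurable_fun setT (A : measurableTypeR R -> \bar R), (forall y, 0 <= A y)%E,
    (\int[lebesgue_measure]_y A y <=
      (2 * Bd (fun s => phi (gamma s) ^+ 2) + 2 * r * eta +
       I (fun z => `|2 * phi z * pderiv ord0 phi z|))%:E)%E &
    forall z, Omega z -> ((phi z ^+ 2)%:E <= A z.2)%E].
Proof.
move=> sp eta0; have cphi := smooth_continuous sp.
have cd := smooth_continuous (smooth_pderiv ord0 sp).
pose psi z := phi z ^+ 2; pose D z := 2 * phi z * pderiv ord0 phi z.
have Cpsi : Ck 1 psi by have := CkM (sp 1%N) (sp 1%N).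
have cD : continuous D.
  move=> z; apply: cvgM; last exact: cd.
  by apply: cvgM; [exact: cvg_cst|exact: cphi].
have dD x y : is_derive x (1 : R) (fun s => psi (s, y)) (D (x, y)).
  have := @is_derive_horizontal R psi x y (Ck_diff Cpsi (x, y)).
  rewrite (_ : pderiv ord0 psi (x, y) = D (x, y))//.
  rewrite (_ : psi = fun z => phi z * phi z); last by apply/funext => z; rewrite /psi expr2.
  rewrite (pderivM _ (smooth_diff sp) (smooth_diff sp)) /D; ring.
have gbox s : square_box r (gamma s).
  by apply: (closure_square_box bO); have /(bdry_open _ oO)[] := gb s.
have [L L0 hL] := C1_lipschitz_box r Cpsi.
have lip : exists2 L, 0 <= L & forall s t, 0 <= s <= l -> 0 <= t <= l ->
     `|psi (gamma s) - psi (gamma t)| <= L * `|s - t|.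
  exists (L + L) => [|s t _ _]; first by rewrite addr_ge0.
  apply: (le_trans (hL _ _ (gbox s) (gbox t))); rewrite mulrDl -mulrDr ler_wpM2l//.
  by apply: lerD.
have [G [mG G0 IG hG]] := slice_bound oO bO l0 (smooth_continuous (fun k => CkM (sp k) (sp k))) cD
   dD (fun z => sqr_ge0 (phi z)) cg lg2 bg lip eta0.
have mf : measurable_fun setT (fun z : plane R => (`|D z| * \1_Omega z)%:E).
  apply/measurable_EFinP; apply: measurable_funM; last exact: measurable_indic.
  by apply: measurableT_comp => //; exact: continuous_measurable2.
have f0 (z : plane R) : (0 <= (`|D z| * \1_Omega z)%:E)%E by rewrite lee_fin mulr_ge0.
pose H y := (\int[lebesgue_measure]_x (`|D (x, y)| * \1_Omega (x, y))%:E)%E.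
have H0 y : (0 <= H y)%E by apply: integral_ge0 => x _; exact: f0.
have mH : measurable_fun setT (H : measurableTypeR R -> \bar R).
  exact: (measurable_fun_fubini_tonelli_G _ mf f0).
pose J : set (measurableTypeR R) := `[- r, r]%classic.
have mJ : measurable J by exact: measurable_itv.
(* The constant eta is restricted to the heights met by Omega, so that its integral is finite. *)
pose E y := (eta * \1_J y)%:E.
have E0 y : (0 <= E y)%E by rewrite lee_fin; apply: mulr_ge0 => //; exact: ltW.
have mE : measurable_fun setT (E : measurableTypeR R -> \bar R).
  by apply/measurable_EFinP; apply: measurable_funM => //; exact: measurable_indic.
exists (fun y => G y + E y + H y)%E; split.
- by apply: emeasurable_funD => //; exact: emeasurable_funD.
- by move=> y; apply: adde_ge0 => //; exact: adde_ge0.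
- rewrite ge0_integralD//; [|by move=> y _; apply: adde_ge0|exact: emeasurable_funD].
  rewrite ge0_integralD// IG !EFinD.
  have h1 : (\int[lebesgue_measure]_y E y <= (2 * r * eta)%:E)%E.
    rewrite /E; under eq_integral do rewrite EFinM.
    rewrite ge0_integralZl//.
    + rewrite integral_indic// setIT [X in (_ * X)%E](_ : _ = (2 * r)%:E).
        by rewrite -EFinM lee_fin mulrC.
      have : lebesgue_measure J = (2 * r)%:E.
        have rr : - r < r by rewrite -subr_gt0 opprK addr_gt0.
        rewrite /J lebesgue_measure_itv/= lte_fin rr.
        by rewrite -EFinB; congr EFin; ring.
      by [].
    + by apply/measurable_EFinP; exact: measurable_indic.
    + by rewrite lee_fin ltW.
  have pg2 : sqint (@lebesgue_measure R) (`[0, l]%classic : set (measurableTypeR R)) (fun s => phi (gamma s)).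
    exact: curve_sqint.
  have h2 : (2%:E * \int[lebesgue_measure]_(s in `[0%R, l]) (psi (gamma s))%:E =
      (2 * Bd (fun s => phi (gamma s) ^+ 2))%:E)%E.
    by rewrite EFinM -(intgE mI pg2.2).
  have h3 : (\int[lebesgue_measure]_y H y = (I (fun z => `|D z|))%:E)%E.
    rewrite -(@fubini_tonelli2 _ _ _ _ _ lebesgue_measure lebesgue_measure _ mf f0).
    rewrite -(intgE mOm); last first.
      by apply: intg_norm; apply: (sqint_intg mOm (domain_finite oO bO)); exact: (continuous_sqint oO bO).
    rewrite [RHS]integral_mkcond; apply: eq_integral => z _.
    by rewrite /patch indicE; case: ifPn => _; rewrite ?mulr1 ?mulr0.
  rewrite h2 h3; apply: leeD => //; exact: leeD2l.
- move=> z Oz; apply: (le_trans (hG z Oz)); rewrite /E indicE mem_set ?mulr1//.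
  by have [] := bO Oz.
Qed.
End data.

Section both.
Variables (Omega : set (R * R)) (r : R) (gamma : R -> R * R) (l : R).
Hypotheses (oO : open Omega) (r0 : 0 < r) (bO : Omega `<=` square_box r) (l0 : 0 < l).
Hypothesis cg : continuous gamma.
Hypothesis lg1 : forall s t, `|(gamma s).1 - (gamma t).1| <= `|s - t|.
Hypothesis lg2 : forall s t, `|(gamma s).2 - (gamma t).2| <= `|s - t|.
Hypothesis gb : forall s, bdry Omega (gamma s).
Hypothesis bg : forall z, bdry Omega z -> exists2 s, 0 <= s <= l & gamma s = z.

Local Notation mu := (@leb2 R).
Local Notation I := (Rintegral mu (Omega : set (plane R))).
Local Notation Bd := (Rintegral (@lebesgue_measure R) (`[0, l]%classic : set (measurableTypeR R))).
Let mOm : measurable (Omega : set (plane R)) := domain_measurable oO.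

Lemma swap_smooth (phi : R * R -> R) : smooth phi -> smooth (phi \o swap2).
Proof.
move=> sp k; have := sp k; elim: k phi {sp} => [phi cp z|k IH phi].
  by apply: continuous_comp; [exact: swap2_continuous|exact: cp].
move=> /CkS[dp pk].
have ds z : differentiable swap2 z.
  by apply: differentiable_pair; [exact: differentiable_snd|exact: differentiable_fst].
have e i : pderiv i (phi \o swap2) = pderiv (if i == ord0 then ord_max else ord0) phi \o swap2.
  apply/funext => z; rewrite /pderiv /derive /=.
  have -> // : (fun h : R => h^-1 *: (((phi \o swap2) \o shift z) (h *: basis2 i) - phi (swap2 z))) =
    (fun h : R => h^-1 *: ((phi \o shift (swap2 z)) (h *: basis2 (if i == ord0 then ord_max else ord0)) - phi (swap2 z))).
  apply/funext => h; congr (_ *: (phi _ - _)); rewrite /swap2 /=.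
  by rewrite /basis2; case: (i == ord0).
apply/CkS; split=> [z|i]; first by apply: differentiable_comp.
by rewrite e; exact: IH.
Qed.

Lemma pderiv_swap (phi : R * R -> R) z : pderiv ord0 (phi \o swap2) z = pderiv ord_max phi (swap2 z).
Proof.
rewrite /pderiv /derive /=.
have -> // : (fun h : R => h^-1 *: (((phi \o swap2) \o shift z) (h *: basis2 ord0) - phi (swap2 z))) =
  (fun h : R => h^-1 *: ((phi \o shift (swap2 z)) (h *: basis2 ord_max) - phi (swap2 z))).
by apply/funext => h; congr (_ *: (phi _ - _)).
Qed.

Lemma swap_integral (f : R * R -> R) : continuous f -> (forall z, 0 <= f z) ->
  Rintegral mu (swap2 @^-1` Omega : set (plane R)) (f \o swap2) = I f.
Proof.
move=> cf f0; congr fine.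
have mf : measurable_fun setT (fun z : plane R => (f z * \1_Omega z)%:E).
  apply/measurable_EFinP; apply: measurable_funM; last exact: measurable_indic.
  exact: continuous_measurable2.
have F0 (z : plane R) : (0 <= (f z * \1_Omega z)%:E)%E by rewrite lee_fin mulr_ge0.
have mO' : measurable (swap2 @^-1` Omega : set (plane R)).
  apply: open_measurable2; apply: open_comp => // z _; exact: swap2_continuous.
have mf' : measurable_fun setT (fun z : plane R => (f (swap2 z) * \1_Omega (swap2 z))%:E).
  apply/measurable_EFinP; apply: measurable_funM.
    apply: continuous_measurable2 => z; apply: continuous_comp; [exact: swap2_continuous|exact: cf].
  rewrite (_ : (fun z => \1_Omega (swap2 z)) = \1_(swap2 @^-1` Omega)); first exact: measurable_indic.
  by apply/funext => z.
transitivity (\int[leb2]_z (f (swap2 z) * \1_Omega (swap2 z))%:E)%E.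
  rewrite integral_mkcond; apply: eq_integral => z _.
  rewrite /patch indicE (_ : (z \in swap2 @^-1` Omega) = (swap2 z \in Omega))//.
  by case: ifPn => _; rewrite ?mulr1 ?mulr0.
transitivity (\int[leb2]_z (f z * \1_Omega z)%:E)%E; last first.
  rewrite [RHS]integral_mkcond; apply: eq_integral => z _.
  by rewrite /patch indicE; case: ifPn => _; rewrite ?mulr1 ?mulr0.
rewrite (fubini_tonelli2 _ mf') ?(fubini_tonelli1 _ mf F0) //.
Qed.

Lemma slice_envelope2 (phi : R * R -> R) (eta : R) : smooth phi -> 0 < eta ->
  exists A : R -> \bar R, [/\
    measurable_fun setT (A : measurableTypeR R -> \bar R), (forall y, 0 <= A y)%E,
    (\int[lebesgue_measure]_y A y <=
      (2 * Bd (fun s => phi (gamma s) ^+ 2) + 2 * r * eta +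
       I (fun z => `|2 * phi z * pderiv ord_max phi z|))%:E)%E &
    forall z, Omega z -> ((phi z ^+ 2)%:E <= A z.1)%E].
Proof.
move=> sp eta0; pose O' := swap2 @^-1` Omega.
have oO' : open O' by apply: open_comp => // z _; exact: swap2_continuous.
have bO' : O' `<=` square_box r by move=> z /bO[].
have b' z : bdry O' z <-> bdry Omega (swap2 z).
  rewrite (bdry_open _ oO') (bdry_open _ oO); split=> -[cz nz]; split => //.
    by move=> U nU; have [w [w1 w2]] := cz _ (swap2_continuous nU); exists (swap2 w).
  move=> U nU; have nU' : nbhs (swap2 z) (swap2 @^-1` U).
    by apply: swap2_continuous; rewrite /swap2/=; case: (z) nU.
  by have [w [w1 w2]] := cz _ nU'; exists (swap2 w); split => //; rewrite /O'/= /swap2/=; case: (w) w1.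
have [||||||A [mA A0 IA hA]] := @slice_envelope O' r (swap2 \o gamma) l oO' r0 bO' l0 _ _ _ _ _ (phi \o swap2) eta _ eta0.
- by move=> s; apply: continuous_comp; [exact: cg|exact: swap2_continuous].
- exact: lg2.
- exact: lg1.
- by move=> s; apply/b'; rewrite /swap2/=; case: (gamma s) (gb s).
- move=> z /b' /bg[s sl e]; exists s => //=; rewrite e /swap2/=; by case: (z).
- exact: swap_smooth.
exists A; split; [exact: mA|exact: A0| |]; last first.
  by move=> [z1 z2] Oz; exact: (hA (z2, z1) Oz).
apply: (le_trans IA); rewrite lee_fin; apply: lerD; last first.
  rewrite -swap_integral; last 2 first.
  - move=> z; apply: cvg_norm; apply: cvgM; last exact: smooth_continuous (smooth_pderiv _ sp) z.
    by apply: cvgM; [exact: cvg_cst|exact: smooth_continuous sp z].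
  - by [].
  by rewrite le_eqVlt; apply/orP; left; apply/eqP; apply: eq_Rint => z _ /=; rewrite pderiv_swap.
apply: lerD => //; rewrite le_eqVlt; apply/orP; left; apply/eqP; congr (_ * _).
by apply: eq_Rint => s _ /=; rewrite /swap2/=; case: (gamma s).
Qed.

(** The envelope is constant in the horizontal direction, where Omega has width at most 2r. The
    resulting product of phi and its derivative is split so that half of the integral of phi^2 is
    absorbed on the left. *)
Lemma poincare_trace (phi : R * R -> R) : smooth phi ->
  I (fun z => phi z ^+ 2) <= 8 * r * Bd (fun s => phi (gamma s) ^+ 2) +
    16 * r ^+ 2 * I (fun z => pderiv ord0 phi z ^+ 2).
Proof.
move=> sp.
have p2 := continuous_sqint oO bO (smooth_continuous sp).
have d2 := continuous_sqint oO bO (smooth_continuous (smooth_pderiv ord0 sp)).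
pose J : set (measurableTypeR R) := `[- r, r]%classic.
have mJ : measurable J by exact: measurable_itv.
have lJ : lebesgue_measure J = (2 * r)%:E.
  have rr : - r < r by rewrite -subr_gt0 opprK addr_gt0.
  rewrite /J lebesgue_measure_itv/= lte_fin rr.
  by rewrite -EFinB; congr EFin; ring.
have h1 : I (fun z => phi z ^+ 2) <= 2 * r * (2 * Bd (fun s => phi (gamma s) ^+ 2) +
       I (fun z => `|2 * phi z * pderiv ord0 phi z|)).
  apply/ler_addgt0Pl => e e0.
  (* The error 2 r eta is integrated over a width 2r, which gives exactly e. *)
  have eta0 : 0 < e / (4 * r ^+ 2) by rewrite divr_gt0// mulr_gt0// exprn_gt0.
  have [A [mA A0 IA hA]] := slice_envelope oO r0 bO l0 cg lg1 lg2 gb bg sp eta0.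
  rewrite -lee_fin -(intgE mOm p2.2).
  have mJ1 : measurable_fun setT (fun x : measurableTypeR R => (\1_J x : R)%:E).
    by apply/measurable_EFinP; exact: measurable_indic.
  have t := integral_tensor mJ1 mA (fun x => _) A0.
  apply: (@le_trans _ _ (\int[mu]_z ((\1_J z.1)%:E * A z.2)))%E.
    rewrite integral_mkcond; apply: ge0_le_integral => //.
    - by move=> z _; rewrite /patch; case: ifP => // _; rewrite lee_fin sqr_ge0.
    - apply: (measurable_restrictT _ mOm).1; apply/measurable_EFinP; apply: measurable_funX.
      by case: p2.
    - apply: emeasurable_funM.
        exact: (measurableT_comp mJ1 measurable_fst).
      exact: (measurableT_comp mA measurable_snd).
    - move=> z _; rewrite /patch; case: ifPn => [/set_mem Oz|_]; last by rewrite mule_ge0 ?lee_fin.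
      by rewrite indicE mem_set ?mul1e ?hA//; have [] := bO Oz.
  rewrite t; last by move=> ?; rewrite lee_fin.
  rewrite integral_indic// setIT [X in (X * _)%E](_ : _ = (2 * r)%:E)//.
  apply: (@le_trans _ _ ((2 * r)%:E * (2 * Bd (fun s => phi (gamma s) ^+ 2) + 2 * r * (e / (4 * r ^+ 2)) +
       I (fun z => `|2 * phi z * pderiv ord0 phi z|))%:E)%E).
    by apply: lee_wpmul2l => //; rewrite lee_fin mulr_ge0 ?ltW.
  rewrite -EFinM lee_fin le_eqVlt; apply/orP; left; apply/eqP; field; exact: lt0r_neq0.
have h2 : 2 * r * I (fun z => `|2 * phi z * pderiv ord0 phi z|) <=
  2^-1 * I (fun z => phi z ^+ 2) + 8 * r ^+ 2 * I (fun z => pderiv ord0 phi z ^+ 2).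
  have i1 : intg mu (Omega : set (plane R)) (fun z => `|2 * phi z * pderiv ord0 phi z|).
    apply: intg_norm; apply: (eq_intg mOm _ (intgZ mOm 2 (sqint_mul mOm p2 d2))).
    by move=> z _; rewrite mulrA.
  rewrite -!(RintZ mOm) ?(p2.2) ?(d2.2)// -(RintD mOm); [|exact: (intgZ mOm _ p2.2)|exact: (intgZ mOm _ d2.2)].
  apply: (le_Rint mOm).
  - exact: intgZ.
  - by apply: (intgD mOm); apply: (intgZ mOm); [exact: p2.2|exact: d2.2].
  (* Young's inequality with weight 4r, so that phi^2 keeps the coefficient 1/2. *)
  - move=> z _; rewrite !normrM (ger0_norm (x := 2))//.
    rewrite -(real_normK (num_real (phi z))) -(real_normK (num_real (pderiv ord0 phi z))).
    have := sqr_ge0 (`|phi z| - 4 * r * `|pderiv ord0 phi z|); nra.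
have : 0 <= Bd (fun s => phi (gamma s) ^+ 2) by apply: Rint_ge0 => z _; exact: sqr_ge0.
nra.
Qed.

(* phi(x,y)^2 is dominated both by a function of x and by a function of y, so phi^4 is dominated by their product. *)
Lemma ladyzhenskaya_trace (phi : R * R -> R) : smooth phi ->
  I (fun z => phi z ^+ 4) <=
   (2 * Bd (fun s => phi (gamma s) ^+ 2) + 2 * r + I (fun z => `|2 * phi z * pderiv ord0 phi z|)) *
   (2 * Bd (fun s => phi (gamma s) ^+ 2) + 2 * r + I (fun z => `|2 * phi z * pderiv ord_max phi z|)).
Proof.
move=> sp; have cphi := smooth_continuous sp.
have [A [mA A0 IA hA]] := slice_envelope oO r0 bO l0 cg lg1 lg2 gb bg sp (@ltr01 R).
have [B [mB B0 IB hB]] := slice_envelope2 sp (@ltr01 R).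
rewrite mulr1 in IA; rewrite mulr1 in IB.
have cp4 : continuous (fun z => phi z ^+ 4).
  have := CkM (CkM (sp 0%N) (sp 0%N)) (CkM (sp 0%N) (sp 0%N)).
  rewrite (_ : (fun z => _) = fun z => phi z ^+ 4)//.
  by apply/funext => z; ring.
have i4 : intg mu (Omega : set (plane R)) (fun z => phi z ^+ 4).
  exact: (sqint_intg mOm (domain_finite oO bO) (continuous_sqint oO bO cp4)).
rewrite -lee_fin -(intgE mOm i4).
apply: (@le_trans _ _ (\int[mu]_z (B z.1 * A z.2)))%E.
  rewrite integral_mkcond; apply: ge0_le_integral => //.
  - by move=> z _; rewrite /patch; case: ifP => // _; rewrite lee_fin exprn_even_ge0.
  - apply: (measurable_restrictT _ mOm).1; apply/measurable_EFinP; exact: (intg_meas i4).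
  - apply: emeasurable_funM.
      exact: (measurableT_comp mB measurable_fst).
    exact: (measurableT_comp mA measurable_snd).
  - move=> z _; rewrite /patch; case: ifPn => [/set_mem Oz|_]; last by rewrite mule_ge0.
    rewrite (_ : phi z ^+ 4 = phi z ^+ 2 * phi z ^+ 2); last by rewrite -exprD.
    by rewrite EFinM; apply: lee_pmul; rewrite ?lee_fin ?sqr_ge0 ?hA ?hB.
rewrite integral_tensor// muleC EFinM.
apply: lee_pmul; [apply: integral_ge0 => x _; exact: A0|apply: integral_ge0 => x _; exact: B0|exact: IA|exact: IB].
Qed.

End both.
End trace_inequalities.

(** * The boundary curve *)

Section parametrization.
Context {R : realType}.
Implicit Types (Omega : set (R * R)) (gamma : R -> R * R).

Lemma is_derive_fst gamma (s : R) : derivable gamma s 1 ->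
  is_derive s (1 : R) (fun t => (gamma t).1) (derive1 gamma s).1.
Proof.
move=> dg.
have h : (fun h : R => h^-1 *: (((fun t => (gamma t).1) \o shift s) (h *: (1 : R)) - (gamma s).1)) @ 0^'
    --> (derive1 gamma s).1.
  rewrite derive1E; apply: (cvg_comp (fun h : R => h^-1 *: ((gamma \o shift s) (h *: (1 : R)) - gamma s)) fst dg).
  exact: continuous_fst2.
by apply: DeriveDef; [apply/cvg_ex; exists (derive1 gamma s).1|exact: (cvg_lim (@Rhausdorff R) h)].
Qed.

Lemma is_derive_snd gamma (s : R) : derivable gamma s 1 ->
  is_derive s (1 : R) (fun t => (gamma t).2) (derive1 gamma s).2.
Proof.
move=> dg.
have h : (fun h : R => h^-1 *: (((fun t => (gamma t).2) \o shift s) (h *: (1 : R)) - (gamma s).2)) @ 0^'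
    --> (derive1 gamma s).2.
  rewrite derive1E; apply: (cvg_comp (fun h : R => h^-1 *: ((gamma \o shift s) (h *: (1 : R)) - gamma s)) snd dg).
  exact: continuous_snd2.
by apply: DeriveDef; [apply/cvg_ex; exists (derive1 gamma s).2|exact: (cvg_lim (@Rhausdorff R) h)].
Qed.

Lemma enorm_sqr (z : R * R) : enorm z ^+ 2 = z.1 ^+ 2 + z.2 ^+ 2.
Proof. by rewrite /enorm /dotp sqr_sqrtr ?addr_ge0 -?expr2 ?sqr_ge0// !expr2. Qed.

Lemma enorm_ge0 (z : R * R) : 0 <= enorm z.
Proof. exact: sqrtr_ge0. Qed.

Lemma enorm1P (z : R * R) : enorm z = 1 -> z.1 ^+ 2 + z.2 ^+ 2 = 1.
Proof. by rewrite -enorm_sqr => ->; rewrite expr1n. Qed.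

Lemma enorm_coord (z : R * R) : `|z.1| <= enorm z /\ `|z.2| <= enorm z.
Proof.
by split; rewrite -sqrtr_sqr /enorm /dotp -!expr2 ler_wsqrtr// ?lerDl ?lerDr sqr_ge0.
Qed.

Lemma exit_point Omega (z v : R * R) : open Omega -> Omega z -> ~ Omega (z + v) ->
  exists2 t : R, 0 < t <= 1 & bdry Omega (z + t *: v).
Proof.
move=> oO Oz nO.
pose S := [set t : R | 0 <= t /\ ~ Omega (z + t *: v)].
have S1 : S 1 by split => //; rewrite scale1r.
have S0 : has_inf S by split; [exists 1|exists 0 => t []].
have fc : continuous (fun t : R => z + t *: v).
  by move=> t; apply: cvgD; [exact: cvg_cst|exact: scalel_continuous].
pose a := inf S.
have alb t : S t -> a <= t by move=> St; apply: ge_inf => //; case: S0.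
have a0 : 0 <= a by apply: lb_le_inf; [case: S0|move=> t []].
have nOa : ~ Omega (z + a *: v).
  move=> Oa; have : nbhs a [set t | Omega (z + t *: v)].
    by apply: fc; exact: open_nbhs_nbhs.
  move=> [e /= e0 he]; have [t St ta] := inf_adherent e0 S0.
  have at_ := alb _ St; case: St => _; apply; apply: he => /=.
  by rewrite distrC ger0_norm ?subr_ge0//; move: ta; rewrite -/a; lra.
have ap : 0 < a.
  rewrite lt_neqAle a0 andbT; apply/eqP => e; apply: nOa.
  by rewrite -e scale0r addr0.
have inO t : 0 <= t < a -> Omega (z + t *: v).
  by move=> /andP[t0 ta]; apply: contrapT => nt; have := alb t (conj t0 nt); lra.
exists a; first by rewrite ap alb.
apply/(bdry_open _ oO); split => // U /fc [e /= e0 he].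
pose t := Num.max 0 (a - e / 2).
have ta : t < a by rewrite gt_max ap ltrBlDr ltrDl divr_gt0.
have t0 : 0 <= t by rewrite le_max lexx.
have at_ : a - e / 2 <= t by rewrite le_max lexx orbT.
exists (z + t *: v); split; first by apply: inO; rewrite t0.
by apply: he => /=; rewrite ger0_norm ?subr_ge0 ?(ltW ta)//; lra.
Qed.

(** Were k positive, the derivative g would be positive just to the right of [s0], and f would
    exceed its maximum there. *)
Lemma second_derivative_at_max (f g : R -> R) (k s0 : R) :
  (forall s, is_derive s (1 : R) f (g s)) -> is_derive s0 (1 : R) g k ->
  (forall t, f t <= f s0) -> g s0 = 0 /\ k <= 0.
Proof.
move=> df dg fmax.
have g0 : g s0 = 0.
  have le2 : s0 - 1 <= s0 + 1 by lra.
  have in2 : s0 \in `]s0 - 1, s0 + 1[ by rewrite in_itv/=; apply/andP; split; lra.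
  have d t : t \in `]s0 - 1, s0 + 1[ -> derivable f t 1 by move=> _; case: (df t).
  have [_ H] := derive1_at_max le2 d in2 (fun t _ => fmax t).
  by have [_ <-] := df s0.
split => //; rewrite leNgt; apply/negP => kp.
have [dk1 dk2] := dg.
have : (fun h : R => h^-1 *: ((g \o shift s0) (h *: (1 : R)) - g s0)) @ 0^' --> k.
  by rewrite -dk2.
move=> /cvgrPdist_lt/(_ _ kp)[e /= e0 he].
have gpos h : 0 < h < e -> 0 < g (s0 + h).
  move=> /andP[h0 h1]; have := he h; rewrite /= sub0r normrN (gtr0_norm h0) => /(_ h1).
  rewrite gt_eqF// => /(_ isT); rewrite g0 subr0 [h *: 1]mulr1 (addrC h) /GRing.scale/=.
  rewrite ltr_norml => /andP[_ h2].
  have : 0 < h^-1 * g (s0 + h) by lra.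
  by rewrite pmulr_rgt0// invr_gt0.
have hlt : s0 < s0 + e / 2 by rewrite ltrDl divr_gt0.
have [|c] := @MVT R f g s0 (s0 + e / 2) hlt (fun s _ => df s).
  by apply: derivable_within_continuous => s _; case: (df s).
rewrite in_itv/= => /andP[c1 c2] E.
have := fmax (s0 + e / 2); rewrite -subr_le0 E leNgt => /negP; apply.
apply: mulr_gt0; last by rewrite subr_gt0.
by rewrite (_ : c = s0 + (c - s0)); [apply: gpos; apply/andP; split; lra|ring].
Qed.

Lemma is_derive_sqr_norm (x y a b a' b' : R -> R) (u v : R) :
  (forall s, is_derive s (1 : R) x (a s)) -> (forall s, is_derive s (1 : R) y (b s)) ->
  (forall s, is_derive s (1 : R) a (a' s)) -> (forall s, is_derive s (1 : R) b (b' s)) ->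
  (forall s, is_derive s (1 : R) (fun s => (x s - u) ^+ 2 + (y s - v) ^+ 2)
     (2 * ((x s - u) * a s + (y s - v) * b s))) /\
  (forall s, is_derive s (1 : R) (fun s => 2 * ((x s - u) * a s + (y s - v) * b s))
     (2 * (a s ^+ 2 + b s ^+ 2 + (x s - u) * a' s + (y s - v) * b' s))).
Proof.
move=> dx dy da db.
have dxu s : is_derive s (1 : R) (fun s => x s - u) (a s).
  by have h := dx s; apply: (is_derive_eq (is_deriveB h (is_derive_cst u s 1))); rewrite subr0.
have dyv s : is_derive s (1 : R) (fun s => y s - v) (b s).
  by have h := dy s; apply: (is_derive_eq (is_deriveB h (is_derive_cst v s 1))); rewrite subr0.
split=> s; have h1 := dxu s; have h2 := dyv s; have h3 := da s; have h4 := db s.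
  rewrite (_ : (fun s => _) = (fun s => x s - u) * (fun s => x s - u) + (fun s => y s - v) * (fun s => y s - v)).
    by apply: (is_derive_eq (is_deriveD (is_deriveM h1 h1) (is_deriveM h2 h2))); rewrite /GRing.scale/=; ring.
  by apply/funext => t; rewrite !expr2.
have E : (fun s => 2 * ((x s - u) * a s + (y s - v) * b s)) =
  2 *: ((fun s => x s - u) * a + (fun s => y s - v) * b) by apply/funext => t.
rewrite E.
by apply: (is_derive_eq (is_deriveZ 2 (is_deriveD (is_deriveM h1 h3) (is_deriveM h2 h4)))); rewrite /GRing.scale/=; ring.
Qed.

(** (X, Y) is the vector from p to a farthest boundary point and (t1, t2) the unit tangent there.
    The first order condition makes (X, Y) equal to c times the left normal (-t2, t1); the second
    order condition becomes curvature times c <= -1. *)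
Lemma frame_coordinates (X Y t1 t2 k1 k2 : R) : t1 ^+ 2 + t2 ^+ 2 = 1 ->
  X * t1 + Y * t2 = 0 -> 1 + X * k1 + Y * k2 <= 0 ->
  exists c, [/\ X = - c * t2, Y = c * t1 & (k1 * - t2 + k2 * t1) * c <= -1].
Proof.
move=> tt tg k0; pose c := - X * t2 + Y * t1.
have xc : X = - c * t2.
  rewrite /c (_ : - _ * t2 = X * (t1 ^+ 2 + t2 ^+ 2) - t1 * (X * t1 + Y * t2)); last by ring.
  by rewrite tt tg; ring.
have yc : Y = c * t1.
  have -> : c * t1 = Y * (t1 ^+ 2 + t2 ^+ 2) - t2 * (X * t1 + Y * t2) by rewrite /c; ring.
  by rewrite tt tg; ring.
exists c; split => //; move: k0; rewrite xc yc; clear; move: c => c; lra.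
Qed.

Lemma pair_equal_spec_coord (z : R * R) (a b : R) : z.1 = a -> z.2 = b -> z = (a, b).
Proof. by case: z => /= z1 z2 -> ->. Qed.

Section arclength.
Variables (Omega : set (R * R)) (gamma : R -> R * R) (l : R).
Hypothesis ag : arclength_param Omega gamma l.

Lemma arclength_continuous : continuous gamma.
Proof.
move=> s; have [_ /(_ s)[dg _] _ _ _] := ag.
exact/differentiable_continuous/derivable1_diffP.
Qed.

Lemma arclength_lip1 s t : `|(gamma s).1 - (gamma t).1| <= `|s - t|.
Proof.
have [_ dg _ ug _] := ag; rewrite -[X in _ <= X]mul1r.
apply: (@derive_lipschitz _ (fun t => (gamma t).1) (fun t => (derive1 gamma t).1)).
  by move=> x; apply: is_derive_fst; case: (dg x).
by move=> x _; rewrite -(ug x); case: (enorm_coord (derive1 gamma x)).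
Qed.

Lemma arclength_lip2 s t : `|(gamma s).2 - (gamma t).2| <= `|s - t|.
Proof.
have [_ dg _ ug _] := ag; rewrite -[X in _ <= X]mul1r.
apply: (@derive_lipschitz _ (fun t => (gamma t).2) (fun t => (derive1 gamma t).2)).
  by move=> x; apply: is_derive_snd; case: (dg x).
by move=> x _; rewrite -(ug x); case: (enorm_coord (derive1 gamma x)).
Qed.

Lemma arclength_bdry s : bdry Omega (gamma s).
Proof. by have [_ _ _ _ [_ _ <- _]] := ag; exists s. Qed.

Lemma arclength_reduce t : exists2 s, 0 <= s < l & gamma s = gamma t.
Proof.
have [l0 _ _ _ [per _ _ _]] := ag.
have pern (n : nat) s : gamma (s + n%:R * l) = gamma s.
  elim: n s => [|n IH] s; first by rewrite mul0r addr0.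
  by rewrite -natr1 mulrDl mul1r addrA per IH.
have perz (n : int) s : gamma (s + n%:~R * l) = gamma s.
  case: n => n; first exact: pern.
  by rewrite NegzE -[RHS](pern n.+1) mulrNz mulNr -[in LHS](pern n.+1 (s - _)) subrK.
exists (t - (Num.floor (t / l))%:~R * l); last by rewrite -mulNr -mulrNz perz.
have := floor_itv (t / l); rewrite rmorphD/= => /andP[f1 f2].
rewrite ler_pdivlMr// in f1; rewrite ltr_pdivrMr// in f2.
by rewrite subr_ge0 f1/= ltrBlDl -[X in _ + X]mul1r -mulrDl.
Qed.

Lemma bdry_arclength z : bdry Omega z -> exists2 s, 0 <= s <= l & gamma s = z.
Proof.
have [_ _ _ _ [_ _ <- _]] := ag => -[t _ <-].
by have [s /andP[s0 sl] e] := arclength_reduce t; exists s; rewrite ?s0 ?ltW.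
Qed.

Lemma farthest_point (p : R * R) : exists s0,
  (forall s, ((gamma s).1 - p.1) ^+ 2 + ((gamma s).2 - p.2) ^+ 2 <=
     ((gamma s0).1 - p.1) ^+ 2 + ((gamma s0).2 - p.2) ^+ 2) /\
  exists t1 t2 k1 k2, [/\ derive1 gamma s0 = (t1, t2),
    (derive1 (derive1 gamma) s0).1 = k1, (derive1 (derive1 gamma) s0).2 = k2 &
    ((gamma s0).1 - p.1) * t1 + ((gamma s0).2 - p.2) * t2 = 0 /\
    1 + ((gamma s0).1 - p.1) * k1 + ((gamma s0).2 - p.2) * k2 <= 0].
Proof.
have [l0 dg _ ug _] := ag.
have [df dgg] := is_derive_sqr_norm p.1 p.2 (fun s => is_derive_fst (dg s).1) (fun s => is_derive_snd (dg s).1)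
  (fun s => is_derive_fst (dg s).2) (fun s => is_derive_snd (dg s).2).
have [s0 _ hs0] := EVT_max (ltW l0) (derivable_within_continuous (fun s (_ : s \in `[0, l]) =>
   let: DeriveDef d _ := df s in d)).
have fmax t : ((gamma t).1 - p.1) ^+ 2 + ((gamma t).2 - p.2) ^+ 2 <=
     ((gamma s0).1 - p.1) ^+ 2 + ((gamma s0).2 - p.2) ^+ 2.
  have [s /andP[s1 s2] <-] := arclength_reduce t.
  by apply: hs0; rewrite in_itv/= s1 ltW.
exists s0; split; first exact: fmax.
have [h1 h2] := second_derivative_at_max df (dgg s0) fmax.
have e := enorm1P (ug s0).
exists (derive1 gamma s0).1, (derive1 gamma s0).2, (derive1 (derive1 gamma) s0).1, (derive1 (derive1 gamma) s0).2.
split => //; first by case: (derive1 gamma s0).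
rewrite e in h2; split; last by rewrite -(pmulr_rle0 _ (ltr0n R 2)).
by move/eqP: h1; rewrite mulf_eq0 pnatr_eq0/= => /eqP.
Qed.

(* At a boundary point farthest from an interior point [p] the curvature is at least the inverse of the distance to [p]. *)
Lemma curvature_farthest r : open Omega -> Omega `<=` square_box r -> Omega !=set0 ->
  exists s, (4 * r)^-1 <= dotp (derive1 (derive1 gamma) s) (rot90 (derive1 gamma s)).
Proof.
move=> oO bO [p Op].
have [l0 dg _ ug [per _ rg left]] := ag.
have [s0 [fmax [t1 [t2 [k1 [k2 [e1 e2 e3 [tg k0]]]]]]]] := farthest_point p.
have tt : t1 ^+ 2 + t2 ^+ 2 = 1 by have := enorm1P (ug s0); rewrite e1.
have [c [xc yc hK]] := frame_coordinates tt tg k0.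
have gE : gamma s0 = (p.1 - c * t2, p.2 + c * t1).
  by apply: pair_equal_spec_coord; [move: xc; lra|move: yc; lra].
have fc : ((gamma s0).1 - p.1) ^+ 2 + ((gamma s0).2 - p.2) ^+ 2 = c ^+ 2.
  by rewrite xc yc -[RHS]mulr1 -tt; ring.
have [p1b p2b] : - r <= p.1 <= r /\ - r <= p.2 <= r.
  by have [] := bO _ Op; rewrite /= !in_itv/=.
have r0 : 0 <= r by lra.
(* A point of the square at signed distance M from p along the normal line: both coordinates differ
   from those of p by at most 2r. *)
have bound M : `|p.1 - M * t2| <= r -> `|p.2 + M * t1| <= r -> M ^+ 2 <= 8 * r ^+ 2.
  rewrite !ler_norml => /andP[b1 b2] /andP[b3 b4].
  have h1 : (M * t2) ^+ 2 <= (2 * r) ^+ 2.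
    by rewrite -[X in X <= _]real_normK ?num_real// lerXn2r ?nnegrE ?mulr_ge0// ler_norml; apply/andP; split; lra.
  have h2 : (M * t1) ^+ 2 <= (2 * r) ^+ 2.
    by rewrite -[X in X <= _]real_normK ?num_real// lerXn2r ?nnegrE ?mulr_ge0// ler_norml; apply/andP; split; lra.
  have h3 : (M * t2) ^+ 2 + (M * t1) ^+ 2 = M ^+ 2 by rewrite -[RHS]mulr1 -tt; ring.
  by rewrite -h3; lra.
have rE : rot90 (derive1 gamma s0) = (- t2, t1) by rewrite e1.
(* If c >= 0, the left normal at the farthest point leads away from p. Omega lies on the left, so
   the line enters Omega beyond that point and must leave it again through a boundary point still
   farther from p. *)
have cneg : c < 0.
  rewrite ltNge; apply/negP => c0.
  have [e /= e0 he] := left s0.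
  pose tt0 := e / 2.
  have tt0p : 0 < tt0 by rewrite divr_gt0.
  have Oq : Omega (gamma s0 + tt0 *: rot90 (derive1 gamma s0)).
    by apply: he => //=; rewrite sub0r normrN gtr0_norm// /tt0; lra.
  rewrite rE gE in Oq.
  (* A length by which the normal line has certainly left the square containing Omega. *)
  pose w := 4 * r + 1; pose v : R * R := w *: (- t2, t1).
  have lineE M N : (p.1 - M * t2, p.2 + M * t1) + N *: (- t2, t1) = (p.1 - (M + N) * t2, p.2 + (M + N) * t1).
    by congr pair; rewrite /= /GRing.scale/=; ring.
  rewrite lineE in Oq.
  have nO : ~ Omega ((p.1 - (c + tt0) * t2, p.2 + (c + tt0) * t1) + v).
    rewrite lineE => /bO[]; rewrite /= !in_itv/= -!ler_norml => b1 b2.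
    have := bound _ b1 b2; rewrite /w; nra.
  have [tau /andP[tau0 tau1] ba] := exit_point oO Oq nO.
  have [s _ es] : range gamma ((p.1 - (c + tt0) * t2, p.2 + (c + tt0) * t1) + tau *: v) by rewrite rg.
  have := fmax s; rewrite fc es /v scalerA lineE /= leNgt => /negP; apply.
  set M := c + tt0 + tau * w.
  rewrite (_ : _ + _ = M ^+ 2 * (t1 ^+ 2 + t2 ^+ 2)); last by ring.
  have : 0 < tau * w by rewrite mulr_gt0// /w; lra.
  by rewrite tt mulr1 /M; nra.
exists s0; rewrite /dotp rE e2 e3 /=.
set K := _ + _ in hK *.
have cr : - c <= 4 * r.
  have [cl _] := (bdry_open (gamma s0) oO).1 (arclength_bdry s0).
  have [] := closure_square_box bO cl; rewrite /= !in_itv/= gE/= -!ler_norml => b1 b2.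
  have := bound _ b1 b2; nra.
have c0 : 0 < - c by rewrite oppr_gt0.
have Kc : (- c)^-1 <= K.
  by rewrite -[X in X <= _]mul1r ler_pdivrMr// mulrN; lra.
by apply: le_trans Kc; rewrite lef_pV2// posrE; lra.
Qed.

End arclength.

Lemma bd_param_spec Omega : C2_boundary Omega ->
  arclength_param Omega (bd_curve Omega) (bd_length Omega).
Proof.
move=> [gamma [l h]]; have : [set p | arclength_param Omega p.1 p.2] !=set0 by exists (gamma, l).
by move=> /(xgetPex ((fun=> 0), 0)).
Qed.

Lemma eps_bound Omega r (eps : R) : open Omega -> Omega `<=` square_box r -> 0 < r -> Omega !=set0 ->
  C2_boundary Omega -> 0 < eps -> (forall s, curvature Omega s <= eps `^ (- 2^-1)) ->
  eps <= 16 * r ^+ 2.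
Proof.
move=> oO bO r0 O0 /bd_param_spec ag e0 hk.
have [s hs] := curvature_farthest ag oO bO O0.
have := le_trans hs (hk s).
rewrite powRN powR12_sqrt; last exact: ltW.
rewrite lef_pV2 ?posrE ?sqrtr_gt0// ?mulr_gt0// => h.
rewrite -[eps]sqr_sqrtr; last exact: ltW.
have -> : 16 * r ^+ 2 = (4 * r) ^+ 2 by ring.
by rewrite lerXn2r ?nnegrE ?sqrtr_ge0// mulr_ge0// ltW.
Qed.

End parametrization.

(** * The distance to the boundary *)

Section distance.
Context {R : realType}.
Implicit Types (Omega : set (R * R)) (z w : R * R).

Lemma enormD z w : enorm (z + w) <= enorm z + enorm w.
Proof.
have h0 := enorm_ge0 z; have h1 := enorm_ge0 w.
have e1 := enorm_sqr z; have e2 := enorm_sqr w; have e3 := enorm_sqr (z + w).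
rewrite -ler_sqr ?nnegrE ?addr_ge0 ?enorm_ge0// e3 /=.
have key : z.1 * w.1 + z.2 * w.2 <= enorm z * enorm w.
  have [neg|pos] := leP (z.1 * w.1 + z.2 * w.2) 0; first by rewrite (le_trans neg)// mulr_ge0.
  rewrite -ler_sqr ?nnegrE ?mulr_ge0 ?(ltW pos)// exprMn e1 e2.
  by have := sqr_ge0 (z.1 * w.2 - z.2 * w.1); nra.
by move: key e1 e2; set a := enorm z; set b := enorm w; nra.
Qed.

Lemma enormZ (a : R) z : enorm (a *: z) = `|a| * enorm z.
Proof.
rewrite /enorm /dotp /= /GRing.scale/= -sqrtr_sqr -sqrtrM ?sqr_ge0//.
by congr Num.sqrt; ring.
Qed.

Lemma enormN z : enorm (- z) = enorm z.
Proof. by rewrite -scaleN1r enormZ normrN normr1 mul1r. Qed.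

Lemma enormB z w : enorm (z - w) = enorm (w - z).
Proof. by rewrite -enormN opprB. Qed.

Lemma enorm_basis2 i : enorm (basis2 i : R * R) = 1.
Proof.
by rewrite /enorm /dotp /basis2; case: ifP => _ /=; rewrite ?mulr1 ?mulr0 ?addr0 ?add0r sqrtr1.
Qed.

Lemma enorm_continuous : continuous (@enorm R).
Proof.
move=> z; apply: (continuous_comp (f := fun z : R * R => dotp z z) (g := Num.sqrt)); last exact: sqrt_continuous.
by apply: cvgD; apply: cvgM; first [exact: continuous_fst2|exact: continuous_snd2].
Qed.

Lemma cvgn_le (u : nat -> R) (a b : R) : u n @[n --> \oo] --> a -> (forall n, u n <= b) -> a <= b.
Proof.
move=> ua ub; exact: (ler_cvg_to ua (cvg_cst b) (nearW _ ub)).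
Qed.

Lemma affine_shift (V : lmodType R) (z w d : V) (t a b : R) : t * a + (1 - t) * b = 1 ->
  t *: (z + a *: d) + (1 - t) *: (w + b *: d) = t *: z + (1 - t) *: w + d.
Proof. by move=> h; rewrite !scalerDr !scalerA addrACA -scalerDl h scale1r. Qed.

Section omega.
Variables (Omega : set (R * R)) (r : R).
Hypotheses (oO : open Omega) (bO : Omega `<=` square_box r).
Hypothesis cO : convex_set (Omega : set (R * R)).
Hypothesis b0 : bdry Omega !=set0.

Let S z := [set enorm (z - w) | w in bdry Omega].
Let infS z : has_inf (S z).
Proof.
split; first by have [b hb] := b0; exists (enorm (z - b)), b.
by exists 0 => _ [w _ <-]; exact: enorm_ge0.
Qed.

Lemma dist_bdry_le z b : bdry Omega b -> dist_bdry Omega z <= enorm (z - b).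
Proof. by move=> hb; apply: ge_inf; [case: (infS z)|exists b]. Qed.

Lemma dist_bdry_ge z (d : R) : (forall b, bdry Omega b -> d <= enorm (z - b)) -> d <= dist_bdry Omega z.
Proof. by move=> h; apply: lb_le_inf; [case: (infS z)|move=> _ [b hb <-]; exact: h]. Qed.

Lemma dist_bdry_ge0 z : 0 <= dist_bdry Omega z.
Proof. by apply: dist_bdry_ge => b _; exact: enorm_ge0. Qed.

Lemma dist_bdry_lip z w : `|dist_bdry Omega z - dist_bdry Omega w| <= enorm (z - w).
Proof.
have h u v : dist_bdry Omega u - enorm (u - v) <= dist_bdry Omega v.
  apply: dist_bdry_ge => b hb; rewrite lerBlDl; apply: (le_trans (dist_bdry_le u hb)).
  by rewrite (_ : u - b = (u - v) + (v - b)); [exact: enormD|rewrite addrA subrK].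
rewrite ler_norml; apply/andP; split.
  by have := h w z; rewrite enormB; lra.
by have := h z w; lra.
Qed.

Lemma dist_bdry_continuous : continuous (dist_bdry Omega).
Proof.
move=> z; apply/cvgrPdist_le => e e0.
have : (enorm (z - w)) @[w --> z] --> (0 : R).
  have := @enorm_continuous (z - z); rewrite /continuous_at subrr => h.
  have -> : (0 : R) = enorm (0 : R * R).
    by rewrite /enorm /dotp /= mulr0 addr0 sqrtr0.
  apply: (cvg_comp (fun w => z - w) (@enorm R) _ h).
  have : (z - w) @[w --> z] --> z - z by apply: cvgB; [exact: cvg_cst|exact: cvg_id].
  by rewrite subrr.
move=> /cvgrPdist_le/(_ e e0); apply: filterS => w; rewrite sub0r normrN.
by rewrite ger0_norm ?enorm_ge0// => /(le_trans (dist_bdry_lip _ _)).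
Qed.

Lemma dist_bdry_locally_lipschitz i : locally_lipschitz i (dist_bdry Omega).
Proof.
move=> s; exists 1 => // z _ t /andP[t0 _]; apply: (le_trans (dist_bdry_lip _ _)).
by rewrite addrK enormZ enorm_basis2 mulr1 mul1r gtr0_norm.
Qed.

(** A segment from z to a point outside Omega meets the boundary, at distance at most its length. *)
Lemma dist_bdry_ball z q : Omega z -> enorm (q - z) < dist_bdry Omega z -> Omega q.
Proof.
move=> Oz qz; apply: contrapT => nq.
have [|t /andP[t0 t1] hb] := @exit_point R Omega z (q - z) oO Oz.
  by rewrite addrC subrK.
have := dist_bdry_le z hb; rewrite opprD addrA subrr sub0r enormN enormZ gtr0_norm//.
have := enorm_ge0 (q - z); nra.
Qed.

Lemma convex_segment z w (t : R) : Omega z -> Omega w -> 0 <= t <= 1 ->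
  Omega (t *: z + (1 - t) *: w).
Proof.
move=> Oz Ow /andP[t0 t1].
by have /set_mem := @cO z w (Itv01 t0 t1) (mem_set Oz) (mem_set Ow).
Qed.

(** Suppose that a boundary point b is nearer to x than the convex combination rho of the two
    distances. The displacement b - x, rescaled by the distance of z, respectively w, over rho,
    stays in the inner ball around that point; the convex combination of the two displaced points is
    b, which would lie in Omega. *)
Lemma dist_bdry_concave z w (t : R) : Omega z -> Omega w -> 0 <= t <= 1 ->
  t * dist_bdry Omega z + (1 - t) * dist_bdry Omega w <=
  dist_bdry Omega (t *: z + (1 - t) *: w).
Proof.
move=> Oz Ow /andP[t0 t1]; set x := t *: z + _.
apply: dist_bdry_ge => b hb; rewrite leNgt; apply/negP => hlt.
set rho := t * dist_bdry Omega z + (1 - t) * dist_bdry Omega w in hlt; have rho0 : 0 < rho by rewrite (le_lt_trans _ hlt)// enorm_ge0.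
pose d := b - x; have dr : enorm d < rho by rewrite /d enormB.
(* When the distance of u is 0 the displacement is 0, and the strict inequality required by
   [dist_bdry_ball] is bypassed. *)
have sub u : Omega u -> Omega (u + (dist_bdry Omega u / rho) *: d).
  move=> Ou; have [->|nz] := eqVneq (dist_bdry Omega u) 0; first by rewrite mul0r scale0r addr0.
  have up : 0 < dist_bdry Omega u by rewrite lt_neqAle eq_sym nz dist_bdry_ge0.
  apply: (dist_bdry_ball Ou); rewrite addrAC subrr add0r enormZ ger0_norm; last first.
    by rewrite divr_ge0// ltW.
  rewrite -[X in _ < X]mulr1 -mulrA ltr_pM2l//.
  by rewrite mulrC ltr_pdivrMr// mul1r.
have := convex_segment (sub z Oz) (sub w Ow) (t := t); rewrite t0 t1 => /(_ isT).
suff -> : t *: (z + (dist_bdry Omega z / rho) *: d) + (1 - t) *: (w + (dist_bdry Omega w / rho) *: d) = b.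
  by move: hb => /(bdry_open _ oO)[].
apply: etrans; first apply: affine_shift.
  by rewrite !mulrA -mulrDl -/rho divff// gt_eqF.
by rewrite /d -/x addrC subrK.
Qed.

(* The distance to the boundary is concave on a convex domain, so its difference quotients are monotone. *)
Lemma dist_quotient_cvg i z : Omega z ->
  cvgn (fun n => n.+1%:R * (dist_bdry Omega (n.+1%:R^-1 *: basis2 i + z) - dist_bdry Omega z)).
Proof.
move=> Oz; set a := fun n : nat => _.
have a1 n : `|a n| <= 1.
  rewrite /a normrM ger0_norm// mulrC -ler_pdivlMr ?ltr0n// mul1r.
  by apply: (le_trans (dist_bdry_lip _ _)); rewrite addrK enormZ enorm_basis2 mulr1 ger0_norm// invr_ge0.
(* Concavity is available inside Omega only, so monotonicity holds from the index at which the
   displaced points are in Omega. *)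
have [N hN] : exists N, forall n, (N <= n)%N -> Omega (n.+1%:R^-1 *: basis2 i + z).
  have : (n.+1%:R^-1 *: basis2 i + z) @[n --> \oo] --> z.
    rewrite -[X in _ --> X]add0r; apply: cvgD; last exact: cvg_cst.
    rewrite -[X in _ --> X](scale0r (basis2 i)); apply: cvgZr_tmp.
    exact: cvg_harmonic.
  by move=> /(_ Omega (open_nbhs_nbhs (conj oO Oz)))[N _ hN]; exists N.
apply/(cvg_ex); suff : cvgn (fun n => a (n + N)%N).
  by move=> /cvg_ex[l hl]; exists l; rewrite -(cvg_shiftn N).
apply: nondecreasing_is_cvgn; last first.
  by exists 1 => _ [n _ <-]; rewrite (le_trans (ler_norm _)).
apply/nondecreasing_seqP => n; rewrite /a addSn; set m := (n + N)%N.
pose k : R := m.+1%:R^-1; pose h : R := m.+2%:R^-1.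
have k0 : 0 < k by rewrite invr_gt0. have h0 : 0 < h by rewrite invr_gt0.
have hk : h <= k by rewrite lef_pV2 ?posrE// ler_nat.
(* The point at step h is the convex combination, with weight h / k, of the point at step k and
   z. *)
have t01 : 0 <= h / k <= 1
  by apply/andP; split; [apply: divr_ge0; exact: ltW|rewrite ler_pdivrMr// mul1r].
have := dist_bdry_concave (hN m (leq_addl _ _)) Oz t01.
rewrite (_ : _ *: _ + _ = h *: basis2 i + z); last first.
  rewrite scalerDr scalerA -/k divfK ?gt_eqF// -addrA -scalerDl.
  by rewrite (_ : h / k + _ = 1) ?scale1r//; ring.
rewrite -/k -/h => hc.
have -> : (m.+1%:R : R) = k^-1 by rewrite invrK.
have -> : (m.+2%:R : R) = h^-1 by rewrite invrK.
move: hc; set A := dist_bdry _ _; set B := dist_bdry Omega z; set C := dist_bdry _ _.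
have -> : h / k * A + (1 - h / k) * B = B + h * (k^-1 * (A - B)) by ring.
by move=> h1; rewrite [leRHS]mulrC ler_pdivlMr// mulrC lerBrDl.
Qed.

(** The pointwise limit of the quotients is kept in the conclusion: on the disc it identifies g off
    the centre as minus the radial unit field. *)
Lemma dist_bdry_weak_pderiv : exists g : 'I_2 -> R * R -> R, forall i,
  [/\ is_weak_pderiv Omega i (dist_bdry Omega) (g i),
    (forall z, Omega z -> `|g i z| <= 1) &
    forall z, Omega z -> n.+1%:R * (dist_bdry Omega (n.+1%:R^-1 *: basis2 i + z) - dist_bdry Omega z)
      @[n --> \oo] --> g i z].
Proof.
pose q i n z := n.+1%:R * (dist_bdry Omega (n.+1%:R^-1 *: basis2 i + z) - dist_bdry Omega z).
have q1 i n z : `|q i n z| <= 1.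
  rewrite /q normrM ger0_norm// mulrC -ler_pdivlMr ?ltr0n// mul1r.
  by apply: (le_trans (dist_bdry_lip _ _)); rewrite addrK enormZ enorm_basis2 mulr1 ger0_norm// invr_ge0.
exists (fun i z => limn (fun n => q i n z)) => i.
have lq z : Omega z -> q i n z @[n --> \oo] --> limn (fun n => q i n z).
  by move=> Oz; have := @dist_quotient_cvg i z Oz.
have b1 z : Omega z -> `|limn (fun n => q i n z)| <= 1.
  move=> Oz; have h : `|q i n z| @[n --> \oo] --> `|limn (fun n => q i n z)| by exact: cvg_norm (lq z Oz).
  exact: cvgn_le h _.
split => //.
apply: (weak_pderiv_difference_quotient oO bO) => //.
- exact: dist_bdry_continuous.
- exact: dist_bdry_locally_lipschitz.
apply: (sqint_bounded (domain_measurable oO) (domain_finite oO bO)) b1.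
apply: (@intg_meas _ _ _ leb2 (Omega : set (plane R))).
apply: (Rint_dct (domain_measurable oO) (F := q i) (G := fun=> 1) _ lq _ _).1 => //; last first.
  by apply: (intg_bounded (domain_measurable oO) (domain_finite oO bO) (M := 1)) => // z _; rewrite normr1.
move=> n; suff cq : continuous (q i n) by have [] := continuous_sqint oO bO cq.
move=> z; apply: cvgM; first exact: cvg_cst.
apply: cvgB; last exact: dist_bdry_continuous.
exact: (@shift_continuous _ (n.+1%:R^-1 *: basis2 i) (dist_bdry Omega) dist_bdry_continuous z).
Qed.

End omega.
End distance.

(** * Fourth powers under convergence in L^2 *)

Section truncation.
Context {R : realType}.
Implicit Types M N x : R.

Definition trunc M x : R := Num.max (- M) (Num.min x M).

Lemma truncE M x : 0 <= M ->
  [\/ x < - M /\ trunc M x = - M, M < x /\ trunc M x = M | (- M <= x <= M) /\ trunc M x = x].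
Proof.
move=> M0; rewrite /trunc; have [h1|h1] := leP x M; last first.
  by apply: Or32; split => //; rewrite max_r//; lra.
have [h2|h2] := leP (- M) x; last by apply: Or31; split => //; rewrite max_l// ltW.
by apply: Or33.
Qed.

Lemma trunc_bound M x : 0 <= M -> `|trunc M x| <= M.
Proof. by move=> M0; have [[_ ->]|[_ ->]|[h ->]] := truncE x M0; [rewrite normrN ger0_norm|rewrite ger0_norm|rewrite ler_norml]. Qed.

Lemma trunc_id M x : `|x| <= M -> trunc M x = x.
Proof.
move=> h; have M0 := le_trans (normr_ge0 x) h; move: h; rewrite ler_norml => /andP[h1 h2].
by have [[? _]|[? _]|[_ ->]] := truncE x M0 => //; lra.
Qed.

Lemma trunc_pow4 M x : 0 <= M -> trunc M x ^+ 4 <= x * trunc M x ^+ 3.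
Proof.
move=> M0; have [[h ->]|[h ->]|[h ->]] := truncE x M0; rewrite exprS//; last first.
  by rewrite ler_wpM2r ?exprn_ge0// ltW.
have : 0 <= M ^+ 3 by exact: exprn_ge0.
by rewrite (_ : (- M) ^+ 3 = - M ^+ 3); [move: (M ^+ 3) => y; nra|ring].
Qed.

Lemma trunc_mono M N x : 0 <= M -> M <= N -> trunc M x ^+ 2 <= trunc N x ^+ 2.
Proof.
move=> M0 MN; have N0 := le_trans M0 MN.
by have [[h ->]|[h ->]|[h ->]] := truncE x M0; have [[h' ->]|[h' ->]|[h' ->]] := truncE x N0; nra.
Qed.
End truncation.

Section limits.
Context d (T : measurableType d) (R : realType).
Variables (mu : {measure set T -> \bar R}) (D : set T).
Hypothesis mD : measurable D.
Local Notation I := (Rintegral mu D).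

Lemma cvg2_sqr (F : nat -> T -> R) f : (forall n, sqint mu D (F n)) -> sqint mu D f -> cvg2 mu D F f ->
  I (fun z => F n z ^+ 2) @[n --> \oo] --> I (fun z => f z ^+ 2).
Proof.
move=> F2 f2 Ff; have h := cvg2_mul mD F2 f2 f2 Ff.
have -> : (fun n => I (fun z => F n z ^+ 2)) =
    fun n => I (fun z => (F n z - f z) ^+ 2) + 2 * I (fun z => F n z * f z) - I (fun z => f z ^+ 2).
  apply/funext => n; have [_ i1] := sqintB mD (F2 n) f2; have i2 := sqint_mul mD (F2 n) f2.
  rewrite -(RintZ mD 2 i2) -(RintD mD i1 (intgZ mD 2 i2)).
  rewrite -(RintB mD (intgD mD i1 (intgZ mD 2 i2)) f2.2).
  by apply: eq_Rint => z _; ring.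
rewrite [X in _ --> X](_ : I (fun z => f z ^+ 2) = 0 + 2 * I (fun z => f z * f z) - I (fun z => f z ^+ 2)); last first.
  rewrite add0r (_ : I (fun z => f z * f z) = I (fun z => f z ^+ 2)); first by ring.
  by apply: eq_Rint => z _; rewrite expr2.
apply: cvgB; [apply: cvgD => //|exact: cvg_cst].
by apply: cvgM => //; exact: cvg_cst.
Qed.

(** A uniform bound on fourth powers passes to an L^2 limit without extracting an almost everywhere
    convergent subsequence: the limit is truncated at height m, the convexity of x^4 gives a lower
    bound linear in [F n], in which n tends to infinity, and monotone convergence then removes the
    truncation. *)
Lemma cvg2_pow4 (F : nat -> T -> R) f (K : R) : (mu D < +oo)%E ->
  (forall n, sqint mu D (F n)) -> (forall n, sqint mu D (fun z => F n z ^+ 2)) ->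
  sqint mu D f -> cvg2 mu D F f ->
  (forall n, I (fun z => F n z ^+ 4) <= K) -> sqint mu D (fun z => f z ^+ 2).
Proof.
move=> muD F2 F4 f2 Ff FK; have mf : measurable_fun D f by case: f2.
pose a (m : nat) z := trunc m%:R (f z).
have n0 (m : nat) : 0 <= m%:R :> R by [].
have ma m : measurable_fun D (a m).
  apply: measurable_maxr; first exact: measurable_cst.
  by apply: measurable_minr => //; exact: measurable_cst.
have am m z : `|a m z| <= m%:R by exact: trunc_bound.
have bnd k m : intg mu D (fun z => a m z ^+ k).
  apply: (intg_bounded mD muD (M := m%:R ^+ k)); first exact: measurable_funX.
  by move=> z _; rewrite normrX lerXn2r ?nnegrE.
have a3 m : sqint mu D (fun z => a m z ^+ 3).
  apply: (sqint_bounded mD muD (M := m%:R ^+ 3)); first exact: measurable_funX.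
  by move=> z _; rewrite normrX lerXn2r ?nnegrE.
have key m : I (fun z => a m z ^+ 4) <= K.
  (* The tangent inequality c^4 >= b^4 + 4 b^3 (c - b), with b the truncated limit and c = [F n z],
     integrated. *)
  have step n : I (fun z => a m z ^+ 4) + 4 * I (fun z => F n z * a m z ^+ 3)
      - 4 * I (fun z => a m z ^+ 4) <= K.
    apply: le_trans (FK n).
    have i4 := bnd 4%N m; have i3 := sqint_mul mD (F2 n) (a3 m).
    rewrite -(RintZ mD 4 i3) -(RintZ mD 4 i4) -(RintD mD i4 (intgZ mD 4 i3)).
    rewrite -(RintB mD (intgD mD i4 (intgZ mD 4 i3)) (intgZ mD 4 i4)).
    apply: le_Rint => //; first by apply: intgB => //; [apply: intgD => //|]; exact: intgZ.
      have [_] := F4 n; apply: eq_intg => // z _; by ring.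
    move=> z _; set b := a m z; set c := F n z; rewrite -subr_ge0.
    rewrite (_ : _ - _ = (c - b) ^+ 2 * ((c + b) ^+ 2 + 2 * b ^+ 2)); last by ring.
    by apply: mulr_ge0; [exact: sqr_ge0|apply: addr_ge0; [exact: sqr_ge0|apply: mulr_ge0 => //; exact: sqr_ge0]].
  have lim : I (fun z => a m z ^+ 4) + 4 * I (fun z => f z * a m z ^+ 3) - 4 * I (fun z => a m z ^+ 4) <= K.
    apply: (cvgn_le _ step); apply: cvgB; last exact: cvg_cst.
    apply: cvgD; first exact: cvg_cst.
    by apply: cvgM; [exact: cvg_cst|exact: cvg2_mul].
  apply: le_trans lim.
  have h : I (fun z => a m z ^+ 4) <= I (fun z => f z * a m z ^+ 3).
    apply: le_Rint => //; first exact: sqint_mul.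
    by move=> z _; exact: trunc_pow4.
  lra.
have a4 z : (a m z ^+ 4)%:E @[m --> \oo] --> (f z ^+ 4)%:E.
  apply: cvg_EFin; first exact: nearW.
  apply: (cvg_near_cst); near=> m.
  rewrite /= /a trunc_id//; near: m; exact: nbhs_infty_ger.
apply: (sqintP _ mD _).2; split; first exact: measurable_funX.
have mono z : {homo (fun m => (a m z ^+ 4)%:E) : m n / (m <= n)%N >-> (m <= n)%E}.
  move=> m n mn; rewrite lee_fin !(exprM _ 2 2) lerXn2r ?nnegrE ?sqr_ge0//.
  by apply: trunc_mono; rewrite ?ler_nat.
have /(_ _ _ _) h := @cvg_monotone_convergence _ _ _ mu D mD (fun m z => (a m z ^+ 4)%:E).
have {}h := h _ _ (fun z _ => mono z).
apply: (@le_lt_trans _ _ K%:E); last exact: ltry.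
rewrite (_ : (\int[mu]_(z in D) ((f z ^+ 2) ^+ 2)%:E = \int[mu]_(x in D) (limn (fun m => (a m x ^+ 4)%:E)))%E); last first.
  apply: eq_integral => z _; rewrite -exprM; apply/esym/cvg_lim => //; exact: a4.
apply: cvge_le (h _ _); last 2 first.
- by move=> m; apply/measurable_EFinP; exact: measurable_funX.
- by move=> m z _; rewrite lee_fin (exprM _ 2 2) sqr_ge0.
by apply: nearW => m; rewrite (intgE mD (bnd 4%N m)) lee_fin.
Unshelve. all: end_near. Qed.
End limits.

(** * Inequalities for functions with a trace *)

Section domain.
Context {R : realType}.
Variables (Omega : set (R * R)) (r : R).
Hypotheses (oO : open Omega) (r0 : 0 < r) (bO : Omega `<=` square_box r).
Hypothesis C2 : C2_boundary Omega.

Local Notation mu := (@leb2 R).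
Local Notation I := (Rintegral mu (Omega : set (plane R))).
Local Notation B := (bd_set Omega).
Local Notation Bd := (Rintegral (@lebesgue_measure R) B).
Let mOm : measurable (Omega : set (plane R)) := domain_measurable oO.
Let Oly : (mu (Omega : set (plane R)) < +oo)%E := domain_finite oO bO.
Let ag := bd_param_spec C2.
Let l0 : 0 < bd_length Omega. Proof. by case: ag. Qed.

Lemma bd_curve_continuous : continuous (bd_curve Omega).
Proof. exact: arclength_continuous ag. Qed.

Let pc phi : smooth phi -> I (fun z => phi z ^+ 2) <=
  8 * r * Bd (fun s => phi (bd_curve Omega s) ^+ 2) + 16 * r ^+ 2 * I (fun z => pderiv ord0 phi z ^+ 2).
Proof.
exact: (poincare_trace oO r0 bO l0 bd_curve_continuous (arclength_lip1 ag) (arclength_lip2 ag)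
  (arclength_bdry ag) (bdry_arclength ag)).
Qed.

Let lc phi : smooth phi -> I (fun z => phi z ^+ 4) <=
   (2 * Bd (fun s => phi (bd_curve Omega s) ^+ 2) + 2 * r + I (fun z => `|2 * phi z * pderiv ord0 phi z|)) *
   (2 * Bd (fun s => phi (bd_curve Omega s) ^+ 2) + 2 * r + I (fun z => `|2 * phi z * pderiv ord_max phi z|)).
Proof.
exact: (ladyzhenskaya_trace oO r0 bO l0 bd_curve_continuous (arclength_lip1 ag) (arclength_lip2 ag)
  (arclength_bdry ag) (bdry_arclength ag)).
Qed.

Section approximated.
Variables (v : R * R -> R) (w : 'I_2 -> R * R -> R) (g : R -> R).
Hypotheses (v2 : L2 Omega v) (vw : forall i, is_weak_pderiv Omega i v (w i)).
Hypothesis tv : has_trace Omega v g.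

Let v2' : sqint mu (Omega : set (plane R)) v := (L2P oO v).1 v2.
Let w2 i : sqint mu (Omega : set (plane R)) (w i).
Proof. by apply/(L2P oO); have [] := vw i. Qed.

Lemma poincare : I (fun z => v z ^+ 2) <=
  8 * r * Bd (fun s => g s ^+ 2) + 16 * r ^+ 2 * I (fun z => w ord0 z ^+ 2).
Proof.
have [g2 [phi [sphi c1 c2 c3]]] := trace_approximation oO bO bd_curve_continuous v2 vw tv.
have p2 n := continuous_sqint oO bO (smooth_continuous (sphi n)).
have d2 n := continuous_sqint oO bO (smooth_continuous (smooth_pderiv ord0 (sphi n))).
have b2 n := curve_sqint (bd_length Omega) (smooth_continuous (sphi n)) bd_curve_continuous.
have h1 := cvg2_sqr mOm p2 v2' c1.
have h2 := cvg2_sqr mOm d2 (w2 ord0) (c2 ord0).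
have h3 := cvg2_sqr (bd_set_measurable Omega) b2 g2 c3.
apply: (ler_cvg_to h1 _ (nearW _ (fun n => pc (sphi n)))).
by apply: cvgD; apply: cvgM => //; exact: cvg_cst.
Qed.

(** Applied to the components of grad u, this makes |grad u|^2 square integrable, so that the well
    term of the energy is finite on [Lambda]. The L^4 bound for smooth functions is uniform along an
    approximating sequence and passes to the limit. *)
Lemma trace_pow4 : sqint mu (Omega : set (plane R)) (fun z => v z ^+ 2).
Proof.
have [g2 [phi [sphi c1 c2 c3]]] := trace_approximation oO bO bd_curve_continuous v2 vw tv.
have p2 n := continuous_sqint oO bO (smooth_continuous (sphi n)).
have d2 i n := continuous_sqint oO bO (smooth_continuous (smooth_pderiv i (sphi n))).
have b2 n := curve_sqint (bd_length Omega) (smooth_continuous (sphi n)) bd_curve_continuous.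
have h1 := cvg2_sqr mOm p2 v2' c1.
have h2 i := cvg2_sqr mOm (d2 i) (w2 i) (c2 i).
have h3 := cvg2_sqr (bd_set_measurable Omega) b2 g2 c3.
(* All quantities on the right of the L^4 inequality are bounded along the sequence because they
   converge. *)
have bnd (a : nat -> R) (x : R) : a n @[n --> \oo] --> x -> exists M, forall n, a n <= M.
  move=> /cvgP/cvg_seq_bounded[M [_ hM]]; exists (M + 1) => n.
  by apply: le_trans (ler_norm _) _; apply: hM => //; rewrite ltrDl.
have [M1 hM1] := bnd _ _ h1; have [M3 hM3] := bnd _ _ h3.
have [Ma hMa] := bnd _ _ (h2 ord0); have [Mb hMb] := bnd _ _ (h2 ord_max).
apply: (cvg2_pow4 mOm Oly p2 _ v2' c1 (K := (2 * M3 + 2 * r + (M1 + Ma)) * (2 * M3 + 2 * r + (M1 + Mb)))).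
  move=> n; apply: (continuous_sqint oO bO (f := fun z => phi n z ^+ 2)) => z.
  by apply: cvgM; exact: smooth_continuous (sphi n) z.
have prod i n : I (fun z => `|2 * phi n z * pderiv i (phi n) z|) <=
    I (fun z => phi n z ^+ 2) + I (fun z => pderiv i (phi n) z ^+ 2).
  rewrite -(RintD mOm (p2 n).2 (d2 i n).2); apply: (le_Rint mOm).
  - apply: intg_norm; apply: (eq_intg mOm (f := fun z => 2 * (phi n z * pderiv i (phi n) z))).
      by move=> z _; ring.
    by apply: (intgZ mOm); apply: (sqint_mul mOm).
  - exact: (intgD mOm (p2 n).2 (d2 i n).2).
  move=> z _; move: (phi n z) (pderiv _ _ _) => a b; rewrite ler_norml; apply/andP; split.
    by have := sqr_ge0 (a + b); nra.
  by have := sqr_ge0 (a - b); nra.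
move=> n; apply: (le_trans (lc (sphi n))).
have B0 : 0 <= Bd (fun s => phi n (bd_curve Omega s) ^+ 2) by apply: Rint_ge0 => s _; exact: sqr_ge0.
have P0 i : 0 <= I (fun z => `|2 * phi n z * pderiv i (phi n) z|) by apply: Rint_ge0.
apply: ler_pM.
- by rewrite !addr_ge0// ?mulr_ge0// ltW.
- by rewrite !addr_ge0// ?mulr_ge0// ltW.
- by apply: lerD; [rewrite lerD2r ler_wpM2l|apply: (le_trans (prod _ n)); apply: lerD].
- by apply: lerD; [rewrite lerD2r ler_wpM2l|apply: (le_trans (prod _ n)); apply: lerD].
Qed.
End approximated.

End domain.

(** * Energy bounds for minimisers *)

Lemma sum3_bound (R : realDomainType) (s0 s1 s2 a0 a1 a2 b0 b1 b2 X A : R) :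
  s0 <= 2 * a0 + 2 * b0 -> s1 <= 2 * a1 + 2 * b1 -> s2 <= 2 * a2 + 2 * b2 ->
  a0 <= X -> a1 <= A -> a2 <= A ->
  s0 + s1 + s2 <= 2 * (X + (A + A)) + 2 * (b0 + (b1 + b2)).
Proof. lra. Qed.

Lemma energy_compare (R : realType) (e wu wv hu hv : R) : 0 < e -> 0 <= hu ->
  e^-1 * wu + e * hu <= e^-1 * wv + e * hv -> wu <= wv + e ^+ 2 * hv.
Proof.
move=> e0 h0; rewrite -(ler_pM2l e0) !mulrDr !mulrA divff ?gt_eqF// !mul1r expr2 -!mulrA => h.
have : 0 <= e * (e * hu) by rewrite mulr_ge0 ?mulr_ge0 ?(ltW e0).
by lra.
Qed.

Section energy.
Context {R : realType}.
Variables (Omega : set (R * R)) (r : R).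
Hypotheses (oO : open Omega) (r0 : 0 < r) (bO : Omega `<=` square_box r).
Hypothesis C2 : C2_boundary Omega.

Local Notation mu := (@leb2 R).
Local Notation I := (Rintegral mu (Omega : set (plane R))).
Let mOm : measurable (Omega : set (plane R)) := domain_measurable oO.
Let Oly : (mu (Omega : set (plane R)) < +oo)%E := domain_finite oO bO.

Section admissible.
Variable u : R * R -> R.
Hypothesis Lu : Lambda Omega u.
Local Notation w := (fun i => wpderiv Omega i u).
Local Notation h := (fun i j => wpderiv Omega j (wpderiv Omega i u)).

Lemma Lambda_W12 : W12 Omega u. Proof. by have [[]] := Lu. Qed.

Lemma Lambda_L2 : L2 Omega u. Proof. by have [] := Lambda_W12. Qed.

Lemma Lambda_weak i : is_weak_pderiv Omega i u (w i).
Proof. exact: is_weak_wpderiv Lambda_W12. Qed.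

Lemma Lambda_grad_L2 i : L2 Omega (w i). Proof. by have [] := Lambda_weak i. Qed.

Lemma Lambda_weak2 i j : is_weak_pderiv Omega j (w i) (h i j).
Proof. by apply: is_weak_wpderiv; have [[_]] := Lu. Qed.

Lemma Lambda_grad_sqint i : sqint mu (Omega : set (plane R)) (w i).
Proof. exact/(L2P oO)/Lambda_grad_L2. Qed.

Lemma Lambda_hess_sqint i j : sqint mu (Omega : set (plane R)) (h i j).
Proof. by apply/(L2P oO); have [] := Lambda_weak2 i j. Qed.

Lemma Lambda_grad_sqr_sqint i : sqint mu (Omega : set (plane R)) (fun z => w i z ^+ 2).
Proof.
have [_ _ [g [tg _]]] := Lu.
exact: (trace_pow4 oO r0 bO C2 (Lambda_grad_L2 i) (Lambda_weak2 i) (tg i)).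
Qed.

Definition well_energy := I (fun z => (1 - wgrad_sq Omega u z) ^+ 2).
Definition hess_energy := I (fun z => whess_sq Omega u z).

Lemma well_sqint : sqint mu (Omega : set (plane R)) (fun z => 1 - wgrad_sq Omega u z).
Proof.
apply: (sqintB mOm).
  by apply: (sqint_bounded mOm Oly (M := 1)) => // z _; rewrite normr1.
apply: (eq_sqint mOm (f := fun z => w ord0 z ^+ 2 + w ord_max z ^+ 2)).
  by move=> z _; rewrite /wgrad_sq sum2.
exact: (sqintD mOm (Lambda_grad_sqr_sqint _) (Lambda_grad_sqr_sqint _)).
Qed.

Lemma whess_sqE z : whess_sq Omega u z =
  h ord0 ord0 z ^+ 2 + h ord0 ord_max z ^+ 2 + (h ord_max ord0 z ^+ 2 + h ord_max ord_max z ^+ 2).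
Proof. rewrite /whess_sq sum2; congr (_ + _); exact: sum2. Qed.

Lemma whess_intg : intg mu (Omega : set (plane R)) (fun z => whess_sq Omega u z).
Proof.
have hh i j := (Lambda_hess_sqint i j).2.
apply: (eq_intg mOm (fun z _ => esym (whess_sqE z))).
by apply: (intgD mOm); apply: (intgD mOm).
Qed.

(** Both terms are integrable for an admissible function, so the extended energy is finite and
    minimality becomes an inequality between real numbers. *)
Lemma AG_energyE (eps : R) :
  AG_energy eps Omega u = (2^-1 * (eps^-1 * well_energy + eps * hess_energy))%:E.
Proof.
have i1 := intgZ mOm eps^-1 well_sqint.2.
have i2 := intgZ mOm eps whess_intg.
rewrite /AG_energy EFinM; congr (_ * _)%E.
rewrite -(RintZ mOm _ well_sqint.2) -(RintZ mOm _ whess_intg) -(RintD mOm i1 i2) -(intgE mOm (intgD mOm i1 i2)).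
by apply: eq_integral => z _; rewrite real_normK// num_real.
Qed.

Lemma well_energy_ge0 : 0 <= well_energy. Proof. by apply: Rint_ge0 => z _; exact: sqr_ge0. Qed.

Lemma hess_energy_ge0 : 0 <= hess_energy.
Proof. by apply: Rint_ge0 => z _; rewrite whess_sqE !addr_ge0 ?sqr_ge0. Qed.

Lemma grad_energy_bound i : I (fun z => w i z ^+ 2) <= I (fun=> 2) + well_energy.
Proof.
have c2 : intg mu (Omega : set (plane R)) (fun=> 2 : R).
  by apply: (intg_bounded mOm Oly (M := 2)) => // z _; rewrite ger0_norm.
rewrite -(RintD mOm c2 well_sqint.2); apply: (le_Rint mOm).
- exact: (Lambda_grad_sqint i).2.
- exact: (intgD mOm c2 well_sqint.2).
move=> z _; have : w i z ^+ 2 <= wgrad_sq Omega u z.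
  rewrite /wgrad_sq sum2; move: i; apply: ord2_ind; first by rewrite lerDl sqr_ge0.
  by rewrite lerDr sqr_ge0.
(* Pointwise s <= 2 + (1 - s)^2, the difference being (s - 3/2)^2 + 3/4. *)
by move: (w i z) (wgrad_sq _ _ _) => a b; have := sqr_ge0 (b - 3 / 2); nra.
Qed.

Lemma Lambda_poincare : I (fun z => u z ^+ 2) <= 16 * r ^+ 2 * I (fun z => w ord0 z ^+ 2).
Proof.
have [_ tu _] := Lu.
have := poincare oO r0 bO C2 Lambda_L2 Lambda_weak tu.
rewrite (_ : Rintegral _ _ (fun s => (0 : R) ^+ 2) = 0) ?mulr0 ?add0r//.
rewrite (_ : (fun=> _) = fun=> 0); last by apply/funext => s; rewrite expr0n.
by rewrite /Rintegral integral0.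
Qed.
End admissible.

Lemma AG_minimiser_energy (eps : R) u v : AG_minimiser eps Omega u -> Lambda Omega v ->
  eps^-1 * well_energy u + eps * hess_energy u <= eps^-1 * well_energy v + eps * hess_energy v.
Proof.
move=> [Lu mu_] Lv; have := mu_ v Lv.
by rewrite (AG_energyE Lu) (AG_energyE Lv) lee_fin ler_pM2l ?invr_gt0.
Qed.

Section distance.
Hypothesis cO : convex_set (Omega : set (R * R)).
Hypothesis b0 : bdry Omega !=set0.

Lemma W12norm_dist u (g : 'I_2 -> R * R -> R) : Lambda Omega u ->
  (forall i, is_weak_pderiv Omega i (dist_bdry Omega) (g i)) ->
  W12norm Omega (u \- dist_bdry Omega) =
  (Num.sqrt (I (fun z => (u z - dist_bdry Omega z) ^+ 2) +
    I (fun z => (wpderiv Omega ord0 u z - g ord0 z) ^+ 2) +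
    I (fun z => (wpderiv Omega ord_max u z - g ord_max z) ^+ 2)))%:E.
Proof.
move=> Lu hg; have d2 : L2 Omega (dist_bdry Omega).
  apply/(L2P oO); apply: (continuous_sqint oO bO); exact: (dist_bdry_continuous b0).
have u2 := Lambda_L2 Lu.
apply: (W12normE oO bO (g := fun i z => wpderiv Omega i u z - g i z)).
  by apply/(L2P oO); apply: (sqintB mOm); apply/(L2P oO).
move=> i; exact: (weak_pderivB oO bO u2 d2 (Lambda_weak Lu i) (hg i)).
Qed.

(** The competitor v is chosen once for Omega, and eps <= E bounds eps^2 times its Hessian energy;
    hence K is uniform in eps. If [Lambda] is empty there is no minimiser. *)
Lemma minimiser_bounded (E : R) : exists K : R, forall eps u, 0 < eps <= E ->
  AG_minimiser eps Omega u -> (W12norm Omega (u \- dist_bdry Omega)%R <= K%:E)%E.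
Proof.
have [[v Lv]|none] := pselect (exists v, Lambda Omega v); last first.
  by exists 0 => eps u _ [Lu _]; exfalso; apply: none; exists u.
have [g hg] := dist_bdry_weak_pderiv oO bO cO b0.
have hw i : is_weak_pderiv Omega i (dist_bdry Omega) (g i) by have [] := hg i.
have g2 i : sqint mu (Omega : set (plane R)) (g i) by apply/(L2P oO); have [] := hw i.
have z2 := continuous_sqint oO bO (dist_bdry_continuous b0).
pose A := I (fun=> 2) + (well_energy v + E ^+ 2 * hess_energy v).
pose G := I (fun z => dist_bdry Omega z ^+ 2) + (I (fun z => g ord0 z ^+ 2) + I (fun z => g ord_max z ^+ 2)).
exists (Num.sqrt (2 * (16 * r ^+ 2 * A + (A + A)) + 2 * G)) => eps u /andP[e0 eE] mini.
have [Lu _] := mini; rewrite (W12norm_dist Lu hw) lee_fin; apply: ler_wsqrtr.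
have wA i : I (fun z => wpderiv Omega i u z ^+ 2) <= A.
  apply: le_trans (grad_energy_bound Lu i) _; rewrite lerD2l.
  have h := AG_minimiser_energy mini Lv; have h0 := hess_energy_ge0 u; have h1 := hess_energy_ge0 v.
  have h2 : well_energy u <= well_energy v + eps ^+ 2 * hess_energy v.
    exact: energy_compare e0 h0 h.
  apply: (le_trans h2); rewrite lerD2l; apply: ler_wpM2r => //.
  by rewrite lerXn2r// nnegrE ltW// (lt_le_trans e0).
have uA : I (fun z => u z ^+ 2) <= 16 * r ^+ 2 * A.
  apply: le_trans (Lambda_poincare Lu) _; apply: ler_wpM2l => //.
  by rewrite mulr_ge0// sqr_ge0.
have sub (a b : R * R -> R) : sqint mu (Omega : set (plane R)) a -> sqint mu (Omega : set (plane R)) b ->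
    I (fun z => (a z - b z) ^+ 2) <= 2 * I (fun z => a z ^+ 2) + 2 * I (fun z => b z ^+ 2).
  move=> a2 b2; have := sq_le2 mOm a2 (sqintN mOm b2).
  by rewrite (_ : I (fun z => (- b z) ^+ 2) = I (fun z => b z ^+ 2))//; apply: eq_Rint => z _; rewrite sqrrN.
have u2 := (L2P oO u).1 (Lambda_L2 Lu).
have s0 := sub _ _ u2 z2.
have s1 := sub _ _ (Lambda_grad_sqint Lu ord0) (g2 ord0).
have s2 := sub _ _ (Lambda_grad_sqint Lu ord_max) (g2 ord_max).
exact: sum3_bound s0 s1 s2 uA (wA ord0) (wA ord_max).
Qed.
End distance.
End energy.

(** * Domains with zero defect *)

Section discs.
Context {R : realType}.
Implicit Types (Omega : set (R * R)) (z c y p : R * R).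

Lemma open_eball c (s : R) : open (eball c s).
Proof.
rewrite (_ : eball c s = (fun z => enorm (z - c)) @^-1` [set x | x < s])//.
apply: open_comp; last exact: open_lt.
move=> z _; apply: (continuous_comp (f := fun z : R * R => z - c) (g := @enorm R)); last exact: enorm_continuous.
by apply: cvgB; [exact: cvg_id|exact: cvg_cst].
Qed.

Lemma nbhs_eball c (s : R) : 0 < s -> nbhs c (eball c s).
Proof.
move=> s0; apply: open_nbhs_nbhs; split; first exact: open_eball.
by rewrite /eball /= subrr /enorm /dotp /= mulr0 addr0 sqrtr0.
Qed.

Lemma open_contains_box U z : open U -> U z -> exists2 e : R, 0 < e &
  (`[z.1 - e, z.1 + e]%classic `*` `[z.2 - e, z.2 + e]%classic : set (R * R)) `<=` U.
Proof.
move=> oU Uz; have /nbhs_ballP[e /= e0 he] := open_nbhs_nbhs (conj oU Uz).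
exists (e / 2); first by rewrite divr_gt0.
move=> w [/= ]; rewrite !in_itv/= => /andP[a1 a2] /andP[b1 b2]; apply: he.
by split; rewrite /ball /= ltr_norml; apply/andP; split; lra.
Qed.

Lemma box_sub p (m : R * R) (d : R) : `|m.1| < d -> `|m.2| < d ->
  (`[p.1 - d, p.1 + d]%classic `*` `[p.2 - d, p.2 + d]%classic : set (R * R)) (p - m).
Proof.
case: p m => p1 p2 [m1 m2] /=; rewrite !ltr_norml => /andP[? ?] /andP[? ?].
by split; rewrite /= in_itv/=; apply/andP; split; lra.
Qed.

(** The point q' approximates z + t (z - p), which lies beyond z as seen from p. Moving p by -1/t
    times the error of q' keeps z on the segment. *)
Lemma reflect_combination z p (q' : R * R) (t : R) : 0 < t ->
  (1 + t)^-1 *: q' + (1 - (1 + t)^-1) *: (p - t^-1 *: (q' - (z + t *: (z - p)))) = z.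
Proof.
case: z p q' => z1 z2 [p1 p2] [q1 q2] t0.
have n0 : 1 + t != 0 by rewrite gt_eqF// addr_gt0.
have n1 : t != 0 by rewrite gt_eqF.
by apply: pair_equal_spec_coord; rewrite /= /GRing.scale/=; field; rewrite ?n0 ?n1.
Qed.

Lemma disc_defect_lt Omega (e : R) : disc_defect Omega = 0%E -> 0 < e ->
  exists2 y, Omega y & (leb2 (Omega `+` eball y 1 : set (plane R)) < e%:E)%E.
Proof.
move=> d0 e0; have : (disc_defect Omega < e%:E)%E by rewrite d0 lte_fin.
by move=> /ereal_inf_lt[_ [y Oy <-] h]; exists y.
Qed.

Section zero_defect.
Variables (Omega : set (R * R)) (r : R).
Hypotheses (oO : open Omega) (bO : Omega `<=` square_box r).
Hypothesis d0 : disc_defect Omega = 0%E.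

(** c is a cluster point of centres whose defects tend to 0; compactness comes from the enclosing
    square. The conclusion is phrased for both inclusions at once: no nonempty open set lies in the
    symmetric difference for all centres near c. *)
Lemma disc_defect0_center : exists c, forall U z (s : R), open U -> U z -> 0 < s ->
  (forall y, eball c s y -> U `<=` Omega `+` eball y 1) -> False.
Proof.
have ex (n : nat) : {y | Omega y /\ (leb2 (Omega `+` eball y 1 : set (plane R)) < (n.+1%:R^-1 : R)%:E)%E}.
  by apply: cid; have [|y h1 h2] := @disc_defect_lt Omega n.+1%:R^-1 d0; [rewrite invr_gt0|exists y].
pose y n := sval (ex n).
have [Oy hy] : (forall n, Omega (y n)) /\
    forall n, (leb2 (Omega `+` eball (y n) 1 : set (plane R)) < (n.+1%:R^-1 : R)%:E)%E.
  by split=> n; have [] := svalP (ex n).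
have cK : compact (square_box r : set (R * R)).
  by apply: compact_setX; exact: segment_compact.
have [|c [_ hc]] := cK _ (fmap_proper_filter y (@eventually_filter)).
  by exists 0%N => // n _; exact: bO (Oy n).
exists c => U z s oU Uz s0 hU.
have [e e0 hQ] := open_contains_box oU Uz.
pose Q := `[z.1 - e, z.1 + e]%classic `*` `[z.2 - e, z.2 + e]%classic : set (plane R).
have mQ : leb2 Q = ((2 * e) ^+ 2)%:E.
  rewrite /Q leb2X; try exact: measurable_itv.
  have lJ (a : R) : lebesgue_measure (`[a - e, a + e]%classic : set (measurableTypeR R)) = (2 * e)%:E.
    rewrite lebesgue_measure_itv/= lte_fin ifT; last by lra.
    by rewrite -EFinB; congr EFin; ring.
  by rewrite !lJ -EFinM expr2.
have ee : 0 < (2 * e) ^+ 2 by rewrite exprn_gt0// mulr_gt0.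
have [N hN] : exists N : nat, forall n, (N <= n)%N -> n.+1%:R^-1 < (2 * e) ^+ 2 :> R.
  have := @cvg_harmonic R => /cvgrPdist_lt/(_ _ ee)[N _ h]; exists N => n Nn.
  by have := h n Nn; rewrite /harmonic /= sub0r normrN ger0_norm.
have [p [[n Nn yn] Up]] : ((y @` [set n | (N <= n)%N]) `&` eball c s) !=set0.
  apply: hc; last exact: nbhs_eball.
  by exists N => // n Nn; exists n.
(* Q has a fixed positive measure, yet it lies in the symmetric difference for the centre [y n],
   whose measure is below 1/(n+1). *)
have : (leb2 Q <= leb2 (Omega `+` eball (y n) 1 : set (plane R)))%E.
  apply: le_measure; rewrite ?inE.
  - by apply: measurableX; exact: measurable_itv.
  - by apply: measurableU; apply: measurableD; apply: open_measurable2 => //; exact: open_eball.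
  - by apply: subset_trans hQ _; apply: hU; rewrite yn.
move=> /le_lt_trans/(_ (hy n)); rewrite mQ lte_fin => h.
by have := lt_trans h (hN n Nn); rewrite ltxx.
Qed.

Hypothesis cO : convex_set (Omega : set (R * R)).

(** Vanishing measure gives inclusions only up to closures. Openness of Omega removes the boundary
    circle from it, and convexity with openness fills in the points of the disc. *)
Lemma disc_defect0_ball : exists c, Omega = eball c 1.
Proof.
have [c hc] := disc_defect0_center; exists c.
(* Otherwise a small ball outside the closure of Omega would lie in all unit discs with centre near
   c; the radius is half the distance to the circle so as to leave room for moving the centre. *)
have inK : eball c 1 `<=` closure Omega.
  move=> z hz; apply: contrapT => nz.
  pose s := (1 - enorm (z - c)) / 2; have s0 : 0 < s by rewrite divr_gt0// subr_gt0.
  apply: (hc (eball z s `&` ~` closure Omega) z s _ _ s0).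
  - by apply: openI; [exact: open_eball|rewrite openC; exact: closed_closure].
  - by split => //; exact: nbhs_singleton (nbhs_eball _ s0).
  move=> y hy w [hw nw]; right; split; last by move=> Ow; apply: nw; exact: subset_closure.
  rewrite /eball /=; move: hy hw; rewrite /eball /= => hy hw.
  rewrite (_ : w - y = (w - z) + ((z - c) - (y - c))); last by ring.
  apply: (le_lt_trans (enormD _ _)); have := enormD (z - c) (- (y - c)); rewrite enormN.
  by move: hw hy; rewrite /s; lra.
have outK z : Omega z -> enorm (z - c) <= 1.
  move=> Oz; rewrite leNgt; apply/negP => hz.
  pose s := (enorm (z - c) - 1) / 2; have s0 : 0 < s by rewrite divr_gt0// subr_gt0.
  apply: (hc (eball z s `&` Omega) z s _ _ s0).
  - by apply: openI; [exact: open_eball|].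
  - by split => //; exact: nbhs_singleton (nbhs_eball _ s0).
  move=> y hy w [hw Ow]; left; split => // wy; move: hy hw wy; rewrite /eball /= => hy hw wy.
  have : enorm (z - c) <= enorm (w - z) + (enorm (w - y) + enorm (y - c)).
    rewrite (_ : z - c = - (w - z) + ((w - y) + (y - c))); last by ring.
    by apply: (le_trans (enormD _ _)); rewrite enormN lerD2l enormD.
  by move: hw hy wy; rewrite /s; lra.
apply/seteqP; split=> [z Oz|z hz].
  (* A point of Omega on the circle could be pushed outwards within Omega to z + e (z - c), against
     [outK]. *)
  rewrite /eball /= lt_neqAle outK// andbT; apply/negP => /eqP e1.
  have [e e0 hQ] := open_contains_box oO Oz.
  have [k1 k2] := enorm_coord (z - c); rewrite e1 in k1 k2.
  have /outK : Omega (z + e *: (z - c)).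
    apply: hQ; split; rewrite /= in_itv/=; [move: k1|move: k2]; rewrite ler_norml => /andP[j1 j2];
      rewrite /GRing.scale/=; apply/andP; split; nra.
  rewrite (_ : _ - c = (1 + e) *: (z - c)); last by rewrite scalerDl scale1r; ring.
  by rewrite enormZ e1 mulr1 ger0_norm; lra.
pose s := 1 - enorm (z - c); have s0 : 0 < s by rewrite subr_gt0.
have [p Op] : exists p, Omega p.
  have [p [Op _]] := inK z hz _ (nbhs_eball z s0); by exists p.
have [d d0' hd] := open_contains_box oO Op.
(* Small enough for the point q beyond z to remain in the disc, where points of Omega approximate
   it. *)
pose t := s / (2 * (enorm (z - p) + 1)).
have p0 : 0 < enorm (z - p) + 1 by rewrite ltr_pwDr// enorm_ge0.
have t0 : 0 < t by rewrite divr_gt0// mulr_gt0.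
pose q := z + t *: (z - p).
have hq : eball c 1 q.
  rewrite /eball /= /q (_ : _ - c = (z - c) + t *: (z - p)); last by ring.
  apply: (le_lt_trans (enormD _ _)); rewrite enormZ gtr0_norm//.
  rewrite -ltrBrDl -/s /t mulrAC ltr_pdivrMr ?mulr_gt0//.
  by have := enorm_ge0 (z - p); nra.
have [q' [Oq' q'q]] := inK q hq _ (nbhs_eball q (mulr_gt0 t0 d0')).
pose p' := p - t^-1 *: (q' - q).
have Op' : Omega p'.
  have [k1 k2] := enorm_coord (q' - q).
  have : enorm (t^-1 *: (q' - q)) < d.
    by rewrite enormZ gtr0_norm ?invr_gt0// ltr_pdivrMl.
  have [] := enorm_coord (t^-1 *: (q' - q)); rewrite /p'; set m := t^-1 *: (q' - q) => j1 j2 j3.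
  by apply: hd; apply: box_sub; [exact: le_lt_trans j1 j3|exact: le_lt_trans j2 j3].
have l01 : 0 <= (1 + t)^-1 <= 1.
  by rewrite invr_ge0 addr_ge0 ?(ltW t0)//= invf_le1 ?lerDl ?(ltW t0)// addr_gt0.
have := convex_segment cO Oq' Op' l01.
rewrite (_ : _ *: q' + _ = z)//.
exact: reflect_combination.
Qed.

End zero_defect.
End discs.

(** * The divergence theorem on the unit disc *)

Section primitives.
Context {R : realType}.
Implicit Types (f : R -> R) (a b : R).

Local Notation J a b := (Rintegral (@lebesgue_measure R) (`[a, b]%classic : set (measurableTypeR R))).

Lemma continuous_itv_sqint f a b : continuous f ->
  sqint (@lebesgue_measure R) (`[a, b]%classic : set (measurableTypeR R)) f.
Proof.
move=> cf; have mI : measurable (`[a, b]%classic : set (measurableTypeR R)) by exact: measurable_itv.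
have [M hM] : exists M, forall x, x \in `[a, b] -> `|f x| <= M.
  have [ab|ab] := leP a b; last by exists 0 => x; rewrite in_itv/= => /andP[h1 h2]; lra.
  have cn : {within `[a, b], continuous (fun x => `|f x|)}.
    by apply: continuous_subspaceT => x; apply: cvg_norm; exact: cf.
  by have [c _ hc] := EVT_max ab cn; exists `|f c|.
apply: (sqint_bounded mI (itv_lty a b) (M := M)); last by move=> z hz; apply: hM; rewrite inE.
by apply: measurable_funTS; exact: continuous_measurable_fun.
Qed.

Lemma continuous_itv_intg f a b : continuous f ->
  intg (@lebesgue_measure R) (`[a, b]%classic : set (measurableTypeR R)) f.
Proof.
move=> cf; have mI : measurable (`[a, b]%classic : set (measurableTypeR R)) by exact: measurable_itv.
exact: (sqint_intg mI (itv_lty a b) (continuous_itv_sqint a b cf)).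
Qed.

Lemma integral_itv_cat f a b c : continuous f -> a <= b -> b <= c -> J a c f = J a b f + J b c f.
Proof.
move=> cf ab bc; have h := @Rintegral_itvB R f (BLeft a) (BRight c) b (continuous_itv_intg a c cf).
rewrite -(Rintegral_itv_obnd_cbnd (r := b)); last first.
  apply: integrableS (continuous_itv_intg b c cf) => //; exact: subset_itv_oc_cc.
by rewrite -h ?bnd_simp// addrC subrK.
Qed.

(** The fundamental theorem is applied from a left endpoint -N. Subtracting the integral up to 0
    makes the value independent of N, so N may depend on x and a single primitive on the whole line
    results. *)
Lemma primitive_exists f : continuous f -> exists P : R -> R, forall x, is_derive x (1 : R) P (f x).
Proof.
move=> cf; pose Q (N x : R) := J (- N) x f - J (- N) 0 f.
have QE N M x : `|x| <= M -> M <= N -> Q N x = Q M x.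
  move=> xM MN; move: (xM); rewrite ler_norml => /andP[h1 h2].
  have M0 := le_trans (normr_ge0 x) xM.
  rewrite /Q (@integral_itv_cat f (- N) (- M) x)//; last by lra.
  by rewrite (@integral_itv_cat f (- N) (- M) 0)//; [ring|lra|lra].
exists (fun x => Q (`|x| + 1) x) => x.
pose N := `|x| + 2.
have dQ : is_derive x (1 : R) (Q N) (f x).
  have [||||h1 h2] := @continuous_FTC1_closed R f (- N) x (x + 1).
  - by rewrite ltrDl.
  - exact: continuous_itv_intg.
  - by rewrite /N; have := ler_norm (- x); rewrite normrN; lra.
  - exact: cf.
  have : is_derive x (1 : R) (fun y => J (- N) y f) (f x).
    by apply: DeriveDef; [exact: h1|rewrite -derive1E; exact: h2].
  rewrite /Q => h; rewrite -[f x]subr0; apply: is_deriveB.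
apply: near_eq_is_derive dQ; near=> y.
have hy : `|y| <= `|x| + 1.
  near: y.
  have : (fun y : R => `|y|) @ x --> `|x| by apply: cvg_norm; exact: cvg_id.
  by move=> /cvgr_le; apply; rewrite ltrDl.
by apply: QE; rewrite ?/N; lra.
Unshelve. all: end_near. Qed.

Lemma integral_primitive f P a b : continuous f -> (forall x, is_derive x (1 : R) P (f x)) -> a <= b ->
  J a b f = P b - P a.
Proof.
move=> cf dP; rewrite le_eqVlt => /predU1P[->|ab].
  by rewrite subrr set_itv1 Rintegral_set1.
have cP : continuous P by move=> x; apply: differentiable_continuous; apply/derivable1_diffP; have [] := dP x.
rewrite /Rintegral (@continuous_FTC2 _ f P)//.
- exact: continuous_subspaceT.
- split; first by move=> x _; have [] := dP x.
  + exact: cvg_at_right_filter (cP a).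
  + exact: cvg_at_left_filter (cP b).
- by move=> x _; rewrite derive1E; have [_ ->] := dP x.
Qed.

Lemma integral_substitution f P (phi dphi : R -> R) a b : continuous f ->
  (forall x, is_derive x (1 : R) P (f x)) ->
  (forall x, is_derive x (1 : R) phi (dphi x)) -> continuous dphi -> a <= b ->
  J a b (fun x => f (phi x) * dphi x) = P (phi b) - P (phi a).
Proof.
move=> cf dP dphi_ cd ab.
have cphi : continuous phi by move=> x; apply: differentiable_continuous; apply/derivable1_diffP; have [] := dphi_ x.
apply: (integral_primitive (P := P \o phi)) => //.
by move=> x; apply: cvgM; [apply: (continuous_comp (cphi x)); exact: cf|exact: cd].
Qed.

Lemma integral_period f a b l : continuous f -> (forall x, f (x + l) = f x) -> 0 <= l ->
  J a (a + l) f = J b (b + l) f.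
Proof.
move=> cf pf l0; have [P dP] := primitive_exists cf.
rewrite !(integral_primitive cf dP) ?lerDl//.
have dQ x : is_derive x (1 : R) (fun y => P (y + l) - P y) 0.
  have dl : is_derive x (1 : R) (fun y : R => y + l) 1.
    by rewrite -[X in is_derive _ _ _ X]addr0; apply: is_deriveD.
  have hc : is_derive x (1 : R) (P \o (fun y => y + l)) (f (x + l) * 1) by apply: is_derive1_comp.
  have h := is_deriveB hc (dP x).
  by apply: is_derive_eq h _; rewrite pf mulr1 subrr.
exact: (is_derive_0_is_cst _ _ dQ).
Qed.
End primitives.

Section circle.
Context {R : realType}.
Implicit Types (c z : R * R) (s t : R).

Lemma angle_exists (x y : R) : x ^+ 2 + y ^+ 2 = 1 -> exists t, cos t = x /\ sin t = y.
Proof.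
move=> h; have x1 : -1 <= x <= 1 by apply/andP; split; have := sqr_ge0 y; nra.
have e1 : 1 - x ^+ 2 = y ^+ 2 by lra.
have [y0|y0] := leP 0 y.
  by exists (acos x); rewrite acosK ?sin_acos ?e1 ?sqrtr_sqr ?ger0_norm// in_itv.
by exists (- acos x); rewrite cosN sinN acosK ?sin_acos ?e1 ?sqrtr_sqr ?ltr0_norm ?opprK// in_itv.
Qed.

(** In the frame rotating with angle s the vector (X, Y) has derivative 0. *)
Lemma circle_ode (X Y : R -> R) : (forall s, is_derive s (1 : R) X (- Y s)) ->
  (forall s, is_derive s (1 : R) Y (X s)) -> X 0 ^+ 2 + Y 0 ^+ 2 = 1 ->
  exists s0, forall s, X s = cos (s + s0) /\ Y s = sin (s + s0).
Proof.
move=> dX dY /angle_exists[s0 [h1 h2]]; exists s0 => s.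
have dA t : is_derive t (1 : R) (fun t => X t * cos t + Y t * sin t) 0.
  have h := is_deriveD (is_deriveM (dX t) (is_derive_cos t)) (is_deriveM (dY t) (is_derive_sin t)).
  by apply: is_derive_eq h _; rewrite /GRing.scale/=; ring.
have dB t : is_derive t (1 : R) (fun t => Y t * cos t - X t * sin t) 0.
  have h := is_deriveB (is_deriveM (dY t) (is_derive_cos t)) (is_deriveM (dX t) (is_derive_sin t)).
  by apply: is_derive_eq h _; rewrite /GRing.scale/=; ring.
have eA := is_derive_0_is_cst s 0 dA; have eB := is_derive_0_is_cst s 0 dB.
move: eA eB; rewrite /= cos0 sin0 !mulr1 !mulr0 addr0 subr0 -h1 -h2 cosD sinD.
have := cos2Dsin2 s; move: (X s) (Y s) (cos s) (sin s) (cos s0) (sin s0) => x y a b p q h3 <- <-.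
split.
  rewrite (_ : _ - _ = x * (a ^+ 2 + b ^+ 2)); last by ring.
  by rewrite h3 mulr1.
rewrite (_ : _ + _ = y * (a ^+ 2 + b ^+ 2)); last by ring.
by rewrite h3 mulr1.
Qed.

Lemma cos_eq1 t : 0 < t -> t <= pi *+ 2 -> cos t = 1 -> t = pi *+ 2.
Proof.
move=> t0; rewrite le_eqVlt => /predU1P[//|t2] h; exfalso.
have e2 : (t / 2) *+ 2 = t by rewrite -mulr_natr divfK.
have := cos_mulr2n (t / 2); rewrite e2 h.
have s0 : 0 < sin (t / 2).
  by apply: sin_gt0_pi; rewrite divr_gt0//= ltr_pdivrMr// mulr_natr.
have := cos2Dsin2 (t / 2); rewrite !mulr2n; nra.
Qed.

Lemma disc_bdry c z : bdry (eball c 1) z -> enorm (z - c) = 1.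
Proof.
move=> /(bdry_open _ (@open_eball R c 1))[cz nz].
apply/eqP; rewrite eq_le; apply/andP; split; last by rewrite leNgt; apply/negP.
rewrite leNgt; apply/negP => hz.
pose s := enorm (z - c) - 1; have s0 : 0 < s by rewrite subr_gt0.
have [w [hw]] := cz _ (nbhs_eball z s0); rewrite /eball /= => hw2.
have := enormD (z - w) (w - c); rewrite addrA subrK (enormB z w).
by move: hw hw2; rewrite /eball /= /s; lra.
Qed.

Lemma orthonormal_frame (x y p q : R) : 0 < x * q - y * p -> x * p + y * q = 0 ->
  p ^+ 2 + q ^+ 2 = 1 -> x ^+ 2 + y ^+ 2 = 1 -> p = - y /\ q = x.
Proof.
move=> h1 h2 h3 h4; have e1 : x * q - y * p = 1.
  have : (x * q - y * p) ^+ 2 = 1.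
    have -> : (x * q - y * p) ^+ 2 = (x ^+ 2 + y ^+ 2) * (p ^+ 2 + q ^+ 2) - (x * p + y * q) ^+ 2 by ring.
    by rewrite h2 h3 h4 expr0n/= subr0 mulr1.
  by move=> e; apply/eqP; rewrite -(@pexpr_eq1 _ _ 2)// ?e// ltW.
split.
  have -> : p = p * (x ^+ 2 + y ^+ 2) by rewrite h4 mulr1.
  by rewrite (_ : _ * _ = x * (x * p + y * q) - y * (x * q - y * p)); [rewrite h2 e1; ring|ring].
have -> : q = q * (x ^+ 2 + y ^+ 2) by rewrite h4 mulr1.
by rewrite (_ : _ * _ = y * (x * p + y * q) + x * (x * q - y * p)); [rewrite h2 e1; ring|ring].
Qed.

(** The unit tangent is orthogonal to the radius, and having the disc on the left fixes its sign;
    hence gamma solves the equations of a counterclockwise rotation. The length is found from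
    periodicity and injectivity. *)
Lemma disc_param c gamma (l : R) : arclength_param (eball c 1) gamma l ->
  l = pi *+ 2 /\ exists s0, forall s, (gamma s).1 - c.1 = cos (s + s0) /\ (gamma s).2 - c.2 = sin (s + s0).
Proof.
move=> ag; have [l0 dg _ ug [per inj rg left]] := ag.
pose X s := (gamma s).1 - c.1; pose Y s := (gamma s).2 - c.2.
have XY s : X s ^+ 2 + Y s ^+ 2 = 1.
  by have /enorm1P := disc_bdry (arclength_bdry ag s).
pose a s := (derive1 gamma s).1; pose b s := (derive1 gamma s).2.
have ab s : a s ^+ 2 + b s ^+ 2 = 1 by exact: enorm1P (ug s).
have d1 s := is_derive_fst (dg s).1; have d2 s := is_derive_snd (dg s).1.
have d3 s := is_derive_fst (dg s).2; have d4 s := is_derive_snd (dg s).2.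
have [h _] := is_derive_sqr_norm c.1 c.2 d1 d2 d3 d4.
have ort s : X s * a s + Y s * b s = 0.
  have [_ e] := h s.
  move: e; rewrite (_ : (fun _ => _) = cst 1); last by apply/funext => t; exact: XY.
  rewrite derive_cst => /esym/eqP; rewrite mulf_eq0 pnatr_eq0/= => /eqP; exact.
(* For small t > 0 the point at distance t along the left normal is in the disc; expanding its
   squared distance to c, which is below 1, gives 2 (X b - Y a) > t. *)
have lft s : 0 < X s * b s - Y s * a s.
  have : \forall t \near 0^'+, 0 < t /\ eball c 1 (gamma s + t *: rot90 (derive1 gamma s)).
    by near=> t; split; near: t; [exact: nbhs_right_gt|exact: left].
  move=> /filter_ex[t [t0]]; rewrite /eball /= => hb.
  have := enorm_sqr (gamma s + t *: rot90 (derive1 gamma s) - c).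
  have : enorm (gamma s + t *: rot90 (derive1 gamma s) - c) ^+ 2 < 1.
    by rewrite expr_lt1// enorm_ge0.
  rewrite [X in _ = X](_ : _ = (X s - t * b s) ^+ 2 + (Y s + t * a s) ^+ 2); last first.
    rewrite /X /Y /a /b /rot90 /= /GRing.scale/=; congr (_ ^+ 2 + _ ^+ 2); ring.
  move=> /[swap] ->; have := XY s; have := ab s.
  move: (X s) (Y s) (a s) (b s) => x y p q; move=> {h d1 d2 d3 d4 ort ab XY hb} h1 h2 h3.
  have : 0 < t * (2 * (x * q - y * p) - t) by nra.
  by rewrite pmulr_rgt0//; lra.
have eab s : a s = - Y s /\ b s = X s.
  have := XY s; have := ab s; have := ort s; have := lft s.
  move: (X s) (Y s) (a s) (b s) => x y p q h1 h2 h3 h4.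
  exact: orthonormal_frame.
have dX s : is_derive s (1 : R) X (- Y s).
  rewrite -(eab s).1 -[a s]subr0; apply: is_deriveB; exact: d1.
have dY s : is_derive s (1 : R) Y (X s).
  rewrite -(eab s).2 -[b s]subr0; apply: is_deriveB; exact: d2.
have [s0 hs] := circle_ode dX dY (XY 0).
split; last by exists s0.
have gE s t : cos (s + s0) = cos (t + s0) -> sin (s + s0) = sin (t + s0) -> gamma s = gamma t.
  have [x1 y1] := hs s; have [x2 y2] := hs t.
  rewrite -x1 -y1 -x2 -y2 => /addIr e1 /addIr e2.
  by move: e1 e2; case: (gamma s) (gamma t) => ? ? [? ?] /= -> ->.
have cl : cos l = 1.
  have [x1 y1] := hs l; have [x2 y2] := hs 0.
  have e := per 0; rewrite add0r in e.
  have ex : X l = X 0 by rewrite /X e.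
  have ey : Y l = Y 0 by rewrite /Y e.
  rewrite (_ : l = (l + s0) - s0); last by rewrite addrK.
  by rewrite cosB -x1 -y1 ex ey x2 y2 add0r -!expr2 cos2Dsin2.
(* If 2 pi < l, the parameters 2 pi and 0 of [0, l[ give the same point, against injectivity. So l
   <= 2 pi, and cos l = 1 leaves only 2 pi. *)
apply: cos_eq1 => //; rewrite leNgt; apply/negP => lt.
have pi0 := @pi_gt0 R.
have : pi *+ 2 = 0 :> R.
  apply: inj; [by rewrite in_itv/= lt andbT mulrn_wge0// ltW|by rewrite in_itv/= lexx l0|].
  by apply: gE; rewrite [pi *+ 2 + _]addrC add0r ?cosD2pi ?sinD2pi.
by move=> /eqP; rewrite mulrn_eq0/= gt_eqF.
Unshelve. all: end_near. Qed.
End circle.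

Section divergence.
Context {R : realType}.
Implicit Types (c z : R * R) (f F : R * R -> R) (s t : R).

Local Notation J a b := (Rintegral (@lebesgue_measure R) (`[a, b]%classic : set (measurableTypeR R))).
Local Notation I D := (Rintegral (@leb2 R) (D : set (plane R))).

Lemma eball_square_box c (s : R) : eball c s `<=` square_box (`|c.1| + `|c.2| + s).
Proof.
move=> z; rewrite /eball /= => hz; have [h1 h2] := enorm_coord (z - c).
have := le_lt_trans h1 hz; have := le_lt_trans h2 hz; rewrite !ltr_norml => /andP[a1 a2] /andP[b1 b2].
have := ler_norm c.1; have := ler_norm c.2; have := ler_norm (- c.1); have := ler_norm (- c.2).
rewrite !normrN /= => k1 k2 k3 k4; have n1 := normr_ge0 c.1; have n2 := normr_ge0 c.2.
move: a1 a2 b1 b2 k1 k2 k3 k4 n1 n2 {h1 h2 hz}.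
case: z c => z1 z2 [c1 c2] /=; move: `|c1| `|c2| => u v a1 a2 b1 b2 k1 k2 k3 k4 n1 n2.
by split; rewrite /= in_itv/=; apply/andP; split; lra.
Qed.

Lemma disc_slice c (x y : R) : let rho := Num.sqrt (1 - (y - c.2) ^+ 2) in
  eball c 1 (x, y) <-> (`]c.1 - rho, c.1 + rho[%classic : set R) x.
Proof.
move=> rho; rewrite /eball /= in_itv/= -ltr_distlC distrC -[`|_|]sqrtr_sqr /rho.
have e : enorm ((x, y) - c) ^+ 2 = (x - c.1) ^+ 2 + (y - c.2) ^+ 2 by rewrite enorm_sqr.
have -> : (enorm ((x, y) - c) < 1) = ((x - c.1) ^+ 2 < 1 - (y - c.2) ^+ 2).
  by rewrite -(@expr_lt1 _ 2)// ?enorm_ge0// e ltrBrDr.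
(* On lines that miss the disc the square root of a nonpositive number is 0 and the open interval is
   empty. *)
have [h|h] := ltP 0 (1 - (y - c.2) ^+ 2); first by rewrite ltr_sqrt.
rewrite (ler0_sqrtr h); split=> k; first by have := lt_le_trans k h; rewrite ltNge sqr_ge0.
by move: k; rewrite ltNge sqrtr_ge0.
Qed.

Lemma continuous_along f (a b : R -> R) : continuous f -> continuous a -> continuous b ->
  continuous (fun x => f (a x, b x)).
Proof.
move=> cf ca cb x; apply: (continuous_comp (f := fun x => (a x, b x)) (g := f)); last exact: cf.
exact: (cvg_pair (ca x) (cb x)).
Qed.

Lemma disc_integral c f : continuous f ->
  I (eball c 1) f = fine (\int[lebesgue_measure]_y
    (J (c.1 - Num.sqrt (1 - (y - c.2) ^+ 2)) (c.1 + Num.sqrt (1 - (y - c.2) ^+ 2)) (fun x => f (x, y)))%:E)%E.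
Proof.
move=> cf; have mD : measurable (eball c 1 : set (plane R)) by apply: open_measurable2; exact: open_eball.
have bD := @eball_square_box c 1; have [M M0 hM] := continuous_bounded_box (`|c.1| + `|c.2| + 1) cf.
pose g (z : R * R) := f z * \1_(eball c 1) z.
have mg : measurable_fun setT (g : plane R -> measurableTypeR R).
  by apply: measurable_funM; [exact: continuous_measurable2|exact: measurable_indic].
have ig : intg leb2 (setT : set (plane R)) g.
  apply: (bounded_support_intg mg (r := `|c.1| + `|c.2| + 1) (M := M)) => z hz.
    by rewrite /g normrM indicE; case: (_ \in _); rewrite ?normr1 ?mulr1 ?normr0 ?mulr0// hM.
  by rewrite /g indicE memNset ?mulr0// => /bD.
have -> : I (eball c 1) f = fine (\int[leb2]_z (g z)%:E)%E.
  congr fine; rewrite integral_mkcond; apply: eq_integral => z _ /=.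
  by rewrite /patch /g indicE; case: ifPn; rewrite ?mulr1 ?mulr0.
congr fine; rewrite -(integral21_prod_meas1 ig); apply: eq_integral => y _.
set rho := Num.sqrt _; have cfy : continuous (fun x => f (x, y)).
  by apply: (continuous_along cf (a := id)) => x; [exact: cvg_id|exact: cvg_cst].
have ii := continuous_itv_intg (c.1 - rho) (c.1 + rho) cfy.
have mI : measurable (`[c.1 - rho, c.1 + rho]%classic : set (measurableTypeR R)) by exact: measurable_itv.
rewrite -(intgE mI ii) -integral_itv_bndo_bndc; last first.
  by apply: measurable_funTS; apply/measurable_EFinP; exact: continuous_measurable_fun.
rewrite -integral_itv_obnd_cbnd; last first.
  by apply: measurable_funTS; apply/measurable_EFinP; exact: continuous_measurable_fun.
rewrite /fubini_G [RHS]integral_mkcond; apply: eq_integral => x _ /=.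
rewrite /patch /g indicE.
have [h|h] := pselect (eball c 1 (x, y)).
  by rewrite mem_set//= mulr1 mem_set//; exact/(disc_slice c x y).
by rewrite memNset//= mulr0 memNset// => /(disc_slice c x y).
Qed.

Definition circle c s : R * R := (c.1 + cos s, c.2 + sin s).

Lemma continuous_on_circle c f : continuous f -> continuous (fun s => f (circle c s)).
Proof.
move=> cf; apply: (continuous_along cf) => s.
  by apply: cvgD; [exact: cvg_cst|exact: continuous_cos].
by apply: cvgD; [exact: cvg_cst|exact: continuous_sin].
Qed.

(** Fubini and the fundamental theorem on horizontal chords leave the difference of F at their
    endpoints. The substitution y = c.2 + sin t turns right endpoints into the half circle from
    -pi/2 to pi/2 and left endpoints into the one from pi/2 to 3 pi/2, the half chord being |cos
    t|. *)
Lemma disc_pderiv0 c F : Ck 1 F ->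
  I (eball c 1) (pderiv ord0 F) = J (- (pi / 2)) (- (pi / 2) + pi *+ 2) (fun t => F (circle c t) * cos t).
Proof.
move=> F1; have dF := Ck_diff F1; have cF := pderiv_continuous (i := ord0) F1.
have c0 : continuous F by exact: (CkW F1).
pose rho y := Num.sqrt (1 - (y - c.2) ^+ 2).
have crho : continuous rho.
  move=> y; apply: (continuous_comp (f := fun y => 1 - (y - c.2) ^+ 2) (g := Num.sqrt)); last exact: sqrt_continuous.
  apply: cvgB; first exact: cvg_cst.
  by apply: cvgM; apply: cvgB; (try exact: cvg_cst); exact: cvg_id.
pose H1 y := F (c.1 + rho y, y); pose H2 y := F (c.1 - rho y, y).
have cH1 : continuous H1.
  apply: (continuous_along c0 (b := id)) => y; last exact: cvg_id.
  by apply: cvgD; [exact: cvg_cst|exact: crho].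
have cH2 : continuous H2.
  apply: (continuous_along c0 (b := id)) => y; last exact: cvg_id.
  by apply: cvgB; [exact: cvg_cst|exact: crho].
have inner y : J (c.1 - rho y) (c.1 + rho y) (fun x => pderiv ord0 F (x, y)) = H1 y - H2 y.
  have r0 : 0 <= rho y by exact: sqrtr_ge0.
  apply: (integral_primitive (P := fun x => F (x, y))); last by lra.
    by apply: (continuous_along cF (a := id)) => x; [exact: cvg_id|exact: cvg_cst].
  by move=> x; exact: is_derive_horizontal.
rewrite (disc_integral _ cF).
have cH : continuous (fun y => H1 y - H2 y) by move=> y; apply: cvgB; [exact: cH1|exact: cH2].
have -> : fine (\int[lebesgue_measure]_y (J (c.1 - rho y) (c.1 + rho y) (fun x => pderiv ord0 F (x, y)))%:E)%E
    = J (c.2 - 1) (c.2 + 1) (fun y => H1 y - H2 y).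
  congr fine; rewrite [RHS]integral_mkcond; apply: eq_integral => y _; rewrite inner /patch.
  (* Outside the heights of the disc the half chord is 0, so the two endpoint values cancel. *)
  case: ifPn => // /negP; rewrite inE /= in_itv/= => hy.
  rewrite /H1 /H2 /rho ler0_sqrtr ?addr0 ?subr0 ?subrr//.
  rewrite subr_le0 leNgt; apply/negP => h; apply: hy.
  have : `|y - c.2| < 1 by rewrite -(@expr_lt1 _ 2)// real_normK// num_real.
  by rewrite ltr_norml => /andP[? ?]; apply/andP; split; lra.
have i1 := continuous_itv_intg (c.2 - 1) (c.2 + 1) cH1.
have i2 := continuous_itv_intg (c.2 - 1) (c.2 + 1) cH2.
have mI (a b : R) : measurable (`[a, b]%classic : set (measurableTypeR R)) by exact: measurable_itv.
rewrite (RintB (mI _ _) i1 i2).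
have [P1 dP1] := primitive_exists cH1; have [P2 dP2] := primitive_exists cH2.
have l11 : c.2 - 1 <= c.2 + 1 by lra.
rewrite (integral_primitive cH1 dP1 l11) (integral_primitive cH2 dP2 l11).
have dphi t : is_derive t (1 : R) (fun t => c.2 + sin t) (cos t).
  by rewrite -[cos t]add0r; apply: is_deriveD.
have pi0 : 0 < pi :> R by exact: pi_gt0.
have l1 : - (pi / 2) <= pi / 2 :> R by lra.
have l2 : pi / 2 <= - (pi / 2) + pi *+ 2 :> R by rewrite -mulr_natr; lra.
have s1 := integral_substitution cH1 dP1 dphi (@continuous_cos R) l1.
have s2 := integral_substitution cH2 dP2 dphi (@continuous_cos R) l2.
have e3 : - (pi / 2) + pi *+ 2 = pi + pi / 2 :> R by rewrite -mulr_natr; field.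
have e4 : sin (pi + pi / 2) = -1 :> R by rewrite sinDpihalf cospi.
rewrite e3 e4 in s2; rewrite e3 in l2 *.
rewrite sinN sin_pihalf in s1; rewrite sin_pihalf in s2.
have cE : continuous (fun t => F (circle c t) * cos t).
  move=> t; apply: cvgM; last exact: continuous_cos.
  exact: continuous_on_circle.
rewrite (integral_itv_cat cE l1 l2).
have rE t : rho (c.2 + sin t) = `|cos t|.
  rewrite /rho (_ : c.2 + sin t - c.2 = sin t); last by ring.
  by rewrite -sqrtr_sqr; congr Num.sqrt; have := cos2Dsin2 t; lra.
have -> : J (- (pi / 2)) (pi / 2) (fun t => F (circle c t) * cos t) = P1 (c.2 + 1) - P1 (c.2 - 1).
  rewrite -s1; apply: eq_Rint => t /= ; rewrite in_itv/= => ht.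
  by rewrite /H1 rE ger0_norm// cos_ge0_pihalf.
have -> : J (pi / 2) (pi + pi / 2) (fun t => F (circle c t) * cos t) = P2 (c.2 - 1) - P2 (c.2 + 1).
  rewrite -s2; apply: eq_Rint => t /= ; rewrite in_itv/= => /andP[t1 t2].
  rewrite /H2 rE ler0_norm ?opprK//.
  have : 0 <= cos (t - pi) by apply: cos_ge0_pihalf; apply/andP; split; lra.
  have := cosDpi (t - pi); rewrite subrK => ->; lra.
ring.
Qed.

(** Extends the Tonelli argument to signed functions, written as (f + |f|) - |f|. *)
Lemma swap_integral_continuous Omega f r : open Omega -> Omega `<=` square_box r -> continuous f ->
  I (swap2 @^-1` Omega) (f \o swap2) = I Omega f.
Proof.
move=> oO bO cf; have oO' : open (swap2 @^-1` Omega).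
  by apply: open_comp => // z _; exact: swap2_continuous.
have bO' : swap2 @^-1` Omega `<=` square_box r by move=> z /bO[].
have ca : continuous (fun z => `|f z|) by move=> z; apply: cvg_norm; exact: cf.
have cs : continuous (fun z => f z + `|f z|) by move=> z; apply: cvgD; [exact: cf|exact: ca].
have cg (g : R * R -> R) : continuous g -> intg leb2 (Omega : set (plane R)) g.
  by move=> cg; apply: (sqint_intg (domain_measurable oO) (domain_finite oO bO)); exact: (continuous_sqint oO bO).
have cg' (g : R * R -> R) : continuous g -> intg leb2 (swap2 @^-1` Omega : set (plane R)) (g \o swap2).
  move=> cg0; apply: (sqint_intg (domain_measurable oO') (domain_finite oO' bO')); apply: (continuous_sqint oO' bO').
  by move=> z; apply: continuous_comp; [exact: swap2_continuous|exact: cg0].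
have -> : I Omega f = I Omega (fun z => f z + `|f z|) - I Omega (fun z => `|f z|).
  by rewrite -(RintB (domain_measurable oO) (cg _ cs) (cg _ ca)); apply: eq_Rint => z _; rewrite addrK.
rewrite -(swap_integral oO cs); last by move=> z; have := ler_norm (- f z); rewrite normrN; lra.
rewrite -(swap_integral oO ca)// -(RintB (domain_measurable oO') (cg' _ cs) (cg' _ ca)).
by apply: eq_Rint => z _ /=; rewrite addrK.
Qed.

(** The previous lemma after exchanging coordinates, which replaces the angle t by pi/2 - t. *)
Lemma disc_pderiv1 c F : smooth F ->
  I (eball c 1) (pderiv ord_max F) = J (- pi) (- pi + pi *+ 2) (fun t => F (circle c t) * sin t).
Proof.
move=> sF; have c0 := smooth_continuous sF.
have eD : swap2 @^-1` eball (swap2 c) 1 = eball c 1.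
  by apply/seteqP; split=> z; rewrite /eball /enorm /dotp /swap2 /= [X in Num.sqrt X < _]addrC.
have ce : continuous (pderiv ord0 (F \o swap2)).
  by apply: (pderiv_continuous (k := 0)); exact: (swap_smooth sF 1%N).
rewrite -{1}eD (eq_Rint leb2 (g := pderiv ord0 (F \o swap2) \o swap2)); last first.
  by move=> z _ /=; rewrite pderiv_swap /swap2/=; case: z.
rewrite (swap_integral_continuous (@open_eball R (swap2 c) 1) (@eball_square_box _ 1) ce).
rewrite (disc_pderiv0 _ (swap_smooth sF 1%N)).
pose f t := F (circle c t) * sin t.
have cf : continuous f.
  move=> t; apply: cvgM; last exact: continuous_sin.
  exact: continuous_on_circle.
have [P dP] := primitive_exists cf.
have dphi t : is_derive t (1 : R) (fun t => pi / 2 - t) (-1).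
  by rewrite -[X in is_derive _ _ _ X]sub0r; apply: is_deriveB.
have pi0 : 0 < pi :> R by exact: pi_gt0.
have l0 : 0 <= pi *+ 2 :> R by rewrite mulrn_wge0// ltW.
have le1 : - (pi / 2) <= - (pi / 2) + pi *+ 2 :> R by rewrite lerDl.
have le2 : - pi <= - pi + pi *+ 2 :> R by rewrite lerDl.
have := integral_substitution cf dP dphi (@cst_continuous _ _ _) le1.
rewrite (_ : pi / 2 - (- (pi / 2) + pi *+ 2) = - pi); last by rewrite -mulr_natr; field.
rewrite (_ : pi / 2 - - (pi / 2) = - pi + pi *+ 2); last by rewrite -mulr_natr; field.
rewrite -[RHS]opprB -(integral_primitive cf dP le2) => /eqP; rewrite -eqr_oppLR => /eqP <-.
have cfp : continuous (fun t => f (pi / 2 - t)).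
  move=> t; apply: (continuous_comp (f := fun t => pi / 2 - t) (g := f)); last exact: cf.
  by apply: cvgB; [exact: cvg_cst|exact: cvg_id].
have mI (a b : R) : measurable (`[a, b]%classic : set (measurableTypeR R)) by exact: measurable_itv.
rewrite -(RintN (mI _ _)); last first.
  apply: continuous_itv_intg => t; apply: cvgM; [exact: cfp|exact: cvg_cst].
apply: eq_Rint => t _; rewrite mulrN1 opprK /f /circle /swap2 /=.
have -> : sin (pi / 2 - t) = cos t by rewrite -[LHS]opprK -sinN opprB sinBpihalf opprK.
by have -> : cos (pi / 2 - t) = sin t by rewrite -cosN opprB cosBpihalf.
Qed.

Definition coord (i : 'I_2) z := if i == ord0 then z.1 else z.2.

(** On the unit circle the outward normal is the position relative to the centre. The starting angle
    of gamma disappears by periodicity. *)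
Lemma disc_divergence c gamma (l : R) i F : arclength_param (eball c 1) gamma l -> smooth F ->
  I (eball c 1) (pderiv i F) = J 0 l (fun s => F (gamma s) * coord i (gamma s - c)).
Proof.
move=> ag sF; have [-> [s0 hs]] := disc_param ag; have c0 := smooth_continuous sF.
have gE s : gamma s = circle c (s + s0).
  have [h1 h2] := hs s; apply: pair_equal_spec_coord; rewrite /=; [rewrite -h1|rewrite -h2]; by rewrite addrC subrK.
have l0 : 0 <= pi *+ 2 :> R by rewrite mulrn_wge0// ltW// pi_gt0.
have dphi t : is_derive t (1 : R) (fun t => t + s0) 1.
  by rewrite -[X in is_derive _ _ _ X]addr0; apply: is_deriveD.
have main (g : R -> R) a : continuous g -> (forall x, g (x + pi *+ 2) = g x) ->
    J 0 (pi *+ 2) (fun s => g (s + s0)) = J a (a + pi *+ 2) g.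
  move=> cg pg; have [P dP] := primitive_exists cg.
  have := integral_substitution cg dP dphi (@cst_continuous _ _ _) l0.
  rewrite -(integral_primitive cg dP) ?lerD2r// add0r [pi *+ 2 + _]addrC (integral_period s0 a cg pg l0) => <-.
  by apply: eq_Rint => t _; rewrite mulr1.
have cFc : continuous (fun t => F (circle c t)) by exact: continuous_on_circle.
have pc t : circle c (t + pi *+ 2) = circle c t by rewrite /circle cosD2pi sinD2pi.
move: i; apply: ord2_ind.
  rewrite (disc_pderiv0 _ (sF 1%N)) -(main (fun t => F (circle c t) * cos t)); first last.
  - by move=> x; rewrite pc cosD2pi.
  - by move=> t; apply: cvgM; [exact: cFc|exact: continuous_cos].
  by apply: eq_Rint => s _; rewrite -gE -(hs s).1.
rewrite (disc_pderiv1 _ sF) -(main (fun t => F (circle c t) * sin t)); first last.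
- by move=> x; rewrite pc sinD2pi.
- by move=> t; apply: cvgM; [exact: cFc|exact: continuous_sin].
by apply: eq_Rint => s _; rewrite -gE -(hs s).2.
Qed.
End divergence.

(** * Smooth functions as admissible functions *)

Section smooth_admissible.
Context {R : realType}.
Variables (Omega : set (R * R)) (r : R).
Hypotheses (oO : open Omega) (bO : Omega `<=` square_box r).
Hypothesis C2 : C2_boundary Omega.

Local Notation mu := (@leb2 R).
Local Notation I := (Rintegral mu (Omega : set (plane R))).
Let mOm : measurable (Omega : set (plane R)) := domain_measurable oO.

Lemma weak_pderiv_ae_l j (w w' : R * R -> R) h : L2 Omega w -> L2 Omega w' ->
  ae_eq mu (Omega : set (plane R)) w w' -> is_weak_pderiv Omega j w h -> is_weak_pderiv Omega j w' h.
Proof.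
move=> w2 w2' ww' /(is_weak_pderivP oO bO _ _ w2)[h2 hw].
apply/(is_weak_pderivP oO bO _ _ w2'); split => // phi tp; rewrite -hw//.
have cp := smooth_continuous (smooth_pderiv j (test_fun_smooth tp)).
have [mp _] := continuous_sqint oO bO cp.
have [mw _] := (L2P oO w).1 w2; have [mw' _] := (L2P oO w').1 w2'.
apply: (ae_eq_Rint mOm); [exact: measurable_funM|exact: measurable_funM|].
by apply: filterS ww' => z /= e Oz; rewrite e.
Qed.

Variable v : R * R -> R.
Hypothesis sv : smooth v.

Lemma smooth_pderiv_L2 i : L2 Omega (pderiv i v).
Proof. exact: (smooth_L2 oO bO (smooth_pderiv i sv)). Qed.

Lemma smooth_W12 : W12 Omega v.
Proof.
by split=> [|i]; [exact: (smooth_L2 oO bO sv)|exists (pderiv i v); exact: (smooth_weak_pderiv oO bO)].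
Qed.

Lemma smooth_wpderiv i : ae_eq mu (Omega : set (plane R)) (wpderiv Omega i v) (pderiv i v).
Proof.
apply: (weak_pderiv_unique oO bO (smooth_L2 oO bO sv)); first exact: is_weak_wpderiv smooth_W12.
exact: (smooth_weak_pderiv oO bO).
Qed.

Let w2 i : L2 Omega (wpderiv Omega i v). Proof. by have [] := is_weak_wpderiv i smooth_W12. Qed.

Lemma smooth_weak_pderiv2 i j : is_weak_pderiv Omega j (wpderiv Omega i v) (pderiv j (pderiv i v)).
Proof.
apply: (weak_pderiv_ae_l (smooth_pderiv_L2 i) (w2 i)); last exact: (smooth_weak_pderiv oO bO j (smooth_pderiv i sv)).
by apply: filterS (smooth_wpderiv i) => z /= e Oz; rewrite e.
Qed.

Lemma smooth_W12_grad i : W12 Omega (wpderiv Omega i v).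
Proof. by split=> [|j]; [exact: w2|exists (pderiv j (pderiv i v)); exact: smooth_weak_pderiv2]. Qed.

Lemma smooth_wpderiv2 i j :
  ae_eq mu (Omega : set (plane R)) (wpderiv Omega j (wpderiv Omega i v)) (pderiv j (pderiv i v)).
Proof.
apply: (weak_pderiv_unique oO bO (w2 i)); first exact: is_weak_wpderiv (smooth_W12_grad i).
exact: smooth_weak_pderiv2.
Qed.

(** The constant sequence phi approximates w. The function w is only almost everywhere equal to phi
    because it will be a representative chosen by [wpderiv]. *)
Lemma trace_of_smooth (phi w : R * R -> R) : smooth phi -> L2 Omega w ->
  (forall j, is_weak_pderiv Omega j w (pderiv j phi)) ->
  ae_eq mu (Omega : set (plane R)) w phi -> has_trace Omega w (fun s => phi (bd_curve Omega s)).
Proof.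
move=> sp w2' hw wphi; have cc := bd_curve_continuous C2.
have cps : continuous (fun s => phi (bd_curve Omega s)).
  by move=> s; apply: continuous_comp; [exact: cc|exact: smooth_continuous sp _].
split.
  by apply: measurable_funTS; exact: continuous_measurable_fun.
exists (fun=> phi); split => //.
  have p2 := smooth_L2 oO bO sp.
  have d2 : L2 Omega (phi \- w) by apply/(L2P oO); apply: (sqintB mOm); apply/(L2P oO).
  have e : W12norm Omega (phi \- w) = 0%E.
    rewrite (W12normE oO bO (g := fun i z => pderiv i phi z - pderiv i phi z) d2); last first.
      by move=> i; apply: (weak_pderivB oO bO p2 w2' _ (hw i)); exact: (smooth_weak_pderiv oO bO).
    have z0 : I (fun=> (0 : R)) = 0 by rewrite /Rintegral integral0.
    have -> : I (fun z => (phi \- w) z ^+ 2) = 0.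
      rewrite -[RHS]z0; have [m1 _] := (L2P oO _).1 d2.
      apply: (ae_eq_Rint mOm); [exact: measurable_funX|exact: measurable_cst|].
      by apply: filterS wphi => z /= h Oz; rewrite h// subrr expr0n.
    have zz i : I (fun z => (pderiv i phi z - pderiv i phi z) ^+ 2) = 0.
      by rewrite -[RHS]z0; apply: eq_Rint => z _; rewrite subrr expr0n.
    by rewrite !zz !addr0 sqrtr0.
  rewrite e; exact: cvg_cst.
rewrite (_ : (fun _ => _) = cst 0%E); first exact: cvg_cst.
apply/funext => n /=; rewrite integral0_eq// => s _; by rewrite subrr expr0n.
Qed.

Lemma smooth_Lambda : (forall s, v (bd_curve Omega s) = 0) ->
  (forall s, dotp (pderiv ord0 v (bd_curve Omega s), pderiv ord_max v (bd_curve Omega s))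
    (inward_normal Omega s) = 1) -> Lambda Omega v.
Proof.
move=> v0 vn; split.
- by split; [exact: smooth_W12|exact: smooth_W12_grad].
- have := trace_of_smooth sv (smooth_L2 oO bO sv) (fun j => smooth_weak_pderiv oO bO j sv) (ae_eq_refl _ _ _).
  by rewrite (_ : (fun s => _) = fun=> 0)//; apply/funext.
- exists (fun i s => pderiv i v (bd_curve Omega s)); split.
    move=> i; apply: (trace_of_smooth (smooth_pderiv i sv)) => //.
    + by move=> j; exact: smooth_weak_pderiv2.
    + exact: smooth_wpderiv.
  exact: aeW.
Qed.

Lemma smooth_well_energy : well_energy Omega v =
  I (fun z => (1 - (pderiv ord0 v z ^+ 2 + pderiv ord_max v z ^+ 2)) ^+ 2).
Proof.
have mw i : measurable_fun (Omega : set (plane R)) (wpderiv Omega i v : plane R -> measurableTypeR R).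
  by have [] := (L2P oO _).1 (w2 i).
have mp i : measurable_fun (Omega : set (plane R)) (pderiv i v : plane R -> measurableTypeR R).
  by have [] := (L2P oO _).1 (smooth_pderiv_L2 i).
have e : I (fun z => (1 - wgrad_sq Omega v z) ^+ 2) =
    I (fun z => (1 - (wpderiv Omega ord0 v z ^+ 2 + wpderiv Omega ord_max v z ^+ 2)) ^+ 2).
  by apply: eq_Rint => z _; rewrite /wgrad_sq sum2.
rewrite /well_energy e; apply: (ae_eq_Rint mOm).
- apply: measurable_funX; apply: measurable_funB; first exact: measurable_cst.
  by apply: measurable_funD; apply: measurable_funX; exact: mw.
- apply: measurable_funX; apply: measurable_funB; first exact: measurable_cst.
  by apply: measurable_funD; apply: measurable_funX; exact: mp.
by apply: filterS2 (smooth_wpderiv ord0) (smooth_wpderiv ord_max) => z /= h0 h1 Oz; rewrite h0// h1.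
Qed.

Lemma smooth_hess_energy : hess_energy Omega v =
  I (fun z => pderiv ord0 (pderiv ord0 v) z ^+ 2 + pderiv ord_max (pderiv ord0 v) z ^+ 2
    + (pderiv ord0 (pderiv ord_max v) z ^+ 2 + pderiv ord_max (pderiv ord_max v) z ^+ 2)).
Proof.
have mw i j : measurable_fun (Omega : set (plane R)) (wpderiv Omega j (wpderiv Omega i v) : plane R -> measurableTypeR R).
  by have [/(L2P oO)[]] := is_weak_wpderiv j (smooth_W12_grad i).
have mp i j : measurable_fun (Omega : set (plane R)) (pderiv j (pderiv i v) : plane R -> measurableTypeR R).
  by have [] := (L2P oO _).1 (smooth_L2 oO bO (smooth_pderiv j (smooth_pderiv i sv))).
have e := eq_Rint mu (fun z (_ : Omega z) => whess_sqE Omega v z).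
rewrite /hess_energy e; apply: (ae_eq_Rint mOm).
- by apply: measurable_funD; apply: measurable_funD; apply: measurable_funX; exact: mw.
- by apply: measurable_funD; apply: measurable_funD; apply: measurable_funX; exact: mp.
have hh i : ae_eq mu (Omega : set (plane R))
    (fun z => wpderiv Omega ord0 (wpderiv Omega i v) z ^+ 2 + wpderiv Omega ord_max (wpderiv Omega i v) z ^+ 2)
    (fun z => pderiv ord0 (pderiv i v) z ^+ 2 + pderiv ord_max (pderiv i v) z ^+ 2).
  apply: filterS2 (smooth_wpderiv2 i ord0) (smooth_wpderiv2 i ord_max) => z /= k0 k1 Oz.
  by rewrite k0// k1.
apply: filterS2 (hh ord0) (hh ord_max) => z k0 k1 Oz; exact: (f_equal2 +%R (k0 Oz) (k1 Oz)).
Qed.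
End smooth_admissible.

(** * The competitor on the unit disc *)

Lemma pderiv_comp_at (R : realType) i (h : R -> R) (f : R * R -> R) z : derivable h (f z) 1 ->
  differentiable f z -> pderiv i (fun z => h (f z)) z = derive1 h (f z) * pderiv i f z.
Proof.
move=> dh1 df; have /derivable1_diffP dh := dh1; rewrite /pderiv.
have dhf : differentiable (h \o f) z by exact: differentiable_comp.
rewrite (_ : (fun z => h (f z)) = h \o f)// !deriveE// diff_comp//.
by rewrite /= deriv1E// mulrC.
Qed.

Section regularized_norm.
Context {R : realType}.
Variables (c : R * R) (e : R).
Hypothesis e0 : 0 < e.
Implicit Types z : R * R.

Definition centered (i : 'I_2) (z : R * R) : R := coord i (z - c).
Definition sqdist (z : R * R) : R := (z.1 - c.1) ^+ 2 + (z.2 - c.2) ^+ 2.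

Lemma sqdistE z : sqdist z = centered ord0 z ^+ 2 + centered ord_max z ^+ 2.
Proof. by []. Qed.

Lemma Ck_centered k i : Ck k (centered i).
Proof.
move: i; apply: ord2_ind; first by apply: CkB; [exact: Ck_fst|exact: Ck_cst].
by apply: CkB; [exact: Ck_snd|exact: Ck_cst].
Qed.

Lemma Ck_sqdist k : Ck k sqdist.
Proof.
rewrite (_ : sqdist = fun z => centered ord0 z * centered ord0 z + centered ord_max z * centered ord_max z).
  by apply: CkD; apply: CkM; exact: Ck_centered.
by apply/funext => z; rewrite sqdistE !expr2.
Qed.

Lemma pderiv_centered i j : pderiv i (centered j) = fun=> (i == j)%:R.
Proof.
have d1 := @differentiable_fst R; have d2 := @differentiable_snd R.
have dc (a : R) z : differentiable (fun=> a : R) z by exact: differentiable_cst.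
have -> : centered j = fun z => (if j == ord0 then z.1 else z.2) + (if j == ord0 then - c.1 else - c.2).
  by apply/funext => z; rewrite /centered /coord; case: ifP.
move: j; apply: ord2_ind => /=; rewrite pderivD//= pderiv_cst ?pderiv_fst ?pderiv_snd; apply/funext => z;
  by move: i; apply: ord2_ind; rewrite /basis2/= addr0.
Qed.

Lemma pderiv_sqdist i : pderiv i sqdist = fun z => 2 * centered i z.
Proof.
have dc j z : differentiable (centered j) z by exact: (Ck_diff (Ck_centered 1 j)).
have -> : sqdist = fun z => centered ord0 z * centered ord0 z + centered ord_max z * centered ord_max z.
  by apply/funext => z; rewrite sqdistE !expr2.
rewrite pderivD; last 2 first.
- by move=> z; apply: differentiableM.
- by move=> z; apply: differentiableM.
rewrite !pderivM// !pderiv_centered; apply/funext => z; move: i; apply: ord2_ind => /=; ring.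
Qed.

(** The reciprocal of the regularised norm, rather than the norm, is the basic function: its
    derivatives are polynomials in the coordinates and itself, so smoothness is an induction, and
    the gradient and Hessian of the competitor are expressed through it. *)
Definition inv_regnorm (z : R * R) : R := (Num.sqrt (sqdist z + e ^+ 2))^-1.

Let pos z : 0 < sqdist z + e ^+ 2.
Proof. by rewrite ltr_wpDl ?exprn_gt0// addr_ge0 ?sqr_ge0. Qed.

Lemma inv_regnorm_gt0 z : 0 < inv_regnorm z.
Proof. by rewrite invr_gt0 sqrtr_gt0. Qed.

Lemma inv_regnorm_sqr z : (sqdist z + e ^+ 2) * inv_regnorm z ^+ 2 = 1.
Proof. by rewrite exprVn sqr_sqrtr ?ltW// divff// gt_eqF. Qed.

Lemma is_derive_inv_sqrt (y : R) : 0 < y ->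
  is_derive y (1 : R) (fun y => (Num.sqrt y)^-1) (- (2^-1 * (Num.sqrt y)^-1 ^+ 3)).
Proof.
move=> y0; have s0 : Num.sqrt y != 0 by rewrite gt_eqF// sqrtr_gt0.
have h := is_deriveV s0 (is_derive1_sqrt y0).
by apply: is_derive_eq h _; rewrite /GRing.scale/=; field.
Qed.

Lemma inv_regnorm_diff z : differentiable inv_regnorm z.
Proof.
apply: (@differentiable_comp _ _ _ _ (fun z => sqdist z + e ^+ 2) (fun y => (Num.sqrt y)^-1)).
  by apply: differentiableD => //; exact: (Ck_diff (Ck_sqdist 1)).
by apply/derivable1_diffP; have [] := is_derive_inv_sqrt (pos z).
Qed.

Lemma pderiv_inv_regnorm i : pderiv i inv_regnorm = fun z => - (centered i z * inv_regnorm z ^+ 3).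
Proof.
apply/funext => z; have ds : differentiable (fun z => sqdist z + e ^+ 2) z.
  by apply: differentiableD => //; exact: (Ck_diff (Ck_sqdist 1)).
have dh := is_derive_inv_sqrt (pos z).
rewrite (pderiv_comp_at i (h := fun y => (Num.sqrt y)^-1) (f := fun z => sqdist z + e ^+ 2) _ ds); last by case: dh.
rewrite derive1E; have [_ ->] := dh.
rewrite (pderivD _ (Ck_diff (Ck_sqdist 1)) (Ck_diff (Ck_cst 1 _))) pderiv_sqdist pderiv_cst /inv_regnorm.
by field; rewrite gt_eqF// sqrtr_gt0.
Qed.

Lemma smooth_inv_regnorm : smooth inv_regnorm.
Proof.
elim=> [z|k IH]; first by apply: differentiable_continuous; exact: inv_regnorm_diff.
split=> [|i]; first exact: inv_regnorm_diff.
rewrite pderiv_inv_regnorm; apply: CkN; apply: CkM; first exact: Ck_centered.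
rewrite (_ : (fun z => _) = fun z => inv_regnorm z * (inv_regnorm z * inv_regnorm z)).
  by apply: CkM => //; exact: CkM.
by apply/funext => z; rewrite !exprS expr0 mulr1.
Qed.

End regularized_norm.
Section affine_pderiv.
Context {R : realType}.
Implicit Types (f : R * R -> R) (a : R).

Lemma pderivZ i a f : (forall z, differentiable f z) -> pderiv i (fun z => a * f z) = fun z => a * pderiv i f z.
Proof.
move=> df; rewrite (pderivM _ (Ck_diff (Ck_cst 1 a)) df) pderiv_cst; apply/funext => z.
by rewrite mul0r add0r.
Qed.

Lemma pderivC_add i a f : pderiv i (fun z => a + f z) = pderiv i f.
Proof.
apply/funext => z; rewrite /pderiv /derive.
rewrite (_ : (fun h : R => h^-1 *: (((fun z => a + f z) \o shift z) (h *: basis2 i) - (a + f z))) =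
  (fun h : R => h^-1 *: ((f \o shift z) (h *: basis2 i) - f z)))//.
by apply/funext => h /=; rewrite opprD addrACA subrr add0r.
Qed.

Lemma pderiv_addC i a f : pderiv i (fun z => f z + a) = pderiv i f.
Proof.
by rewrite -(pderivC_add i a f); congr pderiv; apply/funext => z; exact: addrC.
Qed.
End affine_pderiv.

Section competitor.
Context {R : realType}.
Variables (c : R * R) (e : R).
Hypothesis e0 : 0 < e.
Implicit Types z : R * R.

Local Notation J a b := (Rintegral (@lebesgue_measure R) (`[a, b]%classic : set (measurableTypeR R))).
Local Notation I D := (Rintegral (@leb2 R) (D : set (plane R))).
Local Notation T := (inv_regnorm c e).
Local Notation q := (sqdist c).
Local Notation x := (centered c).
Local Notation b := ((Num.sqrt (1 + e ^+ 2))^-1).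

Lemma inv_sqrt_bounds : [/\ 0 < b, (1 + e ^+ 2) * b ^+ 2 = 1 & 0 <= 1 - b <= e ^+ 2].
Proof.
have p1 : 0 < 1 + e ^+ 2 by rewrite ltr_wpDr// sqr_ge0.
have b0 : 0 < b by rewrite invr_gt0 sqrtr_gt0.
have be : (1 + e ^+ 2) * b ^+ 2 = 1 by rewrite exprVn sqr_sqrtr ?ltW// divff// gt_eqF.
have := sqr_ge0 e; split=> //; move: b0 be; set y := b => y0 ye.
have y1 : y <= 1 by rewrite leNgt; apply/negP => h; nra.
by apply/andP; split; nra.
Qed.

(* A smoothing of the cone 1 - |z - c| at scale e: sqrt(1 + e^2) - sqrt(|z - c|^2 + e^2), with a quadratic correction
   that makes the inward normal derivative equal to 1 on the unit circle. *)
Definition competitor z := b^-1 - (q z + e ^+ 2) * T z + (b - 1) / 2 * (q z - 1).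

Lemma smooth_competitor : smooth competitor.
Proof.
move=> k; apply: CkD; last by apply: CkM; [exact: Ck_cst|apply: CkB; [exact: Ck_sqdist|exact: Ck_cst]].
apply: CkB; first exact: Ck_cst.
by apply: CkM; [apply: CkD; [exact: Ck_sqdist|exact: Ck_cst]|exact: smooth_inv_regnorm].
Qed.

(** On the unit circle [inv_regnorm] equals b, so the gradient there is exactly minus the position,
    as the boundary condition demands. *)
Lemma pderiv_competitor i : pderiv i competitor = fun z => x i z * (b - 1 - T z).
Proof.
have cq := Ck_sqdist c 1; have cT := smooth_inv_regnorm c e0 1%N.
have cp (a : R) : Ck 1 (fun z => q z + a) by apply: CkD => //; exact: Ck_cst.
have cm : Ck 1 (fun z => (q z + e ^+ 2) * T z) by apply: CkM.
have -> : competitor = fun z => b^-1 + ((-1) * ((q z + e ^+ 2) * T z) + (b - 1) / 2 * (q z + -1)).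
  by apply/funext => z; rewrite /competitor mulN1r addrA.
rewrite pderivC_add pderivD; [|exact: Ck_diff (CkZ _ cm)|exact: Ck_diff (CkZ _ (cp _))].
rewrite (pderivZ _ _ (Ck_diff cm)) (pderivZ _ _ (Ck_diff (cp _))) (pderivM _ (Ck_diff (cp _)) (Ck_diff cT)).
rewrite !pderiv_addC pderiv_sqdist (pderiv_inv_regnorm c e0); apply/funext => z.
have := inv_regnorm_sqr c e0 z; move: (q z) (T z) (x i z) (b) => Q t X B h.
have -> : (Q + e ^+ 2) * - (X * t ^+ 3) = - (X * t).
  by rewrite (_ : _ * _ = - (X * t * ((Q + e ^+ 2) * t ^+ 2))); [rewrite h mulr1|ring].
by field.
Qed.

Lemma pderiv2_competitor i j : pderiv j (pderiv i competitor) =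
  fun z => (j == i)%:R * (b - 1 - T z) + x i z * x j z * T z ^+ 3.
Proof.
have cT := smooth_inv_regnorm c e0 1%N; have cx := Ck_centered c 1 i.
have -> : pderiv i competitor = fun z => x i z * ((b - 1) + (-1) * T z).
  by rewrite pderiv_competitor; apply/funext => z; rewrite mulN1r.
rewrite (pderivM _ (Ck_diff cx) (Ck_diff (CkD (Ck_cst 1 _) (CkZ (-1) cT)))) pderiv_centered.
rewrite pderivC_add (pderivZ _ _ (Ck_diff cT)) (pderiv_inv_regnorm c e0); apply/funext => z; ring.
Qed.

Lemma sqdist_ball z : eball c 1 z -> 0 <= q z < 1.
Proof.
rewrite /eball /= => h; rewrite addr_ge0 ?sqr_ge0//=.
by have := enorm_sqr (z - c); rewrite /sqdist /= => <-; rewrite expr_lt1// enorm_ge0.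
Qed.

Hypothesis e1 : e <= 1.

Lemma inv_regnorm_ge z : eball c 1 z -> 1 <= 2 * T z ^+ 2.
Proof.
move=> /sqdist_ball/andP[q0 q1]; have := inv_regnorm_sqr c e0 z.
have e21 : e ^+ 2 <= 1 by rewrite expr_le1// ltW.
have : 0 <= (2 - (q z + e ^+ 2)) * T z ^+ 2 by rewrite mulr_ge0 ?sqr_ge0//; lra.
by rewrite mulrBl; lra.
Qed.

(** With Q = |x|^2, T the reciprocal norm and m = 1 - b, the identity (Q + e^2) T^2 = 1 turns 1 -
    |grad|^2 into e^2 T^2 minus two corrections bounded together by 3 e^2. As 1 <= 2 T^2 on the
    disc, everything is at most 7 e^2 T^2. *)
Lemma competitor_well z : eball c 1 z ->
  (1 - (pderiv ord0 competitor z ^+ 2 + pderiv ord_max competitor z ^+ 2)) ^+ 2 <= 49 * (e ^+ 4 * T z ^+ 4).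
Proof.
move=> Oz; have t2 := inv_regnorm_ge Oz; have /andP[q0 q1] := sqdist_ball Oz.
have [_ _ /andP[m0 me]] := inv_sqrt_bounds.
rewrite !pderiv_competitor (_ : 49 * _ = (7 * (e ^+ 2 * T z ^+ 2)) ^+ 2); last by ring.
have h := inv_regnorm_sqr c e0 z; have t0 := inv_regnorm_gt0 c e0 z.
have -> : (x ord0 z * (b - 1 - T z)) ^+ 2 + (x ord_max z * (b - 1 - T z)) ^+ 2 = q z * (T z + (1 - b)) ^+ 2.
  by rewrite sqdistE; ring.
have e20 := sqr_ge0 e; have e21 : e ^+ 2 <= 1 by rewrite expr_le1// ltW.
move: (1 - b) m0 me (q z) q0 q1 (T z) t0 h t2 => m m0 me Q q0 q1 t t0 h t2.
have e' : 1 - Q * (t + m) ^+ 2 = e ^+ 2 * t ^+ 2 - 2 * m * (Q * t) - m ^+ 2 * Q.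
  by rewrite -{1}h; ring.
rewrite e'; move: (e ^+ 2) e20 e21 me h => E e20 e21 me h.
have Qt0 : 0 <= Q * t by rewrite mulr_ge0// ltW.
have Qt1 : Q * t <= 1.
  rewrite -(@expr_le1 _ 2)//.
  have -> : (Q * t) ^+ 2 = Q * (Q * t ^+ 2) by ring.
  have := sqr_ge0 t; move: (t ^+ 2) h => s h s0.
  have Es : 0 <= E * s by rewrite mulr_ge0.
  by apply: mulr_ile1 => //; [exact: mulr_ge0|exact: ltW|move: h; rewrite mulrDl; lra].
have a1 : 0 <= m * (Q * t) <= E by apply/andP; split; nra.
have a2 : 0 <= m ^+ 2 * Q <= E.
  have : m ^+ 2 <= E by nra.
  by have := sqr_ge0 m; move: (m ^+ 2) => s s0 s1; apply/andP; split; nra.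
have a3 : E <= 2 * (E * t ^+ 2) by nra.
rewrite -subr_ge0 subr_sqr mulr_ge0//; lra.
Qed.

(** Each diagonal entry is -(m + T) plus a multiple of T^3, with m = 1 - b and (m + T)^2 <= 6 T^2.
    The two diagonal terms contribute 24 T^2, and the rank one part at most 2 T^2. *)
Lemma competitor_hess z : eball c 1 z ->
  pderiv ord0 (pderiv ord0 competitor) z ^+ 2 + pderiv ord_max (pderiv ord0 competitor) z ^+ 2
  + (pderiv ord0 (pderiv ord_max competitor) z ^+ 2 + pderiv ord_max (pderiv ord_max competitor) z ^+ 2)
  <= 26 * T z ^+ 2.
Proof.
move=> Oz; have t2 := inv_regnorm_ge Oz; have /andP[q0 q1] := sqdist_ball Oz.
have [_ _ /andP[m0 me]] := inv_sqrt_bounds.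
rewrite !pderiv2_competitor /=.
have h := inv_regnorm_sqr c e0 z; have t0 := inv_regnorm_gt0 c e0 z.
have e20 := sqr_ge0 e; have e21 : e ^+ 2 <= 1 by rewrite expr_le1// ltW.
have m1 : 1 - b <= 1 by lra.
have -> : b - 1 - T z = - ((1 - b) + T z) by ring.
rewrite !mul1r !mul0r !add0r; move: (sqdistE c z) q0 q1 h.
move: (1 - b) m0 m1 (q z) (T z) t0 t2 (x ord0 z) (x ord_max z) => m m0 m1 Q t t0 t2 u w -> q0 q1 h.
have A : (u ^+ 2 + w ^+ 2) * t ^+ 2 <= 1.
  by have := sqr_ge0 t; move: h; move: (u ^+ 2 + w ^+ 2) (t ^+ 2) => s r; nra.
have m2 : m ^+ 2 <= 1 by rewrite expr_le1.
have B : (m + t) ^+ 2 <= 6 * t ^+ 2 by have := sqr_ge0 (m - t); nra.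
have C s : s * t ^+ 3 = (s * t ^+ 2) * t by ring.
have sq (a d : R) : (- a + d) ^+ 2 <= 2 * a ^+ 2 + 2 * d ^+ 2 by have := sqr_ge0 (a + d); nra.
have D : (u * u * t ^+ 3) ^+ 2 + (w * w * t ^+ 3) ^+ 2 + 2 * (u * w * t ^+ 3) ^+ 2 <= t ^+ 2.
  have -> : (u * u * t ^+ 3) ^+ 2 + (w * w * t ^+ 3) ^+ 2 + 2 * (u * w * t ^+ 3) ^+ 2 =
     ((u ^+ 2 + w ^+ 2) * t ^+ 2) ^+ 2 * t ^+ 2 by ring.
  rewrite -[leRHS]mul1r; apply: ler_wpM2r; first exact: sqr_ge0.
  by rewrite expr_le1// mulr_ge0// ?sqr_ge0.
have s1 := sq (m + t) (u * u * t ^+ 3); have s2 := sq (m + t) (w * w * t ^+ 3).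
have -> : w * u = u * w by ring.
have := sqr_ge0 (u * w * t ^+ 3); lra.
Qed.

Lemma integral_inverse_quadratic (a d : R) : 0 < a ->
  J (d - 1) (d + 1) (fun y => ((y - d) ^+ 2 + a ^+ 2)^-1) <= pi / a.
Proof.
move=> a0; have p y : (y - d) ^+ 2 + a ^+ 2 != 0 by rewrite gt_eqF// ltr_wpDl ?sqr_ge0// exprn_gt0.
have dP y : is_derive y (1 : R) (fun y => a^-1 * atan (a^-1 * (y - d))) ((y - d) ^+ 2 + a ^+ 2)^-1.
  have dl : is_derive y (1 : R) (fun y => a^-1 * (y - d)) a^-1.
    have h := is_deriveZ a^-1 (is_deriveB (is_derive_id y (1 : R)) (is_derive_cst d y (1 : R))).
    by apply: is_derive_eq h _; rewrite subr0 /GRing.scale/= mulr1.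
  have hc : is_derive y (1 : R) (atan \o (fun y => a^-1 * (y - d))) ((1 + (a^-1 * (y - d)) ^+ 2)^-1 * a^-1).
    exact: (@is_derive1_comp _ atan (fun y => a^-1 * (y - d)) y _ _ (is_derive1_atan _) dl).
  have h := is_deriveZ a^-1 hc.
  apply: is_derive_eq h _; rewrite /GRing.scale/=; field.
  by rewrite p gt_eqF.
have cf : continuous (fun y : R => ((y - d) ^+ 2 + a ^+ 2)^-1).
  move=> y; apply: cvgV; first exact: p.
  apply: cvgD; last exact: cvg_cst.
  by apply: cvgM; apply: cvgB; (try exact: cvg_cst); exact: cvg_id.
rewrite (integral_primitive cf dP); last by lra.
rewrite -mulrBr mulrC ler_wpM2r ?invr_ge0 ?ltW//.
have := atan_ltpi2 (a^-1 * (d + 1 - d)); have := atan_gtNpi2 (a^-1 * (d - 1 - d)); lra.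
Qed.

(** With a = e/2, the arithmetic-geometric mean inequality bounds T^4 by 1/4 times a product of
    functions (X^2 + a^2)^-1 of one coordinate each, whose integrals are arctangents bounded by pi /
    a. *)
Lemma integral_inv_regnorm4 : I (eball c 1) (fun z => T z ^+ 4) <= pi ^+ 2 / e ^+ 2.
Proof.
have mD : measurable (eball c 1 : set (plane R)) by apply: open_measurable2; exact: open_eball.
pose a := e / 2; have a0 : 0 < a by rewrite divr_gt0.
pose k (d y : R) := (((y - d) ^+ 2 + a ^+ 2)^-1 * \1_(`[d - 1, d + 1]%classic : set R) y)%:E.
have pos (d y : R) : 0 < (y - d) ^+ 2 + a ^+ 2 by rewrite ltr_wpDl ?sqr_ge0// exprn_gt0.
have cq (d : R) : continuous (fun y : R => ((y - d) ^+ 2 + a ^+ 2)^-1).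
  move=> y; apply: cvgV; first by rewrite gt_eqF.
  apply: cvgD; last exact: cvg_cst.
  by apply: cvgM; apply: cvgB; (try exact: cvg_cst); exact: cvg_id.
have mk d : measurable_fun setT (k d : measurableTypeR R -> \bar R).
  apply/measurable_EFinP; apply: measurable_funM; last exact: measurable_indic.
  exact: continuous_measurable_fun.
have k0 d y : (0 <= k d y)%E by rewrite lee_fin mulr_ge0// invr_ge0 ltW.
have Ik d : (\int[lebesgue_measure]_y k d y <= (pi / a)%:E)%E.
  have ii := continuous_itv_intg (d - 1) (d + 1) (cq d).
  have mI : measurable (`[d - 1, d + 1]%classic : set (measurableTypeR R)) by exact: measurable_itv.
  apply: le_trans (_ : (J (d - 1) (d + 1) (fun y => ((y - d) ^+ 2 + a ^+ 2)^-1))%:E <= _)%E.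
    rewrite -(intgE mI ii) [leRHS]integral_mkcond le_eqVlt; apply/orP; left; apply/eqP.
    apply: eq_integral => y _; rewrite /patch /k indicE; case: ifPn => _; by rewrite ?mulr1 ?mulr0.
  by rewrite lee_fin integral_inverse_quadratic.
have c4 : continuous (fun z => T z ^+ 4).
  have cT := smooth_continuous (smooth_inv_regnorm c e0).
  rewrite (_ : (fun z => _) = fun z => (T z * T z) * (T z * T z)); last by apply/funext => z; ring.
  by move=> z; apply: cvgM; apply: cvgM; exact: cT.
have i4 : intg leb2 (eball c 1 : set (plane R)) (fun z => T z ^+ 4).
  have oB := @open_eball R c 1; have bB := @eball_square_box R c 1.
  exact: (sqint_intg mD (domain_finite oB bB) (continuous_sqint oB bB c4)).
have key z : eball c 1 z -> ((T z ^+ 4)%:E <= 4^-1%:E * (k c.1 z.1 * k c.2 z.2))%E.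
  move=> Oz; have h := inv_regnorm_sqr c e0 z.
  have [h1 h2] := enorm_coord (z - c); move: Oz; rewrite /eball /= => Oz.
  have := le_lt_trans h1 Oz; have := le_lt_trans h2 Oz; rewrite !ltr_norml /= => /andP[x1 x2] /andP[x3 x4].
  rewrite /k !indicE !mem_set/= ?in_itv/=; [|by apply/andP; split; lra|by apply/andP; split; lra].
  rewrite !mulr1 -!EFinM lee_fin -!invfM -[leRHS]mul1r ler_pdivlMr ?mulr_gt0//.
  have h4 : T z ^+ 4 * (q z + e ^+ 2) ^+ 2 = 1.
    by rewrite (_ : _ * _ = ((q z + e ^+ 2) * T z ^+ 2) ^+ 2); [rewrite h expr1n|ring].
  rewrite -[leRHS]h4; apply: ler_wpM2l; first by rewrite exprn_ge0// ltW// inv_regnorm_gt0.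
  have a2 : a ^+ 2 + a ^+ 2 <= e ^+ 2 by rewrite /a; have := sqr_ge0 e; lra.
  have := pos c.1 z.1; have := pos c.2 z.2; move: a2; rewrite /sqdist.
  move: ((z.1 - c.1) ^+ 2) (sqr_ge0 (z.1 - c.1)) ((z.2 - c.2) ^+ 2) (sqr_ge0 (z.2 - c.2)) (a ^+ 2) (e ^+ 2).
  move=> u u0 v v0 A E a2 p1 p2.
  have : (u + A + (v + A)) ^+ 2 <= (u + v + E) ^+ 2.
    rewrite ler_sqr ?nnegrE; lra.
  by have := sqr_ge0 (u + A - (v + A)); lra.
have kk0 (z : plane R) : (0 <= k c.1 z.1 * k c.2 z.2)%E by exact: mule_ge0.
have mkk : measurable_fun setT (fun z : plane R => k c.1 z.1 * k c.2 z.2)%E.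
  apply: emeasurable_funM; first exact: (measurableT_comp (mk c.1) measurable_fst).
  exact: (measurableT_comp (mk c.2) measurable_snd).
have : (\int[leb2]_(z in eball c 1) (T z ^+ 4)%:E <= 4^-1%:E * ((pi / a)%:E * (pi / a)%:E))%E.
  apply: (@le_trans _ _ (\int[leb2]_(z in eball c 1) (4^-1%:E * (k c.1 z.1 * k c.2 z.2)))%E).
    apply: ge0_le_integral => //.
    - by move=> z _; rewrite lee_fin exprn_ge0// ltW// inv_regnorm_gt0.
    - by have := intg_meas i4 => /measurable_EFinP.
    - by apply: emeasurable_funM => //; exact: measurable_funTS.
  rewrite ge0_integralZl//; last exact: measurable_funTS.
  apply: lee_wpmul2l; first by rewrite lee_fin.
  apply: (@le_trans _ _ (\int[leb2]_z (k c.1 z.1 * k c.2 z.2))%E); first exact: ge0_subset_integral.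
  rewrite (integral_tensor (mk c.1) (mk c.2))//.
  by apply: lee_pmul => //; exact: integral_ge0.
rewrite (intgE mD i4) -!EFinM lee_fin => /le_trans; apply.
by rewrite /a le_eqVlt; apply/orP; left; apply/eqP; field; rewrite gt_eqF.
Qed.

End competitor.

Lemma enorm_gt0 (R : realType) (z : R * R) : (0 < enorm z) = (z != 0).
Proof.
rewrite lt_neqAle enorm_ge0 andbT eq_sym -(sqrf_eq0 (enorm z)) enorm_sqr paddr_eq0 ?sqr_ge0// !sqrf_eq0.
by case: z.
Qed.

Section disc_competitor.
Context {R : realType}.
Variable c : R * R.
Let Omega : set (R * R) := eball c 1.
Hypothesis C2 : C2_boundary Omega.
Let oO : open Omega := @open_eball R c 1.
Let bO : Omega `<=` square_box (`|c.1| + `|c.2| + 1) := @eball_square_box R c 1.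
Let ag := bd_param_spec C2.

Local Notation mu := (@leb2 R).
Local Notation I := (Rintegral mu (Omega : set (plane R))).
Let mOm : measurable (Omega : set (plane R)) := domain_measurable oO.

Lemma disc_sqdist s : sqdist c (bd_curve Omega s) = 1.
Proof. by have /enorm1P := disc_bdry (arclength_bdry ag s). Qed.

Lemma disc_inward_normal s : inward_normal Omega s = - (bd_curve Omega s - c).
Proof.
have [_ [s0 hs]] := disc_param ag; have [_ dg _ _ _] := ag.
have d1 := is_derive_fst (dg s).1; have d2 := is_derive_snd (dg s).1.
have ds : is_derive s (1 : R) (fun t => t + s0) 1.
  by rewrite -[X in is_derive _ _ _ X]addr0; apply: is_deriveD.
have k1 : is_derive s (1 : R) (fun t => (bd_curve Omega t).1) (- sin (s + s0)).
  rewrite (_ : (fun _ => _) = fun t => c.1 + (cos \o (fun t => t + s0)) t); last first.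
    by apply/funext => t /=; rewrite -(hs t).1 addrC subrK.
  have hc := @is_derive1_comp _ cos (fun t => t + s0) s _ _ (is_derive_cos _) ds.
  by rewrite mulr1 in hc; rewrite -[- sin _]add0r; apply: is_deriveD.
have k2 : is_derive s (1 : R) (fun t => (bd_curve Omega t).2) (cos (s + s0)).
  rewrite (_ : (fun _ => _) = fun t => c.2 + (sin \o (fun t => t + s0)) t); last first.
    by apply/funext => t /=; rewrite -(hs t).2 addrC subrK.
  have hc := @is_derive1_comp _ sin (fun t => t + s0) s _ _ (is_derive_sin _) ds.
  by rewrite mulr1 in hc; rewrite -[cos _]add0r; apply: is_deriveD.
have [_ e1] := d1; have [_ e2] := d2; have [_ e3] := k1; have [_ e4] := k2.
apply: pair_equal_spec_coord.
  by rewrite /inward_normal /rot90 /= -e2 e4 -(hs s).1 opprB.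
by rewrite /inward_normal /rot90 /= -e1 e3 -(hs s).2 opprB.
Qed.

Variable e : R.
Hypotheses (e0 : 0 < e) (e1 : e <= 1).
Local Notation v := (competitor c e).

Let bT s : inv_regnorm c e (bd_curve Omega s) = (Num.sqrt (1 + e ^+ 2))^-1.
Proof. by rewrite /inv_regnorm disc_sqdist. Qed.

Lemma competitor_bdry s : v (bd_curve Omega s) = 0.
Proof.
have [b0 h _] := inv_sqrt_bounds e; rewrite /competitor bT disc_sqdist subrr mulr0 addr0.
move: b0 h; set b := (Num.sqrt _)^-1 => b0 h; apply/eqP; rewrite subr_eq0; apply/eqP.
by apply: (mulIf (lt0r_neq0 b0)); rewrite mulVf ?gt_eqF// -mulrA -expr2 h.
Qed.

Lemma competitor_grad_bdry i s : pderiv i v (bd_curve Omega s) = - centered c i (bd_curve Omega s).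
Proof. by rewrite (pderiv_competitor _ e0) bT; ring. Qed.

Lemma competitor_Lambda : Lambda Omega v.
Proof.
apply: (smooth_Lambda oO bO C2 (smooth_competitor c e0)) => s; first exact: competitor_bdry.
rewrite !competitor_grad_bdry disc_inward_normal /dotp /=.
by have := disc_sqdist s; rewrite sqdistE /centered /coord /= => <-; ring.
Qed.

(** Large enough for both energies: 49 pi^2 comes from the well term, and 13 = 26 / 2 from the
    Hessian term. *)
Definition disc_const : R := 49 * pi ^+ 2 + 13 * (pi ^+ 2 + I (fun=> 1)).

Let iT2 k : intg mu (Omega : set (plane R)) (fun z => inv_regnorm c e z ^+ k).
Proof.
apply: (sqint_intg mOm (domain_finite oO bO)); apply: (continuous_sqint oO bO).
have cT := smooth_continuous (smooth_inv_regnorm c e0).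
elim: k => [|k IH]; first exact: cst_continuous.
rewrite (_ : (fun _ => _) = fun z => inv_regnorm c e z * inv_regnorm c e z ^+ k).
  by move=> z; apply: cvgM; [exact: cT|exact: IH].
by apply/funext => z; rewrite exprS.
Qed.

Let i1 : intg mu (Omega : set (plane R)) (fun=> 1 : R).
Proof. by apply: (intg_bounded mOm (domain_finite oO bO) (M := 1)) => // z _; rewrite normr1. Qed.

Let A0 : 0 <= I (fun=> 1). Proof. by apply: Rint_ge0. Qed.

Let cd i : continuous (pderiv i v) := smooth_continuous (smooth_pderiv i (smooth_competitor c e0)).

Let c_intg (f : R * R -> R) : continuous f -> intg mu (Omega : set (plane R)) f.
Proof. by move=> cf; apply: (sqint_intg mOm (domain_finite oO bO)); exact: (continuous_sqint oO bO). Qed.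

Lemma competitor_well_energy : well_energy Omega v <= disc_const * e ^+ 2.
Proof.
rewrite (smooth_well_energy oO bO (smooth_competitor c e0)).
have i4 := intgZ mOm (49 * e ^+ 4) (iT2 4%N).
apply: (@le_trans _ _ (I (fun z => 49 * e ^+ 4 * inv_regnorm c e z ^+ 4))).
  apply: (le_Rint mOm _ i4) => [|z Oz]; last by rewrite -mulrA; exact: competitor_well.
  apply: c_intg; rewrite (_ : (fun _ => _) = fun z =>
    (1 - (pderiv ord0 v z * pderiv ord0 v z + pderiv ord_max v z * pderiv ord_max v z)) *
    (1 - (pderiv ord0 v z * pderiv ord0 v z + pderiv ord_max v z * pderiv ord_max v z))); last first.
    by apply/funext => z; rewrite !expr2.
  by move=> z; apply: cvgM; (apply: cvgB; [exact: cvg_cst|]); apply: cvgD; apply: cvgM; exact: cd.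
rewrite (RintZ mOm _ (iT2 4%N)).
apply: (@le_trans _ _ (49 * e ^+ 4 * (pi ^+ 2 / e ^+ 2))).
  apply: ler_wpM2l; last exact: integral_inv_regnorm4.
  by rewrite mulr_ge0// exprn_ge0// ltW.
rewrite (_ : 49 * e ^+ 4 * (pi ^+ 2 / e ^+ 2) = 49 * pi ^+ 2 * e ^+ 2); last by field; rewrite gt_eqF.
apply: ler_wpM2r; first exact: sqr_ge0.
by rewrite /disc_const lerDl mulr_ge0// addr_ge0 ?sqr_ge0.
Qed.

Lemma competitor_hess_energy : hess_energy Omega v <= disc_const / e.
Proof.
have sv := smooth_competitor c e0.
rewrite (smooth_hess_energy oO bO sv).
have i2 := intgZ mOm 26 (iT2 2%N).
apply: (@le_trans _ _ (I (fun z => 26 * inv_regnorm c e z ^+ 2))).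
  apply: (le_Rint mOm _ i2) => [|z Oz]; last exact: competitor_hess.
  have s2 i j : intg mu (Omega : set (plane R)) (fun z => pderiv j (pderiv i v) z ^+ 2).
    by have [] := continuous_sqint oO bO (smooth_continuous (smooth_pderiv j (smooth_pderiv i sv))).
  by apply: (intgD mOm); apply: (intgD mOm).
rewrite (RintZ mOm _ (iT2 2%N)).
have j4 := intgZ mOm (e / 2) (iT2 4%N); have j1 := intgZ mOm (2 * e)^-1 i1.
(* T^2 <= (e/2) T^4 + 1/(2e), because (e T^2 - 1)^2 >= 0; this reduces the Hessian energy to the
   integral of T^4. *)
have : I (fun z => inv_regnorm c e z ^+ 2) <=
    e / 2 * I (fun z => inv_regnorm c e z ^+ 4) + (2 * e)^-1 * I (fun=> 1).
  rewrite -(RintZ mOm _ (iT2 4%N)) -(RintZ mOm _ i1) -(RintD mOm j4 j1).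
  apply: (le_Rint mOm (iT2 2%N)); first exact: (intgD mOm j4 j1).
  move=> z _; move: (inv_regnorm c e z) => t; rewrite -subr_ge0 mulr1.
  rewrite (_ : _ - _ = (e * t ^+ 2 - 1) ^+ 2 / (2 * e)); last by field; rewrite gt_eqF.
  by rewrite divr_ge0 ?sqr_ge0// mulr_ge0// ltW.
move=> h; apply: (@le_trans _ _ (26 * (e / 2 * (pi ^+ 2 / e ^+ 2) + (2 * e)^-1 * I (fun=> 1)))).
  apply: ler_wpM2l => //; apply: (le_trans h); rewrite lerD2r; apply: ler_wpM2l.
    by rewrite divr_ge0// ltW.
  exact: integral_inv_regnorm4.
rewrite (_ : 26 * _ = 13 * (pi ^+ 2 + I (fun=> 1)) / e); last by field; rewrite gt_eqF.
apply: ler_wpM2r; first by rewrite invr_ge0 ltW.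
by rewrite /disc_const lerDr mulr_ge0// sqr_ge0.
Qed.

Lemma competitor_dist z : Omega z -> `|v z - (1 - enorm (z - c))| <= 3 * e.
Proof.
move=> Oz; have /andP[q0 q1] := sqdist_ball Oz; have [b0 hb /andP[m0 m1]] := inv_sqrt_bounds e.
have h := inv_regnorm_sqr c e0 z; have t0 := inv_regnorm_gt0 c e0 z.
have n2 : enorm (z - c) ^+ 2 = sqdist c z by exact: enorm_sqr.
have n0 := enorm_ge0 (z - c); rewrite /competitor.
have S0 : 0 <= (sqdist c z + e ^+ 2) * inv_regnorm c e z.
  by rewrite mulr_ge0 ?addr_ge0 ?sqr_ge0// ltW.
have S2 : ((sqdist c z + e ^+ 2) * inv_regnorm c e z) ^+ 2 = sqdist c z + e ^+ 2.
  by rewrite exprMn expr2 -mulrA h mulr1.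
have B2 : ((Num.sqrt (1 + e ^+ 2))^-1)^-1 ^+ 2 = 1 + e ^+ 2.
  by rewrite invrK sqr_sqrtr// addr_ge0// sqr_ge0.
have B0 : 0 <= ((Num.sqrt (1 + e ^+ 2))^-1)^-1 by rewrite invrK sqrtr_ge0.
move: B0 B2 S0 S2 n0 n2 m0 m1 q0 q1.
move: ((Num.sqrt (1 + e ^+ 2))^-1) (sqdist c z) (enorm (z - c)) ((sqdist c z + e ^+ 2) * inv_regnorm c e z)
  ((Num.sqrt (1 + e ^+ 2))^-1^-1) => b Q N S B B0 B2 S0 S2 N0 N2 m0 m1 q0 q1.
have e20 := sqr_ge0 e; have e2 : e ^+ 2 <= e by rewrite expr2 ler_piMl// ltW.
have h1 : 1 <= B <= 1 + e by apply/andP; split; nra.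
have h2 : N <= S <= N + e by apply/andP; split; nra.
have h3 : 0 <= (b - 1) / 2 * (Q - 1) <= e by apply/andP; split; nra.
by rewrite ler_norml; apply/andP; split; lra.
Qed.

(** Both gradients are radial. If s >= 0 is the modulus of the gradient of the competitor, the left
    side is (1 - s)^2, which is at most (1 - s^2)^2 since 1 + s >= 1. *)
Lemma competitor_grad_dist z : Omega z -> z != c ->
  (pderiv ord0 v z + centered c ord0 z / enorm (z - c)) ^+ 2 +
  (pderiv ord_max v z + centered c ord_max z / enorm (z - c)) ^+ 2 <=
  (1 - (pderiv ord0 v z ^+ 2 + pderiv ord_max v z ^+ 2)) ^+ 2.
Proof.
move=> Oz zc; have [b0 hb /andP[m0 m1]] := inv_sqrt_bounds e.
have t0 := inv_regnorm_gt0 c e0 z.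
have N0 : 0 < enorm (z - c) by rewrite enorm_gt0 subr_eq0.
have n2 : centered c ord0 z ^+ 2 + centered c ord_max z ^+ 2 = enorm (z - c) ^+ 2 by rewrite enorm_sqr.
rewrite !(pderiv_competitor _ e0); move: n2 N0 t0 m0.
move: (centered c ord0 z) (centered c ord_max z) (enorm _) (inv_regnorm c e z) (_^-1) => x y N t b n2 N0 t0 m0.
have -> : (x * (b - 1 - t) + x / N) ^+ 2 + (y * (b - 1 - t) + y / N) ^+ 2 =
    (x ^+ 2 + y ^+ 2) * (N^-1 - (t + (1 - b))) ^+ 2 by ring.
have -> : (x * (b - 1 - t)) ^+ 2 + (y * (b - 1 - t)) ^+ 2 = (x ^+ 2 + y ^+ 2) * (t + (1 - b)) ^+ 2 by ring.
rewrite n2 -exprMn mulrBr divff ?gt_eqF// -exprMn.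
have : 0 <= N * (t + (1 - b)) by rewrite mulr_ge0// ltW// ltr_wpDr.
move: (N * _) => s s0; rewrite (_ : (1 - s ^+ 2) ^+ 2 = (1 - s) ^+ 2 * (1 + s) ^+ 2); last by ring.
by rewrite ler_peMr ?sqr_ge0// exprn_ege1// lerDl.
Qed.
End disc_competitor.

(** * The calibration *)

Section truncated_gradient.
Context {R : realType}.
Implicit Types (p q f g : R).

(* The calibration is cubic in the gradient, which is only in L^2 together with its derivatives; it is therefore
   applied to the bounded field tgrad, which agrees with the gradient (p, q) where |(p, q)| = 1. *)
Definition well p q : R := p ^+ 2 + q ^+ 2 - 1.
Definition tau p q : R := (1 + well p q ^+ 2)^-1.
Definition tgrad p q : R := tau p q * p.
(** The common weight of the calibration errors, zero where (p, q) has norm 1. It is bounded and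
    Lipschitz, which allows passing to limits, and at most twice |[well]|, which gives the
    estimate. *)
Definition sigma p q : R := (`|well p q| + well p q ^+ 2) * tau p q.

Lemma tauE p q : tau p q * (1 + well p q ^+ 2) = 1.
Proof. by rewrite mulVf// gt_eqF// ltr_wpDr// sqr_ge0. Qed.

Lemma wellC p q : well p q = well q p. Proof. by rewrite /well [p ^+ 2 + _]addrC. Qed.

Lemma tauC p q : tau p q = tau q p. Proof. by rewrite /tau wellC. Qed.

Lemma sigmaC p q : sigma p q = sigma q p. Proof. by rewrite /sigma wellC tauC. Qed.

Lemma tau_gt0 p q : 0 < tau p q.
Proof. by rewrite invr_gt0 ltr_wpDr// sqr_ge0. Qed.

Lemma tau_bounds p q : [/\ tau p q <= 1, well p q ^+ 2 * tau p q <= 1, `|well p q| * tau p q <= 1 &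
  (p ^+ 2 + q ^+ 2) * tau p q <= 2].
Proof.
have t0 := tau_gt0 p q; have h := tauE p q.
have y1 : p ^+ 2 + q ^+ 2 = 1 + well p q by rewrite /well; ring.
rewrite y1; have := real_normK (num_real (well p q)); have := ler_norm (well p q); have := normr_ge0 (well p q).
move: (well p q) `|_| (tau p q) t0 h => y m t t0 h m0 ym m2.
rewrite -m2 in h *; have s0 := sqr_ge0 m.
have h1 : t + m ^+ 2 * t = 1 by rewrite -h; ring.
have h2 : 0 <= m ^+ 2 * t by rewrite mulr_ge0// ltW.
have h3 : m * t <= 1 by have : 0 <= (m - 1) ^+ 2 * t by [rewrite mulr_ge0 ?sqr_ge0// ltW]; nra.
by split; [lra|lra|lra|nra].
Qed.

Lemma sigma_ge0 p q : 0 <= sigma p q.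
Proof. by rewrite mulr_ge0 ?addr_ge0 ?sqr_ge0// ltW// tau_gt0. Qed.

Lemma sigma_le p q : sigma p q <= 2.
Proof. by have [_ h1 h2 _] := tau_bounds p q; rewrite /sigma mulrDl; lra. Qed.

Lemma sigma_le_well p q : sigma p q <= 2 * `|well p q|.
Proof.
have [h0 _ h1 _] := tau_bounds p q; have t0 := tau_gt0 p q; have n0 := normr_ge0 (well p q).
rewrite /sigma -(real_normK (num_real (well p q))); nra.
Qed.

Lemma tgrad_bound p q : `|tgrad p q| <= 2.
Proof.
have [h0 _ _ h1] := tau_bounds p q; have t0 := tau_gt0 p q.
rewrite /tgrad normrM (gtr0_norm t0); move: h1; rewrite -(real_normK (num_real p)).
have := normr_ge0 p; have := sqr_ge0 q; move: `|p| (q ^+ 2) (tau p q) t0 h0 => m s t t0 h0 s0 m0.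
by have := sqr_ge0 (m - 1); nra.
Qed.

Lemma tgrad_sqr p q : `|1 - (tgrad p q ^+ 2 + tgrad q p ^+ 2)| <= 3 * sigma p q.
Proof.
have t0 := tau_gt0 p q; have h := tauE p q; have [h0 h1 h2 _] := tau_bounds p q.
rewrite /tgrad (tauC q p) /sigma !exprMn -mulrDr.
have -> : p ^+ 2 + q ^+ 2 = 1 + well p q by rewrite /well; ring.
have := real_normK (num_real (well p q)); have := ler_norm (well p q); have := ler_norm (- well p q).
rewrite normrN; move: (well p q) `|_| (tau p q) t0 h h0 h1 h2 (normr_ge0 (well p q)).
move=> y m t t0 h h0 h1 h2 m0 y1 y2 m2.
have -> : 1 - t ^+ 2 * (1 + y) = t * (t * (2 * y ^+ 2 + y ^+ 4 - y)).
  by transitivity ((t * (1 + y ^+ 2)) ^+ 2 - t ^+ 2 * (1 + y)); [rewrite h expr1n|ring].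
rewrite normrM gtr0_norm// [leRHS]mulrA [leRHS]mulrC ler_pM2l//.
have y20 := sqr_ge0 y.
have a1 : 0 <= y ^+ 2 * t by rewrite mulr_ge0// ltW.
have a2 : 0 <= m * t by rewrite mulr_ge0// ltW.
have -> : t * (2 * y ^+ 2 + y ^+ 4 - y) = 2 * (y ^+ 2 * t) + (y ^+ 2 * t) * y ^+ 2 - y * t by ring.
have a3 : y ^+ 2 * t <= y ^+ 2 by nra.
have a4 : (y ^+ 2 * t) * y ^+ 2 <= y ^+ 2 by nra.
have a5 : 0 <= (y ^+ 2 * t) * y ^+ 2 by rewrite mulr_ge0.
have a6 : m * t <= m by nra.
have a7 : y * t <= m * t by rewrite ler_pM2r. have a8 : - y * t <= m * t by rewrite ler_pM2r.
by rewrite ler_norml; apply/andP; split; lra.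
Qed.

Lemma tgrad_dist p q : `|p - tgrad p q| <= `|well p q|.
Proof.
have t0 := tau_gt0 p q; have h := tauE p q; have [h0 h1 h2 h3] := tau_bounds p q.
(* With W = [well p q], the difference is p W times W tau, and it remains to see |p W| <= 1 + W^2 =
   1 / tau, a consequence of p^2 <= 1 + |W|. *)
rewrite /tgrad (_ : p - _ = p * (well p q * (well p q * tau p q))); last first.
  by rewrite -{1}[p]mulr1 -h; ring.
rewrite !normrM (gtr0_norm t0) mulrCA -[leRHS]mulr1 ler_wpM2l//.
have : p ^+ 2 <= 1 + `|well p q|.
  have : p ^+ 2 <= 1 + well p q by rewrite /well; have := sqr_ge0 q; lra.
  by have := ler_norm (well p q); lra.
rewrite -(real_normK (num_real p)); move: h1; rewrite -(real_normK (num_real (well p q))).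
have := normr_ge0 p; have := normr_ge0 (well p q); move: h h2; rewrite -(real_normK (num_real (well p q))).
move: `|p| `|well p q| (tau p q) t0 h0 => n m t t0 h0 h h2 m0 n0 h1 n2.
have : (n * m) ^+ 2 <= (1 + m ^+ 2) ^+ 2.
  rewrite exprMn; have := mulr_ge0 m0 m0; nra.
rewrite ler_sqr ?nnegrE ?mulr_ge0 ?addr_ge0 ?sqr_ge0// => k.
by rewrite mulrA -h mulrC ler_pM2l.
Qed.

Lemma is_derive_well p q : is_derive p (1 : R) (fun p => well p q) (2 * p).
Proof.
pose a : R := q ^+ 2; pose b : R := -1.
have h := is_deriveD (is_deriveD (is_deriveX 2 (is_derive_id p (1 : R))) (is_derive_cst a p (1 : R)))
  (is_derive_cst b p (1 : R)).
by apply: is_derive_eq h _; rewrite /GRing.scale/=; ring.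
Qed.

Lemma is_derive_tau p q : is_derive p (1 : R) (fun p => tau p q) (- (4 * well p q * p * tau p q ^+ 2)).
Proof.
have d0 : 1 + well p q ^+ 2 != 0 by rewrite gt_eqF// ltr_wpDr// sqr_ge0.
pose a : R := 1.
have hd : is_derive p (1 : R) (fun p => 1 + well p q ^+ 2) (2 * well p q * (2 * p)).
  have h := is_deriveD (is_derive_cst a p (1 : R)) (is_deriveX 2 (is_derive_well p q)).
  by apply: is_derive_eq h _; rewrite /GRing.scale/=; ring.
have h := is_deriveV (f := fun p => 1 + well p q ^+ 2) d0 hd.
by apply: is_derive_eq h _; rewrite /GRing.scale/= /tau; field.
Qed.

Let prod_bound p q : [/\ `|well p q * p ^+ 2 * tau p q ^+ 2| <= 2, `|well p q * p * q * tau p q ^+ 2| <= 2,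
  `|well p q * p * tau p q ^+ 2| <= 2, `|p * tau p q| <= 2 & `|well p q ^+ 2 * p * tau p q ^+ 2| <= 2].
Proof.
have t0 := tau_gt0 p q; have [h0 h1 h2 h3] := tau_bounds p q; have h4 := tgrad_bound p q.
rewrite /tgrad mulrC in h4; move: h4; rewrite !normrM (gtr0_norm t0) => h4.
have p2 : `|p| ^+ 2 * tau p q <= 2.
  by rewrite real_normK ?num_real//; move: h3; rewrite mulrDl; have := mulr_ge0 (sqr_ge0 q) (ltW t0); lra.
have pq : `|p| * `|q| * tau p q <= 2.
  move: h3; rewrite -(real_normK (num_real p)) -(real_normK (num_real q)).
  by have := sqr_ge0 (`|p| - `|q|); move: `|p| `|q| (tau p q) t0 => u v t t0; nra.
have y2 : `|well p q| ^+ 2 * tau p q <= 1 by rewrite real_normK ?num_real.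
have n0 := normr_ge0 p; have m0 := normr_ge0 (well p q); have k0 := normr_ge0 q.
have u0 : 0 <= `|well p q| * tau p q by rewrite mulr_ge0// ltW.
have v0 : 0 <= `|p| * tau p q by rewrite mulr_ge0// ltW.
have le2 (x y : R) : 0 <= x -> x <= 1 -> 0 <= y -> y <= 2 -> x * y <= 2 by move=> *; nra.
split.
- rewrite (_ : _ * _ = (`|well p q| * tau p q) * (`|p| ^+ 2 * tau p q)); last by ring.
  by apply: le2 => //; rewrite mulr_ge0 ?sqr_ge0// ltW.
- rewrite (_ : _ * _ = (`|well p q| * tau p q) * (`|p| * `|q| * tau p q)); last by ring.
  by apply: le2 => //; rewrite mulr_ge0 ?mulr_ge0// ltW.
- by rewrite (_ : _ * _ = (`|well p q| * tau p q) * (`|p| * tau p q)); [exact: le2|ring].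
- exact: h4.
- rewrite (_ : _ * _ = (`|well p q| ^+ 2 * tau p q) * (`|p| * tau p q)); last by ring.
  by apply: le2 => //; rewrite mulr_ge0 ?sqr_ge0// ltW.
Qed.

Lemma tgrad_lip1 p p' q : `|tgrad p q - tgrad p' q| <= 9 * `|p - p'|.
Proof.
apply: (derive_lipschitz (F := fun p => tgrad p q) (d := fun p => tau p q - 4 * (well p q * p ^+ 2 * tau p q ^+ 2))) => x.
  have h := is_deriveM (is_derive_tau x q) (is_derive_id x (1 : R)).
  by apply: is_derive_eq h _; rewrite /GRing.scale/=; ring.
move=> _; have [h1 _ _ _ _] := prod_bound x q; have [h2 _ _ _] := tau_bounds x q; have t0 := tau_gt0 x q.
by move: h1; rewrite !ler_norml => /andP[? ?]; apply/andP; split; lra.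
Qed.

Lemma tgrad_lip2 p q q' : `|tgrad p q - tgrad p q'| <= 9 * `|q - q'|.
Proof.
apply: (derive_lipschitz (F := fun q => tgrad p q)
  (d := fun q => - (4 * (well q p * q * p * tau q p ^+ 2)))) => x.
  have -> : (fun q => tgrad p q) = fun q => tau q p * p by apply/funext => y; rewrite /tgrad tauC.
  have h := is_deriveM (is_derive_tau x p) (is_derive_cst p x (1 : R)).
  by apply: is_derive_eq h _; rewrite /GRing.scale/=; ring.
move=> _; have [_ h1 _ _ _] := prod_bound x p.
by move: h1; rewrite !ler_norml => /andP[? ?]; apply/andP; split; lra.
Qed.

Lemma tgrad_lip p q p' q' : `|tgrad p q - tgrad p' q'| <= 9 * (`|p - p'| + `|q - q'|).
Proof.
have := tgrad_lip1 p p' q; have := tgrad_lip2 p' q q'.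
have := ler_normD (tgrad p q - tgrad p' q) (tgrad p' q - tgrad p' q'); rewrite addrA subrK; lra.
Qed.

Lemma sigma_lip p q p' q' : `|sigma p q - sigma p' q'| <= 20 * (`|p - p'| + `|q - q'|).
Proof.
have main a a' b : `|sigma a b - sigma a' b| <= 20 * `|a - a'|.
  (* In the form |W tau| + (1 - tau), sigma is built from two functions with bounded derivatives. *)
  have e1 x : sigma x b = `|well x b * tau x b| + (1 - tau x b).
    by rewrite /sigma mulrDl normrM (gtr0_norm (tau_gt0 _ _)) -[X in X - _](tauE x b); ring.
  rewrite !e1.
  have k1 : `|well a b * tau a b - well a' b * tau a' b| <= 12 * `|a - a'|.
    apply: (derive_lipschitz (F := fun a => well a b * tau a b)
      (d := fun a => 2 * (a * tau a b) - 4 * (well a b ^+ 2 * a * tau a b ^+ 2))) => x.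
      have h := is_deriveM (is_derive_well x b) (is_derive_tau x b).
      by apply: is_derive_eq h _; rewrite /GRing.scale/=; ring.
    move=> _; have [_ _ _ h1 h2] := prod_bound x b.
    by move: h1 h2; rewrite !ler_norml => /andP[? ?] /andP[? ?]; apply/andP; split; lra.
  have k2 : `|tau a b - tau a' b| <= 8 * `|a - a'|.
    apply: (derive_lipschitz (F := fun a => tau a b) (d := fun a => - (4 * (well a b * a * tau a b ^+ 2)))) => x.
      by have h := is_derive_tau x b; apply: is_derive_eq h _; ring.
    move=> _; have [_ _ h1 _ _] := prod_bound x b.
    by move: h1; rewrite !ler_norml => /andP[? ?]; apply/andP; split; lra.
  have k3 := ler_dist_dist (well a b * tau a b) (well a' b * tau a' b).
  rewrite (_ : _ - _ = (`|well a b * tau a b| - `|well a' b * tau a' b|) - (tau a b - tau a' b)); last by ring.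
  apply: (le_trans (ler_normB _ _)); lra.
have := main p p' q; have := main q q' p'; rewrite !(sigmaC _ p').
have := ler_normD (sigma p q - sigma p' q) (sigma p' q - sigma p' q'); rewrite addrA subrK; lra.
Qed.

End truncated_gradient.

Section polynomial_expressions.
Context {R : realType}.

(* Reified polynomials: their divergence is computed syntactically, and smoothness and Lipschitz bounds follow by
   induction on the syntax. *)
Inductive pexp := PVar of nat | PCst of R | PAdd of pexp & pexp | PMul of pexp & pexp.

Fixpoint pev (f : nat -> R) (t : pexp) : R :=
  match t with
  | PVar k => f k
  | PCst a => a
  | PAdd t1 t2 => pev f t1 + pev f t2
  | PMul t1 t2 => pev f t1 * pev f t2
  end.

Fixpoint pdv (f d : nat -> R) (t : pexp) : R :=
  match t with
  | PVar k => d k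
  | PCst a => 0
  | PAdd t1 t2 => pdv f d t1 + pdv f d t2
  | PMul t1 t2 => pdv f d t1 * pev f t2 + pev f t1 * pdv f d t2
  end.

Variable F : nat -> R * R -> R.
Hypothesis sF : forall k, smooth (F k).

Lemma smooth_pev t : smooth (fun z => pev (F ^~ z) t).
Proof.
elim: t => [k|a|t1 h1 t2 h2|t1 h1 t2 h2] n /=.
- exact: sF.
- exact: Ck_cst.
- exact: CkD (h1 n) (h2 n).
- exact: CkM (h1 n) (h2 n).
Qed.

Lemma pderiv_pev i t : pderiv i (fun z => pev (F ^~ z) t) =
  fun z => pdv (F ^~ z) (fun k => pderiv i (F k) z) t.
Proof.
elim: t => [k|a|t1 h1 t2 h2|t1 h1 t2 h2] /=.
- by [].
- exact: pderiv_cst.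
- by rewrite (pderivD _ (smooth_diff (smooth_pev t1)) (smooth_diff (smooth_pev t2))) h1 h2.
- by rewrite (pderivM _ (smooth_diff (smooth_pev t1)) (smooth_diff (smooth_pev t2))) h1 h2.
Qed.
End polynomial_expressions.

Section inverse.
Context {R : realType}.
Implicit Types f : R * R -> R.

Lemma pderiv_inv i f : Ck 1 f -> (forall z, f z != 0) ->
  pderiv i (fun z => (f z)^-1) = fun z => - ((f z)^-1 ^+ 2 * pderiv i f z).
Proof.
move=> f1 f0; apply/funext => z.
have dh := is_deriveV (f0 z) (is_derive_id (f z) (1 : R)).
rewrite (pderiv_comp_at i (h := fun y => y^-1) _ (Ck_diff f1 z)); last by case: dh.
by rewrite derive1E; have [_ ->] := dh; rewrite /GRing.scale/= mulr1 exprVn mulNr.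
Qed.

Lemma inv_differentiable f z : Ck 1 f -> (forall z, f z != 0) -> differentiable (fun z => (f z)^-1) z.
Proof.
move=> f1 f0; apply: (differentiable_comp (f := f) (g := fun y => y^-1)); first exact: (Ck_diff f1).
by apply/derivable1_diffP; have [] := is_deriveV (f0 z) (is_derive_id (f z) (1 : R)).
Qed.

Lemma smooth_inv f : smooth f -> (forall z, f z != 0) -> smooth (fun z => (f z)^-1).
Proof.
move=> sf f0; elim=> [z|k IH]; first by apply: differentiable_continuous; exact: (inv_differentiable _ (sf 1%N)).
split=> [z|i]; first exact: (inv_differentiable _ (sf 1%N)).
rewrite (pderiv_inv _ (sf 1%N) f0); apply: CkN; apply: CkM; last exact: smooth_pderiv.
by rewrite (_ : (fun z => _) = fun z => (f z)^-1 * (f z)^-1); [exact: CkM|apply/funext => z; rewrite expr2].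
Qed.
End inverse.

Section calibration.
Context {R : realType}.
Local Notation V := (@PVar R). Local Notation K := (@PCst R).
Local Notation "s + t" := (PAdd s t) : pexp_scope. Local Notation "s * t" := (PMul s t) : pexp_scope.
Delimit Scope pexp_scope with P.

Definition sqre : pexp := (V 0 * V 0 + K (-1) * (V 1 * V 1))%P.
Definition sqim : pexp := (K 2 * (V 0 * V 1))%P.
Definition cubre : pexp := (V 2 * V 2 * V 2 + K (-3) * (V 2 * V 3 * V 3))%P.
Definition cubim : pexp := (K 3 * (V 2 * V 2 * V 3) + K (-1) * (V 3 * V 3 * V 3))%P.
Definition damp : pexp := (K 2^-1 + K (- 4^-1) * (V 2 * V 2 + V 3 * V 3))%P.

(* In complex notation, with z the position and w the gradient, the vector field
   z^2 conj(w) (1/2 - |w|^2/4) + conj(z)^2 w^3 / 12.  Its coefficients are chosen so that in calib_divergence the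
   derivatives of w only occur multiplied by 1 - |w|^2 or through the curl of w. *)
Definition calib (i : 'I_2) : pexp :=
  if i == ord0 then (damp * (sqre * V 2 + sqim * V 3) + K 12^-1 * (sqre * cubre + sqim * cubim))%P
  else (damp * (sqim * V 2 + K (-1) * (sqre * V 3)) + K 12^-1 * (sqre * cubim + K (-1) * (sqim * cubre)))%P.

(** Variables 0 and 1 are the position, 2 and 3 the field; all further variables have the value
    0. *)
Definition env4 (a b p q : R) (k : nat) : R := nth 0 [:: a; b; p; q] k.

(** The two derivative environments differentiate position and field in the two coordinate
    directions, so the left side is a divergence; q0 - p1 is the curl of the field. *)
Lemma calib_divergence (a b p q p0 p1 q0 q1 : R) :
  pdv (env4 a b p q) (env4 1 0 p0 q0) (calib ord0) + pdv (env4 a b p q) (env4 0 1 p1 q1) (calib ord_max) =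
  (a * p + b * q) + (1 - (p ^+ 2 + q ^+ 2)) *
    ((a * p + b * q) + 2^-1 * ((a ^+ 2 - b ^+ 2) * (p0 - q1) + 2 * a * b * (q0 + p1))) +
  (a * b * (p ^+ 2 - q ^+ 2) - (a ^+ 2 - b ^+ 2) * (p * q)) * (q0 - p1).
Proof. by rewrite /calib /= /env4 /=; field. Qed.

(** Differentiating tau times the field also differentiates tau; k stands for f or g. The bound
    keeps the factor |W| tau, which is at most 1 and at most [sigma]. *)
Lemma tau_deriv_bound (f g u v k : R) : k ^+ 2 <= f ^+ 2 + g ^+ 2 ->
  `|- (4 * well f g * (f * u + g * v) * tau f g ^+ 2) * k| <= 8 * (`|well f g| * tau f g) * (`|u| + `|v|).
Proof.
move=> kb; have t0 := tau_gt0 f g; have [_ _ _ h] := tau_bounds f g.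
have e (x : R) : x ^+ 2 <= f ^+ 2 + g ^+ 2 -> `|x| * `|k| * tau f g <= 2.
  move=> xb; apply: le_trans h; apply: ler_wpM2r; first exact: ltW.
  have := sqr_ge0 (`|x| - `|k|); move: xb kb; rewrite -(real_normK (num_real x)) -(real_normK (num_real k)).
  by move: `|x| `|k| => ? ?; lra.
have hf : `|f| * `|k| * tau f g <= 2 by apply: e; rewrite lerDl sqr_ge0.
have hg : `|g| * `|k| * tau f g <= 2 by apply: e; rewrite lerDr sqr_ge0.
have m0 : 0 <= `|well f g| * tau f g by rewrite mulr_ge0// ltW.
have tri : `|f * u + g * v| <= `|f| * `|u| + `|g| * `|v| by rewrite -!normrM ler_normD.
have -> : `|- (4 * well f g * (f * u + g * v) * tau f g ^+ 2) * k| =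
    4 * (`|well f g| * tau f g) * (`|f * u + g * v| * `|k| * tau f g).
  by rewrite !normrM normrN !normrM (gtr0_norm t0) (ger0_norm (_ : 0 <= 4))//; ring.
rewrite (_ : 8 * _ * _ = 4 * (`|well f g| * tau f g) * (2 * (`|u| + `|v|))); last by ring.
apply: ler_wpM2l; first by rewrite mulr_ge0.
apply: (@le_trans _ _ ((`|f| * `|u| + `|g| * `|v|) * `|k| * tau f g)).
  by apply: ler_wpM2r; [exact: ltW|exact: ler_wpM2r].
have := ler_wpM2r (normr_ge0 u) hf; have := ler_wpM2r (normr_ge0 v) hg; lra.
Qed.

Lemma calib_remainder_aux (a b P Q p0 p1 q0 q1 s x y S c : R) : a ^+ 2 + b ^+ 2 <= 1 -> 0 <= s ->
  `|P| <= 2 -> `|Q| <= 2 -> `|1 - (P ^+ 2 + Q ^+ 2)| <= 3 * s ->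
  `|p0| <= 9 * x -> `|q0| <= 9 * x -> `|p1| <= 9 * y -> `|q1| <= 9 * y -> x + y = S ->
  `|q0 - p1| <= c + 8 * (s * S) -> 0 <= c -> 0 <= S ->
  `|a * P + b * Q + (1 - (P ^+ 2 + Q ^+ 2)) *
    (a * P + b * Q + 2^-1 * ((a ^+ 2 - b ^+ 2) * (p0 - q1) + 2 * a * b * (q0 + p1))) +
    (a * b * (P ^+ 2 - Q ^+ 2) - (a ^+ 2 - b ^+ 2) * (P * Q)) * (q0 - p1) - (a * P + b * Q)| <=
  100 * (s * (1 + S) + c).
Proof.
move=> ab s0 hP hQ hw h1 h2 h3 h4 xyS hc c0 S0.
have ab2 : `|a ^+ 2 - b ^+ 2| <= 1.
  by have := sqr_ge0 a; have := sqr_ge0 b; rewrite ler_norml => ? ?; apply/andP; split; lra.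
have ab1 : `|2 * a * b| <= 1.
  by have := sqr_ge0 (a - b); have := sqr_ge0 (a + b); rewrite ler_norml => ? ?; apply/andP; split; lra.
have a1 : `|a| <= 1 by rewrite -(@expr_le1 _ 2)// real_normK ?num_real//; have := sqr_ge0 b; lra.
have b1 : `|b| <= 1 by rewrite -(@expr_le1 _ 2)// real_normK ?num_real//; have := sqr_ge0 a; lra.
have X : `|a * P + b * Q| <= 4.
  apply: (le_trans (ler_normD _ _)); rewrite !normrM.
  have : `|a| * `|P| <= 1 * 2 by exact: ler_pM.
  have : `|b| * `|Q| <= 1 * 2 by exact: ler_pM.
  lra.
have Y : `|2^-1 * ((a ^+ 2 - b ^+ 2) * (p0 - q1) + 2 * a * b * (q0 + p1))| <= 9 * S.
  have k1 : `|(a ^+ 2 - b ^+ 2) * (p0 - q1)| <= 1 * (9 * S).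
    rewrite normrM; apply: ler_pM => //; apply: (le_trans (ler_normB _ _)); lra.
  have k2 : `|2 * a * b * (q0 + p1)| <= 1 * (9 * S).
    rewrite normrM; apply: ler_pM => //; apply: (le_trans (ler_normD _ _)); lra.
  have := ler_normD ((a ^+ 2 - b ^+ 2) * (p0 - q1)) (2 * a * b * (q0 + p1)).
  move=> k3; rewrite [leLHS]normrM (ger0_norm (_ : 0 <= 2^-1))//; lra.
have Z : `|a * b * (P ^+ 2 - Q ^+ 2) - (a ^+ 2 - b ^+ 2) * (P * Q)| <= 8.
  have k1 : `|2 * a * b * (P ^+ 2 - Q ^+ 2)| <= 1 * 8.
    rewrite normrM; apply: ler_pM => //.
    have : P ^+ 2 <= 4 by rewrite -(real_normK (num_real P)); have := normr_ge0 P; nra.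
    have : Q ^+ 2 <= 4 by rewrite -(real_normK (num_real Q)); have := normr_ge0 Q; nra.
    by have := sqr_ge0 P; have := sqr_ge0 Q; rewrite ler_norml => ? ? ? ?; apply/andP; split; lra.
  have k2 : `|(a ^+ 2 - b ^+ 2) * (P * Q)| <= 1 * (2 * 2).
    by rewrite normrM; apply: ler_pM => //; rewrite normrM; apply: ler_pM.
  rewrite (_ : a * b * (P ^+ 2 - Q ^+ 2) = 2^-1 * (2 * a * b * (P ^+ 2 - Q ^+ 2))); last by field.
  apply: (le_trans (ler_normB _ _)); rewrite normrM (ger0_norm (_ : 0 <= 2^-1))//; lra.
rewrite (_ : _ - _ = (1 - (P ^+ 2 + Q ^+ 2)) *
    (a * P + b * Q + 2^-1 * ((a ^+ 2 - b ^+ 2) * (p0 - q1) + 2 * a * b * (q0 + p1))) +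
    (a * b * (P ^+ 2 - Q ^+ 2) - (a ^+ 2 - b ^+ 2) * (P * Q)) * (q0 - p1)); last by ring.
apply: (le_trans (ler_normD _ _)); rewrite !normrM.
have k3 : `|a * P + b * Q + 2^-1 * ((a ^+ 2 - b ^+ 2) * (p0 - q1) + 2 * a * b * (q0 + p1))| <= 4 + 9 * S.
  by apply: (le_trans (ler_normD _ _)); exact: lerD.
have k1 := ler_pM (normr_ge0 _) (normr_ge0 _) hw k3.
have k2 := ler_pM (normr_ge0 _) (normr_ge0 _) Z hc.
have sS : 0 <= s * S by exact: mulr_ge0.
by apply: (le_trans (lerD k1 k2)); rewrite (_ : 3 * s * (4 + 9 * S) = 12 * s + 27 * (s * S)); [lra|ring].
Qed.

(** Truncation does not preserve curl-free fields: the curl of tau w is tau times the curl of w plus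
    terms with the derivative of tau, and these carry a factor bounded by [sigma]. Only the curl of
    the original field is left unweighted. *)
Lemma calib_remainder (a b f g f0 f1 g0 g1 t t0 t1 : R) : a ^+ 2 + b ^+ 2 <= 1 ->
  t = tau f g -> t0 = - (4 * well f g * (f * f0 + g * g0) * t ^+ 2) ->
  t1 = - (4 * well f g * (f * f1 + g * g1) * t ^+ 2) ->
  `|pdv (env4 a b (t * f) (t * g)) (env4 1 0 (t0 * f + t * f0) (t0 * g + t * g0)) (calib ord0) +
    pdv (env4 a b (t * f) (t * g)) (env4 0 1 (t1 * f + t * f1) (t1 * g + t * g1)) (calib ord_max) -
    (a * (t * f) + b * (t * g))| <=
  100 * (sigma f g * (1 + (`|f0| + `|f1| + (`|g0| + `|g1|))) + `|g0 - f1|).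
Proof.
move=> ab te t0e t1e; rewrite calib_divergence.
have tt0 := tau_gt0 f g; have [tle _ mt _] := tau_bounds f g; rewrite -te in tt0 tle mt.
have hP := tgrad_bound f g; have hQ := tgrad_bound g f; have hw := tgrad_sqr f g; have s0 := sigma_ge0 f g.
rewrite /tgrad (tauC g f) -te in hP hQ hw.
have sm : `|well f g| * t <= sigma f g.
  by rewrite te /sigma mulrDl lerDl mulr_ge0 ?sqr_ge0// -te ltW.
have ff : f ^+ 2 <= f ^+ 2 + g ^+ 2 by rewrite lerDl sqr_ge0.
have gg : g ^+ 2 <= f ^+ 2 + g ^+ 2 by rewrite lerDr sqr_ge0.
have b1 := tau_deriv_bound f0 g0 ff; have b2 := tau_deriv_bound f0 g0 gg.
have b3 := tau_deriv_bound f1 g1 ff; have b4 := tau_deriv_bound f1 g1 gg.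
rewrite -te -?t0e -?t1e in b1 b2 b3 b4.
have tn (x : R) : `|t * x| <= `|x|.
  by rewrite normrM (gtr0_norm tt0) -[leRHS]mul1r ler_wpM2r.
have n1 := tn f0; have n2 := tn f1; have n3 := tn g0; have n4 := tn g1; have n5 := tn (g0 - f1).
have mt0 : 0 <= `|well f g| * t by rewrite mulr_ge0// ltW.
have nf0 := normr_ge0 f0; have nf1 := normr_ge0 f1; have ng0 := normr_ge0 g0; have ng1 := normr_ge0 g1.
set S := `|f0| + `|f1| + (`|g0| + `|g1|).
have S0 : 0 <= S by rewrite !addr_ge0.
have p0b : `|t0 * f + t * f0| <= 9 * (`|f0| + `|g0|).
  apply: (le_trans (ler_normD _ _)); apply: (@le_trans _ _ (8 * 1 * (`|f0| + `|g0|) + `|f0|)); last by lra.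
  apply: lerD => //; apply: (le_trans b1); apply: ler_wpM2r; first exact: addr_ge0.
  by rewrite ler_pM2l.
have q0b : `|t0 * g + t * g0| <= 9 * (`|f0| + `|g0|).
  apply: (le_trans (ler_normD _ _)); apply: (@le_trans _ _ (8 * 1 * (`|f0| + `|g0|) + `|g0|)); last by lra.
  apply: lerD => //; apply: (le_trans b2); apply: ler_wpM2r; first exact: addr_ge0.
  by rewrite ler_pM2l.
have p1b : `|t1 * f + t * f1| <= 9 * (`|f1| + `|g1|).
  apply: (le_trans (ler_normD _ _)); apply: (@le_trans _ _ (8 * 1 * (`|f1| + `|g1|) + `|f1|)); last by lra.
  apply: lerD => //; apply: (le_trans b3); apply: ler_wpM2r; first exact: addr_ge0.
  by rewrite ler_pM2l.
have q1b : `|t1 * g + t * g1| <= 9 * (`|f1| + `|g1|).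
  apply: (le_trans (ler_normD _ _)); apply: (@le_trans _ _ (8 * 1 * (`|f1| + `|g1|) + `|g1|)); last by lra.
  apply: lerD => //; apply: (le_trans b4); apply: ler_wpM2r; first exact: addr_ge0.
  by rewrite ler_pM2l.
have curlb : `|t0 * g + t * g0 - (t1 * f + t * f1)| <= `|g0 - f1| + 8 * (sigma f g * S).
  have -> : t0 * g + t * g0 - (t1 * f + t * f1) = t * (g0 - f1) + (t0 * g - t1 * f) by ring.
  apply: (le_trans (ler_normD _ _)); apply: lerD => //.
  apply: (le_trans (ler_normB _ _)).
  apply: (@le_trans _ _ (8 * sigma f g * (`|f0| + `|g0|) + 8 * sigma f g * (`|f1| + `|g1|))).
    apply: lerD; [apply: (le_trans b2)|apply: (le_trans b3)]; (apply: ler_wpM2r; first exact: addr_ge0);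
      by rewrite ler_pM2l.
  by rewrite /S; lra.
apply: (calib_remainder_aux ab s0 hP hQ hw p0b q0b p1b q1b _ curlb) => //.
by rewrite /S; lra.
Qed.
End calibration.

Section smooth_calibration.
Context {R : realType}.
Variable c : R * R.
Let Omega : set (R * R) := eball c 1.
Hypothesis C2 : C2_boundary Omega.
Let oO : open Omega := @open_eball R c 1.
Let bO : Omega `<=` square_box (`|c.1| + `|c.2| + 1) := @eball_square_box R c 1.
Let ag := bd_param_spec C2.

Local Notation mu := (@leb2 R).
Local Notation I := (Rintegral mu (Omega : set (plane R))).
Local Notation B := (bd_set Omega).
Local Notation Bd := (Rintegral (@lebesgue_measure R) B).
Local Notation x := (centered c).
Let mOm : measurable (Omega : set (plane R)) := domain_measurable oO.

Definition calib_at (i : 'I_2) (z : R * R) (p q : R) : R :=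
  pev (env4 (x ord0 z) (x ord_max z) (tgrad p q) (tgrad q p)) (calib i).

Definition flux_density (z : R * R) (p q : R) : R :=
  calib_at ord0 z p q * x ord0 z + calib_at ord_max z p q * x ord_max z.

Variables f g : R * R -> R.
Hypotheses (sf : smooth f) (sg : smooth g).

(** A second use of reified polynomials, with f and g as variables 0 and 1: [den] denotes 1 + W^2,
    whose inverse is tau, so smoothness and derivatives of tau come from the syntax. *)
Let wellx : @pexp R := PAdd (PAdd (PMul (PVar 0) (PVar 0)) (PMul (PVar 1) (PVar 1))) (PCst (-1)).
Let den : @pexp R := PAdd (PCst 1) (PMul wellx wellx).
Let G (k : nat) (z : R * R) : R := env4 (f z) (g z) 0 0 k.

Let sG k : smooth (G k).
Proof. by case: k => [|[|[|[|[|k]]]]] //= n; exact: Ck_cst. Qed.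

Let denE z : pev (G ^~ z) den = 1 + well (f z) (g z) ^+ 2.
Proof. by rewrite /= /G /env4 /= /well; ring. Qed.

Let T z := tau (f z) (g z).

Let TE : T = fun z => (pev (G ^~ z) den)^-1.
Proof. by apply/funext => z; rewrite denE. Qed.

Let den0 z : pev (G ^~ z) den != 0.
Proof. by rewrite denE gt_eqF// ltr_wpDr// sqr_ge0. Qed.

Let sT : smooth T.
Proof. by rewrite TE; apply: smooth_inv den0; exact: (smooth_pev sG). Qed.

Let dT i : pderiv i T = fun z => - (4 * well (f z) (g z) * (f z * pderiv i f z + g z * pderiv i g z) * T z ^+ 2).
Proof.
rewrite TE (pderiv_inv _ (smooth_pev sG den 1%N) den0) (pderiv_pev sG); apply/funext => z.
by rewrite denE /= /G /env4 /= /well; ring.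
Qed.

Let F (k : nat) (z : R * R) : R := env4 (x ord0 z) (x ord_max z) (T z * f z) (T z * g z) k.

Let sM (h k : R * R -> R) : smooth h -> smooth k -> smooth (fun z => h z * k z).
Proof. by move=> sh sk n; apply: CkM. Qed.

Let sF k : smooth (F k).
Proof.
case: k => [|[|[|[|[|k]]]]] /=; try (by move=> n; exact: Ck_cst).
- by move=> n; exact: Ck_centered.
- by move=> n; exact: Ck_centered.
- exact: (sM sT sf).
- exact: (sM sT sg).
Qed.

Let FE z : F ^~ z = env4 (x ord0 z) (x ord_max z) (tgrad (f z) (g z)) (tgrad (g z) (f z)).
Proof. by apply/funext => k; rewrite /F /T /tgrad (tauC (g z)). Qed.

Let dF i z : (fun k => pderiv i (F k) z) = env4 (i == ord0)%:R (i == ord_max)%:R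
  (pderiv i T z * f z + T z * pderiv i f z) (pderiv i T z * g z + T z * pderiv i g z).
Proof.
apply/funext; case=> [|[|[|[|k]]]]; rewrite /F /env4 /=.
- by rewrite pderiv_centered.
- by rewrite pderiv_centered.
- by rewrite (pderivM _ (smooth_diff sT) (smooth_diff sf)).
- by rewrite (pderivM _ (smooth_diff sT) (smooth_diff sg)).
- by rewrite nth_nil pderiv_cst.
Qed.

Let hess_sum z := `|pderiv ord0 f z| + `|pderiv ord_max f z| + (`|pderiv ord0 g z| + `|pderiv ord_max g z|).

Let c_intg (h : R * R -> R) : continuous h -> intg mu (Omega : set (plane R)) h.
Proof. by move=> ch; apply: (sqint_intg mOm (domain_finite oO bO)); exact: (continuous_sqint oO bO). Qed.

Lemma flux_continuous : continuous (fun z => flux_density z (f z) (g z)).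
Proof.
rewrite (_ : (fun z => _) = fun z => pev (F ^~ z) (calib ord0) * x ord0 z + pev (F ^~ z) (calib ord_max) * x ord_max z).
  by move=> z; apply: cvgD; (apply: cvgM; [exact: smooth_continuous (smooth_pev sF _) z|exact: (Ck_centered c 0)]).
by apply/funext => z; rewrite /flux_density /calib_at -!FE.
Qed.

Lemma remainder_intg : intg mu (Omega : set (plane R)) (fun z => sigma (f z) (g z) * (1 + hess_sum z) + `|pderiv ord0 g z - pderiv ord_max f z|).
Proof.
have cf := smooth_continuous sf; have cg := smooth_continuous sg.
have cD i (h : R * R -> R) : smooth h -> continuous (pderiv i h) by move=> sh; exact: smooth_continuous (smooth_pderiv i sh).
have cT := smooth_continuous sT.
  apply: c_intg => z; apply: cvgD; last first.
    by apply: cvg_norm; apply: cvgB; exact: cD.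
  apply: cvgM; last first.
    by apply: cvgD; [exact: cvg_cst|apply: cvgD; apply: cvgD; apply: cvg_norm; exact: cD].
  have cw : continuous (fun z => well (f z) (g z)).
    rewrite (_ : (fun z => _) = fun z => f z * f z + g z * g z - 1).
      by move=> y; apply: cvgB; [apply: cvgD; apply: cvgM; first [exact: cf|exact: cg]|exact: cvg_cst].
    by apply/funext => y; rewrite /well !expr2.
  apply: cvgM; last exact: cT.
  apply: cvgD; first by apply: cvg_norm; exact: cw.
  by apply: cvgM; exact: cw.
Qed.

(** The pair (f, g) is not assumed to be a gradient, since the two components will be approximated
    independently; this is why the curl stands in the remainder. *)
Lemma smooth_calibration : `|I (fun z => x ord0 z * tgrad (f z) (g z) + x ord_max z * tgrad (g z) (f z)) -
    Bd (fun s => flux_density (bd_curve Omega s) (f (bd_curve Omega s)) (g (bd_curve Omega s)))| <=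
  100 * I (fun z => sigma (f z) (g z) * (1 + hess_sum z) + `|pderiv ord0 g z - pderiv ord_max f z|).
Proof.
have cf := smooth_continuous sf; have cg := smooth_continuous sg.
have cD i (h : R * R -> R) : smooth h -> continuous (pderiv i h) by move=> sh; exact: smooth_continuous (smooth_pderiv i sh).
have cx i : continuous (x i) := Ck_centered c 0 i.
have sC i : smooth (fun z => pev (F ^~ z) (calib i)) by exact: (smooth_pev sF).
have iD i := c_intg (cD i _ (sC i)).
have cT := smooth_continuous sT.
have flux : I (fun z => pderiv ord0 (fun z => pev (F ^~ z) (calib ord0)) z +
     pderiv ord_max (fun z => pev (F ^~ z) (calib ord_max)) z) =
   Bd (fun s => flux_density (bd_curve Omega s) (f (bd_curve Omega s)) (g (bd_curve Omega s))).
  rewrite (RintD mOm (iD ord0) (iD ord_max)) (disc_divergence ord0 ag (sC ord0)) (disc_divergence ord_max ag (sC ord_max)).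
  have cb i : continuous (fun s => pev (F ^~ (bd_curve Omega s)) (calib i) * x i (bd_curve Omega s)).
    move=> s; apply: cvgM.
      exact: (continuous_comp (bd_curve_continuous C2 (x:=s)) (smooth_continuous (sC i) (x:=_))).
    exact: (continuous_comp (bd_curve_continuous C2 (x:=s)) (cx i _)).
  rewrite -(RintD (bd_set_measurable Omega) (continuous_itv_intg 0 (bd_length Omega) (cb ord0)) (continuous_itv_intg 0 (bd_length Omega) (cb ord_max))).
  by apply: eq_Rint => s _; rewrite /flux_density /calib_at -!FE.
rewrite -flux.
have iX : intg mu (Omega : set (plane R)) (fun z => x ord0 z * tgrad (f z) (g z) + x ord_max z * tgrad (g z) (f z)).
  rewrite (_ : (fun z => _) = fun z => x ord0 z * (T z * f z) + x ord_max z * (T z * g z)); last first.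
    by apply/funext => z; rewrite /T /tgrad (tauC (g z)).
  by apply: c_intg => z; apply: cvgD; (apply: cvgM; [exact: cx|apply: cvgM => //]); [exact: cT|exact: cf|exact: cT|exact: cg].
have iDD := intgD mOm (iD ord0) (iD ord_max).
rewrite distrC -(RintB mOm iDD iX).
have iR := remainder_intg.
rewrite -(RintZ mOm 100 iR).
apply: (le_trans (norm_Rint mOm (intgB mOm iDD iX))).
apply: (le_Rint mOm); [exact/intg_norm/(intgB mOm iDD iX)|exact: (intgZ mOm)|].
move=> z Oz; rewrite !(pderiv_pev sF) !dF.
have e2 : tgrad (g z) (f z) = T z * g z by rewrite /T /tgrad (tauC (g z)).
have q1 : x ord0 z ^+ 2 + x ord_max z ^+ 2 <= 1.
  by have /andP[_ /ltW] := sqdist_ball Oz; rewrite sqdistE.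
have key := @calib_remainder R (x ord0 z) (x ord_max z) (f z) (g z)
  (pderiv ord0 f z) (pderiv ord_max f z) (pderiv ord0 g z) (pderiv ord_max g z) (T z) _ _
  q1 (erefl (T z)) (f_equal (@^~ z) (dT ord0)) (f_equal (@^~ z) (dT ord_max)).
rewrite e2; exact: key.
Qed.
End smooth_calibration.

(** * The trace of the gradient on the circle *)

Lemma common_summand (V : zmodType) (a a' b d e e' : V) : a + b = 0 -> a' + d = 0 -> a = a' -> e' = e ->
  b + e' = d + e.
Proof. by move=> h1 h2 h3 h4; apply: (addrI a); rewrite addrA h1 add0r h4 addrA h3 h2 add0r. Qed.

Section boundary_gradient.
Context {R : realType}.
Variable c : R * R.
Let Omega : set (R * R) := eball c 1.
Hypothesis C2 : C2_boundary Omega.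
Let oO : open Omega := @open_eball R c 1.
Let bO : Omega `<=` square_box (`|c.1| + `|c.2| + 1) := @eball_square_box R c 1.
Let ag := bd_param_spec C2.

Local Notation mu := (@leb2 R).
Local Notation I := (Rintegral mu (Omega : set (plane R))).
Local Notation B := (bd_set Omega).
Local Notation Bd := (Rintegral (@lebesgue_measure R) B).
Local Notation x := (centered c).
Local Notation gam := (bd_curve Omega).
Let mOm : measurable (Omega : set (plane R)) := domain_measurable oO.
Let mBB := bd_set_measurable Omega.
Let cgam : continuous gam := bd_curve_continuous C2.

Let cont_bd (f : R * R -> R) : continuous f -> continuous (fun s => f (gam s)).
Proof. by move=> cf s; exact: (continuous_comp (cgam (x:=s)) (cf _)). Qed.

Let bd2 (f : R * R -> R) : continuous f -> sqint lebesgue_measure B (fun s => f (gam s)).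
Proof. by move=> cf; apply: continuous_itv_sqint; exact: cont_bd. Qed.

Let cx i : continuous (x i) := Ck_centered c 0 i.

(** The divergence theorem for [phi n * psi], in which all three factors depending on n converge in
    L^2. *)
Lemma green_trace (v : R * R -> R) (w : 'I_2 -> R * R -> R) (g : R -> R) (psi : R * R -> R) i :
  L2 Omega v -> (forall i, is_weak_pderiv Omega i v (w i)) -> has_trace Omega v g -> smooth psi ->
  Bd (fun s => g s * (psi (gam s) * x i (gam s))) = I (fun z => v z * pderiv i psi z + w i z * psi z).
Proof.
move=> v2 vw tv spsi.
have [g2 [phi [sphi c1 c2 c3]]] := trace_approximation oO bO cgam v2 vw tv.
have v2' := (L2P oO v).1 v2.
have w2 : sqint mu (Omega : set (plane R)) (w i) by apply/(L2P oO); have [] := vw i.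
have cpsi := smooth_continuous spsi.
have p2 n := continuous_sqint oO bO (smooth_continuous (sphi n)).
have d2 n := continuous_sqint oO bO (smooth_continuous (smooth_pderiv i (sphi n))).
have s2 := continuous_sqint oO bO cpsi.
have s2' := continuous_sqint oO bO (smooth_continuous (smooth_pderiv i spsi)).
have cpx : continuous (fun z => psi z * x i z) by move=> z; apply: cvgM; [exact: cpsi|exact: cx].
have k1 := cvg2_mul mBB (fun n => bd2 (smooth_continuous (sphi n))) g2 (bd2 cpx) c3.
have k2 := cvg2_mul mOm p2 v2' s2' c1.
have k3 := cvg2_mul mOm d2 w2 s2 (c2 i).
rewrite (RintD mOm (sqint_mul mOm v2' s2') (sqint_mul mOm w2 s2)).
apply: (cvg_unique (@Rhausdorff R) k1).
rewrite (_ : (fun n => _) = fun n => I (fun z => phi n z * pderiv i psi z) + I (fun z => pderiv i (phi n) z * psi z)).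
  exact: cvgD.
apply/funext => n; have sm : smooth (fun z => phi n z * psi z) by move=> k; apply: CkM; [exact: sphi|exact: spsi].
have := disc_divergence i ag sm; rewrite (pderivM _ (smooth_diff (sphi n)) (smooth_diff spsi)) => e.
rewrite -(RintD mOm (sqint_mul mOm (p2 n) s2') (sqint_mul mOm (d2 n) s2)).
transitivity (Bd (fun s => phi n (gam s) * psi (gam s) * coord i (gam s - c))).
  by apply: eq_Rint => s _; rewrite mulrA.
by rewrite -e; apply: eq_Rint => z _; rewrite addrC.
Qed.

Variables (u : R * R -> R) (w : 'I_2 -> R * R -> R) (h : 'I_2 -> 'I_2 -> R * R -> R) (g : 'I_2 -> R -> R).
Hypotheses (uL2 : L2 Omega u) (uw : forall i, is_weak_pderiv Omega i u (w i)).
Hypothesis wh : forall i j, is_weak_pderiv Omega j (w i) (h i j).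
Hypotheses (tu : has_trace Omega u (fun=> 0)) (tg : forall i, has_trace Omega (w i) (g i)).
Hypothesis ng : {ae lebesgue_measure, forall s, s \in `[0, bd_length Omega] ->
  dotp (g ord0 s, g ord_max s) (inward_normal Omega s) = 1}.

Let wL2 i : L2 Omega (w i). Proof. by have [] := uw i. Qed.

Lemma weak_hess_symmetric : ae_eq mu (Omega : set (plane R)) (h ord0 ord_max) (h ord_max ord0).
Proof.
exact: (mixed_weak_pderiv oO bO uL2 (uw ord0) (uw ord_max) (wh ord0 ord_max) (wh ord_max ord0)).
Qed.

(** Both sides are weak mixed derivatives of psi, and these agree almost everywhere. *)
Lemma smooth_symmetric (psi : R * R -> R) : smooth psi ->
  ae_eq mu (Omega : set (plane R)) (pderiv ord_max (pderiv ord0 psi)) (pderiv ord0 (pderiv ord_max psi)).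
Proof.
move=> sp; have w1 i := smooth_weak_pderiv oO bO i sp.
have w2 i j := smooth_weak_pderiv oO bO j (smooth_pderiv i sp).
exact: (mixed_weak_pderiv oO bO (smooth_L2 oO bO sp) (w1 ord0) (w1 ord_max) (w2 ord0 ord_max) (w2 ord_max ord0)).
Qed.

(* Two integrations by parts: u vanishes on the boundary and its weak Hessian is symmetric, so the tangential component
   of the trace of its gradient vanishes. *)
Lemma tangential_trace (psi : R * R -> R) : smooth psi ->
  Bd (fun s => g ord_max s * (psi (gam s) * x ord0 (gam s))) = Bd (fun s => g ord0 s * (psi (gam s) * x ord_max (gam s))).
Proof.
move=> sp; have u2 := (L2P oO u).1 uL2.
have w2 i := (L2P oO (w i)).1 (wL2 i); have h2 i j := (L2P oO (h i j)).1 (wh i j).1.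
have ss f : smooth f -> sqint mu (Omega : set (plane R)) f.
  by move=> sf; exact: (continuous_sqint oO bO (smooth_continuous sf)).
have s2 := ss _ sp; have p2 i := ss _ (smooth_pderiv i sp).
have pp2 i j := ss _ (smooth_pderiv j (smooth_pderiv i sp)).
rewrite (green_trace ord0 (wL2 ord_max) (wh ord_max) (tg ord_max) sp).
rewrite (green_trace ord_max (wL2 ord0) (wh ord0) (tg ord0) sp).
have z0 i f : smooth f -> I (fun z => u z * pderiv i f z + w i z * f z) = 0.
  move=> sf; rewrite -(green_trace i uL2 uw tu sf).
  rewrite (_ : (fun s => _) = fun=> 0); last by apply/funext => s; rewrite mul0r.
  by rewrite /Rintegral integral0.
have e0 := z0 ord_max _ (smooth_pderiv ord0 sp); have e1 := z0 ord0 _ (smooth_pderiv ord_max sp).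
move: e0 e1.
rewrite (RintD mOm (sqint_mul mOm u2 (pp2 ord0 ord_max)) (sqint_mul mOm (w2 ord_max) (p2 ord0))).
rewrite (RintD mOm (sqint_mul mOm u2 (pp2 ord_max ord0)) (sqint_mul mOm (w2 ord0) (p2 ord_max))).
rewrite (RintD mOm (sqint_mul mOm (w2 ord_max) (p2 ord0)) (sqint_mul mOm (h2 ord_max ord0) s2)).
rewrite (RintD mOm (sqint_mul mOm (w2 ord0) (p2 ord_max)) (sqint_mul mOm (h2 ord0 ord_max) s2)).
move=> e0 e1; apply: (common_summand e0 e1).
  apply: (ae_eq_Rint mOm).
  - exact: intg_meas (sqint_mul mOm u2 (pp2 ord0 ord_max)).
  - exact: intg_meas (sqint_mul mOm u2 (pp2 ord_max ord0)).
  by apply: filterS (smooth_symmetric sp) => z k Oz; rewrite k.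
apply: (ae_eq_Rint mOm).
- exact: intg_meas (sqint_mul mOm (h2 ord_max ord0) s2).
- exact: intg_meas (sqint_mul mOm (h2 ord0 ord_max) s2).
by apply: filterS weak_hess_symmetric => z k Oz; rewrite k.
Qed.

(** The tangential component of the trace vanishes by [tangential_trace] and the normal one is
    prescribed, so the trace is -x. The sequences that define the traces of the components therefore
    converge to -x on the circle. *)
Lemma boundary_gradient : exists phi : 'I_2 -> nat -> R * R -> R,
  [/\ forall i n, smooth (phi i n), forall i, cvg2 mu (Omega : set (plane R)) (phi i) (w i),
     forall i j, cvg2 mu (Omega : set (plane R)) (fun n => pderiv j (phi i n)) (h i j) &
     forall i, cvg2 lebesgue_measure B (fun n s => phi i n (gam s)) (fun s => - x i (gam s))].
Proof.
have ap i := trace_approximation oO bO cgam (wL2 i) (wh i) (tg i).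
have g2 i : sqint lebesgue_measure B (g i) := (ap i).1.
have [phi hphi] := choice (fun i => (ap i).2).
exists phi; split.
- by move=> i n; have [] := hphi i.
- by move=> i; have [] := hphi i.
- by move=> i j; have [] := hphi i.
have x2 i := bd2 (cx (i := i)).
have xb i s : `|x i (gam s)| <= 1.
  have := disc_sqdist C2 s; rewrite sqdistE => e.
  rewrite -(@expr_le1 _ 2)// real_normK ?num_real//; move: i; apply: ord2_ind; rewrite -e.
    by rewrite lerDl sqr_ge0.
  by rewrite lerDr sqr_ge0.
have mx i : measurable_fun B (fun s => x i (gam s)) by case: (x2 i).
pose gt s := x ord0 (gam s) * g ord_max s - x ord_max (gam s) * g ord0 s.
have gx2 i j : sqint lebesgue_measure B (fun s => x i (gam s) * g j s).
  exact: (sqint_bmul mBB (g2 j) (mx i) (fun s _ => xb i s)).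
have gt2 : sqint lebesgue_measure B gt by exact: (sqintB mBB).
have xgt2 i : sqint lebesgue_measure B (fun s => x i (gam s) * gt s).
  exact: (sqint_bmul mBB gt2 (mx i) (fun s _ => xb i s)).
have sphi i n : smooth (phi i n) by have [] := hphi i.
have p2 i n := bd2 (smooth_continuous (sphi i n)).
have cb i : cvg2 lebesgue_measure B (fun n s => phi i n (gam s)) (g i) by have [] := hphi i.
(* [tangential_trace] admits smooth test functions only. It is applied to the tangential component
   of the approximating field, which tends to [gt], so the vanishing pairings converge to the
   integral of [gt] squared. *)
have zero : Bd (fun s => gt s ^+ 2) = 0.
  have l1 := cvg2_mul mBB (p2 ord_max) (g2 ord_max) (xgt2 ord0) (cb ord_max).
  have l2 := cvg2_mul mBB (p2 ord0) (g2 ord0) (xgt2 ord_max) (cb ord0).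
  have -> : Bd (fun s => gt s ^+ 2) = Bd (fun s => g ord_max s * (x ord0 (gam s) * gt s)) -
      Bd (fun s => g ord0 s * (x ord_max (gam s) * gt s)).
    rewrite -(RintB mBB (sqint_mul mBB (g2 _) (xgt2 _)) (sqint_mul mBB (g2 _) (xgt2 _))).
    by apply: eq_Rint => s _; rewrite /gt; ring.
  have l3 : (Bd (fun s => phi ord_max n (gam s) * (x ord0 (gam s) * gt s)) -
      Bd (fun s => phi ord0 n (gam s) * (x ord_max (gam s) * gt s))) @[n --> \oo] -->
      Bd (fun s => g ord_max s * (x ord0 (gam s) * gt s)) - Bd (fun s => g ord0 s * (x ord_max (gam s) * gt s)).
    exact: cvgB l1 l2.
  suff l4 : (fun n => Bd (fun s => phi ord_max n (gam s) * (x ord0 (gam s) * gt s)) -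
      Bd (fun s => phi ord0 n (gam s) * (x ord_max (gam s) * gt s))) = fun=> 0.
    by rewrite l4 in l3; exact: (cvg_unique (@Rhausdorff R) l3 (cvg_cst 0)).
  apply/funext => n.
  rewrite -[RHS](subrr (Bd (fun s => g ord_max s * ((x ord0 (gam s) * phi ord_max n (gam s) - x ord_max (gam s) * phi ord0 n (gam s)) * x ord0 (gam s))))).
  have sps : smooth (fun z => x ord0 z * phi ord_max n z - x ord_max z * phi ord0 n z).
    by move=> k; apply: CkB; apply: CkM; first [exact: Ck_centered|exact: sphi].
  rewrite [in X in _ = _ - X](tangential_trace sps).
  have cps i : continuous (fun z => (x ord0 z * phi ord_max n z - x ord_max z * phi ord0 n z) * x i z).
    by move=> z; apply: cvgM; [exact: smooth_continuous sps z|exact: cx].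
  rewrite -(RintB mBB (sqint_mul mBB (p2 _ _) (xgt2 _)) (sqint_mul mBB (p2 _ _) (xgt2 _))).
  rewrite -(RintB mBB (sqint_mul mBB (g2 _) (bd2 (cps _))) (sqint_mul mBB (g2 _) (bd2 (cps _)))).
  by apply: eq_Rint => s _; rewrite /gt; ring.
(* As the normal component equals that of -x and |x| = 1, the difference g + x is tangential: each
   coordinate is a coordinate of x, up to sign, times [gt]. *)
have gE i : Bd (fun s => (g i s + x i (gam s)) ^+ 2) = 0.
  have gx : ae_eq lebesgue_measure B (fun s => g i s + x i (gam s))
      (fun s => (if i == ord0 then - x ord_max (gam s) else x ord0 (gam s)) * gt s).
    have [A [mA A0 sA]] := ng; exists A; split => //; apply: subset_trans sA => s /= nh hs; apply: nh => Bs.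
    have e : - (g ord0 s * x ord0 (gam s) + g ord_max s * x ord_max (gam s)) = 1.
      by have := hs Bs; rewrite (disc_inward_normal C2) /dotp /= => <-; rewrite /centered /coord /=; ring.
    have q1 := disc_sqdist C2 s; rewrite sqdistE in q1; rewrite /gt; move: e q1.
    move: i; apply: ord2_ind => /=; move: (g ord0 s) (g ord_max s) (x ord0 (gam s)) (x ord_max (gam s)) => g0 g1 a b e q1.
      apply/eqP; rewrite -subr_eq0 (_ : _ - _ = g0 * (1 - (a ^+ 2 + b ^+ 2)) + a * (1 + (g0 * a + g1 * b))); last by ring.
      by rewrite q1 subrr mulr0 add0r -e addNr mulr0.
    apply/eqP; rewrite -subr_eq0 (_ : _ - _ = g1 * (1 - (a ^+ 2 + b ^+ 2)) + b * (1 + (g0 * a + g1 * b))); last by ring.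
    by rewrite q1 subrr mulr0 add0r -e addNr mulr0.
  have gxs : sqint lebesgue_measure B (fun s => g i s + x i (gam s)) by exact: (sqintD mBB).
  have k2 : sqint lebesgue_measure B (fun s => (if i == ord0 then - x ord_max (gam s) else x ord0 (gam s)) * gt s).
    case: (i == ord0); last exact: xgt2.
    by apply: (eq_sqint mBB (f := fun s => - (x ord_max (gam s) * gt s))); [move=> s _; rewrite mulNr|exact: (sqintN mBB)].
  rewrite (@ae_eq_Rint _ _ _ _ _ mBB _ (fun s => ((if i == ord0 then - x ord_max (gam s) else x ord0 (gam s)) * gt s) ^+ 2)); first last.
  - by apply: filterS gx => s k Bs; rewrite k.
  - exact: intg_meas k2.2.
  - exact: intg_meas gxs.2.
  apply/eqP; rewrite eq_le; apply/andP; split; last by apply: Rint_ge0 => s _; exact: sqr_ge0.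
  rewrite -zero; apply: (le_Rint mBB k2.2 gt2.2) => s _; rewrite exprMn -[leRHS]mul1r.
  apply: ler_wpM2r; first exact: sqr_ge0.
  by rewrite -real_normK ?num_real// expr_le1//; case: (i == ord0); rewrite ?normrN.
move=> i; have gxs : sqint lebesgue_measure B (fun s => g i s + x i (gam s)) by exact: (sqintD mBB).
apply: (squeeze_cvgr (f := fun=> 0) (h := fun n => 2 * Bd (fun s => (phi i n (gam s) - g i s) ^+ 2))).
- apply: nearW => n; apply/andP; split; first by apply: Rint_ge0 => s _; exact: sqr_ge0.
  have := sq_le2 mBB (sqintB mBB (p2 i n) (g2 i)) gxs; rewrite gE mulr0 addr0; apply: le_trans.
  by rewrite le_eqVlt; apply/orP; left; apply/eqP; apply: eq_Rint => s _; congr (_ ^+ 2); ring.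
- exact: cvg_cst.
- by rewrite -[X in _ --> X](mulr0 2); apply: cvgM; [exact: cvg_cst|exact: cb].
Qed.
End boundary_gradient.

(** * Passing to the limit in the calibration *)

Section polynomial_lipschitz.
Context {R : realType}.

Lemma pev_bounded (M : R) (t : @pexp R) : 0 <= M ->
  exists2 K, 0 <= K & forall f, (forall k, `|f k| <= M) -> `|pev f t| <= K.
Proof.
move=> M0; elim: t => [k|a|t1 [K1 p1 h1] t2 [K2 p2 h2]|t1 [K1 p1 h1] t2 [K2 p2 h2]].
- by exists M => // f hf; exact: hf.
- by exists `|a|.
- exists (K1 + K2); first exact: addr_ge0.
  by move=> f hf /=; apply: (le_trans (ler_normD _ _)); apply: lerD; [exact: h1|exact: h2].
- exists (K1 * K2); first exact: mulr_ge0.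
  by move=> f hf /=; rewrite normrM; apply: ler_pM => //; [exact: h1|exact: h2].
Qed.

Lemma pev_lipschitz (M : R) (t : @pexp R) : 0 <= M ->
  exists2 L, 0 <= L & forall f g d, (forall k, `|f k| <= M) -> (forall k, `|g k| <= M) -> 0 <= d ->
    (forall k, `|f k - g k| <= d) -> `|pev f t - pev g t| <= L * d.
Proof.
move=> M0; elim: t => [k|a|t1 [K1 p1 h1] t2 [K2 p2 h2]|t1 [K1 p1 h1] t2 [K2 p2 h2]].
- by exists 1 => // f g d hf hg d0 hd; rewrite mul1r; exact: hd.
- by exists 0 => // f g d hf hg d0 hd; rewrite /= subrr normr0 mul0r.
- exists (K1 + K2); first exact: addr_ge0.
  move=> f g d hf hg d0 hd /=; rewrite opprD addrACA mulrDl.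
  by apply: (le_trans (ler_normD _ _)); apply: lerD; [exact: h1|exact: h2].
- have [B1 q1 b1] := pev_bounded t1 M0; have [B2 q2 b2] := pev_bounded t2 M0.
  exists (K1 * B2 + B1 * K2); first by rewrite addr_ge0// mulr_ge0.
  move=> f g d hf hg d0 hd /=.
  rewrite (_ : _ - _ = (pev f t1 - pev g t1) * pev f t2 + pev g t1 * (pev f t2 - pev g t2)); last by ring.
  apply: (le_trans (ler_normD _ _)); rewrite !normrM.
  rewrite (_ : _ * d = (K1 * d) * B2 + B1 * (K2 * d)); last by ring.
  by apply: lerD; apply: ler_pM => //; [exact: h1|exact: b2|exact: b1|exact: h2].
Qed.
End polynomial_lipschitz.

Section abs_limits.
Context d (T : measurableType d) (R : realType).
Variables (mu : {measure set T -> \bar R}) (D : set T).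
Hypothesis mD : measurable D.
Local Notation I := (Rintegral mu D).

Lemma sqint_norm (f : T -> R) : sqint mu D f -> sqint mu D (fun z => `|f z|).
Proof.
move=> [mf fi]; split; first exact: measurableT_comp.
by apply: (eq_intg mD (f := fun z => f z ^+ 2)) => // z _; rewrite real_normK// num_real.
Qed.

Lemma cvg2_abs (F : nat -> T -> R) (f k : T -> R) : (forall n, sqint mu D (F n)) -> sqint mu D f ->
  sqint mu D k -> cvg2 mu D F f -> I (fun z => `|F n z - f z| * k z) @[n --> \oo] --> (0 : R).
Proof.
move=> F2 f2 k2 Ff; have d2 n := sqint_norm (sqintB mD (F2 n) f2).
pose N (h : T -> R) := Num.sqrt (I (fun z => h z ^+ 2)).
have lim : N (fun z => `|F n z - f z|) * N k @[n --> \oo] --> (0 : R).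
  rewrite -[X in _ --> X](mul0r (N k)); apply: cvgM; last exact: cvg_cst.
  rewrite -[X in _ --> X](@sqrtr0 R) (_ : (fun n => N _) = fun n => Num.sqrt (I (fun z => (F n z - f z) ^+ 2))).
    by apply: (cvg_comp _ Num.sqrt Ff); exact: sqrt_continuous.
  by apply/funext => n; rewrite /N; congr Num.sqrt; apply: eq_Rint => z _; rewrite real_normK// num_real.
apply: (norm_cvg0 (f := fun n => I (fun z => `|F n z - f z| * k z))).
apply: (squeeze_cvgr (f := fun=> 0) (h := fun n => N (fun z => `|F n z - f z|) * N k)) => //.
- by apply: nearW => n; rewrite normr_ge0/=; exact: cauchy_schwarz.
- exact: cvg_cst.
Qed.

Lemma le_add_cvg0 (X a : R) (err : nat -> R) : err n @[n --> \oo] --> (0 : R) ->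
  (forall n, X <= a + err n) -> X <= a.
Proof.
move=> e0 h; have l : a + err n @[n --> \oo] --> a + 0 by apply: cvgD => //; exact: cvg_cst.
by rewrite -[leRHS]addr0; exact: (ler_cvg_to (cvg_cst X) l (nearW _ h)).
Qed.
End abs_limits.

Section tgrad_continuous.
Context {R : realType}.

Lemma well_continuous : continuous (fun z : R * R => well z.1 z.2).
Proof.
rewrite (_ : (fun z => _) = fun z : R * R => z.1 * z.1 + z.2 * z.2 - 1).
  move=> z; apply: cvgB; last exact: cvg_cst.
  by apply: cvgD; apply: cvgM; first [exact: continuous_fst2|exact: continuous_snd2].
by apply/funext => z; rewrite /well !expr2.
Qed.

Lemma tau_continuous : continuous (fun z : R * R => tau z.1 z.2).
Proof.
move=> z; apply: cvgV; first by rewrite gt_eqF// ltr_wpDr// sqr_ge0.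
apply: cvgD; first exact: cvg_cst.
by apply: cvgM; exact: well_continuous.
Qed.

Lemma tgrad_continuous : continuous (fun z : R * R => tgrad z.1 z.2).
Proof. by move=> z; apply: cvgM; [exact: tau_continuous|exact: continuous_fst2]. Qed.

Lemma sigma_continuous : continuous (fun z : R * R => sigma z.1 z.2).
Proof.
move=> z; apply: cvgM; last exact: tau_continuous.
by apply: cvgD; [apply: cvg_norm|apply: cvgM]; exact: well_continuous.
Qed.

Variable D : set (plane R).
Hypothesis mD : measurable D.
Local Notation mu := (@leb2 R).
Hypothesis Dlty : (mu D < +oo)%E.

Lemma continuous2_measurable (G : R * R -> R) (a b : plane R -> R) : continuous G ->
  measurable_fun D (a : plane R -> measurableTypeR R) -> measurable_fun D (b : plane R -> measurableTypeR R) ->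
  measurable_fun D ((fun z => G (a z, b z)) : plane R -> measurableTypeR R).
Proof.
move=> cG ma mb; have mr (f : plane R -> measurableTypeR R) : measurable_fun D f ->
    measurable_fun setT (f \_ D) by move=> mf; apply/(measurable_restrictT _ mD).
have := measurableT_comp (continuous_measurable2 cG) (measurable_fun_pair (mr _ ma) (mr _ mb)).
move=> /(measurable_funS measurableT (@subsetT _ D)).
by apply: eq_measurable_fun => z Oz /=; rewrite /patch Oz.
Qed.

Lemma tgrad_sqint (a b : plane R -> R) : sqint mu D a -> sqint mu D b -> sqint mu D (fun z => tgrad (a z) (b z)).
Proof.
move=> [ma _] [mb _]; apply: (sqint_bounded mD Dlty (M := 2)); last by move=> z _; exact: tgrad_bound.
exact: (continuous2_measurable tgrad_continuous).
Qed.

Lemma sigma_sqint (a b : plane R -> R) : sqint mu D a -> sqint mu D b -> sqint mu D (fun z => sigma (a z) (b z)).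
Proof.
move=> [ma _] [mb _]; apply: (sqint_bounded mD Dlty (M := 2)).
  exact: (continuous2_measurable sigma_continuous).
by move=> z _; rewrite ger0_norm ?sigma_ge0// sigma_le.
Qed.
End tgrad_continuous.

Section calibration_limit.
Context {R : realType}.
Variable c : R * R.
Let Omega : set (R * R) := eball c 1.
Hypothesis C2 : C2_boundary Omega.
Let oO : open Omega := @open_eball R c 1.
Let bO : Omega `<=` square_box (`|c.1| + `|c.2| + 1) := @eball_square_box R c 1.

Local Notation mu := (@leb2 R).
Local Notation I := (Rintegral mu (Omega : set (plane R))).
Local Notation B := (bd_set Omega).
Local Notation Bd := (Rintegral (@lebesgue_measure R) B).
Local Notation x := (centered c).
Local Notation gam := (bd_curve Omega).
Let mOm : measurable (Omega : set (plane R)) := domain_measurable oO.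
Let mBB := bd_set_measurable Omega.
Let cgam : continuous gam := bd_curve_continuous C2.

Lemma flux_lipschitz : exists2 L : R, 0 <= L & forall s p q p' q',
  `|flux_density c (gam s) p q - flux_density c (gam s) p' q'| <= L * (`|p - p'| + `|q - q'|).
Proof.
have two : 0 <= 2 :> R by [].
have [L0 l0 h0] := pev_lipschitz (calib ord0) two; have [L1 l1 h1] := pev_lipschitz (calib ord_max) two.
exists (9 * (L0 + L1)); first by rewrite mulr_ge0// addr_ge0.
move=> s p q p' q'; have q1 := disc_sqdist C2 s; rewrite sqdistE in q1.
have xb i : `|x i (gam s)| <= 1.
  rewrite -(@expr_le1 _ 2)// real_normK ?num_real//; move: i; apply: ord2_ind; rewrite -q1.
    by rewrite lerDl sqr_ge0.
  by rewrite lerDr sqr_ge0.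
pose E p q := env4 (x ord0 (gam s)) (x ord_max (gam s)) (tgrad p q) (tgrad q p).
have Eb a b k : `|E a b k| <= 2.
  case: k => [|[|[|[|k]]]] /=; rewrite ?tgrad_bound//; try (by apply: (le_trans (xb _)); rewrite ler1n).
  by rewrite /E /env4 /= nth_nil normr0.
have s0 : 0 <= `|p - p'| + `|q - q'| by rewrite addr_ge0.
have Ed k : `|E p q k - E p' q' k| <= 9 * (`|p - p'| + `|q - q'|).
  case: k => [|[|[|[|k]]]]; rewrite /E /env4 /=; try (by rewrite ?nth_nil subrr normr0 mulr_ge0).
    exact: tgrad_lip.
  by rewrite [X in _ <= _ * X]addrC; exact: tgrad_lip.
have d9 : 0 <= 9 * (`|p - p'| + `|q - q'|) by rewrite mulr_ge0.
have k0 := h0 _ _ _ (Eb p q) (Eb p' q') d9 Ed; have k1 := h1 _ _ _ (Eb p q) (Eb p' q') d9 Ed.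
rewrite /flux_density (_ : _ - _ = (calib_at c ord0 (gam s) p q - calib_at c ord0 (gam s) p' q') * x ord0 (gam s) +
  (calib_at c ord_max (gam s) p q - calib_at c ord_max (gam s) p' q') * x ord_max (gam s)); last by ring.
apply: (le_trans (ler_normD _ _)); rewrite !normrM.
apply: (@le_trans _ _ (L0 * (9 * (`|p - p'| + `|q - q'|)) * 1 + L1 * (9 * (`|p - p'| + `|q - q'|)) * 1)).
  by apply: lerD; apply: ler_pM.
by rewrite le_eqVlt; apply/orP; left; apply/eqP; ring.
Qed.

(** The flux of the calibration for the boundary field -x. Its value is never computed: it cancels
    between minimiser and competitor. *)
Definition calib_flux := Bd (fun s => flux_density c (gam s) (- x ord0 (gam s)) (- x ord_max (gam s))).

Variables (w : 'I_2 -> R * R -> R) (h : 'I_2 -> 'I_2 -> R * R -> R) (phi : 'I_2 -> nat -> R * R -> R).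
Hypotheses (w2 : forall i, sqint mu (Omega : set (plane R)) (w i)).
Hypotheses (h2 : forall i j, sqint mu (Omega : set (plane R)) (h i j)).
Hypothesis hs : ae_eq mu (Omega : set (plane R)) (h ord0 ord_max) (h ord_max ord0).
Hypotheses (sphi : forall i n, smooth (phi i n)).
Hypothesis cw : forall i, cvg2 mu (Omega : set (plane R)) (phi i) (w i).
Hypothesis ch : forall i j, cvg2 mu (Omega : set (plane R)) (fun n => pderiv j (phi i n)) (h i j).
Hypothesis cb : forall i, cvg2 lebesgue_measure B (fun n s => phi i n (gam s)) (fun s => - x i (gam s)).

Definition hess_l1 (z : R * R) := `|h ord0 ord0 z| + `|h ord0 ord_max z| + (`|h ord_max ord0 z| + `|h ord_max ord_max z|).

(** Replaces the approximating field by its limit in the remainder. Errors in [sigma] are Lipschitz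
    and multiply the limiting Hessian, which is in L^2; errors in the Hessian multiply [sigma],
    which is at most 2. All of them thus tend to 0 in L^1. *)
Lemma calib_remainder_perturb (f g a b f0 f1 g0 g1 h00 h01 h10 h11 : R) :
  sigma f g * (1 + (`|f0| + `|f1| + (`|g0| + `|g1|))) + `|g0 - f1| <=
  sigma a b * (1 + (`|h00| + `|h01| + (`|h10| + `|h11|))) + (`|h10 - h01| +
   (20 * ((`|f - a| + `|g - b|) * (1 + (`|h00| + `|h01| + (`|h10| + `|h11|)))) +
   3 * (`|f0 - h00| + `|f1 - h01| + (`|g0 - h10| + `|g1 - h11|)))).
Proof.
have lip := sigma_lip f g a b; have s2 := sigma_le f g; have s0 := sigma_ge0 f g.
have tr (u v : R) : `|u| <= `|v| + `|u - v| by have := ler_normD v (u - v); rewrite addrC subrK.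
have t1 := tr f0 h00; have t2 := tr f1 h01; have t3 := tr g0 h10; have t4 := tr g1 h11.
have curl : `|g0 - f1| <= `|h10 - h01| + (`|g0 - h10| + `|f1 - h01|).
  rewrite (_ : g0 - f1 = (h10 - h01) + ((g0 - h10) - (f1 - h01))); last by ring.
  by apply: (le_trans (ler_normD _ _)); rewrite lerD2l; exact: ler_normB.
have n1 := normr_ge0 h00; have n2 := normr_ge0 h01; have n3 := normr_ge0 h10; have n4 := normr_ge0 h11.
have m1 := normr_ge0 (f0 - h00); have m2 := normr_ge0 (f1 - h01).
have m3 := normr_ge0 (g0 - h10); have m4 := normr_ge0 (g1 - h11).
set H := 1 + (`|h00| + `|h01| + (`|h10| + `|h11|)); have H0 : 0 <= H by rewrite /H; lra.
set d := `|f0 - h00| + `|f1 - h01| + (`|g0 - h10| + `|g1 - h11|).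
have d0 : 0 <= d by rewrite /d; lra.
have k1 : sigma f g * (1 + (`|f0| + `|f1| + (`|g0| + `|g1|))) <= sigma f g * H + 2 * d.
  apply: (@le_trans _ _ (sigma f g * (H + d))); first by apply: ler_wpM2l => //; rewrite /H /d; lra.
  by rewrite mulrDr lerD2l ler_wpM2r.
have k2 : sigma f g * H <= (sigma a b + 20 * (`|f - a| + `|g - b|)) * H.
  by apply: ler_wpM2r => //; have := ler_norm (sigma f g - sigma a b); lra.
apply: (le_trans (lerD k1 curl)); apply: (le_trans (lerD (lerD k2 (lexx _)) (lexx _))).
by rewrite mulrDl -!mulrA /d; lra.
Qed.

Let c_sq (f : R * R -> R) : smooth f -> sqint mu (Omega : set (plane R)) f.
Proof. by move=> sf; exact: (continuous_sqint oO bO (smooth_continuous sf)). Qed.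

Let one2 : sqint mu (Omega : set (plane R)) (fun=> 1 : R).
Proof. by apply: (sqint_bounded mOm (domain_finite oO bO) (M := 1)) => // z _; rewrite normr1. Qed.

Let H2 : sqint mu (Omega : set (plane R)) (fun z => 1 + hess_l1 z).
Proof.
have n2 i j := sqint_norm mOm (h2 i j).
by apply: (sqintD mOm one2); apply: (sqintD mOm); exact: (sqintD mOm).
Qed.

Let T2 : sqint mu (Omega : set (plane R)) (fun z => tgrad (w ord0 z) (w ord_max z)).
Proof. exact: (tgrad_sqint mOm (domain_finite oO bO) (w2 ord0) (w2 ord_max)). Qed.

Let T2' : sqint mu (Omega : set (plane R)) (fun z => tgrad (w ord_max z) (w ord0 z)).
Proof. exact: (tgrad_sqint mOm (domain_finite oO bO) (w2 ord_max) (w2 ord0)). Qed.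

Let S2 : sqint mu (Omega : set (plane R)) (fun z => sigma (w ord0 z) (w ord_max z)).
Proof. exact: (sigma_sqint mOm (domain_finite oO bO) (w2 ord0) (w2 ord_max)). Qed.

(** For each n the smooth estimate is applied to the approximations. Changing the interior integral,
    the flux and the remainder into their limits costs a total of [err n], which tends to 0, because
    the truncated field, the flux density and [sigma] are Lipschitz in the field. *)
Lemma calibration_estimate :
  `|I (fun z => x ord0 z * tgrad (w ord0 z) (w ord_max z) + x ord_max z * tgrad (w ord_max z) (w ord0 z)) - calib_flux|
  <= 100 * I (fun z => sigma (w ord0 z) (w ord_max z) * (1 + hess_l1 z)).
Proof.
have Oly := domain_finite oO bO.
have [L L0 hL] := flux_lipschitz.
pose H z := 1 + hess_l1 z.
have d2 i n := sqint_norm mOm (sqintB mOm (c_sq (sphi i n)) (w2 i)).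
have e2 i j n := sqint_norm mOm (sqintB mOm (c_sq (smooth_pderiv j (sphi i n))) (h2 i j)).
have bc f : smooth f -> sqint lebesgue_measure B (fun s => f (gam s)).
  by move=> sf; apply: (curve_sqint _ (smooth_continuous sf) cgam).
have x2 i : sqint lebesgue_measure B (fun s => - x i (gam s)).
  by apply: (sqintN mBB); apply: bc => k; exact: Ck_centered.
have b2 i n := sqint_norm mBB (sqintB mBB (bc _ (sphi i n)) (x2 i)).
have oneB : sqint lebesgue_measure B (fun=> 1 : R).
  by apply: (sqint_bounded mBB (itv_lty _ _) (M := 1)) => // z _; rewrite normr1.
pose D i n := I (fun z => `|phi i n z - w i z| * 1).
pose DH i n := I (fun z => `|phi i n z - w i z| * H z).
pose E i j n := I (fun z => `|pderiv j (phi i n) z - h i j z| * 1).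
pose Q i n := Bd (fun s => `|phi i n (gam s) - - x i (gam s)| * 1).
have D0 i : D i n @[n --> \oo] --> (0 : R) by apply: (cvg2_abs mOm (fun n => c_sq (sphi i n))).
have DH0 i : DH i n @[n --> \oo] --> (0 : R) by apply: (cvg2_abs mOm (fun n => c_sq (sphi i n))).
have E0 i j : E i j n @[n --> \oo] --> (0 : R).
  by apply: (cvg2_abs mOm (fun n => c_sq (smooth_pderiv j (sphi i n)))).
have Q0 i : Q i n @[n --> \oo] --> (0 : R) by apply: (cvg2_abs mBB (fun n => bc _ (sphi i n))).
pose err n := 9 * 2 * (D ord0 n + D ord_max n) + L * (Q ord0 n + Q ord_max n) +
  100 * (20 * (DH ord0 n + DH ord_max n) + 3 * (E ord0 ord0 n + E ord0 ord_max n + (E ord_max ord0 n + E ord_max ord_max n))).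
have err0 : err n @[n --> \oo] --> (0 : R).
  have cm (k : R) (a : nat -> R) : a n @[n --> \oo] --> (0 : R) -> k * a n @[n --> \oo] --> (0 : R).
    by move=> h0; rewrite -[X in _ --> X](mulr0 k); apply: cvgM => //; exact: cvg_cst.
  have cd (a b : nat -> R) : a n @[n --> \oo] --> (0 : R) -> b n @[n --> \oo] --> (0 : R) ->
      a n + b n @[n --> \oo] --> (0 : R).
    by move=> h0 h1; rewrite -[X in _ --> X](addr0 0); apply: cvgD.
  apply: (cd _ _); first by apply: (cd _ _); apply: (cm _ _); exact: (cd _ _).
  by apply: (cm _ _); apply: (cd _ _); apply: (cm _ _); (try exact: (cd _ _)); apply: (cd _ _); exact: (cd _ _).
apply: (le_add_cvg0 err0) => n.
have cx i : continuous (x i) := Ck_centered c 0 i.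
have xb i z : Omega z -> `|x i z| <= 1.
  move=> Oz; have /andP[_ /ltW] := sqdist_ball Oz; rewrite sqdistE => q1.
  rewrite -(@expr_le1 _ 2)// real_normK ?num_real//; move: i; apply: ord2_ind; apply: (le_trans _ q1).
    by rewrite lerDl sqr_ge0.
  by rewrite lerDr sqr_ge0.
set f := phi ord0 n; set g := phi ord_max n.
have sf : smooth f by exact: sphi. have sg : smooth g by exact: sphi.
have i1 i : intg mu (Omega : set (plane R)) (fun z => `|phi i n z - w i z| * 1) := sqint_mul mOm (d2 i n) one2.
have iH i : intg mu (Omega : set (plane R)) (fun z => `|phi i n z - w i z| * H z) := sqint_mul mOm (d2 i n) H2.
have iE i j : intg mu (Omega : set (plane R)) (fun z => `|pderiv j (phi i n) z - h i j z| * 1) :=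
  sqint_mul mOm (e2 i j n) one2.
have iQ i : intg lebesgue_measure B (fun s => `|phi i n (gam s) - - x i (gam s)| * 1) := sqint_mul mBB (b2 i n) oneB.
have x2' i := continuous_sqint oO bO (cx i).
have iX := intgD mOm (sqint_mul mOm (x2' ord0) T2) (sqint_mul mOm (x2' ord_max) T2').
have iP : intg mu (Omega : set (plane R)) (fun z => x ord0 z * tgrad (f z) (g z) + x ord_max z * tgrad (g z) (f z)).
  have ct (a b : R * R -> R) : smooth a -> smooth b -> sqint mu (Omega : set (plane R)) (fun z => tgrad (a z) (b z)).
    move=> /smooth_continuous ca /smooth_continuous cb'; apply: (continuous_sqint oO bO) => z.
    apply: (continuous_comp (f := fun z => (a z, b z)) (g := fun z : R * R => tgrad z.1 z.2)); last exact: tgrad_continuous.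
    exact: (cvg_pair (ca z) (cb' z)).
  exact: (intgD mOm (sqint_mul mOm (x2' _) (ct _ _ sf sg)) (sqint_mul mOm (x2' _) (ct _ _ sg sf))).
set X := I _; set P := I (fun z => x ord0 z * tgrad (f z) (g z) + x ord_max z * tgrad (g z) (f z)).
have hP : `|X - P| <= 9 * 2 * (D ord0 n + D ord_max n).
  rewrite /X /P -(RintB mOm iX iP) -(RintD mOm (i1 _) (i1 _)) -(RintZ mOm _ (intgD mOm (i1 _) (i1 _))).
  apply: (le_trans (norm_Rint mOm (intgB mOm iX iP))).
  apply: (le_Rint mOm); [exact/intg_norm/(intgB mOm iX iP)|exact: (intgZ mOm _ (intgD mOm (i1 _) (i1 _)))|].
  move=> z Oz; rewrite !mulr1.
  have l0 := tgrad_lip (w ord0 z) (w ord_max z) (f z) (g z); have l1 := tgrad_lip (w ord_max z) (w ord0 z) (g z) (f z).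
  rewrite (_ : _ - _ = x ord0 z * (tgrad (w ord0 z) (w ord_max z) - tgrad (f z) (g z)) +
    x ord_max z * (tgrad (w ord_max z) (w ord0 z) - tgrad (g z) (f z))); last by ring.
  apply: (le_trans (ler_normD _ _)); rewrite !normrM.
  have m0 := ler_pM (normr_ge0 _) (normr_ge0 _) (xb ord0 z Oz) l0.
  have m1 := ler_pM (normr_ge0 _) (normr_ge0 _) (xb ord_max z Oz) l1.
  apply: (le_trans (lerD m0 m1)); rewrite !(distrC (w _ z)) /f /g.
  by rewrite le_eqVlt; apply/orP; left; apply/eqP; ring.
set F := Bd (fun s => flux_density c (gam s) (f (gam s)) (g (gam s))).
have sx i : smooth (fun z => - x i z) by move=> k; apply: CkN; exact: Ck_centered.
have cfl (a b : R * R -> R) : smooth a -> smooth b ->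
    intg lebesgue_measure B (fun s => flux_density c (gam s) (a (gam s)) (b (gam s))).
  move=> sa sb; apply: continuous_itv_intg => s.
  apply: (continuous_comp (f := gam) (g := fun z => flux_density c z (a z) (b z))); first exact: cgam.
  exact: (@flux_continuous R c a b sa sb (gam s)).
have hF : `|F - calib_flux| <= L * (Q ord0 n + Q ord_max n).
  rewrite /F /calib_flux -(RintB mBB (cfl _ _ sf sg) (cfl _ _ (sx ord0) (sx ord_max))).
  rewrite -(RintD mBB (iQ _) (iQ _)) -(RintZ mBB _ (intgD mBB (iQ _) (iQ _))).
  have iD := intgB mBB (cfl _ _ sf sg) (cfl _ _ (sx ord0) (sx ord_max)).
  apply: (le_trans (norm_Rint mBB iD)).
  apply: (le_Rint mBB); [exact/intg_norm|exact: (intgZ mBB _ (intgD mBB (iQ _) (iQ _)))|].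
  by move=> s _; rewrite !mulr1; exact: hL.
have hS := smooth_calibration C2 sf sg; rewrite -/P -/F in hS.
have hR : I (fun z => sigma (f z) (g z) * (1 + (`|pderiv ord0 f z| + `|pderiv ord_max f z| +
     (`|pderiv ord0 g z| + `|pderiv ord_max g z|))) + `|pderiv ord0 g z - pderiv ord_max f z|) <=
   I (fun z => sigma (w ord0 z) (w ord_max z) * (1 + hess_l1 z)) +
   (20 * (DH ord0 n + DH ord_max n) + 3 * (E ord0 ord0 n + E ord0 ord_max n + (E ord_max ord0 n + E ord_max ord_max n))).
  have iS : intg mu (Omega : set (plane R)) (fun z => sigma (w ord0 z) (w ord_max z) * (1 + hess_l1 z)).
    exact: (sqint_mul mOm S2 H2).
  have hd2 : sqint mu (Omega : set (plane R)) (fun z => h ord_max ord0 z - h ord0 ord_max z) by exact: (sqintB mOm).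
  have iC : intg mu (Omega : set (plane R)) (fun z => `|h ord_max ord0 z - h ord0 ord_max z|).
    exact: (sqint_intg mOm Oly (sqint_norm mOm hd2)).
  (* The symmetry of the weak Hessian removes the curl of the limit. *)
  have C0 : I (fun z => `|h ord_max ord0 z - h ord0 ord_max z|) = 0.
    rewrite (@ae_eq_Rint _ _ _ _ _ mOm _ (fun=> 0)); first by rewrite /Rintegral integral0.
    - exact: intg_meas iC.
    - exact: measurable_cst.
    by apply: filterS hs => z k Oz; rewrite k// subrr normr0.
  have iHH := intgZ mOm 20 (intgD mOm (iH ord0) (iH ord_max)).
  have iEE := intgZ mOm 3 (intgD mOm (intgD mOm (iE ord0 ord0) (iE ord0 ord_max)) (intgD mOm (iE ord_max ord0) (iE ord_max ord_max))).
  apply: (@le_trans _ _ (I (fun z => sigma (w ord0 z) (w ord_max z) * (1 + hess_l1 z) +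
    (`|h ord_max ord0 z - h ord0 ord_max z| + (20 * (`|phi ord0 n z - w ord0 z| * H z + `|phi ord_max n z - w ord_max z| * H z) +
    3 * (`|pderiv ord0 (phi ord0 n) z - h ord0 ord0 z| * 1 + `|pderiv ord_max (phi ord0 n) z - h ord0 ord_max z| * 1 +
     (`|pderiv ord0 (phi ord_max n) z - h ord_max ord0 z| * 1 + `|pderiv ord_max (phi ord_max n) z - h ord_max ord_max z| * 1))))))).
    apply: (le_Rint mOm (remainder_intg c sf sg)); first exact: (intgD mOm iS (intgD mOm iC (intgD mOm iHH iEE))).
    move=> z Oz; rewrite !mulr1 -mulrDl; exact: calib_remainder_perturb.
  rewrite (RintD mOm iS (intgD mOm iC (intgD mOm iHH iEE))) (RintD mOm iC (intgD mOm iHH iEE)) C0 add0r (RintD mOm iHH iEE).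
  rewrite (RintZ mOm _ (intgD mOm (iH ord0) (iH ord_max))) (RintD mOm (iH ord0) (iH ord_max)).
  rewrite (RintZ mOm 3 (intgD mOm (intgD mOm (iE ord0 ord0) (iE ord0 ord_max)) (intgD mOm (iE ord_max ord0) (iE ord_max ord_max)))).
  rewrite (RintD mOm (intgD mOm (iE ord0 ord0) (iE ord0 ord_max)) (intgD mOm (iE ord_max ord0) (iE ord_max ord_max))).
  by rewrite (RintD mOm (iE ord0 ord0) (iE ord0 ord_max)) (RintD mOm (iE ord_max ord0) (iE ord_max ord_max)).
have tri : `|X - calib_flux| <= `|X - P| + (`|P - F| + `|F - calib_flux|).
  rewrite (_ : X - calib_flux = (X - P) + ((P - F) + (F - calib_flux))); last by ring.
  by apply: (le_trans (ler_normD _ _)); rewrite lerD2l ler_normD.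
rewrite /err; move: tri hP hF hS hR; lra.
Qed.
End calibration_limit.

(** * The estimate on the unit disc *)

Section disc_distance.
Context {R : realType}.
Variable c : R * R.
Let Omega : set (R * R) := eball c 1.
Hypothesis C2 : C2_boundary Omega.
Let oO : open Omega := @open_eball R c 1.
Let ag := bd_param_spec C2.
Local Notation x := (centered c).

Lemma disc_bdry_nonempty : bdry Omega !=set0.
Proof. by exists (bd_curve Omega 0); exact: arclength_bdry ag 0. Qed.

Lemma disc_dist_bdry z : Omega z -> dist_bdry Omega z = 1 - enorm (z - c).
Proof.
move=> Oz; apply/eqP; rewrite eq_le; apply/andP; split; last first.
  apply: (dist_bdry_ge disc_bdry_nonempty) => b /disc_bdry b1.
  by have := enormD (b - z) (z - c); rewrite addrA subrK b1 (enormB b z); lra.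
have [z0|z0] := eqVneq z c.
  rewrite z0 subrr (_ : enorm 0 = 0) ?subr0; last by rewrite /enorm /dotp /= mulr0 addr0 sqrtr0.
  have b1 := disc_bdry (arclength_bdry ag 0).
  by apply: (le_trans (dist_bdry_le disc_bdry_nonempty _ (arclength_bdry ag 0))); rewrite enormB b1.
have N0 : 0 < enorm (z - c) by rewrite enorm_gt0 subr_eq0.
(* Chosen so that z + k (z - c) is the radial projection of z on the unit circle. *)
pose k := (1 - enorm (z - c)) / enorm (z - c).
have N1 : enorm (z - c) < 1 by exact: Oz.
have k0 : 0 <= k by apply: divr_ge0; [rewrite subr_ge0; exact: ltW|exact: ltW].
have nO : ~ Omega (z + k *: (z - c)).
  rewrite /Omega /eball /= (_ : _ - c = (1 + k) *: (z - c)); last by rewrite scalerDl scale1r; ring.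
  rewrite enormZ ger0_norm ?addr_ge0// /k mulrDl mul1r divfK ?gt_eqF//.
  by rewrite addrC subrK ltxx.
have [t /andP[t0 t1] hb] := exit_point oO Oz nO.
apply: (le_trans (dist_bdry_le disc_bdry_nonempty _ hb)).
rewrite opprD addrA subrr sub0r enormN enormZ enormZ (gtr0_norm t0) (ger0_norm k0) /k divfK ?gt_eqF//.
by rewrite ler_piMl// subr_ge0 ltW.
Qed.

Lemma enorm_pderiv i z : z != c ->
  differentiable (fun z => enorm (z - c)) z /\ pderiv i (fun z => enorm (z - c)) z = x i z / enorm (z - c).
Proof.
move=> zc; have N0 : 0 < enorm (z - c) by rewrite enorm_gt0 subr_eq0.
have e2 y : sqdist c y = enorm (y - c) ^+ 2 by exact: esym (enorm_sqr (y - c)).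
have e : (fun z => enorm (z - c)) = fun z => Num.sqrt (sqdist c z).
  by apply/funext => y; rewrite e2 sqrtr_sqr ger0_norm// enorm_ge0.
have q0 : 0 < sqdist c z by rewrite e2 exprn_gt0.
have ds := is_derive1_sqrt q0.
have dq : differentiable (sqdist c) z := Ck_diff (Ck_sqdist c 1) z.
have dd : derivable Num.sqrt (sqdist c z) 1 by case: ds.
rewrite e; split.
  by apply: (differentiable_comp (f := sqdist c) (g := Num.sqrt)) => //; exact/derivable1_diffP.
rewrite (pderiv_comp_at i dd dq) derive1E pderiv_sqdist; have [_ ->] := ds.
rewrite e2 sqrtr_sqr ger0_norm ?enorm_ge0//.
by field; rewrite gt_eqF.
Qed.

Lemma disc_dist_grad (g : R) i z : Omega z -> z != c ->
  n.+1%:R * (dist_bdry Omega (n.+1%:R^-1 *: basis2 i + z) - dist_bdry Omega z) @[n --> \oo] --> g ->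
  g = - (x i z / enorm (z - c)).
Proof.
move=> Oz zc hg; have [dN eN] := enorm_pderiv i zc.
have [h0 hc] := @harmonic_seq_props R.
have lim := cvg_difference_quotient (v := basis2 i) dN h0 hc.
apply: (cvg_unique (@Rhausdorff R) hg).
rewrite -eN; apply: cvg_trans (cvgN lim).
have inO : \forall n \near \oo, Omega (n.+1%:R^-1 *: basis2 i + z).
  have : (n.+1%:R^-1 *: basis2 i + z) @[n --> \oo] --> z.
    rewrite -[X in _ --> X]add0r; apply: cvgD; last exact: cvg_cst.
    by rewrite -[X in _ --> X](scale0r (basis2 i)); exact: cvgZr_tmp hc.
  by move=> /(_ Omega (open_nbhs_nbhs (conj oO Oz))).
apply: near_eq_cvg; near=> n.
rewrite (disc_dist_bdry Oz) disc_dist_bdry; last by near: n.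
rewrite [LHS](_ : _ = - (n.+1%:R^-1^-1 * (enorm (n.+1%:R^-1 *: basis2 i + z - c) - enorm (z - c))))//.
by rewrite invrK; ring.
Unshelve. all: end_near. Qed.
End disc_distance.

Section Lambda_calibration.
Context {R : realType}.
Variable c : R * R.
Let Omega : set (R * R) := eball c 1.
Hypothesis C2 : C2_boundary Omega.
Let oO : open Omega := @open_eball R c 1.
Let bO : Omega `<=` square_box (`|c.1| + `|c.2| + 1) := @eball_square_box R c 1.
Let r0 : 0 < `|c.1| + `|c.2| + 1. Proof. by rewrite ltr_wpDl// addr_ge0. Qed.

Local Notation mu := (@leb2 R).
Local Notation I := (Rintegral mu (Omega : set (plane R))).
Local Notation x := (centered c).
Let mOm : measurable (Omega : set (plane R)) := domain_measurable oO.

Variable u : R * R -> R.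
Hypothesis Lu : Lambda Omega u.
Local Notation w := (fun i => wpderiv Omega i u).
Local Notation h := (fun i j => wpderiv Omega j (wpderiv Omega i u)).

Lemma Lambda_calibration_sigma :
  `|I (fun z => x ord0 z * tgrad (w ord0 z) (w ord_max z) + x ord_max z * tgrad (w ord_max z) (w ord0 z)) - calib_flux c|
  <= 100 * I (fun z => sigma (w ord0 z) (w ord_max z) * (1 + hess_l1 h z)).
Proof.
have [_ tu [g [tg ng]]] := Lu.
have [phi [sphi c1 c2 c3]] := boundary_gradient C2 (Lambda_L2 Lu) (Lambda_weak Lu) (Lambda_weak2 Lu) tu tg ng.
exact: (calibration_estimate C2 (Lambda_grad_sqint oO Lu) (Lambda_hess_sqint oO Lu)
  (weak_hess_symmetric (Lambda_L2 Lu) (Lambda_weak Lu) (Lambda_weak2 Lu)) sphi c1 c2 c3).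
Qed.

End Lambda_calibration.

(** * From the calibration to the gradient *)

Section calibration_deficit.
Context {R : realType}.
Implicit Types N p q : R.

Lemma sqr_le_norm (a W : R) : 0 <= W -> a ^+ 2 <= W ^+ 2 -> `|a| <= W.
Proof. by move=> W0 h; rewrite -(@ler_pXn2r _ 2)// real_normK ?num_real. Qed.

Lemma prod_le_norm (a b W : R) : `|a| <= 1 -> `|b| <= W -> a * b <= W.
Proof.
move=> a1 bW; apply: (le_trans (ler_norm _)); rewrite normrM -[leRHS]mul1r.
by apply: ler_pM.
Qed.

(** Used for the competitor, with T the truncated field: 1 - g.T splits into g.(g - (p, q)) and
    g.((p, q) - T), that is four terms, each at most |[well]|. For N = 0, the centre, nothing is
    assumed on g beyond boundedness. *)
Lemma deficit_le_well (g0 g1 N p q : R) : 0 <= N <= 1 -> `|g0| <= 1 -> `|g1| <= 1 ->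
  (N != 0 -> g0 ^+ 2 + g1 ^+ 2 = 1 /\ (p - g0) ^+ 2 + (q - g1) ^+ 2 <= well p q ^+ 2) ->
  N - N * (g0 * tgrad p q + g1 * tgrad q p) <= 4 * `|well p q|.
Proof.
move=> /andP[N0 N1] b0 b1; have W0 := normr_ge0 (well p q).
have [->|_ /(_ isT)[g2 h]] := eqVneq N 0; first by rewrite mul0r subr0 => _; rewrite mulr_ge0.
rewrite -(real_normK (num_real (well p q))) in h.
have d0 : `|g0 - p| <= `|well p q|.
  by rewrite distrC; apply: (sqr_le_norm W0); apply: (le_trans _ h); rewrite lerDl sqr_ge0.
have d1 : `|g1 - q| <= `|well p q|.
  by rewrite distrC; apply: (sqr_le_norm W0); apply: (le_trans _ h); rewrite lerDr sqr_ge0.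
have t0 := tgrad_dist p q; have t1 := tgrad_dist q p; rewrite (wellC q p) in t1.
have e0 := prod_le_norm b0 d0; have e1 := prod_le_norm b1 d1.
have f0 := prod_le_norm b0 t0; have f1 := prod_le_norm b1 t1.
have k : 1 - (g0 * tgrad p q + g1 * tgrad q p) =
  g0 * (g0 - p) + g1 * (g1 - q) + (g0 * (p - tgrad p q) + g1 * (q - tgrad q p)) by rewrite -g2; ring.
rewrite -[X in X - _]mulr1 -mulrBr k.
have le4 : g0 * (g0 - p) + g1 * (g1 - q) + (g0 * (p - tgrad p q) + g1 * (q - tgrad q p)) <= 4 * `|well p q| by lra.
apply: (le_trans (ler_wpM2l N0 le4)).
by rewrite ler_piMl// mulr_ge0.
Qed.

(** With T the truncated field and g a unit vector, |T - g|^2 = 2 (1 - g.T) + (|T|^2 - 1), and |T|^2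
    - 1 is controlled by [tgrad_sqr]. *)
Lemma deviation_le_deficit (g0 g1 N p q : R) : 0 <= N <= 1 -> (N != 0 -> g0 ^+ 2 + g1 ^+ 2 = 1) ->
  N * ((tgrad p q - g0) ^+ 2 + (tgrad q p - g1) ^+ 2) <=
  2 * (N - N * (g0 * tgrad p q + g1 * tgrad q p)) + 6 * `|well p q|.
Proof.
move=> /andP[N0 N1]; have W0 := normr_ge0 (well p q).
have [->|_ /(_ isT) g2] := eqVneq N 0; first by rewrite !mul0r subr0 mulr0 add0r => _; rewrite mulr_ge0.
have s1 := tgrad_sqr p q; have s2 := sigma_le_well p q; have s0 := sigma_ge0 p q.
have s3 : tgrad p q ^+ 2 + tgrad q p ^+ 2 - 1 <= 6 * `|well p q|.
  by have := ler_normr (1 - (tgrad p q ^+ 2 + tgrad q p ^+ 2)) (3 * sigma p q); move: s1; rewrite ler_norml => /andP[]; lra.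
have k : (tgrad p q - g0) ^+ 2 + (tgrad q p - g1) ^+ 2 =
  2 * (1 - (g0 * tgrad p q + g1 * tgrad q p)) + (tgrad p q ^+ 2 + tgrad q p ^+ 2 - 1) by
    rewrite [LHS](_ : _ = tgrad p q ^+ 2 + tgrad q p ^+ 2 - 2 * (g0 * tgrad p q + g1 * tgrad q p) + (g0 ^+ 2 + g1 ^+ 2)); [rewrite g2; ring|ring].
rewrite k mulrDr.
have h : N * (tgrad p q ^+ 2 + tgrad q p ^+ 2 - 1) <= 6 * `|well p q|.
  apply: (le_trans (ler_wpM2l N0 s3)); by rewrite ler_piMl// mulr_ge0.
by apply: lerD h; rewrite le_eqVlt; apply/orP; left; apply/eqP; ring.
Qed.

(** Removes the weight N. Where N >= rho it is divided out; where N < rho one has 4 rho^4 t^4 >= 1,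
    so the last term exceeds the bound 18 = 72 / 4. The function t^4 acts as a smooth substitute for
    the indicator of the ball, with an integral already known. *)
Lemma deviation_split (rho N q t : R) : 0 < rho -> 0 <= N -> 0 <= q <= 18 ->
  (N ^+ 2 + rho ^+ 2) * t ^+ 2 = 1 -> q <= rho^-1 * (N * q) + 72 * rho ^+ 4 * t ^+ 4.
Proof.
move=> r0 N0 /andP[q0 q18] ht; have t4 : 0 <= t ^+ 4 by rewrite (exprM t 2 2) sqr_ge0.
have [rN|Nr] := lerP rho N.
  rewrite -[leLHS]addr0 lerD//; last by rewrite mulr_ge0// mulr_ge0// exprn_ge0// ltW.
  by rewrite mulrA ler_peMl// mulrC ler_pdivlMr// mul1r.
apply: (le_trans q18); rewrite -[leLHS]add0r lerD//.
  by rewrite mulr_ge0 ?invr_ge0 ?mulr_ge0// ltW.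
have h : 1 <= 2 * rho ^+ 2 * t ^+ 2.
  rewrite -[leLHS]ht; apply: ler_wpM2r; first exact: sqr_ge0.
  have : N ^+ 2 <= rho ^+ 2 by rewrite ler_pXn2r ?nnegrE// ltW.
  by lra.
have := ler_pM ler01 ler01 h h; rewrite mulr1.
rewrite (_ : 2 * rho ^+ 2 * t ^+ 2 * (2 * rho ^+ 2 * t ^+ 2) = 4 * (rho ^+ 4 * t ^+ 4)); last by ring.
by rewrite -mulrA; lra.
Qed.

Lemma deviation_le18 (g0 g1 p q : R) : `|g0| <= 1 -> `|g1| <= 1 ->
  (tgrad p q - g0) ^+ 2 + (tgrad q p - g1) ^+ 2 <= 18.
Proof.
have sq (g a b : R) : `|g| <= 1 -> (tgrad a b - g) ^+ 2 <= 9.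
  move=> hg; have := tgrad_bound a b; have := ler_normB (tgrad a b) g.
  rewrite -(real_normK (num_real (_ - _))); move: `|_ - _| (normr_ge0 (tgrad a b - g)) => s s0 h1 h2.
  have s3 : s <= 3 by lra.
  have := ler_pM s0 s0 s3 s3; rewrite -expr2; lra.
by move=> /(sq _ p q) h0 /(sq _ q p) h1; lra.
Qed.

Lemma grad_dist_le (g0 g1 p q : R) :
  (p - g0) ^+ 2 + (q - g1) ^+ 2 <=
  4 * well p q ^+ 2 + 2 * ((tgrad p q - g0) ^+ 2 + (tgrad q p - g1) ^+ 2).
Proof.
have sq2 (a b : R) : (a + b) ^+ 2 <= 2 * a ^+ 2 + 2 * b ^+ 2 by have := sqr_ge0 (a - b); rewrite !expr2; lra.
have ws (a b : R) : (a - tgrad a b) ^+ 2 <= well a b ^+ 2.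
  by rewrite -(real_normK (num_real (a - _))) -(real_normK (num_real (well a b))) ler_pXn2r ?nnegrE// tgrad_dist.
have := ws p q; have := ws q p; rewrite (wellC q p).
have := sq2 (p - tgrad p q) (tgrad p q - g0); have := sq2 (q - tgrad q p) (tgrad q p - g1).
by rewrite !addrA !subrK; lra.
Qed.
End calibration_deficit.

Section gradient_estimate.
Context {R : realType}.
Local Notation mu := (@leb2 R).
Variable D : set (plane R).
Hypothesis mD : measurable D.
Hypothesis Dlty : (mu D < +oo)%E.
Local Notation I := (Rintegral mu D).

Let norm1 (f : plane R -> R) : sqint mu D f ->
  I (fun z => `|f z|) <= Num.sqrt (I (fun z => f z ^+ 2)) * Num.sqrt (I (fun=> 1)).
Proof.
move=> f2; have one2 : sqint mu D (fun=> 1 : R).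
  by apply: (sqint_bounded mD Dlty (M := 1)) => // z _; rewrite normr1.
have := cauchy_schwarz mD (sqint_norm mD f2) one2.
rewrite (_ : I (fun z => `|f z| * 1) = I (fun z => `|f z|)); last by apply: eq_Rint => z _; rewrite mulr1.
rewrite (_ : I (fun z => `|f z| ^+ 2) = I (fun z => f z ^+ 2)); last first.
  by apply: eq_Rint => z _; rewrite real_normK ?num_real.
rewrite (_ : I (fun=> 1 ^+ 2) = I (fun=> 1)); last by apply: eq_Rint => z _; rewrite expr1n.
by rewrite ger0_norm//; apply: Rint_ge0.
Qed.

(** [sigma] is at most twice |[well]|, then Cauchy-Schwarz; the factor 5 bounds the square of a sum
    of five terms by the sum of squares. *)
Lemma sigma_hess_estimate (w0 w1 h00 h01 h10 h11 : plane R -> R) :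
  sqint mu D w0 -> sqint mu D w1 -> sqint mu D (fun z => well (w0 z) (w1 z)) ->
  sqint mu D h00 -> sqint mu D h01 -> sqint mu D h10 -> sqint mu D h11 ->
  I (fun z => sigma (w0 z) (w1 z) * (1 + (`|h00 z| + `|h01 z| + (`|h10 z| + `|h11 z|)))) <=
  2 * (Num.sqrt (I (fun z => well (w0 z) (w1 z) ^+ 2)) *
       Num.sqrt (5 * (I (fun=> 1) + I (fun z => h00 z ^+ 2 + h01 z ^+ 2 + (h10 z ^+ 2 + h11 z ^+ 2))))).
Proof.
move=> w0s w1s Ws s00 s01 s10 s11.
have one2 : sqint mu D (fun=> 1 : R).
  by apply: (sqint_bounded mD Dlty (M := 1)) => // z _; rewrite normr1.
have Ws' := sqint_norm mD Ws.
pose H z := 1 + (`|h00 z| + `|h01 z| + (`|h10 z| + `|h11 z|)).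
have Hs : sqint mu D H.
  apply: (sqintD mD one2); apply: (sqintD mD); apply: (sqintD mD); exact: (sqint_norm mD).
have H0 z : 0 <= H z by rewrite /H !addr_ge0.
have iWH := sqint_mul mD Ws' Hs.
have a1 : I (fun z => sigma (w0 z) (w1 z) * H z) <= I (fun z => 2 * (`|well (w0 z) (w1 z)| * H z)).
  apply: (le_Rint mD (sqint_mul mD (sigma_sqint mD Dlty w0s w1s) Hs) (intgZ mD 2 iWH)) => z _.
  by rewrite mulrA ler_wpM2r// sigma_le_well.
apply: (le_trans a1); rewrite (RintZ mD 2 iWH) ler_wpM2l//.
apply: (le_trans (ler_norm _)); apply: (le_trans (cauchy_schwarz mD Ws' Hs)).
rewrite (_ : I (fun z => `|well (w0 z) (w1 z)| ^+ 2) = I (fun z => well (w0 z) (w1 z) ^+ 2)); last first.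
  by apply: eq_Rint => z _; rewrite real_normK ?num_real.
rewrite ler_wpM2l ?sqrtr_ge0// ler_sqrt; last first.
  by rewrite mulr_ge0// addr_ge0//; apply: Rint_ge0 => z _; rewrite ?addr_ge0 ?sqr_ge0.
have i1 : intg mu D (fun=> 1 : R) := sqint_intg mD Dlty one2.
have ih := intgD mD (intgD mD s00.2 s01.2) (intgD mD s10.2 s11.2).
rewrite -(RintD mD i1 ih) -(RintZ mD 5 (intgD mD i1 ih)).
apply: (le_Rint mD Hs.2 (intgZ mD 5 (intgD mD i1 ih))) => z _.
rewrite -(real_normK (num_real (h00 z))) -(real_normK (num_real (h01 z))).
rewrite -(real_normK (num_real (h10 z))) -(real_normK (num_real (h11 z))) /H.
move: `|h00 z| `|h01 z| `|h10 z| `|h11 z| => a b c d.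
have := sqr_ge0 (1 - a); have := sqr_ge0 (1 - b); have := sqr_ge0 (1 - c); have := sqr_ge0 (1 - d).
have := sqr_ge0 (a - b); have := sqr_ge0 (a - c); have := sqr_ge0 (a - d).
have := sqr_ge0 (b - c); have := sqr_ge0 (b - d); have := sqr_ge0 (c - d).
by rewrite !expr2; lra.
Qed.

Variables (w0 w1 v0 v1 g0 g1 N t : plane R -> R) (rho F E : R).
Hypotheses (w0s : sqint mu D w0) (w1s : sqint mu D w1) (v0s : sqint mu D v0) (v1s : sqint mu D v1).
Hypotheses (Ws : sqint mu D (fun z => well (w0 z) (w1 z))) (Vs : sqint mu D (fun z => well (v0 z) (v1 z))).
Hypotheses (g0s : sqint mu D g0) (g1s : sqint mu D g1) (Ns : sqint mu D N).
Hypothesis ti : intg mu D (fun z => t z ^+ 4).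
Hypotheses (gb : forall z, D z -> `|g0 z| <= 1 /\ `|g1 z| <= 1) (Nb : forall z, D z -> 0 <= N z <= 1).
Hypothesis gu : forall z, D z -> N z != 0 ->
  g0 z ^+ 2 + g1 z ^+ 2 = 1 /\ (v0 z - g0 z) ^+ 2 + (v1 z - g1 z) ^+ 2 <= well (v0 z) (v1 z) ^+ 2.
Hypotheses (rho0 : 0 < rho) (tN : forall z, D z -> (N z ^+ 2 + rho ^+ 2) * t z ^+ 2 = 1).

(** On the disc N = |x| and N g = -x, so this integrand is the product of x with the truncated
    field, the quantity estimated by the calibration. *)
Let flux (p q : plane R -> R) z := - (N z * (g0 z * tgrad (p z) (q z) + g1 z * tgrad (q z) (p z))).
Hypotheses (fw : `|I (flux w0 w1) - F| <= E) (fv : `|I (flux v0 v1) - F| <= E).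

(** With T the truncated field, the integral of N (1 - g.T) is small for v, because v is close to g
    where N is nonzero. By [fw] and [fv] it is larger for w by at most 2 E. It controls the integral
    of N |T - g|^2, from which [deviation_split] removes the weight. *)
Lemma gradient_estimate :
  I (fun z => (w0 z - g0 z) ^+ 2 + (w1 z - g1 z) ^+ 2) <=
  4 * I (fun z => well (w0 z) (w1 z) ^+ 2) +
  2 * (rho^-1 * (4 * E + (6 * Num.sqrt (I (fun z => well (w0 z) (w1 z) ^+ 2)) +
                          8 * Num.sqrt (I (fun z => well (v0 z) (v1 z) ^+ 2))) * Num.sqrt (I (fun=> 1))) +
    72 * rho ^+ 4 * I (fun z => t z ^+ 4)).
Proof.
have [Nm _] := Ns.
have Nn z : D z -> `|N z| <= 1 by move=> /Nb/andP[n0 n1]; rewrite ger0_norm.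
have fi p q : sqint mu D p -> sqint mu D q -> intg mu D (flux p q).
  move=> ps qs; have T := tgrad_sqint mD Dlty ps qs; have T' := tgrad_sqint mD Dlty qs ps.
  have gN g : sqint mu D g -> sqint mu D (fun z => N z * g z) by move=> gs; exact: (sqint_bmul mD gs Nm Nn).
  apply: (eq_intg mD (f := fun z => - (N z * g0 z * tgrad (p z) (q z) + N z * g1 z * tgrad (q z) (p z)))).
    by move=> z _; rewrite /flux; ring.
  exact: (intgN (intgD mD (sqint_mul mD (gN _ g0s) T) (sqint_mul mD (gN _ g1s) T'))).
have Ni := sqint_intg mD Dlty Ns.
have iw := fi _ _ w0s w1s; have iv := fi _ _ v0s v1s.
have Wa := sqint_intg mD Dlty (sqint_norm mD Ws); have Va := sqint_intg mD Dlty (sqint_norm mD Vs).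
have dv : I N + I (flux v0 v1) <= 4 * I (fun z => `|well (v0 z) (v1 z)|).
  rewrite -(RintD mD Ni iv) -(RintZ mD 4 Va); apply: (le_Rint mD (intgD mD Ni iv) (intgZ mD 4 Va)) => z Dz.
  by have [b0 b1] := gb Dz; exact: (deficit_le_well (Nb Dz) b0 b1 (gu Dz)).
pose q z := (tgrad (w0 z) (w1 z) - g0 z) ^+ 2 + (tgrad (w1 z) (w0 z) - g1 z) ^+ 2.
have T := sqintB mD (tgrad_sqint mD Dlty w0s w1s) g0s; have T' := sqintB mD (tgrad_sqint mD Dlty w1s w0s) g1s.
have qi : intg mu D q := intgD mD T.2 T'.2.
have q0 z : 0 <= q z by rewrite addr_ge0 ?sqr_ge0.
have qs : sqint mu D q.
  apply: (sqint_bounded mD Dlty (M := 18)); first exact: intg_meas qi.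
  by move=> z Dz; have [b0 b1] := gb Dz; rewrite ger0_norm//; exact: deviation_le18.
have Nqi : intg mu D (fun z => N z * q z) := sqint_mul mD Ns qs.
have hN : I (fun z => N z * q z) <= 2 * (I N + I (flux w0 w1)) + 6 * I (fun z => `|well (w0 z) (w1 z)|).
  rewrite -(RintD mD Ni iw) -(RintZ mD 2 (intgD mD Ni iw)) -(RintZ mD 6 Wa).
  rewrite -(RintD mD (intgZ mD 2 (intgD mD Ni iw)) (intgZ mD 6 Wa)).
  apply: (le_Rint mD Nqi (intgD mD (intgZ mD 2 (intgD mD Ni iw)) (intgZ mD 6 Wa))) => z Dz.
  by apply: (deviation_le_deficit _ _ (Nb Dz)) => n0; have [] := gu Dz n0.
have hq : I q <= rho^-1 * I (fun z => N z * q z) + 72 * rho ^+ 4 * I (fun z => t z ^+ 4).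
  rewrite -(RintZ mD _ Nqi) -(RintZ mD _ ti) -(RintD mD (intgZ mD rho^-1 Nqi) (intgZ mD (72 * rho ^+ 4) ti)).
  apply: (le_Rint mD qi (intgD mD (intgZ mD rho^-1 Nqi) (intgZ mD (72 * rho ^+ 4) ti))) => z Dz.
  have /andP[N0 _] := Nb Dz; have [b0 b1] := gb Dz; apply: (deviation_split rho0 N0 _ (tN Dz)).
  by rewrite q0 deviation_le18.
have hg : I (fun z => (w0 z - g0 z) ^+ 2 + (w1 z - g1 z) ^+ 2) <= 4 * I (fun z => well (w0 z) (w1 z) ^+ 2) + 2 * I q.
  rewrite -(RintZ mD 4 Ws.2) -(RintZ mD 2 qi) -(RintD mD (intgZ mD 4 Ws.2) (intgZ mD 2 qi)).
  have i0 := (sqintB mD w0s g0s).2; have i1 := (sqintB mD w1s g1s).2.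
  apply: (le_Rint mD (intgD mD i0 i1) (intgD mD (intgZ mD 4 Ws.2) (intgZ mD 2 qi))) => z _.
  exact: grad_dist_le.
apply: (le_trans hg); rewrite lerD2l ler_wpM2l//; apply: (le_trans hq); rewrite lerD2r ler_wpM2l ?invr_ge0 ?(ltW rho0)//.
have n1 := norm1 Ws; have n2 := norm1 Vs.
move: fw fv; rewrite !ler_norml => /andP[_ u2] /andP[u1 _].
move: hN dv n1 n2 u2 u1.
move: (I (fun z => N z * q z)) (I (fun z => `|well (w0 z) (w1 z)|)) (I (fun z => `|well (v0 z) (v1 z)|)).
move: (I (flux w0 w1)) (I (flux v0 v1)) (I N) => a b m k l n.
move: (Num.sqrt _) (Num.sqrt _) (Num.sqrt _) => s1 s2 s3.
by lra.
Qed.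
End gradient_estimate.

Section disc_scaling.
Context {R : realType}.
Implicit Types d K M : R.

(* The minimiser has eps = d^9 and is compared with the competitor regularised at scale d^6. *)
Lemma energy_scaling d K (Au Av Hu Hv : R) : 0 < d -> 0 <= Au -> 0 <= Hu ->
  Av <= K * (d ^+ 6) ^+ 2 -> Hv <= K / d ^+ 6 ->
  (d ^+ 9)^-1 * Au + d ^+ 9 * Hu <= (d ^+ 9)^-1 * Av + d ^+ 9 * Hv ->
  Au <= 2 * K * d ^+ 12 /\ Hu <= 2 * K / d ^+ 6.
Proof.
move=> d0 A0 H0 hA hH; have p9 : 0 < d ^+ 9 by rewrite exprn_gt0.
have p9' : 0 < (d ^+ 9)^-1 by rewrite invr_gt0.
have p6 : 0 < d ^+ 6 by rewrite exprn_gt0.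
have p3 : 0 < d ^+ 3 by rewrite exprn_gt0.
have k1 := ler_wpM2l (ltW p9') hA; have k2 := ler_wpM2l (ltW p9) hH.
have e1 : (d ^+ 9)^-1 * (K * (d ^+ 6) ^+ 2) = K * d ^+ 3 by field; rewrite gt_eqF.
have e2 : d ^+ 9 * (K / d ^+ 6) = K * d ^+ 3 by field; rewrite gt_eqF.
rewrite e1 in k1; rewrite e2 in k2 => h.
have a0 : 0 <= (d ^+ 9)^-1 * Au by rewrite mulr_ge0// ltW.
have h0 : 0 <= d ^+ 9 * Hu by rewrite mulr_ge0// ltW.
split.
  rewrite -(ler_pM2l p9') (_ : _ * (2 * K * _) = 2 * (K * d ^+ 3)); first by lra.
  by field; rewrite gt_eqF.
rewrite -(ler_pM2l p9) (_ : _ * (2 * K / _) = 2 * (K * d ^+ 3)); first by lra.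
by field; rewrite gt_eqF.
Qed.

Lemma sqrt_well_scaling d K (A : R) : 0 < d -> 0 <= K -> A <= 2 * K * d ^+ 12 ->
  Num.sqrt A <= Num.sqrt (2 * K) * d ^+ 6.
Proof.
move=> d0 K0 hA; have d6 : 0 <= d ^+ 6 by rewrite exprn_ge0// ltW.
have d12 : 0 <= d ^+ 12 by rewrite exprn_ge0// ltW.
rewrite -[X in _ * X](ger0_norm d6) -sqrtr_sqr -sqrtrM ?mulr_ge0//.
rewrite (_ : (d ^+ 6) ^+ 2 = d ^+ 12); last by ring.
by apply: ler_wsqrtr.
Qed.

Lemma calibration_scaling d K M (A H : R) : 0 < d <= 1 -> 0 <= K -> 0 <= M ->
  A <= 2 * K * d ^+ 12 -> H <= 2 * K / d ^+ 6 ->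
  Num.sqrt A * Num.sqrt (5 * (M + H)) <= Num.sqrt (2 * K) * Num.sqrt (5 * (M + 2 * K)) * d ^+ 3.
Proof.
move=> /andP[d0 d1] K0 M0 hA hH; have d3 : 0 < d ^+ 3 by rewrite exprn_gt0.
have s := sqrt_well_scaling d0 K0 hA.
have q : Num.sqrt (5 * (M + H)) <= Num.sqrt (5 * (M + 2 * K)) / d ^+ 3.
  rewrite -[X in _ / X](gtr0_norm d3) -sqrtr_sqr -sqrtrV ?sqr_ge0// -sqrtrM; last by rewrite mulr_ge0// addr_ge0// mulr_ge0.
  rewrite ler_sqrt; last by rewrite divr_ge0 ?sqr_ge0// mulr_ge0// addr_ge0// mulr_ge0.
  have p6 : 0 < d ^+ 6 by rewrite exprn_gt0.
  have i6 : 1 <= (d ^+ 6)^-1 by rewrite invf_ge1// exprn_ile1// ltW.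
  have m : M <= M / d ^+ 6 by rewrite ler_peMr.
  rewrite (_ : 5 * (M + 2 * K) / (d ^+ 3) ^+ 2 = 5 * (M / d ^+ 6 + 2 * K / d ^+ 6)); last by field; rewrite gt_eqF.
  by rewrite ler_pM2l// lerD.
apply: (le_trans (ler_pM (sqrtr_ge0 _) (sqrtr_ge0 _) s q)).
by rewrite le_eqVlt; apply/orP; left; apply/eqP; field; rewrite gt_eqF.
Qed.

Definition grad_const K M : R :=
  8 * K + 2 * (800 * (Num.sqrt (2 * K) * Num.sqrt (5 * (M + 2 * K))) +
    14 * (Num.sqrt (2 * K) * Num.sqrt M) + 72 * pi ^+ 2).

(** With rho = d the contributions have orders d^3 / d, d^6 / d and d^4 d^-2; together with the well
    term d^12 all are at most of order d^2. *)
Lemma gradient_scaling d K M (A A' P : R) : 0 < d <= 1 -> 0 <= K -> 0 <= M ->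
  A <= 2 * K * d ^+ 12 -> A' <= 2 * K * d ^+ 12 -> P <= pi ^+ 2 / d ^+ 2 ->
  4 * A + 2 * (d^-1 * (4 * (200 * (Num.sqrt (2 * K) * Num.sqrt (5 * (M + 2 * K)) * d ^+ 3)) +
    (6 * Num.sqrt A + 8 * Num.sqrt A') * Num.sqrt M) + 72 * d ^+ 4 * P) <= grad_const K M * d ^+ 2.
Proof.
move=> /andP[d0 d1] K0 M0 hA hA' hP; rewrite /grad_const.
have s := sqrt_well_scaling d0 K0 hA; have s' := sqrt_well_scaling d0 K0 hA'.
set S := Num.sqrt (2 * K) * Num.sqrt _; move: s s'; set q := Num.sqrt (2 * K) => s s'.
have q0 : 0 <= q by exact: sqrtr_ge0. have m0 : 0 <= Num.sqrt M by exact: sqrtr_ge0.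
move: (Num.sqrt M) m0 => m m0; move: (Num.sqrt A) (Num.sqrt A') s s' => a a' s s'.
have pw n : (2 <= n)%N -> d ^+ n <= d ^+ 2 by move=> n2; apply: ler_wiXn2l => //; exact: ltW.
have t1 : 4 * A <= 8 * K * d ^+ 2.
  apply: (@le_trans _ _ (8 * K * d ^+ 12)); first by lra.
  by rewrite ler_wpM2l ?mulr_ge0// pw.
have t2 : d^-1 * ((6 * a + 8 * a') * m) <= 14 * (q * m) * d ^+ 2.
  apply: (@le_trans _ _ (d^-1 * (14 * (q * d ^+ 6) * m))).
    apply: ler_wpM2l; first by rewrite invr_ge0 ltW.
    by apply: ler_wpM2r => //; lra.
  rewrite (_ : d^-1 * _ = 14 * (q * m) * d ^+ 5); last by field; rewrite gt_eqF.
  by rewrite ler_wpM2l ?pw// !mulr_ge0.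
have t3 : 72 * d ^+ 4 * P <= 72 * pi ^+ 2 * d ^+ 2.
  have d4 : 0 <= 72 * d ^+ 4 by rewrite mulr_ge0// exprn_ge0// ltW.
  apply: (le_trans (ler_wpM2l d4 hP)).
  by rewrite le_eqVlt; apply/orP; left; apply/eqP; field; rewrite gt_eqF.
have t4 : d^-1 * (4 * (200 * (S * d ^+ 3))) = 800 * S * d ^+ 2 by field; rewrite gt_eqF.
rewrite (mulrDr d^-1) t4; move: (_ ^-1 * _) t2 => X t2; move: t1 t2 t3; lra.
Qed.
End disc_scaling.

Section trace_subtraction.
Context {R : realType}.
Variable Omega : set (R * R).

(** Makes the Poincare inequality available for the difference of the minimiser and the competitor:
    psi is subtracted from every approximating function, and it vanishes on the curve. *)
Lemma has_trace_subr (u psi : R * R -> R) g : has_trace Omega u g -> smooth psi ->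
  (forall s, psi (bd_curve Omega s) = 0) -> has_trace Omega (u \- psi) g.
Proof.
move=> [mg [phi [sphi c1 c2]]] spsi p0; split => //.
exists (fun n => phi n \- psi); split.
- by move=> n k; apply: CkB; [exact: sphi|exact: spsi].
- have e n : (phi n \- psi) \- (u \- psi) = phi n \- u by apply/funext => z /=; rewrite opprB addrA subrK.
  by under eq_fun do rewrite e.
have e n : (fun s => (((phi n \- psi) (bd_curve Omega s) - g s) ^+ 2)%:E) =
  fun s => ((phi n (bd_curve Omega s) - g s) ^+ 2)%:E by apply/funext => s; rewrite /= p0 subr0.
by under eq_fun do rewrite e.
Qed.
End trace_subtraction.

Lemma wellE (R : realType) (p q : R) : well p q = - (1 - (p ^+ 2 + q ^+ 2)).
Proof. by rewrite /well; ring. Qed.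

Section disc_energy.
Context {R : realType}.
Variable c : R * R.
Let Omega : set (R * R) := eball c 1.
Hypothesis C2 : C2_boundary Omega.
Let oO : open Omega := @open_eball R c 1.
Let r : R := `|c.1| + `|c.2| + 1.
Let bO : Omega `<=` square_box r := @eball_square_box R c 1.
Let r0 : 0 < r. Proof. by rewrite ltr_wpDl// addr_ge0. Qed.

Local Notation mu := (@leb2 R).
Local Notation I := (Rintegral mu (Omega : set (plane R))).
Local Notation x := (centered c).
Let mOm : measurable (Omega : set (plane R)) := domain_measurable oO.
Let Oly : (mu (Omega : set (plane R)) < +oo)%E := domain_finite oO bO.
Local Notation M := (I (fun=> 1)).

Lemma well_sqint_grad u : Lambda Omega u ->
  sqint mu (Omega : set (plane R)) (fun z => well (wpderiv Omega ord0 u z) (wpderiv Omega ord_max u z)).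
Proof.
move=> Lu; apply: (eq_sqint mOm _ (sqintN mOm (well_sqint oO r0 bO C2 Lu))) => z _.
by rewrite wellE -(sum2 (fun i => wpderiv Omega i u z ^+ 2)).
Qed.

Lemma well_energyE u :
  well_energy Omega u = I (fun z => well (wpderiv Omega ord0 u z) (wpderiv Omega ord_max u z) ^+ 2).
Proof. by apply: eq_Rint => z _; rewrite wellE sqrrN -(sum2 (fun i => wpderiv Omega i u z ^+ 2)). Qed.

Lemma hess_energyE u : let h i j := wpderiv Omega j (wpderiv Omega i u) in
  hess_energy Omega u = I (fun z => h ord0 ord0 z ^+ 2 + h ord0 ord_max z ^+ 2 +
    (h ord_max ord0 z ^+ 2 + h ord_max ord_max z ^+ 2)).
Proof. by move=> h; apply: eq_Rint => z _; exact: whess_sqE. Qed.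

Lemma Lambda_calibration u : Lambda Omega u ->
  `|I (fun z => x ord0 z * tgrad (wpderiv Omega ord0 u z) (wpderiv Omega ord_max u z) +
      x ord_max z * tgrad (wpderiv Omega ord_max u z) (wpderiv Omega ord0 u z)) - calib_flux c| <=
  200 * (Num.sqrt (well_energy Omega u) * Num.sqrt (5 * (M + hess_energy Omega u))).
Proof.
move=> Lu; apply: (le_trans (Lambda_calibration_sigma C2 Lu)).
have gs i := Lambda_grad_sqint oO Lu i; have hs i j := Lambda_hess_sqint oO Lu i j.
have := sigma_hess_estimate mOm Oly (gs ord0) (gs ord_max) (well_sqint_grad Lu)
  (hs ord0 ord0) (hs ord0 ord_max) (hs ord_max ord0) (hs ord_max ord_max).
rewrite -(well_energyE u) -(hess_energyE u) => h.
rewrite (_ : 200 * _ = 100 * (2 * (Num.sqrt (well_energy Omega u) * Num.sqrt (5 * (M + hess_energy Omega u))))); last by ring.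
by apply: ler_wpM2l.
Qed.
End disc_energy.

Section disc_estimate.
Context {R : realType}.
Variable c : R * R.
Let Omega : set (R * R) := eball c 1.
Hypothesis C2 : C2_boundary Omega.
Hypothesis cO : convex_set (Omega : set (R * R)).
Let oO : open Omega := @open_eball R c 1.
Let r : R := `|c.1| + `|c.2| + 1.
Let bO : Omega `<=` square_box r := @eball_square_box R c 1.
Let r0 : 0 < r. Proof. by rewrite ltr_wpDl// addr_ge0. Qed.
Let b0 : bdry Omega !=set0 := disc_bdry_nonempty C2.

Local Notation mu := (@leb2 R).
Local Notation I := (Rintegral mu (Omega : set (plane R))).
Local Notation x := (centered c).
Let mOm : measurable (Omega : set (plane R)) := domain_measurable oO.
Let Oly : (mu (Omega : set (plane R)) < +oo)%E := domain_finite oO bO.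
Local Notation M := (I (fun=> 1)).
Local Notation K := (disc_const c).

Let M0 : 0 <= M. Proof. exact: Rint_ge0. Qed.

Let K0 : 0 <= K.
Proof.
have := competitor_well_energy c ltr01 (lexx 1); rewrite expr1n mulr1; apply: le_trans.
exact: well_energy_ge0.
Qed.

Variables (g : 'I_2 -> R * R -> R).
Hypothesis gw : forall i, is_weak_pderiv Omega i (dist_bdry Omega) (g i).
Hypothesis gb : forall i z, Omega z -> `|g i z| <= 1.
Hypothesis gx : forall i z, Omega z -> z != c -> g i z = - (x i z / enorm (z - c)).

Let N z := enorm (z - c).

Let gN i z : Omega z -> N z * g i z = - x i z.
Proof.
move=> Oz; have [->|zc] := eqVneq z c.
  have e0 : N c = 0 by rewrite /N subrr /enorm /dotp /= mulr0 addr0 sqrtr0.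
  by rewrite e0 mul0r; move: i; apply: ord2_ind; rewrite /centered /coord /= subrr oppr0.
have n0 : N z != 0 by rewrite gt_eqF// enorm_gt0 subr_eq0.
by rewrite (gx i Oz zc) mulrN mulrC divfK.
Qed.

Section vector_field.
Variables (w0 w1 v0 v1 : R * R -> R) (d : R).
Hypotheses (d0 : 0 < d) (d1 : d <= 1).
Hypotheses (w0s : sqint mu (Omega : set (plane R)) w0) (w1s : sqint mu (Omega : set (plane R)) w1).
Hypotheses (v0s : sqint mu (Omega : set (plane R)) v0) (v1s : sqint mu (Omega : set (plane R)) v1).
Hypothesis Ws : sqint mu (Omega : set (plane R)) (fun z => well (w0 z) (w1 z)).
Hypothesis Vs : sqint mu (Omega : set (plane R)) (fun z => well (v0 z) (v1 z)).
Hypothesis vx : forall z, Omega z -> z != c ->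
  (v0 z + x ord0 z / enorm (z - c)) ^+ 2 + (v1 z + x ord_max z / enorm (z - c)) ^+ 2 <=
  well (v0 z) (v1 z) ^+ 2.
Hypothesis Wb : I (fun z => well (w0 z) (w1 z) ^+ 2) <= 2 * K * d ^+ 12.
Hypothesis Vb : I (fun z => well (v0 z) (v1 z) ^+ 2) <= 2 * K * d ^+ 12.
Let flux (p q : R * R -> R) z := x ord0 z * tgrad (p z) (q z) + x ord_max z * tgrad (q z) (p z).
Let S := 200 * (Num.sqrt (2 * K) * Num.sqrt (5 * (M + 2 * K)) * d ^+ 3).
Hypothesis fw : `|I (flux w0 w1) - calib_flux c| <= S.
Hypothesis fv : `|I (flux v0 v1) - calib_flux c| <= S.

Lemma disc_gradient_estimate :
  I (fun z => (w0 z - g ord0 z) ^+ 2 + (w1 z - g ord_max z) ^+ 2) <= grad_const K M * d ^+ 2.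
Proof.
have gs i : sqint mu (Omega : set (plane R)) (g i) by apply/(L2P oO); have [] := gw i.
have cN : continuous N.
  by move=> z; apply: continuous_comp; [apply: cvgB => //; exact: cvg_cst|exact: enorm_continuous].
have Ns := continuous_sqint oO bO cN.
(* The auxiliary weight is regularised at scale d, the radius of the excised ball, whereas the
   competitor is regularised at scale d^6. *)
have t2s := continuous_sqint oO bO (smooth_continuous (smooth_inv_regnorm c d0)).
have t4s : intg mu (Omega : set (plane R)) (fun z => inv_regnorm c d z ^+ 4).
  have ct : continuous (fun z => inv_regnorm c d z * inv_regnorm c d z).
    by move=> z; apply: cvgM; exact: (smooth_continuous (smooth_inv_regnorm c d0)).
  apply: (eq_intg mOm _ (continuous_sqint oO bO ct).2) => z _.
  by rewrite -expr2 -exprM.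
have gb2 z : Omega z -> `|g ord0 z| <= 1 /\ `|g ord_max z| <= 1 by move=> Oz; split; exact: gb.
have Nb z : Omega z -> 0 <= N z <= 1 by move=> Oz; rewrite enorm_ge0 ltW//; exact: Oz.
have gu z : Omega z -> N z != 0 -> g ord0 z ^+ 2 + g ord_max z ^+ 2 = 1 /\
    (v0 z - g ord0 z) ^+ 2 + (v1 z - g ord_max z) ^+ 2 <= well (v0 z) (v1 z) ^+ 2.
  move=> Oz n0; have zc : z != c.
    by apply: contra n0 => /eqP ->; rewrite /N subrr /enorm /dotp /= mulr0 addr0 sqrtr0.
  rewrite !(gx _ Oz zc) !opprK; split; last exact: vx.
  rewrite !sqrrN !expr_div_n -mulrDl -sqdistE.
  rewrite (_ : sqdist c z = enorm (z - c) ^+ 2) ?divff ?sqrf_eq0//; exact: esym (enorm_sqr (z - c)).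
have tN z : Omega z -> (N z ^+ 2 + d ^+ 2) * inv_regnorm c d z ^+ 2 = 1.
  by move=> _; rewrite /N enorm_sqr; exact: inv_regnorm_sqr.
have fe p q : I (fun z => - (N z * (g ord0 z * tgrad (p z) (q z) + g ord_max z * tgrad (q z) (p z)))) = I (flux p q).
  apply: eq_Rint => z Oz; rewrite /flux mulrDr !mulrA !(gN _ Oz) !mulNr -opprD opprK//.
have fw' := fw; have fv' := fv; rewrite -fe in fw'; rewrite -fe in fv'.
have h := gradient_estimate mOm Oly w0s w1s v0s v1s Ws Vs (gs ord0) (gs ord_max) Ns t4s gb2 Nb gu d0 tN fw' fv'.
apply: (le_trans h); apply: gradient_scaling => //; first by rewrite d0.
exact: integral_inv_regnorm4.
Qed.
End vector_field.
End disc_estimate.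

Lemma W12_combination (R : realFieldType) (r m k d p q s : R) :
  q <= 2 * p + 2 * (9 * d ^+ 2 * m) -> p <= 16 * r ^+ 2 * (4 * (k * d ^+ 2)) -> s <= k * d ^+ 2 ->
  q + s <= (128 * r ^+ 2 * k + 18 * m + k) * d ^+ 2.
Proof. by lra. Qed.

Section disc_minimiser.
Context {R : realType}.
Variable c : R * R.
Let Omega : set (R * R) := eball c 1.
Hypothesis C2 : C2_boundary Omega.
Hypothesis cO : convex_set (Omega : set (R * R)).
Let oO : open Omega := @open_eball R c 1.
Let r : R := `|c.1| + `|c.2| + 1.
Let bO : Omega `<=` square_box r := @eball_square_box R c 1.
Let r0 : 0 < r. Proof. by rewrite ltr_wpDl// addr_ge0. Qed.
Let b0 : bdry Omega !=set0 := disc_bdry_nonempty C2.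

Local Notation mu := (@leb2 R).
Local Notation I := (Rintegral mu (Omega : set (plane R))).
Local Notation x := (centered c).
Let mOm : measurable (Omega : set (plane R)) := domain_measurable oO.
Let Oly : (mu (Omega : set (plane R)) < +oo)%E := domain_finite oO bO.
Local Notation M := (I (fun=> 1)).
Local Notation K := (disc_const c).
Local Notation G := (grad_const K M).

Let M0 : 0 <= M. Proof. exact: Rint_ge0. Qed.

Let K0 : 0 <= K.
Proof.
have := competitor_well_energy c ltr01 (lexx 1); rewrite expr1n mulr1; apply: le_trans.
exact: well_energy_ge0.
Qed.

Section fixed.
Variables (d : R) (u : R * R -> R) (g : 'I_2 -> R * R -> R).
Hypotheses (d0 : 0 < d) (d1 : d <= 1).
Hypothesis mini : AG_minimiser (d ^+ 9) Omega u.
Hypothesis gw : forall i, is_weak_pderiv Omega i (dist_bdry Omega) (g i).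
Hypothesis gb : forall i z, Omega z -> `|g i z| <= 1.
Hypothesis gx : forall i z, Omega z -> z != c -> g i z = - (x i z / enorm (z - c)).

Let e := d ^+ 6.
Let e0 : 0 < e. Proof. exact: exprn_gt0. Qed.
Let e1 : e <= 1. Proof. by apply: exprn_ile1 => //; exact: ltW. Qed.
Let v := competitor c e.
Let Lu : Lambda Omega u. Proof. by case: mini. Qed.
Let Lv : Lambda Omega v. Proof. exact: competitor_Lambda. Qed.
Let sv : smooth v. Proof. exact: smooth_competitor. Qed.

Let energy : well_energy Omega u <= 2 * K * d ^+ 12 /\ hess_energy Omega u <= 2 * K / d ^+ 6.
Proof.
have := AG_minimiser_energy oO r0 bO C2 mini Lv.
apply: (energy_scaling d0); [exact: well_energy_ge0|exact: hess_energy_ge0| |].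
  exact: competitor_well_energy.
exact: competitor_hess_energy.
Qed.

Let vwell : well_energy Omega v <= 2 * K * d ^+ 12.
Proof.
apply: (le_trans (competitor_well_energy c e0 e1)).
rewrite (_ : e ^+ 2 = d ^+ 12); last by rewrite -exprM.
rewrite -mulrA mulr_natl mulr2n lerDl; apply: mulr_ge0 => //; apply: exprn_ge0; exact: ltW.
Qed.

Let vhess : hess_energy Omega v <= 2 * K / d ^+ 6.
Proof.
apply: (le_trans (competitor_hess_energy c e0 e1)).
rewrite -mulrA mulr_natl mulr2n lerDl; apply: divr_ge0 => //; exact: ltW.
Qed.

Let calib w : Lambda Omega w -> well_energy Omega w <= 2 * K * d ^+ 12 -> hess_energy Omega w <= 2 * K / d ^+ 6 ->
  `|I (fun z => x ord0 z * tgrad (wpderiv Omega ord0 w z) (wpderiv Omega ord_max w z) +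
      x ord_max z * tgrad (wpderiv Omega ord_max w z) (wpderiv Omega ord0 w z)) - calib_flux c| <=
  200 * (Num.sqrt (2 * K) * Num.sqrt (5 * (M + 2 * K)) * d ^+ 3).
Proof.
move=> Lw hA hH; apply: (le_trans (Lambda_calibration C2 Lw)); apply: ler_wpM2l => //.
by apply: calibration_scaling => //; rewrite d0.
Qed.

Let vs i : sqint mu (Omega : set (plane R)) (pderiv i v).
Proof. exact: (continuous_sqint oO bO (smooth_continuous (smooth_pderiv i sv))). Qed.

Let vwells : sqint mu (Omega : set (plane R)) (fun z => well (pderiv ord0 v z) (pderiv ord_max v z)).
Proof.
have cv i : continuous (pderiv i v) := smooth_continuous (smooth_pderiv i sv).
apply: (continuous_sqint oO bO) => z.
apply: (continuous_comp (f := fun z => (pderiv ord0 v z, pderiv ord_max v z)) (g := fun z : R * R => well z.1 z.2)).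
  exact: (cvg_pair (cv ord0 z) (cv ord_max z)).
exact: well_continuous.
Qed.

Let vwellE : I (fun z => well (pderiv ord0 v z) (pderiv ord_max v z) ^+ 2) = well_energy Omega v.
Proof.
rewrite (smooth_well_energy oO bO sv); apply: eq_Rint => z _.
by rewrite wellE sqrrN.
Qed.

Let vcalib : `|I (fun z => x ord0 z * tgrad (pderiv ord0 v z) (pderiv ord_max v z) +
      x ord_max z * tgrad (pderiv ord_max v z) (pderiv ord0 v z)) - calib_flux c| <=
  200 * (Num.sqrt (2 * K) * Num.sqrt (5 * (M + 2 * K)) * d ^+ 3).
Proof.
have h := calib Lv vwell vhess.
have fm p q : sqint mu (Omega : set (plane R)) p -> sqint mu (Omega : set (plane R)) q ->
    measurable_fun (Omega : set (plane R))
      ((fun z => x ord0 z * tgrad (p z) (q z) + x ord_max z * tgrad (q z) (p z)) : plane R -> measurableTypeR R).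
  move=> ps qs; have xs i := continuous_sqint oO bO (Ck_centered c 0 i).
  exact: (intg_meas (intgD mOm (sqint_mul mOm (xs _) (tgrad_sqint mOm Oly ps qs))
    (sqint_mul mOm (xs _) (tgrad_sqint mOm Oly qs ps)))).
have gs i := Lambda_grad_sqint oO Lv i.
rewrite (ae_eq_Rint mOm (fm _ _ (gs ord0) (gs ord_max)) (fm _ _ (vs ord0) (vs ord_max))) in h; first exact: h.
have := smooth_wpderiv oO bO sv ord_max; have := smooth_wpderiv oO bO sv ord0.
by apply: filterS2 => z h0 h1 Oz; rewrite (h0 Oz) (h1 Oz).
Qed.

Let vx z : Omega z -> z != c ->
  (pderiv ord0 v z + x ord0 z / enorm (z - c)) ^+ 2 + (pderiv ord_max v z + x ord_max z / enorm (z - c)) ^+ 2 <=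
  well (pderiv ord0 v z) (pderiv ord_max v z) ^+ 2.
Proof. by move=> Oz zc; rewrite wellE sqrrN; exact: competitor_grad_dist. Qed.

Let vVb : I (fun z => well (pderiv ord0 v z) (pderiv ord_max v z) ^+ 2) <= 2 * K * d ^+ 12.
Proof. by rewrite vwellE. Qed.

Let ugrad : I (fun z => (wpderiv Omega ord0 u z - g ord0 z) ^+ 2 + (wpderiv Omega ord_max u z - g ord_max z) ^+ 2) <=
  G * d ^+ 2.
Proof.
have [hA hH] := energy; have cu := calib Lu hA hH; rewrite (well_energyE c) in hA.
exact: (disc_gradient_estimate gw gb gx d0 d1 (Lambda_grad_sqint oO Lu ord0) (Lambda_grad_sqint oO Lu ord_max)
  (vs ord0) (vs ord_max) (well_sqint_grad C2 Lu) vwells vx hA vVb cu vcalib).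
Qed.

(** The vector field estimate with the competitor in both roles. *)
Let vgrad : I (fun z => (pderiv ord0 v z - g ord0 z) ^+ 2 + (pderiv ord_max v z - g ord_max z) ^+ 2) <= G * d ^+ 2.
Proof.
exact: (disc_gradient_estimate gw gb gx d0 d1 (vs ord0) (vs ord_max) (vs ord0) (vs ord_max)
  vwells vwells vx vVb vVb vcalib vcalib).
Qed.

(** The competitor serves as intermediate function: u - v has zero trace, so its L^2 norm is
    controlled by its gradient, while v - dist is at most 3 d^6 pointwise. *)
Let L2_split : I (fun z => (u z - dist_bdry Omega z) ^+ 2) <=
  2 * I (fun z => (u z - v z) ^+ 2) + 2 * (9 * d ^+ 2 * M).
Proof.
have us : sqint mu (Omega : set (plane R)) u := (L2P oO u).1 (Lambda_L2 Lu).
have vs' := continuous_sqint oO bO (smooth_continuous sv).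
have ds := continuous_sqint oO bO (dist_bdry_continuous b0).
have uvs := sqintB mOm us vs'; have vds := sqintB mOm vs' ds.
have := sq_le2 mOm uvs vds.
rewrite (_ : I (fun z => (u z - v z + (v z - dist_bdry Omega z)) ^+ 2) = I (fun z => (u z - dist_bdry Omega z) ^+ 2)); last first.
  by apply: eq_Rint => z _; rewrite addrA subrK.
move=> h; apply: (le_trans h); rewrite lerD2l ler_pM2l//.
have i1 : intg mu (Omega : set (plane R)) (fun=> 1 : R).
  by apply: (intg_bounded mOm Oly (M := 1)) => // z _; rewrite normr1.
rewrite -(RintZ mOm _ i1); apply: (le_Rint mOm vds.2 (intgZ mOm _ i1)) => z Oz.
rewrite mulr1 (disc_dist_bdry C2 Oz).
have h3 := competitor_dist e0 e1 Oz; rewrite -(real_normK (num_real (_ - _))).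
apply: (@le_trans _ _ ((3 * e) ^+ 2)); first by rewrite ler_pXn2r ?nnegrE// mulr_ge0// ltW.
rewrite exprMn (_ : 3 ^+ 2 = 9 :> R); last by ring.
rewrite ler_pM2l// /e -exprM; apply: ler_wiXn2l => //; exact: ltW.
Qed.

Let grad_split : I (fun z => (wpderiv Omega ord0 u z - pderiv ord0 v z) ^+ 2) <= 4 * (G * d ^+ 2).
Proof.
have gs : sqint mu (Omega : set (plane R)) (g ord0) by apply/(L2P oO); have [] := gw ord0.
have gs1 : sqint mu (Omega : set (plane R)) (g ord_max) by apply/(L2P oO); have [] := gw ord_max.
have us i := Lambda_grad_sqint oO Lu i.
have f2 := sqintB mOm (us ord0) gs; have h2 := sqintB mOm gs (vs ord0).
have h2' := sqintB mOm (vs ord0) gs.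
have m2 := sqintB mOm (us ord_max) gs1; have k2 := sqintB mOm (vs ord_max) gs1.
have hu := ugrad; rewrite (RintD mOm f2.2 m2.2) in hu.
have hv := vgrad; rewrite (RintD mOm h2'.2 k2.2) in hv.
have p1 : 0 <= I (fun z => (wpderiv Omega ord_max u z - g ord_max z) ^+ 2) by apply: Rint_ge0 => z _; exact: sqr_ge0.
have p2 : 0 <= I (fun z => (pderiv ord_max v z - g ord_max z) ^+ 2) by apply: Rint_ge0 => z _; exact: sqr_ge0.
have := sq_le2 mOm f2 h2.
rewrite (_ : I (fun z => (wpderiv Omega ord0 u z - g ord0 z + (g ord0 z - pderiv ord0 v z)) ^+ 2) =
  I (fun z => (wpderiv Omega ord0 u z - pderiv ord0 v z) ^+ 2)); last first.
  by apply: eq_Rint => z _; rewrite addrA subrK.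
rewrite (_ : I (fun z => (g ord0 z - pderiv ord0 v z) ^+ 2) = I (fun z => (pderiv ord0 v z - g ord0 z) ^+ 2)); last first.
  by apply: eq_Rint => z _; rewrite -sqrrN opprB.
move=> h; apply: (le_trans h); move: p1 p2 hu hv.
move: (G * _) => X; move: (I _) (I _) (I _) (I _) => a b a' b'; lra.
Qed.

Lemma disc_minimiser_bound :
  (W12norm Omega (u \- dist_bdry Omega)%R <= (Num.sqrt (128 * r ^+ 2 * G + 18 * M + G) * d)%:E)%E.
Proof.
have gs i : sqint mu (Omega : set (plane R)) (g i) by apply/(L2P oO); have [] := gw i.
have us i := Lambda_grad_sqint oO Lu i.
have usg i := sqintB mOm (us i) (gs i).
have hu := ugrad.
have G0 : 0 <= G.
  have d2 : 0 < d ^+ 2 by exact: exprn_gt0.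
  rewrite -(pmulr_lge0 _ d2); apply: le_trans hu; apply: Rint_ge0 => z _.
  by apply: addr_ge0; exact: sqr_ge0.
rewrite (RintD mOm (usg ord0).2 (usg ord_max).2) in hu.
have C0 : 0 <= 128 * r ^+ 2 * G + 18 * M + G.
  apply: (addr_ge0 _ G0); apply: addr_ge0; last exact: mulr_ge0.
  by apply: (mulr_ge0 _ G0); apply: mulr_ge0 => //; exact: sqr_ge0.
rewrite (W12norm_dist oO bO b0 Lu gw) lee_fin -[X in _ * X](gtr0_norm d0) -sqrtr_sqr -sqrtrM//.
apply: ler_wsqrtr.
have uL : L2 Omega u := Lambda_L2 Lu.
have vL : L2 Omega v := smooth_L2 oO bO sv.
have tr : has_trace Omega (u \- v) (fun=> 0).
  by have [_ tu _] := Lu; apply: (has_trace_subr tu sv) => s; exact: competitor_bdry.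
have wuv i := weak_pderivB oO bO uL vL (Lambda_weak Lu i) (smooth_weak_pderiv oO bO i sv).
have uvL : L2 Omega (fun z => u z - v z).
  by apply/(L2P oO); apply: (sqintB mOm); exact/(L2P oO).
have := poincare oO r0 bO C2 uvL wuv tr.
have z0 : Rintegral lebesgue_measure (bd_set Omega) (fun=> 0 ^+ 2) = 0 :> R.
  by rewrite expr0n /Rintegral integral0.
rewrite z0 mulr0 add0r => pc.
have r2 : 0 <= 16 * r ^+ 2 by rewrite mulr_ge0// sqr_ge0.
have pc' := le_trans pc (ler_wpM2l r2 grad_split).
rewrite -addrA; exact: (W12_combination L2_split pc' hu).
Qed.
End fixed.

Lemma disc_estimate : exists C : R, forall d u, 0 < d <= 1 -> AG_minimiser (d ^+ 9) Omega u ->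
  (W12norm Omega (u \- dist_bdry Omega)%R <= (C * d)%:E)%E.
Proof.
have [g hg] := dist_bdry_weak_pderiv oO bO cO b0.
exists (Num.sqrt (128 * r ^+ 2 * G + 18 * M + G)) => d u /andP[d0 d1] mini.
apply: (disc_minimiser_bound d0 d1 mini (g := g)) => [i|i z Oz|i z Oz zc]; have [h1 h2 h3] := hg i.
- exact: h1.
- exact: h2.
- exact: (disc_dist_grad C2 Oz zc (h3 z Oz)).
Qed.
End disc_minimiser.

(** * Combination of the cases *)

Section power_bounds.
Context {R : realType}.

Lemma ediam_square_box (Omega : set (R * R)) : ediam Omega = 2%:E ->
  Omega !=set0 /\ exists2 r : R, 0 < r & Omega `<=` square_box r.
Proof.
move=> d2; have [p Op] : Omega !=set0.
  apply/set0P/eqP => O0; move: d2; rewrite /ediam O0 set0X image_set0 ereal_sup0.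
  by [].
split; first by exists p.
exists (`|p.1| + `|p.2| + 2) => [|z Oz]; first by rewrite ltr_wpDl// addr_ge0.
have zp : enorm (z - p) <= 2.
  by rewrite -lee_fin -d2; apply: ereal_sup_ubound; exists (z, p).
have [c1 c2] := enorm_coord (z - p).
have n1 := ler_normD (z.1 - p.1) p.1; have n2 := ler_normD (z.2 - p.2) p.2; rewrite !subrK in n1 n2.
have m1 := normr_ge0 p.1; have m2 := normr_ge0 p.2.
split; rewrite /= in_itv /= -ler_norml; move: c1 c2 => /=; lra.
Qed.

Lemma disc_defect_ge0 (Omega : set (R * R)) : (0 <= disc_defect Omega)%E.
Proof. by apply: le_ereal_inf_tmp => _ [y _ <-]; exact: measure_ge0. Qed.

Lemma le_mul_poweR (l C m eps : R) (D : \bar R) : 0 < l -> 0 < C -> 0 <= m -> 0 <= eps -> (m%:E <= D)%E ->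
  ((C * m `^ l)%:E <= C%:E * (eps%:E + D) `^ l)%E.
Proof.
move=> l0 C0 m0 e0; case: D => [d| |] md //; last first.
  by rewrite addey// poweRyr ?gt_eqF// gt0_muley ?leey// lte_fin.
rewrite lee_fin in md; rewrite -EFinD poweR_EFin -EFinM lee_fin ler_pM2l//.
by apply: ge0_ler_powR; rewrite ?nnegrE ?(ltW l0) ?addr_ge0 ?(le_trans m0 md)//; lra.
Qed.
End power_bounds.

Unset Implicit Arguments.

Theorem corollary1 (R : realType) :
  exists lambda : R, 0 < lambda < 1 /\
  forall Omega : set (R * R),
    open Omega -> convex_set (Omega : set (R * R)) ->
    ediam Omega = 2%:E -> C2_boundary Omega ->
  exists C : R, 1 < C /\
  forall eps : R, 0 < eps ->
    (forall s : R, curvature Omega s <= eps `^ (- 2^-1)) ->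
  forall u : R * R -> R, AG_minimiser eps Omega u ->
    (W12norm Omega (u \- dist_bdry Omega)%R
       <= C%:E * (eps%:E + disc_defect Omega) `^ lambda)%E.
Proof.
pose lam : R := 9^-1; have lam0 : 0 < lam by rewrite invr_gt0.
have one : 1 `^ lam = 1 :> R by rewrite powR1.
exists lam; split; first by rewrite lam0 invf_lt1// ltr1n.
move=> Omega oO cO dm C2; have [ne0 [r r0 bO]] := ediam_square_box dm.
have b0 : bdry Omega !=set0 by exists (bd_curve Omega 0); exact: arclength_bdry (bd_param_spec C2) 0.
have [K hK] := minimiser_bounded oO r0 bO C2 cO b0 (16 * r ^+ 2).
have bound eps u : 0 < eps -> (forall s : R, curvature Omega s <= eps `^ (- 2^-1)) -> AG_minimiser eps Omega u ->
    (W12norm Omega (u \- dist_bdry Omega)%R <= `|K|%:E)%E.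
  move=> e0 hc mini; apply: (le_trans (hK eps u _ mini)); last by rewrite lee_fin ler_norm.
  by rewrite e0; exact: (eps_bound oO bO r0 ne0 C2 e0 hc).
have [D0|Dn0] := eqVneq (disc_defect Omega) 0%E; last first.
  (* A positive real lower bound of the defect, also when the defect is infinite. *)
  have [m m0 mD] : exists2 m : R, 0 < m & (m%:E <= disc_defect Omega)%E.
    have := disc_defect_ge0 Omega; move: Dn0; case: (disc_defect Omega) => [d| |]// d0 dge.
      by exists d => //; rewrite lt_neqAle eq_sym -eqe d0 -lee_fin.
    by exists 1; rewrite ?leey.
  have p0 : 0 < m `^ lam by exact: powR_gt0.
  have C0 : 0 <= `|K| / m `^ lam by apply: divr_ge0 => //; exact: ltW.
  (* The right-hand side is at least the constant times m^lambda, which exceeds |K|; the summand 2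
     makes the constant greater than 1. *)
  exists (2 + `|K| / m `^ lam); split; first by lra.
  move=> eps e0 hc u mini; apply: (le_trans (bound _ _ e0 hc mini)).
  have C1 : 0 < 2 + `|K| / m `^ lam by lra.
  apply: le_trans (le_mul_poweR lam0 C1 (ltW m0) (ltW e0) mD).
  by rewrite lee_fin mulrDl divfK ?gt_eqF// lerDr mulr_ge0// ltW.
have [c Oc] := disc_defect0_ball oO bO D0 cO.
have C2' : C2_boundary (eball c 1) by rewrite -Oc.
have cO' : convex_set (eball c 1 : set (R * R)) by rewrite -Oc.
have [C hC] := disc_estimate C2' cO'; rewrite -Oc in hC.
have k0 := normr_ge0 K; have c0 := normr_ge0 C.
(* |K| serves the case eps > 1 and |C| the case eps <= 1. *)
exists (2 + `|K| + `|C|); split; first by lra.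
move=> eps e0 hc u mini; rewrite D0 adde0 poweR_EFin -EFinM.
have S0 : 0 <= 2 + `|K| + `|C| by lra.
have [e1|e1] := lerP eps 1; last first.
  apply: (le_trans (bound _ _ e0 hc mini)); rewrite lee_fin.
  have p1 : 1 <= eps `^ lam.
    by rewrite -[leLHS]one; apply: ge0_ler_powR; rewrite ?nnegrE ?(ltW lam0) ?ltW.
  have := ler_wpM2l S0 p1; lra.
(* As lambda = 1/9, this gives eps = d^9, the scaling of [disc_estimate]. *)
pose d := eps `^ lam.
have d0 : 0 < d by exact: powR_gt0.
have d1 : d <= 1.
  by rewrite -[leRHS]one; apply: ge0_ler_powR; rewrite ?nnegrE ?(ltW lam0)// ltW.
have d9 : d ^+ 9 = eps by rewrite -powR_mulrn ?ltW// -powRrM mulVf// powRr1// ltW.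
rewrite -d9 in mini; have d01 : 0 < d <= 1 by rewrite d0.
apply: (le_trans (hC d u d01 mini)); rewrite lee_fin -/d.
by apply: ler_wpM2r; [exact: ltW|have := ler_norm C; lra].
Qed.
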